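(* Let $T>0$, let $U\subset\mathbb{R}^m$ be compact, and let $v\colon[0,T]\times\mathbb{R}^n\times U\to\mathbb{R}^n$ be continuous, twice continuously differentiable with respect to $x$, and such that for some positive constants $L,C$ and all $t\in[0,T]$, $u\in U$, $x,x'\in\mathbb{R}^n$, $$|v(t,x,u)-v(t,x',u)|\le L|x-x'|\quad\text{and}\quad |v(t,x,u)|\le C(1+|x|).$$ Let $A\subset\mathbb{R}^n$ be compact, let $\theta$ be a Borel probability measure on $\mathbb{R}^n$, and put $r=\max\{1,e^{LT}\}$. For a probability measure $\vartheta$ and a generalized control $\nu\in\mathcal{Y}([0,T];U)$ let $t\mapsto\mu(t,\vartheta,\nu)$ be the trajectory corresponding to the initial distribution $\vartheta$ and to $\nu$. Consider the problems (over generalized controls $\nu\in\mathcal{Y}([0,T];U)$) $$(P)\colon\ \text{maximize } \mu(T,\theta,\nu)(A),\qquad (P_\varepsilon)\colon\ \text{maximize } \mu(T,(\theta*\eta_\varepsilon)\lambda,\nu)(A_{r\varepsilon}),\quad \varepsilon>0,$$ and let $\bar\nu_\varepsilon$ be optimal for $(P_\varepsilon)$ for each $\varepsilon>0$. Then every accumulation point $\bar\nu$ (in the narrow topology, as $\varepsilon\to0$) of the family $(\bar\nu_\varepsilon)_{\varepsilon>0}$ is optimal for $(P)$, and $\max(P_\varepsilon)\to\max(P)$ as $\varepsilon\to0$. Moreover, if $\theta$ is absolutely continuous and $\lambda(\partial A)=0$, then $$\max(P)=\lim_{\varepsilon\to0}\mu(T,\theta,\bar\nu_\varepsilon)(A)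.$$
   Context: $\lambda$ is Lebesgue measure on $\mathbb{R}^n$ and $\rho\lambda$ is the measure with density $\rho$. $\mathcal{P}(\mathbb{R}^n)$ is the set of Borel probability measures with the narrow topology. $A_\delta=\{x\colon |x-y|\le\delta\text{ for some }y\in A\}$ is the closed $\delta$-neighbourhood. $\eta$ is the standard mollifier on $\mathbb{R}^n$ (smooth, nonnegative, radial, supported in the closed unit ball, with integral $1$), $\eta_\varepsilon(x)=\varepsilon^{-n}\eta(x/\varepsilon)$, and $(\theta*\eta_\varepsilon)(x)=\int_{\mathbb{R}^n}\eta_\varepsilon(x-y)\,d\theta(y)$. Generalized controls. A Young measure on $[0,T]\times\mathbb{R}^m$ is a positive Borel measure $\nu$ on $[0,T]\times\mathbb{R}^m$ with $\nu(B\times\mathbb{R}^m)=|B|$ (one-dimensional Lebesgue measure) for every Borel $B\subseteq[0,T]$. The narrow topology on Young measures is the weakest topology making $\nu\mapsto\int\phi\,d\nu$ continuous for every bounded Carathéodory integrand $\phi$ (measurable on $[0,T]\times\mathbb{R}^m$, continuous in the second variable). A generalized control is a Young measure supported in $[0,T]\times U$; the set of these is $\mathcal{Y}([0,T];U)$. The disintegration of $\nu$ is the family $(\nu_t)_{t\in[0,T]}$ of probability measures with $\int\psi\,d\nu=\int_0^T\int\psi(t,\omega)\,d\nu_t(\omega)\,dt$ for all $\nu$-integrable $\psi$. An accumulation point of $(\bar\nu_\varepsilon)$ is a narrow limit of a sequence $\bar\nu_{\varepsilon_j}$ with $\varepsilon_j\to0$. Trajectories. $\mu(\cdot,\vartheta,\nu)\in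 C^0([0,T];\mathcal{P}(\mathbb{R}^n))$ is the (unique) distributional solution of $\mu_t+\mathrm{div}_x(\bar v(t,x)\mu)=0$, $\mu(0)=\vartheta$, with $\bar v(t,x)=\int_U v(t,x,\omega)\,d\nu_t(\omega)$, meaning $\mu(0)=\vartheta$ and $\int_0^T\int_{\mathbb{R}^n}(\varphi_t+\bar v\cdot\nabla_x\varphi)\,d\mu(t)\,dt=0$ for all $\varphi\in C_c^\infty((0,T)\times\mathbb{R}^n)$. It is known that $\mu(t)(E)=\vartheta(V_t^0(E))$ for Borel $E$, where $V$ is the flow of $\bar v$: $s\mapsto V_t^s(x)$ solves $\dot y(s)=\bar v(s,y(s))$, $y(t)=x$. *)

(* Defs.v *)
From HB Require Import structures.
From mathcomp Require Import all_boot all_order all_algebra.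
From mathcomp Require Import lra.
From mathcomp Require Import all_classical all_reals all_analysis measurable_realfun.

Set Implicit Arguments.
Unset Strict Implicit.
Unset Printing Implicit Defensive.

Import Order.TTheory GRing.Theory Num.Theory.
Import numFieldNormedType.Exports.

Local Open Scope classical_set_scope.
Local Open Scope ring_scope.

Section borel_rV.
Context (R : realType) (n : nat).

HB.instance Definition _ :=
  @isMeasurable.Build (sigma_display (@open 'rV[R]_n)) 'rV[R]_n
    <<s @open 'rV[R]_n >> (@sigma_algebra0 _ setT _)
    (@sigma_algebraC _ _) (@sigma_algebra_bigcup _ setT _).

Lemma rV_open_measurable (U : set 'rV[R]_n) : open U -> measurable U.
Proof. by move=> oU; exact: sub_sigma_algebra. Qed.

Lemma rV_ball_rat (U : set 'rV[R]_n) x : open U -> U x ->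
  exists (q : 'rV[rat]_n) (p : rat),
    (forall i, `|ratr (q 0 i) - x 0 i| < ratr p) /\
    [set y : 'rV[R]_n | forall i, `|ratr (q 0 i) - y 0 i| < ratr p] `<=` U.
Proof.
move=> oU Ux; have /nbhs_ballP[e /= e0 eU] := open_nbhs_nbhs (conj oU Ux).
have /rat_in_itvoo[p] : 0 < e / 2 by rewrite divr_gt0.
rewrite in_itv/= => /andP[p0 pe].
have /choice[q qP] (i : 'I_n) : exists q : rat, `|ratr q - x 0 i| < ratr p.
  have /rat_in_itvoo[q] : x 0 i - ratr p < x 0 i + ratr p.
    by lra.
  by rewrite in_itv/= -ltr_distl => ?; exists q.
exists (\row_i q i), p; split=> [i|y yq]; first by rewrite mxE.
apply: eU; split=> // i j; rewrite (ord1 i) /ball/=.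
rewrite (_ : _ - _ = (x 0 j - ratr (q j)) + (ratr (q j) - y 0 j)); last first.
  by rewrite addrA subrK.
rewrite (le_lt_trans (ler_normD _ _))// (splitr e) ltrD//.
  by rewrite distrC (lt_trans (qP j)).
by have := yq j; rewrite mxE => /lt_trans; apply.
Qed.

Lemma measurable_fun_rV d (X : measurableType d) (f : X -> 'rV[R]_n) :
  (forall i, measurable_fun setT (fun x => f x 0 i)) -> measurable_fun setT f.
Proof.
move=> mf; apply: (@measurability _ _ _ _ _ _ (@open 'rV[R]_n)) => //.
move=> _ [U oU <-]; rewrite setTI.
pose B (qp : 'rV[rat]_n * rat) :=
  [set y : 'rV[R]_n | forall i, `|ratr (qp.1 0 i) - y 0 i| < ratr qp.2].
have -> : f @^-1` U = \bigcup_(qp in [set qp | B qp `<=` U]) (f @^-1` B qp).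
  apply/seteqP; split=> [x Ux|x [qp /= BU Bx]]; last exact: BU.
  by have [q [p [? ?]]] := rV_ball_rat oU Ux; exists (q, p).
have -> : \bigcup_(qp in [set qp | B qp `<=` U]) (f @^-1` B qp) =
    \bigcup_(k in [set k | exists2 qp, unpickle k = Some qp & B qp `<=` U])
      (if unpickle k is Some qp then f @^-1` B qp else set0).
  apply/seteqP; split=> [x [qp BU Bx]|x [k [qp kqp BU]]]; last first.
    by rewrite kqp => Bx; exists qp.
  by exists (pickle qp); rewrite /= pickleK//; exists qp.
apply: bigcup_measurable => k [qp -> _].
have -> : f @^-1` B qp =
    \bigcap_(i in [set: 'I_n]) [set x | `|ratr (qp.1 0 i) - f x 0 i| < ratr qp.2].
  by apply/seteqP; split=> x /=; [move=> + i _; apply|move=> + i; apply].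
apply: fin_bigcap_measurable => // i _.
rewrite -[X in measurable X]setTI.
have : measurable_fun setT (fun x => `|ratr (qp.1 0 i) - f x 0 i| < ratr qp.2).
  apply: measurable_fun_ltr => //; apply: measurableT_comp => //.
  exact: measurable_funB.
by move=> /(_ measurableT [set true]); apply.
Qed.

Lemma measurable_coord_rV i : measurable_fun setT (fun x : 'rV[R]_n => x 0 i).
Proof.
apply: (measurability _ (RGenOpens.measurableE R)) => //.
move=> _ [_ [a [b ->]] <-].
rewrite setTI; apply: rV_open_measurable.
by apply: open_comp => // x _; exact: coord_continuous.
Qed.

End borel_rV.

Section lebesgue_rV.
Context (R : realType).

Definition consrV n (p : measurableTypeR R * 'rV[R]_n) : 'rV[R]_n.+1 :=
  \row_i oapp (p.2 0) p.1 (unlift ord0 i).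

Definition unconsrV n (x : 'rV[R]_n.+1) : measurableTypeR R * 'rV[R]_n :=
  (x 0 ord0, \row_i x 0 (lift ord0 i)).

Lemma consrVK n : cancel (@consrV n) (@unconsrV n).
Proof.
move=> [a x]; rewrite /unconsrV /consrV mxE unlift_none/=; congr pair.
by apply/rowP => i; rewrite !mxE liftK.
Qed.

Lemma measurable_consrV n : measurable_fun setT (@consrV n).
Proof.
apply: measurable_fun_rV => i; rewrite /consrV.
under eq_fun do rewrite mxE.
case: (unlift ord0 i) => /= [j|]; last exact: measurable_fst.
exact: (measurableT_comp (measurable_coord_rV (R := R) j)).
Qed.

Lemma measurable_unconsrV n : measurable_fun setT (@unconsrV n).
Proof.
apply: measurable_fun_pair; first exact: measurable_coord_rV.
apply: measurable_fun_rV => i; under eq_fun do rewrite mxE.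
exact: measurable_coord_rV.
Qed.

Section step.
Variables (n : nat) (m : {sigma_finite_measure set 'rV[R]_n -> \bar R}).

Definition lebesgue_rVS : set 'rV[R]_n.+1 -> \bar R :=
  pushforward (lebesgue_measure \x m)%E (@consrV n).

Let mpreim A : measurable A -> measurable (@consrV n @^-1` A).
Proof.
by move=> mA; rewrite -[X in measurable X]setTI; exact: measurable_consrV.
Qed.

Let lebesgue_rVS0 : lebesgue_rVS set0 = 0%E.
Proof. by rewrite /lebesgue_rVS /pushforward preimage_set0 measure0. Qed.

Let lebesgue_rVS_ge0 A : (0 <= lebesgue_rVS A)%E.
Proof. by rewrite /lebesgue_rVS /pushforward measure_ge0. Qed.

Let lebesgue_rVS_sigma_additive : semi_sigma_additive lebesgue_rVS.
Proof.
move=> F mF tF mUF; rewrite /lebesgue_rVS /pushforward preimage_bigcup.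
apply: measure_semi_sigma_additive.
- by move=> k; exact: mpreim.
- apply/trivIsetP => /= i j _ _ ij; rewrite -preimage_setI.
  by move/trivIsetP : tF => /(_ _ _ _ _ ij) ->//; rewrite preimage_set0.
- by rewrite -preimage_bigcup; exact: mpreim.
Qed.

HB.instance Definition _ := isMeasure.Build _ _ _ lebesgue_rVS
  lebesgue_rVS0 lebesgue_rVS_ge0 lebesgue_rVS_sigma_additive.

Let lebesgue_rVS_sigma_finite : sigma_finite setT lebesgue_rVS.
Proof.
have /sigma_finiteP[F [TF ndF Foo]] := sigma_finiteT (@lebesgue_measure R).
have /sigma_finiteP[G [TG ndG Goo]] := sigma_finiteT m.
exists (fun k => @unconsrV n @^-1` (F k `*` G k)) => [|k].
  apply/seteqP; split=> // x _; rewrite -preimage_bigcup.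
  have [i _ Fi] : (\bigcup_i F i) (unconsrV x).1 by rewrite -TF.
  have [j _ Gj] : (\bigcup_i G i) (unconsrV x).2 by rewrite -TG.
  exists (maxn i j) => //; split.
  - by move: Fi; exact/subsetPset/ndF/leq_maxl.
  - by move: Gj; exact/subsetPset/ndG/leq_maxr.
have [? ?] := Foo k; have [? ?] := Goo k; split.
  by rewrite -[X in measurable X]setTI; apply: measurable_unconsrV => //;
    exact: measurableX.
rewrite /lebesgue_rVS /pushforward -comp_preimage (_ : _ \o _ = id)/=.
  by rewrite preimage_id product_measure1E// lte_mul_pinfty// ge0_fin_numE.
by apply/funext => p /=; rewrite consrVK.
Qed.

HB.instance Definition _ := Measure_isSigmaFinite.Build _ _ _ lebesgue_rVS
  lebesgue_rVS_sigma_finite.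

End step.

Fixpoint lebesgue_rV n : {sigma_finite_measure set 'rV[R]_n -> \bar R} :=
  if n is k.+1 then lebesgue_rVS (lebesgue_rV k) else \d_(0 : 'rV[R]_0).

Lemma lebesgue_rV_box n (a b : 'rV[R]_n) : (forall i, a 0 i <= b 0 i) ->
  lebesgue_rV n [set x | forall i, a 0 i <= x 0 i <= b 0 i] =
  (\prod_i (b 0 i - a 0 i))%:E.
Proof.
elim: n a b => [|n IH] a b ab.
  by rewrite big_ord0 /= diracE mem_set//= => -[].
rewrite big_ord_recl /= /lebesgue_rVS /pushforward.
pose E1 := [set x : R | a 0 ord0 <= x <= b 0 ord0].
pose E2 := [set x : 'rV[R]_n | forall i, (\row_j a 0 (lift ord0 j)) 0 i
  <= x 0 i <= (\row_j b 0 (lift ord0 j)) 0 i].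
rewrite (_ : _ @^-1` _ = E1 `*` E2); last first.
  apply/seteqP; split=> [[x y]/= h|[x y]/= [h1 h2] i].
    split=> [|i]; first by have := h ord0; rewrite mxE unlift_none.
    by have := h (lift ord0 i); rewrite !mxE liftK.
  rewrite mxE; case: unliftP => [j ->|->] //=.
  by have := h2 j; rewrite !mxE.
have mE1 : measurable E1.
  by rewrite (_ : E1 = `[a 0 ord0, b 0 ord0]%classic)// set_itvE.
have mE2 : measurable E2.
  pose B i := [set x : 'rV[R]_n | (\row_j a 0 (lift ord0 j)) 0 i
    <= x 0 i <= (\row_j b 0 (lift ord0 j)) 0 i].
  rewrite (_ : E2 = \bigcap_(i in setT) B i).
    apply: fin_bigcap_measurable => // i _; rewrite -[X in measurable X]setTI.
    have := @measurable_coord_rV R n i measurableT _ (measurable_itv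
      `[(\row_j a 0 (lift ord0 j)) 0 i, (\row_j b 0 (lift ord0 j)) 0 i]).
    by congr measurable; apply/seteqP; split=> x /=; rewrite in_itv.
  by apply/seteqP; split=> x /=; [move=> + i _; apply|move=> + i; apply].
rewrite product_measure1E// IH; last by move=> i; rewrite !mxE.
rewrite EFinM; congr (_ * _)%E; last first.
  by congr (_%:E); apply: eq_bigr => i _; rewrite !mxE.
rewrite (_ : E1 = `[a 0 ord0, b 0 ord0]%classic); last by rewrite set_itvE.
rewrite [LHS]lebesgue_measure_itv/= lte_fin.
have := ab ord0; rewrite le_eqVlt => /predU1P[->|->] //.
by rewrite ltxx subrr.
Qed.

End lebesgue_rV.

Section calculus.
Context (R : realType).

(* Only meant for finite-dimensional V, where continuity of all the directional
   derivatives amounts to continuity of the differential. *)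
Fixpoint Ck (V W : normedModType R) (k : nat) (f : V -> W) : Prop :=
  if k is j.+1 then
    (forall x, differentiable f x) /\ (forall v, Ck j (fun x => 'D_v f x))
  else continuous f.

Definition smooth (V W : normedModType R) (f : V -> W) := forall k, Ck k f.

Definition boundary (X : topologicalType) (A : set X) := closure A `\` A°.

End calculus.

Section euclidean.
Context (R : realType) (n : nat).
Implicit Types (x y : 'rV[R]_n) (A : set 'rV[R]_n).

(* The norm of the library on matrices is the sup norm. *)
Definition enorm x : R := Num.sqrt (\sum_i x 0 i ^+ 2).

Definition closed_nbhd A (delta : R) :=
  [set x | exists2 y, A y & enorm (x - y) <= delta].

Definition mollifier (eta : 'rV[R]_n -> R) :=
  [/\ smooth eta,
      forall x, 0 <= eta x,
      forall x y, enorm x = enorm y -> eta x = eta y,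
      forall x, 1 < enorm x -> eta x = 0
    & (\int[lebesgue_rV R n]_x (eta x)%:E = 1)%E].

Definition rescale (eta : 'rV[R]_n -> R) (eps : R) x : R :=
  eps ^- n * eta (eps^-1 *: x).

Definition mollify (theta : probability 'rV[R]_n R) (rho : 'rV[R]_n -> R) x : R :=
  \int[theta]_y rho (x - y).

Definition with_density (rho : 'rV[R]_n -> R) : set 'rV[R]_n -> \bar R :=
  fun E => (\int[lebesgue_rV R n]_(x in E) (rho x)%:E)%E.

End euclidean.

(* Measures on [0, T] x R^m are represented by measures on R x R^m that vanish
   outside of [0, T] x R^m. *)
Section young.
Context (R : realType) (m : nat) (T : R).

Definition ymeasure :=
  {measure set (measurableTypeR R * 'rV[R]_m)%type -> \bar R}.
Implicit Types nu : ymeasure.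

Definition strip : set (measurableTypeR R * 'rV[R]_m) := `[0, T] `*` setT.

Definition young_measure nu := nu (~` strip) = 0%E /\
  forall B : set (measurableTypeR R), measurable B -> B `<=` `[0, T] ->
    nu (B `*` setT) = lebesgue_measure B.

Definition bounded_caratheodory (phi : measurableTypeR R * 'rV[R]_m -> R) :=
  [/\ measurable_fun strip phi,
      forall t, t \in `[0, T] -> continuous (fun w => phi (t, w))
    & exists M, forall p, strip p -> `|phi p| <= M].

(* Convergence in the coarsest topology that makes nu |-> \int[nu] phi
   continuous for every bounded Caratheodory integrand phi. *)
Definition young_cvg (nus : nat -> ymeasure) nu :=
  forall phi, bounded_caratheodory phi ->
    \int[nus j]_(p in strip) phi p @[j --> \oo] --> \int[nu]_(p in strip) phi p.

(* For closed U, the support of nu is contained in [0, T] x U if and only if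
   the complement of [0, T] x U is null. *)
Definition gen_control (U : set 'rV[R]_m) nu :=
  young_measure nu /\ nu (~` (`[0, T] `*` U)) = 0%E.

(* The values of the kernel outside of [0, T] are irrelevant. *)
Definition disintegration nu (k : R.-pker measurableTypeR R ~> 'rV[R]_m) :=
  forall psi : measurableTypeR R * 'rV[R]_m -> R,
    nu.-integrable strip (EFin \o psi) ->
    (\int[nu]_(p in strip) (psi p)%:E =
     \int[lebesgue_measure]_(t in `[0%R, T]) \int[k t]_w (psi (t, w))%:E)%E.

End young.

Section trajectories.
Context (R : realType) (n m : nat) (T : R) (U : set 'rV[R]_m)
        (v : R -> 'rV[R]_n -> 'rV[R]_m -> 'rV[R]_n).

Definition averaged_field (k : R.-pker measurableTypeR R ~> 'rV[R]_m)
    (t : R) (x : 'rV[R]_n) : 'rV[R]_n :=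
  \row_i \int[k t]_(w in U) v t x w 0 i.

(* C_c^oo(]0, T[ x R^n), extended by 0 to R x R^n. *)
Definition test_function (phi : R * 'rV[R]_n -> R) :=
  let supp := closure [set p | phi p != 0] in
  [/\ smooth phi, compact supp & supp `<=` `]0, T[ `*` setT].

Definition narrowly_continuous (mu : R -> probability 'rV[R]_n R) :=
  forall f : 'rV[R]_n -> R, continuous f -> (exists M, forall x, `|f x| <= M) ->
    {within `[0, T], continuous (fun t => \int[mu t]_x f x)}.

Definition continuity_equation (b : R -> 'rV[R]_n -> 'rV[R]_n)
    (mu : R -> probability 'rV[R]_n R) :=
  forall phi, test_function phi ->
    \int[lebesgue_measure]_(t in `[0, T]) \int[mu t]_x
      ('D_(1, 0) phi (t, x)
       + \sum_i b t x 0 i * 'D_(0, delta_mx 0 i) phi (t, x)) = 0.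

Definition is_trajectory (vartheta : set 'rV[R]_n -> \bar R) (nu : ymeasure R m)
    (mu : R -> probability 'rV[R]_n R) :=
  [/\ narrowly_continuous mu,
      forall E, measurable E -> mu 0 E = vartheta E
    & exists2 k, disintegration T nu k &
        continuity_equation (averaged_field k) mu].

(* The trajectory is unique on [0, T] only: its values elsewhere are junk. *)
Definition trajectory vartheta nu : R -> probability 'rV[R]_n R :=
  get (is_trajectory vartheta nu).

Definition payoff vartheta A nu : \bar R := trajectory vartheta nu T A.

Definition optimal vartheta A nu := gen_control T U nu /\
  forall nu', gen_control T U nu' ->
    (payoff vartheta A nu' <= payoff vartheta A nu)%E.

Definition max_payoff vartheta A : \bar R :=
  ereal_sup [set payoff vartheta A nu | nu in gen_control T U].

End trajectories.

(* Main.v *)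
(* Along the Euler scheme, hence for the flow of the averaged field, a control
   enters only through integrals of v(., x, .) against it, so the time-T flow map
   Phi_nu depends continuously (pointwise) on nu. Testing the continuity equation
   against mollified Lipschitz functions transported by the Euler maps shows that
   any trajectory satisfies mu(T) = image of its initial measure by Phi_nu, so the
   payoff of nu is the measure of the preimage of A.

   Controls are sequentially compact: the masses of finer and finer cells of U
   converge along an ultrafilter; the time densities of the limits (Radon-Nikodym)
   are stacked into nested subintervals of [0, 1], and following the nested cells
   gives a measurable map (t, z) -> U whose law in z is the limit kernel at t.
   Since Phi_nu is r-Lipschitz,
     theta(Phi^-1 A) <= theta_eps(Phi^-1 A_(r eps)) <= theta(Phi^-1 A_(2 r eps)),
   and with the pointwise convergence of the flow maps this gives the limits. In
   the last claim Phi^-1 of the null set (boundary of A) is null because Phi is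
   bi-Lipschitz. *)
Require Import Defs.
From HB Require Import structures.
From mathcomp Require Import all_boot all_order all_algebra.
From mathcomp Require Import zify lra ring.
From mathcomp Require Import all_classical all_reals all_analysis measurable_realfun.

Set Implicit Arguments.
Unset Strict Implicit.
Unset Printing Implicit Defensive.

Import Order.TTheory GRing.Theory Num.Theory.
Import numFieldNormedType.Exports.

Local Open Scope classical_set_scope.
Local Open Scope ring_scope.

(** * Integrals of bounded functions *)

(** Two obstacles shape the proof. Narrow convergence of controls gives no pointwise convergence of
    the averaged fields: oscillations in time only average out after integration in t with x frozen.
    An Euler step does freeze x, so it passes to the limit, and its error depends on L, C, T and x
    but not on the control. The Euler maps also carry the sharp constant exp(LT) behind r.

    The averaged field is handled as merely measurable in time, so its flow cannot be put inside a
    test function. Instead mu is mollified at scale eps and paired with f composed with the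
    remaining Euler steps. Mollifying before or after a step changes the pairing by O(dt eps), which
    sums to O(eps); N tends to infinity first, then eps to 0.

    [trajectory] is a [get], so payoffs are known only after existence and uniqueness. Both use a
    disintegration of the control, obtained from compactness applied to a constant sequence. The
    ultrafilter limit yields a control but no subsequence of controls; a subsequence is extracted
    for the flow maps only, through a countable dense set of points. *)

Section bounded_integrals.
Context d (T : measurableType d) (R : realType) (mu : {measure set T -> \bar R}).
Implicit Types (D : set T) (f g : T -> R).

(** Bounded measurable functions on a set of finite measure are stable under products as well as
    sums, which integrability is not. One predicate thus discharges the side conditions of all the
    integral manipulations below. *)
Definition bmeas D f := [/\ measurable D, (mu D < +oo)%E, measurable_fun D f
  & exists M, forall x, D x -> `|f x| <= M].

Lemma bmeas_integrable D f : bmeas D f -> mu.-integrable D (EFin \o f).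
Proof.
move=> [mD Doo mf [M fM]]; apply: measurable_bounded_integrable => //.
exists M; split; first exact: num_real.
by move=> y My x Dx; rewrite /= (le_trans (fM _ Dx))// ltW.
Qed.

Lemma bmeas_cst D k : measurable D -> (mu D < +oo)%E -> bmeas D (fun=> k).
Proof. by move=> mD Doo; split => //; exists `|k|. Qed.

Lemma bmeasD D f g : bmeas D f -> bmeas D g -> bmeas D (fun x => f x + g x).
Proof.
move=> [mD Doo mf [M fM]] [_ _ mg [N gN]]; split => //.
  exact: measurable_funD.
by exists (M + N) => x Dx; rewrite (le_trans (ler_normD _ _))// lerD ?fM ?gN.
Qed.

Lemma bmeasM D f g : bmeas D f -> bmeas D g -> bmeas D (fun x => f x * g x).
Proof.
move=> [mD Doo mf [M fM]] [_ _ mg [N gN]]; split => //.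
  exact: measurable_funM.
by exists (M * N) => x Dx; rewrite normrM ler_pM// ?fM ?gN.
Qed.

Lemma bmeasZ D k f : bmeas D f -> bmeas D (fun x => k * f x).
Proof. by move=> bf; apply: bmeasM => //; case: bf => *; exact: bmeas_cst. Qed.

Lemma bmeasN D f : bmeas D f -> bmeas D (fun x => - f x).
Proof.
by move=> bf; under eq_fun do rewrite -mulN1r; exact: bmeasZ.
Qed.

Lemma bmeasB D f g : bmeas D f -> bmeas D g -> bmeas D (fun x => f x - g x).
Proof. by move=> bf bg; apply: bmeasD => //; exact: bmeasN. Qed.

Lemma bmeas_norm D f : bmeas D f -> bmeas D (fun x => `|f x|).
Proof.
move=> [mD Doo mf [M fM]]; split => //; first exact: measurableT_comp.
by exists M => x Dx; rewrite normr_id fM.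
Qed.

Lemma bmeas_sum D (I : Type) (r : seq I) (F : I -> T -> R) :
  measurable D -> (mu D < +oo)%E -> (forall i, bmeas D (F i)) ->
  bmeas D (fun x => \sum_(i <- r) F i x).
Proof.
move=> mD Doo bF; elim: r => [|i r IH].
  under eq_fun do rewrite big_nil; exact: bmeas_cst.
by under eq_fun do rewrite big_cons; exact: bmeasD.
Qed.

Lemma bmeasS D D' f : measurable D' -> D' `<=` D -> bmeas D f -> bmeas D' f.
Proof.
move=> mD' DD [mD Doo mf [M fM]]; split => //.
- by rewrite (le_lt_trans _ Doo)// le_measure// inE.
- exact: measurable_funS mf.
- by exists M => x /DD; exact: fM.
Qed.

Lemma eq_bmeas D f g : (forall x, D x -> f x = g x) -> bmeas D f -> bmeas D g.
Proof.
move=> fg [mD Doo mf [M fM]]; split => //.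
  by apply: eq_measurable_fun mf => x; rewrite inE => /fg.
by exists M => x Dx; rewrite -fg// fM.
Qed.

Lemma Rintegral_sum D (I : Type) (r : seq I) (F : I -> T -> R) :
  measurable D -> (mu D < +oo)%E -> (forall i, bmeas D (F i)) ->
  \int[mu]_(x in D) (\sum_(i <- r) F i x) = \sum_(i <- r) \int[mu]_(x in D) F i x.
Proof.
move=> mD Doo bF; elim: r => [|i r IH].
  rewrite big_nil; under eq_Rintegral do rewrite big_nil.
  by rewrite Rintegral_cst// mul0r.
rewrite big_cons -IH; under eq_Rintegral do rewrite big_cons.
by rewrite RintegralD//; apply: bmeas_integrable => //; exact: bmeas_sum.
Qed.

Lemma le_normr_bound D f M : bmeas D f -> (forall x, D x -> `|f x| <= M) ->
  `|\int[mu]_(x in D) f x| <= M * fine (mu D).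
Proof.
move=> bf fM; have [mD Doo _ _] := bf.
rewrite (le_trans (le_normr_Rintegral _ (bmeas_integrable bf)))//.
rewrite -Rintegral_cst//; apply: le_Rintegral => //; apply: bmeas_integrable.
  exact: bmeas_norm.
exact: bmeas_cst.
Qed.

Lemma bmeas_dominated_cvg D (f_ : nat -> T -> R) f M :
  (forall n, bmeas D (f_ n)) -> (forall n x, D x -> `|f_ n x| <= M) ->
  (forall x, D x -> f_ ^~ x @ \oo --> f x) ->
  bmeas D f /\
  \int[mu]_(x in D) f_ n x @[n --> \oo] --> \int[mu]_(x in D) f x.
Proof.
move=> bf fM ff; have [mD Doo _ _] := bf 0%N.
have mf : measurable_fun D f.
  apply: (@measurable_fun_cvg _ _ _ _ f_) => //.
  by move=> n; case: (bf n).
have fM' x : D x -> `|f x| <= M.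
  move=> Dx; have /cvg_norm := ff _ Dx.
  move=> h; rewrite -(cvg_lim _ h)//.
  apply: limr_le; first by apply/cvg_ex; eexists; exact: h.
  by apply: nearW => n; exact: fM.
have bff : bmeas D f by split => //; exists M.
split=> //.
have ig : mu.-integrable D (cst M%:E).
  by apply: (@bmeas_integrable D (cst M)); exact: bmeas_cst.
have mf_ n : measurable_fun D (EFin \o f_ n).
  by apply/measurable_EFinP; case: (bf n).
have mf' : measurable_fun D (EFin \o f) by exact/measurable_EFinP.
have ae1 : {ae mu, forall x, D x -> (fun n => (EFin \o f_ n) x) @ \oo --> (EFin \o f) x}.
  by apply: aeW => x Dx; apply: cvg_comp (ff _ Dx) _.
have ae2 : {ae mu, forall x n, D x -> (`|(EFin \o f_ n) x| <= cst M%:E x)%E}.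
  by apply: aeW => x n Dx; rewrite lee_fin fM.
have [_ _ h] := dominated_convergence mD mf_ mf' ae1 ig ae2.
apply: fine_cvg; rewrite fineK; first exact: h.
by apply: integrable_fin_num => //; exact: bmeas_integrable.
Qed.

Lemma RintD D f g : bmeas D f -> bmeas D g ->
  \int[mu]_(x in D) (f x + g x) = \int[mu]_(x in D) f x + \int[mu]_(x in D) g x.
Proof.
by move=> bf bg; rewrite RintegralD//; [case: bf|exact: bmeas_integrable..].
Qed.

Lemma RintB D f g : bmeas D f -> bmeas D g ->
  \int[mu]_(x in D) (f x - g x) = \int[mu]_(x in D) f x - \int[mu]_(x in D) g x.
Proof.
by move=> bf bg; rewrite RintegralB//; [case: bf|exact: bmeas_integrable..].
Qed.

Lemma RintZ D k f : bmeas D f ->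
  \int[mu]_(x in D) (k * f x) = k * \int[mu]_(x in D) f x.
Proof. by move=> bf; rewrite RintegralZl//; [case: bf|exact: bmeas_integrable]. Qed.

Lemma le_Rint D f g : bmeas D f -> bmeas D g -> (forall x, D x -> f x <= g x) ->
  \int[mu]_(x in D) f x <= \int[mu]_(x in D) g x.
Proof.
by move=> bf bg; apply: le_Rintegral; [case: bf|exact: bmeas_integrable..].
Qed.

Lemma le_normr_Rint D f : bmeas D f ->
  `|\int[mu]_(x in D) f x| <= \int[mu]_(x in D) `|f x|.
Proof.
by move=> bf; apply: le_normr_Rintegral; [case: bf|exact: bmeas_integrable].
Qed.

Lemma RintE D f : bmeas D f ->
  (\int[mu]_(x in D) f x)%:E = (\int[mu]_(x in D) (f x)%:E)%E.
Proof.
move=> bf; rewrite fineK//; apply: integrable_fin_num => //.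
  by case: bf.
exact: bmeas_integrable.
Qed.

Lemma bmeas_indic D A : measurable D -> (mu D < +oo)%E -> measurable A ->
  bmeas D (\1_A : T -> R).
Proof.
move=> mD Doo mA; split => //.
by exists 1 => x _; rewrite indicE; case: (_ \in _); rewrite ?normr1 ?normr0.
Qed.

End bounded_integrals.
Arguments bmeas {d T R} mu D f.

Section bounded_fubini.
Context d1 d2 (X : measurableType d1) (Y : measurableType d2) (R : realType).
Variables (m1 : {sigma_finite_measure set X -> \bar R})
  (m2 : {sigma_finite_measure set Y -> \bar R}).
Variables (D1 : set X) (D2 : set Y) (f : X -> Y -> R) (M : R).
Hypothesis mD1 : measurable D1.
Hypothesis mD2 : measurable D2.
Hypothesis D1oo : (m1 D1 < +oo)%E.
Hypothesis D2oo : (m2 D2 < +oo)%E.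
Hypothesis mf : measurable_fun (D1 `*` D2) (fun p => f p.1 p.2).
Hypothesis fM : forall x y, D1 x -> D2 y -> `|f x y| <= M.

(** Extension by zero turns integrals over the rectangle into integrals over the whole product,
    where Fubini's theorem applies; [FE] and [GE] translate its sections back. *)
Let F := (fun p => f p.1 p.2) \_ (D1 `*` D2).

Let mF : measurable_fun setT F.
Proof. by apply/(measurable_restrictT _ _).1 => //; exact: measurableX. Qed.

Let bF : bmeas (m1 \x m2)%E (D1 `*` D2) (fun p => f p.1 p.2).
Proof.
split => //; first exact: measurableX.
  have := @product_measure1E _ _ _ _ _ m1 m2 _ _ mD1 mD2 => /= ->.
  by rewrite lte_mul_pinfty// ge0_fin_numE.
by exists M => -[x y] [/= ? ?]; exact: fM.
Qed.

Let iF : (m1 \x m2)%E.-integrable setT (EFin \o F).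
Proof.
rewrite -restrict_EFin; apply/integrable_restrict => //.
  exact: measurableX.
by rewrite setTI; exact: bmeas_integrable.
Qed.

Let bfx x : D1 x -> bmeas m2 D2 (f x).
Proof.
move=> D1x; split => //; last by exists M => y; exact: fM.
apply: eq_measurable_fun (_ : measurable_fun D2 (fun y => F (x, y))).
  move=> y; rewrite inE => D2y.
  by rewrite /F patchE mem_set.
apply: measurable_funTS.
exact: measurable_comp (measurableT) _ mF (measurable_pair1 _).
Qed.

Let bfy y : D2 y -> bmeas m1 D1 (f ^~ y).
Proof.
move=> D2y; split => //; last by exists M => x D1x; exact: fM.
apply: eq_measurable_fun (_ : measurable_fun D1 (fun x => F (x, y))).
  move=> x; rewrite inE => D1x.
  by rewrite /F patchE mem_set.
apply: measurable_funTS.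
exact: measurable_comp (measurableT) _ mF (measurable_pair2 _).
Qed.

Let FE x : (\int[m2]_y (F (x, y))%:E)%E =
  ((fun x => (\int[m2]_(y in D2) f x y))%R \_ D1 x)%:E.
Proof.
rewrite patchE; case: ifPn => [|] D1x.
  rewrite inE in D1x; rewrite RintE; last exact: bfx.
  rewrite [RHS]integral_mkcond; apply: eq_integral => y _.
  by rewrite restrict_EFin /F !patchE in_setX (mem_set D1x).
by apply: integral0_eq => y _; rewrite /F patchE in_setX (negbTE D1x).
Qed.

Let GE y : (\int[m1]_x (F (x, y))%:E)%E =
  ((fun y => (\int[m1]_(x in D1) f x y))%R \_ D2 y)%:E.
Proof.
rewrite patchE; case: ifPn => [|] D2y.
  rewrite inE in D2y; rewrite RintE; last exact: bfy.
  rewrite [RHS]integral_mkcond; apply: eq_integral => x _.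
  by rewrite restrict_EFin /F !patchE in_setX (mem_set D2y) andbT.
by apply: integral0_eq => x _; rewrite /F patchE in_setX (negbTE D2y) andbF.
Qed.

Lemma bmeas_Rint1 : bmeas m1 D1 (fun x => \int[m2]_(y in D2) f x y).
Proof.
split => //; last first.
  exists (M * fine (m2 D2)) => x D1x; apply: le_normr_bound; first exact: bfx.
  by move=> y; exact: fM.
apply/(measurable_restrictT _ _).2 => //; apply/measurable_EFinP.
have := measurable_fubini_F iF; congr measurable_fun.
by apply/funext => x; exact: FE.
Qed.

Lemma bmeas_Rint2 : bmeas m2 D2 (fun y => \int[m1]_(x in D1) f x y).
Proof.
split => //; last first.
  exists (M * fine (m1 D1)) => y D2y; apply: le_normr_bound; first exact: bfy.
  by move=> x D1x; exact: fM.
apply/(measurable_restrictT _ _).2 => //; apply/measurable_EFinP.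
have := measurable_fubini_G iF; congr measurable_fun.
by apply/funext => x; exact: GE.
Qed.

Lemma Rint_fubini : \int[m1]_(x in D1) \int[m2]_(y in D2) f x y =
  \int[m2]_(y in D2) \int[m1]_(x in D1) f x y.
Proof.
apply: EFin_inj; rewrite !RintE; [|exact: bmeas_Rint2|exact: bmeas_Rint1].
rewrite [LHS]integral_mkcond [RHS]integral_mkcond.
have := Fubini iF; congr (_ = _).
  by apply: eq_integral => x _; rewrite restrict_EFin; first [exact: FE|exact/esym/FE].
by apply: eq_integral => x _; rewrite restrict_EFin; exact: GE.
Qed.

Lemma Rint_prod : \int[(m1 \x m2)%E]_(p in D1 `*` D2) f p.1 p.2 =
  \int[m1]_(x in D1) \int[m2]_(y in D2) f x y.
Proof.
apply: EFin_inj; rewrite !RintE//; last exact: bmeas_Rint1.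
rewrite [LHS]integral_mkcond [RHS]integral_mkcond.
have := integral12_prod_meas1 iF => /esym; congr (_ = _).
  by apply: eq_integral => x _; rewrite restrict_EFin.
by apply: eq_integral => x _; rewrite restrict_EFin; first [exact: FE|exact/esym/FE].
Qed.

End bounded_fubini.

(** * Euclidean norm on row vectors and its comparison with the sup norm *)

Section enorm_theory.
Context (R : realType) (n : nat).
Implicit Types (x y z : 'rV[R]_n) (k : R).

Lemma enorm_ge0 x : 0 <= enorm x. Proof. exact: sqrtr_ge0. Qed.

Lemma sqr_enorm x : enorm x ^+ 2 = \sum_i x 0 i ^+ 2.
Proof. by rewrite sqr_sqrtr// sumr_ge0// => i _; exact: sqr_ge0. Qed.

Lemma enorm_le x k : 0 <= k -> (\sum_i x 0 i ^+ 2 <= k ^+ 2) = (enorm x <= k).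
Proof. by move=> k0; rewrite -sqr_enorm ler_sqr ?nnegrE ?enorm_ge0. Qed.

Lemma enorm0 : enorm (0 : 'rV[R]_n) = 0.
Proof. by rewrite /enorm big1 ?sqrtr0// => i _; rewrite mxE expr0n. Qed.

Lemma enormZ k x : enorm (k *: x) = `|k| * enorm x.
Proof.
rewrite /enorm -sqrtr_sqr -sqrtrM ?sqr_ge0//; congr Num.sqrt.
by rewrite mulr_sumr; apply: eq_bigr => i _; rewrite mxE exprMn.
Qed.

Lemma enormN x : enorm (- x) = enorm x.
Proof. by rewrite -scaleN1r enormZ normrN1 mul1r. Qed.

Lemma enorm_distC x y : enorm (x - y) = enorm (y - x).
Proof. by rewrite -enormN opprB. Qed.

Lemma coord_le_enorm x i : `|x 0 i| <= enorm x.
Proof.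
rewrite -sqrtr_sqr; apply: ler_wsqrtr.
by rewrite (bigD1 i)//= lerDl sumr_ge0// => j _; exact: sqr_ge0.
Qed.

Lemma enorm_eq0 x : enorm x = 0 -> x = 0.
Proof.
move=> x0; apply/rowP => i; apply/eqP; rewrite mxE -normr_le0 -x0.
exact: coord_le_enorm.
Qed.

(** Cauchy-Schwarz, by summing the squares of |y| |x_i| - |x| |y_i|. Dividing by 2 |x| |y| requires
    both norms to be positive, so the zero vectors are treated first. *)
Lemma enorm_dot x y : `|\sum_i x 0 i * y 0 i| <= enorm x * enorm y.
Proof.
have [/eqP/enorm_eq0->|x0] := boolP (enorm x == 0).
  by rewrite big1 ?normr0 ?mulr_ge0 ?enorm_ge0// => i _; rewrite mxE mul0r.
have [/eqP/enorm_eq0->|y0] := boolP (enorm y == 0).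
  by rewrite big1 ?normr0 ?mulr_ge0 ?enorm_ge0// => i _; rewrite mxE mulr0.
have {}x0 : 0 < enorm x by rewrite lt_neqAle eq_sym x0 enorm_ge0.
have {}y0 : 0 < enorm y by rewrite lt_neqAle eq_sym y0 enorm_ge0.
rewrite (le_trans (ler_norm_sum _ _ _))//.
rewrite -subr_ge0 -(pmulr_rge0 _ (_ : 0 < 2 * (enorm x * enorm y))); last first.
  by rewrite !mulr_gt0.
rewrite mulrBr -mulrA -expr2 exprMn.
have -> : 2 * (enorm x ^+ 2 * enorm y ^+ 2) =
    \sum_i (enorm y ^+ 2 * x 0 i ^+ 2 + enorm x ^+ 2 * y 0 i ^+ 2).
  rewrite big_split/= -!mulr_sumr -!sqr_enorm; ring.
rewrite mulr_sumr -sumrB sumr_ge0// => i _.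
have -> : enorm y ^+ 2 * x 0 i ^+ 2 + enorm x ^+ 2 * y 0 i ^+ 2 -
    2 * (enorm x * enorm y) * `|x 0 i * y 0 i| =
    (enorm y * `|x 0 i| - enorm x * `|y 0 i|) ^+ 2.
  by rewrite normrM sqrrB !exprMn -!normrX !(ger0_norm (sqr_ge0 _)); ring.
exact: sqr_ge0.
Qed.

Lemma enormD x y : enorm (x + y) <= enorm x + enorm y.
Proof.
rewrite -enorm_le ?addr_ge0 ?enorm_ge0//.
have -> : \sum_i (x + y) 0 i ^+ 2 =
    enorm x ^+ 2 + 2 * (\sum_i x 0 i * y 0 i) + enorm y ^+ 2.
  rewrite !sqr_enorm mulr_sumr -!big_split/=; apply: eq_bigr => i _.
  by rewrite mxE; ring.
rewrite [leRHS](_ : _ = enorm x ^+ 2 + 2 * (enorm x * enorm y) + enorm y ^+ 2).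
  by rewrite lerD2r lerD2l ler_pM2l// (le_trans (ler_norm _))// enorm_dot.
by ring.
Qed.

Lemma enormB x y : enorm (x - y) <= enorm x + enorm y.
Proof. by rewrite (le_trans (enormD _ _))// enormN. Qed.

Lemma enorm_triangle x y z : enorm (x - z) <= enorm (x - y) + enorm (y - z).
Proof.
have -> : x - z = (x - y) + (y - z) by rewrite addrA subrK.
exact: enormD.
Qed.

Lemma enorm_dist x y : `|enorm x - enorm y| <= enorm (x - y).
Proof.
have h (a b : 'rV[R]_n) : enorm a - enorm b <= enorm (a - b).
  by rewrite lerBlDr; have := enormD (a - b) b; rewrite subrK.
by rewrite ler_norml h andbT lerNl opprB enorm_distC h.
Qed.

Lemma norm_le_enorm x : `|x| <= enorm x.
Proof.
rewrite [leLHS]/Num.norm/= mx_normrE; apply: bigmax_le; first exact: enorm_ge0.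
by move=> [i j] _ /=; rewrite (ord1 i) coord_le_enorm.
Qed.

Lemma coord_le_norm x i : `|x 0 i| <= `|x|.
Proof.
rewrite [leRHS]/Num.norm/= mx_normrE.
exact: (le_bigmax _ (fun ij => `|x ij.1 ij.2|) (0, i)).
Qed.

Lemma enorm_le_norm x : enorm x <= n%:R * `|x|.
Proof.
rewrite -enorm_le ?mulr_ge0//.
have [n0|n0] := posnP n.
  rewrite big1 ?sqr_ge0// => i _; exfalso.
  by case: i => i; rewrite n0.
apply: (@le_trans _ _ (\sum_(i < n) `|x| ^+ 2)).
  apply: ler_sum => i _.
  by rewrite -(ger0_norm (sqr_ge0 (x 0 i))) normrX ler_sqr ?nnegrE// coord_le_norm.
rewrite sumr_const card_ord exprMn -[leLHS]mulr_natl ler_wpM2r ?sqr_ge0//.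
by rewrite -natrX ler_nat -[leqLHS]muln1 leq_mul2l n0 orbT.
Qed.

Lemma enorm_continuous : continuous (@enorm R n).
Proof.
move=> x; apply/(@cvgrPdist_le R R _ (nbhs x) (@nbhs_pfilter _ x)) => e e0.
have e1 : 0 < e / (n%:R + 1) by rewrite divr_gt0// ltr_wpDl.
near=> y; rewrite (le_trans (enorm_dist _ _))// (le_trans (enorm_le_norm _))//.
have : `|x - y| <= e / (n%:R + 1) by near: y; exact: cvgr_dist_le.
rewrite ler_pdivlMr ?ltr_wpDl// mulrC => /(le_trans _); apply.
by rewrite ler_wpM2r// lerDl.
Unshelve. all: by end_near. Qed.

Lemma cvg_enormP (I : Type) (F : set_system I) (f : I -> 'rV[R]_n) x :
  Filter F -> f @ F --> x <-> enorm (f z - x) @[z --> F] --> (0 : R).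
Proof.
move=> FF; split=> [Fx|h].
  have h : f z - x @[z --> F] --> x - x by apply: cvgB => //; exact: cvg_cst.
  by have := cvg_comp _ (@enorm R n) h (@enorm_continuous (x - x)); rewrite subrr enorm0.
apply/cvgrPdist_le => e e0.
move/cvgrPdist_le : h => /(_ _ e0).
apply: filterS => y; rewrite sub0r normrN ger0_norm ?enorm_ge0//.
by apply: le_trans; rewrite enorm_distC norm_le_enorm.
Qed.

Lemma cvg_rowP (I : Type) (F : set_system I) (f : I -> 'rV[R]_n) x : Filter F ->
  (forall i, f z 0 i @[z --> F] --> x 0 i) -> f @ F --> x.
Proof.
move=> FF fx; apply/cvgrPdist_le => e e0.
have : \forall z \near F, forall i, `|x 0 i - f z 0 i| <= e.
  apply: filter_forall => i; apply: (cvgrPdist_le _ _).1 => //; exact: fx.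
apply: filterS => z zP.
rewrite [leLHS]/Num.norm/= mx_normrE; apply: bigmax_le; first exact: ltW.
by move=> [i j] _ /=; rewrite (ord1 i) !mxE.
Qed.

Lemma compact_enorm_bounded (A : set 'rV[R]_n) : compact A ->
  exists2 B, 0 < B & forall x, A x -> enorm x <= B.
Proof.
move=> /compact_bounded[M [Mr hM]].
exists (n%:R * (`|M| + 1) + 1); first by rewrite ltr_wpDl// mulr_ge0.
move=> x Ax; rewrite (le_trans (enorm_le_norm _))//.
rewrite -[leLHS]addr0 lerD// ler_wpM2l//; apply: hM Ax.
by rewrite (le_lt_trans (ler_norm M))// ltrDl.
Qed.

Lemma closed_enorm_compact (A : set 'rV[R]_n) B : closed A ->
  (forall x, A x -> enorm x <= B) -> compact A.
Proof.
move=> cA AB; apply: bounded_closed_compact => //.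
exists B; split; first exact: num_real.
move=> y By x Ax /=; rewrite (le_trans (norm_le_enorm _))//.
by rewrite (le_trans (AB _ Ax))// ltW.
Qed.

End enorm_theory.

(** * Coordinatewise integrals of vector-valued functions *)

Section vector_integral.
Context d (T : measurableType d) (R : realType) (n : nat).

Definition rowint (mu : {measure set T -> \bar R}) (D : set T)
  (f : T -> 'rV[R]_n) : 'rV[R]_n := \row_i \int[mu]_(z in D) f z 0 i.

Variable mu : {measure set T -> \bar R}.

(** Coordinatewise bounds would cost a dimensional factor. Pairing the integral u with itself avoids
    it: |u|^2 is the integral of u . f, hence at most |u| times the integral of g. *)
Lemma enorm_rowint_le (D : set T) (f : T -> 'rV[R]_n) (g : T -> R) :
  (forall i, bmeas mu D (fun z => f z 0 i)) -> bmeas mu D g ->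
  (forall z, D z -> enorm (f z) <= g z) ->
  enorm (rowint mu D f) <= \int[mu]_(z in D) g z.
Proof.
move=> bf bg fg; set u := rowint mu D f.
have K0 : 0 <= \int[mu]_(z in D) g z.
  by apply: Rintegral_ge0 => z Dz; rewrite (le_trans _ (fg _ Dz))// enorm_ge0.
have [u0|u0] := leP (enorm u) 0; first exact: le_trans K0.
rewrite -(ler_pM2l u0) -expr2 sqr_enorm.
have [mD Doo _ _] := bg.
have bs : bmeas mu D (fun z => \sum_i u 0 i * f z 0 i).
  by apply: bmeas_sum => // i; exact: bmeasZ.
have -> : \sum_i u 0 i ^+ 2 = \int[mu]_(z in D) (\sum_i u 0 i * f z 0 i).
  rewrite Rintegral_sum// => [|i]; last exact: bmeasZ.
  by apply: eq_bigr => i _; rewrite RintZ// expr2 {2}/u mxE.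
rewrite -RintZ//; apply: le_Rint => //; first exact: bmeasZ.
move=> z Dz; rewrite (le_trans (ler_norm _))// (le_trans (enorm_dot _ _))//.
by rewrite ler_wpM2l ?enorm_ge0// fg.
Qed.

Lemma enorm_rowint (D : set T) (f : T -> 'rV[R]_n) M :
  measurable D -> (mu D < +oo)%E ->
  (forall i, bmeas mu D (fun z => f z 0 i)) ->
  (forall z, D z -> enorm (f z) <= M) ->
  enorm (rowint mu D f) <= M * fine (mu D).
Proof.
move=> mD Doo bf fM; rewrite -Rintegral_cst//.
by apply: enorm_rowint_le => //; exact: bmeas_cst.
Qed.

Lemma rowintB (D : set T) (f g : T -> 'rV[R]_n) :
  (forall i, bmeas mu D (fun z => f z 0 i)) ->
  (forall i, bmeas mu D (fun z => g z 0 i)) ->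
  rowint mu D f - rowint mu D g = rowint mu D (fun z => f z - g z).
Proof.
move=> bf bg; apply/rowP => i; rewrite !mxE -RintB//.
by apply: eq_Rintegral => z _; rewrite !mxE.
Qed.

End vector_integral.

(** * Measurability of continuous functions for product sigma-algebras *)

Section continuous_measurable.
Context (R : realType).

Lemma cvg_pairP (I : Type) (F : set_system I) (V W : topologicalType)
  (f : I -> V) (g : I -> W) (a : V) (b : W) : Filter F ->
  f @ F --> a -> g @ F --> b -> (f x, g x) @[x --> F] --> (a, b).
Proof. by move=> FF fa gb; exact: cvg_pair. Qed.

Lemma within_continuous_measurable_rV n (D : set 'rV[R]_n) (f : 'rV[R]_n -> R) :
  closed D -> {within D, continuous f} -> measurable_fun D f.
Proof.
move=> cD cf; have mD : measurable D.
  by rewrite -[D]setCK; apply: measurableC; apply: rV_open_measurable;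
     exact: closed_openC.
apply: (measurability _ (RGenOpens.measurableE R)) => //.
move=> _ [_ [a [b ->]] <-].
have oab : open (`]a, b[%classic : set R) by exact: interval_open.
have [V oV VD] := (open_subspaceP _ _).1 ((continuousP _).1 cf _ oab).
rewrite setIC -VD; apply: measurableI => //.
exact: rV_open_measurable.
Qed.

Lemma continuous_measurable_rV n (f : 'rV[R]_n -> R) :
  continuous f -> measurable_fun setT f.
Proof.
move=> cf; apply: within_continuous_measurable_rV; first exact: closedT.
exact: continuous_subspaceT.
Qed.

Lemma continuous_measurable_RrV n (f : R * 'rV[R]_n -> R) : continuous f ->
  measurable_fun setT (f : measurableTypeR R * 'rV[R]_n -> R).
Proof.
move=> cf.
have -> : f = (f \o @unconsrV R n) \o @consrV R n.
  by apply/funext => p /=; rewrite consrVK.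
apply: (measurableT_comp _ (@measurable_consrV R n)).
apply: continuous_measurable_rV => x; apply: continuous_comp; last exact: cf.
apply: (@cvg_pairP _ (nbhs x) R 'rV[R]_n (fun x : 'rV[R]_n.+1 => x 0 ord0)
  (fun x : 'rV[R]_n.+1 => \row_i x 0 (lift ord0 i))).
  exact: coord_continuous.
by apply: cvg_rowP => i; rewrite mxE; under eq_fun do rewrite mxE;
  exact: coord_continuous.
Qed.

(** The sigma-algebra on the triple is a product one, not generated by open sets. Gluing the triple
    into a single row vector moves the question to a space whose measurable sets are Borel by
    definition: [h] is continuous, and its right inverse [g] is measurable coordinate by
    coordinate. *)
Lemma within_continuous_measurable_glue n m
  (D : set (R * 'rV[R]_n * 'rV[R]_m)) (f : R * 'rV[R]_n * 'rV[R]_m -> R) :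
  closed D -> {within D, continuous f} ->
  measurable_fun (D : set (measurableTypeR R * 'rV[R]_n * 'rV[R]_m))
    (f : measurableTypeR R * 'rV[R]_n * 'rV[R]_m -> R).
Proof.
move=> cD cf.
pose h (x : 'rV[R]_(n.+1 + m)) : R * 'rV[R]_n * 'rV[R]_m :=
  (@unconsrV R n (lsubmx x), rsubmx x).
pose g (p : measurableTypeR R * 'rV[R]_n * 'rV[R]_m) : 'rV[R]_(n.+1 + m) :=
  row_mx (@consrV R n p.1) p.2.
have hg p : h (g p) = p.
  by case: p => [p q]; rewrite /h /g row_mxKl row_mxKr consrVK.
have ch : continuous h.
  move=> x; apply: (@cvg_pairP _ (nbhs x) (R * 'rV[R]_n)%type 'rV[R]_m
    (fun x => @unconsrV R n (lsubmx x)) (fun x => rsubmx x)).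
    apply: (@cvg_pairP _ (nbhs x) R 'rV[R]_n
      (fun x : 'rV[R]_(n.+1 + m) => (lsubmx x) 0 ord0)
      (fun x => \row_i (lsubmx x) 0 (lift ord0 i))).
  - by rewrite mxE; under eq_fun do rewrite mxE; exact: coord_continuous.
  - apply: cvg_rowP => i; rewrite !mxE; under eq_fun do rewrite !mxE.
    exact: coord_continuous.
  - apply: cvg_rowP => i; rewrite !mxE; under eq_fun do rewrite !mxE.
    exact: coord_continuous.
have mg : measurable_fun setT g.
  apply: measurable_fun_rV => i; rewrite /g.
  have [j|j] := splitP i => ij.
    have -> : i = lshift m j by exact: val_inj.
    under eq_fun do rewrite row_mxEl.
    apply: (measurableT_comp (@measurable_coord_rV R _ j)).
    exact: (measurableT_comp (@measurable_consrV R n) measurable_fst).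
  have -> : i = rshift n.+1 j by exact: val_inj.
  under eq_fun do rewrite row_mxEr.
  exact: (measurableT_comp (@measurable_coord_rV R _ j) measurable_snd).
have mfh : measurable_fun (h @^-1` D) (f \o h).
  apply: within_continuous_measurable_rV.
    by apply: closed_comp => // x _; exact: ch.
  apply/continuousP => V oV.
  have [W oW WD] := (open_subspaceP _ _).1 ((continuousP _).1 cf V oV).
  apply/open_subspaceP; exists (h @^-1` W).
    by apply: open_comp => // x _; exact: ch.
  by rewrite -preimage_setI WD.
have cD' : closed (h @^-1` D) by apply: closed_comp => // x _; exact: ch.
have mE : measurable (h @^-1` D).
  rewrite -[X in measurable X]setCK; apply: measurableC.
  by apply: rV_open_measurable; exact: closed_openC.
have gE : g @` D `<=` h @^-1` D by move=> _ [p Dp <-] /=; rewrite hg.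
have := measurable_comp mE gE mfh (measurable_funTS mg).
by congr measurable_fun; apply/funext => p /=; rewrite hg.
Qed.

End continuous_measurable.

(** * Integrals over intervals and geometric convergence *)

Section interval_integrals.
Context (R : realType).
Local Notation leb := (@lebesgue_measure R).

Lemma leb_itv_fin (a c : R) : (leb `[a, c] < +oo)%E.
Proof. by rewrite lebesgue_measure_itv/=; case: ifP => _; rewrite ?ltry// -EFinB ltry. Qed.

Lemma leb_itvE (a c : R) : a <= c -> fine (leb `[a, c]) = c - a.
Proof.
move=> ac; rewrite lebesgue_measure_itv/= lte_fin.
by move: ac; rewrite le_eqVlt => /predU1P[->|->]//; rewrite ltxx subrr.
Qed.

Lemma bmeas_itv (a c M : R) (f : R -> R) : measurable_fun setT f ->
  (forall s, a <= s <= c -> `|f s| <= M) -> bmeas leb `[a, c] f.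
Proof.
move=> mf fM; split => //; [exact: leb_itv_fin|exact: measurable_funTS|].
by exists M => s /=; rewrite in_itv/=; exact: fM.
Qed.

Lemma bmeas_itv_cst (a c k : R) : bmeas leb `[a, c] (fun=> k).
Proof. by apply: bmeas_cst => //; exact: leb_itv_fin. Qed.

Lemma Rint_itvD (a b c : R) (f : R -> R) : a <= b -> b <= c ->
  bmeas leb `[a, c] f ->
  \int[leb]_(s in `[a, c]) f s =
  \int[leb]_(s in `[a, b]) f s + \int[leb]_(s in `[b, c]) f s.
Proof.
move=> ab bc bf; apply/eqP; rewrite addrC -subr_eq; apply/eqP.
rewrite Rintegral_itvB//; last exact: bmeas_integrable.
rewrite Rintegral_itv_obnd_cbnd//; apply: bmeas_integrable.
apply: bmeasS bf => // s /=; rewrite !in_itv/= => /andP[bs ->].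
by rewrite (le_trans ab)// ltW.
Qed.

Lemma Rint_FTC (F f : R -> R) (a c : R) : a <= c -> continuous f ->
  (forall x : R, is_derive x 1 F (f x)) ->
  \int[leb]_(s in `[a, c]) f s = F c - F a.
Proof.
rewrite le_eqVlt => /predU1P[->|ac] cf dF.
  by rewrite set_itv1 Rintegral_set1 subrr.
have cF : continuous F.
  move=> x; have := dF x => -[dx _].
  by apply: differentiable_continuous; exact/derivable1_diffP.
rewrite /Rintegral (@continuous_FTC2 _ f F)//.
- exact: continuous_subspaceT.
- split; first by move=> x _; case: (dF x).
  + by apply: cvg_at_right_filter; exact: cF.
  + by apply: cvg_at_left_filter; exact: cF.
- by move=> x _; rewrite derive1E; case: (dF x).
Qed.

Lemma Rint_expR (k t : R) : 0 <= t ->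
  \int[leb]_(s in `[0, t]) (k * expR (k * s)) = expR (k * t) - 1.
Proof.
move=> t0.
have dF (x : R) : is_derive x 1 (fun s : R => expR (k * s)) (k * expR (k * x)).
  have h : is_derive x 1 (fun s : R => k * s) k.
    by have := @is_deriveZ R R R id k x 1 1 (is_derive_id _ _); rewrite /GRing.scale/= mulr1.
  have := @is_derive1_comp R expR (fun s : R => k * s) x (expR (k * x)) k
    (is_derive_expR _) h.
  by rewrite mulrC.
rewrite (Rint_FTC (F := fun s => expR (k * s)) (f := fun s => k * expR (k * s)))//.
- by rewrite mulr0 expR0.
- move=> x; apply: cvgM; first exact: cvg_cst.
  apply: continuous_comp; last exact: continuous_expR.
  by apply: cvgM; [exact: cvg_cst|exact: cvg_id].
Qed.

(** Nested intervals: [v] increases, [w] decreases, and the limit is the supremum of [v]. The factor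
    2 is the sum of the geometric tail. *)
Lemma geometric_limit (u : nat -> R) A :
  (forall k, `|u k.+1 - u k| <= A / 2 ^+ k) ->
  exists l, forall k, `|u k - l| <= 2 * A / 2 ^+ k.
Proof.
move=> uA.
pose v k := u k - 2 * A / 2 ^+ k.
pose w k := u k + 2 * A / 2 ^+ k.
have A0 : 0 <= A by have := le_trans (normr_ge0 _) (uA 0%N); rewrite expr0 divr1.
have e k : 2 * A / 2 ^+ k = A / 2 ^+ k + A / 2 ^+ k.
  by rewrite -mulrA mulr_natl mulr2n.
have e' k : 2 * A / 2 ^+ k.+1 = A / 2 ^+ k.
  by rewrite exprS invfM mulrACA divff ?mul1r.
have vS k : v k <= v k.+1.
  rewrite /v e' e; have := uA k; rewrite ler_norml => /andP[h _].
  by rewrite -lerBlDl in h *; lra.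
have wS k : w k.+1 <= w k.
  rewrite /w e' e; have := uA k; rewrite ler_norml => /andP[_ h].
  by lra.
have vw k : v k <= w k.
  have : 0 <= 2 * A / 2 ^+ k by rewrite divr_ge0 ?exprn_ge0// mulr_ge0.
  by rewrite /v /w; lra.
have vmono : {homo v : i j / (i <= j)%N >-> i <= j}.
  by apply: homo_leq => //; exact: le_trans.
have wmono : {homo w : i j / (i <= j)%N >-> j <= i}.
  by apply: homo_leq => //; move=> ? ? ? ab bc; exact: le_trans bc ab.
have vw2 i j : v i <= w j.
  rewrite (le_trans (vmono _ _ (leq_maxl i j)))// (le_trans (vw _))//.
  exact/wmono/leq_maxr.
have hs : has_sup (range v).
  split; first by exists (v 0%N), 0%N.
  by exists (w 0%N) => _ [i _ <-].
exists (sup (range v)) => k; rewrite ler_norml.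
have h1 : v k <= sup (range v) by apply: sup_upper_bound => //; exists k.
have h2 : sup (range v) <= w k.
  by apply: ge_sup; [case: hs|move=> _ [i _ <-]].
by move: h1 h2; rewrite /v /w => h1 h2; apply/andP; split; lra.
Qed.

Lemma cvg_geom0 (A : R) : A / 2 ^+ k @[k --> \oo] --> (0 : R).
Proof.
rewrite -[X in _ --> X](mulr0 A); apply: cvgM; first exact: cvg_cst.
under eq_fun do rewrite -exprVn.
apply: cvg_expr; rewrite ger0_norm ?invr_ge0//.
by rewrite invf_lt1// ltr1n.
Qed.

Lemma cvg_geom_dist (u : nat -> R) l A : (forall k, `|u k - l| <= A / 2 ^+ k) ->
  u k @[k --> \oo] --> l.
Proof.
move=> h; apply/cvgrPdist_le => e e0.
have /cvgrPdist_le/(_ _ e0) := cvg_geom0 A.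
apply: filterS => k; rewrite sub0r normrN => kA.
by rewrite distrC (le_trans (h k))// (le_trans (ler_norm _)).
Qed.

Lemma le_geom (a c A : R) : (forall k, a <= c + A / 2 ^+ k) -> a <= c.
Proof.
move=> h; rewrite -[c]addr0.
have hc : c + A / 2 ^+ k @[k --> \oo] --> c + (0 : R).
  by apply: cvgD; [exact: cvg_cst|exact: cvg_geom0].
rewrite -(cvg_lim _ hc)//; apply: limr_ge; first by apply/cvg_ex; exists (c + 0).
exact: nearW.
Qed.

End interval_integrals.

(** * Flows and Euler maps *)
Section flows.
Context (R : realType) (n : nat) (L C : R).
Hypothesis L0 : 0 < L.
Hypothesis C0 : 0 < C.
Local Notation leb := (@lebesgue_measure R).
Local Notation V := 'rV[R]_n.
Implicit Types (b : R -> V -> V) (x : V) (y : R -> V) (t : R).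

(** Time dependence is only measurable, because a field averaged over a kernel inherits no
    continuity in time. The bounds are asked for all times; [control_field] is extended so as to
    satisfy them. *)
Definition admissible b :=
  [/\ forall i, measurable_fun setT
        (fun p : measurableTypeR R * V => b p.1 p.2 0 i),
      forall s x x', enorm (b s x - b s x') <= L * enorm (x - x')
    & forall s x, enorm (b s x) <= C * (1 + enorm x)].

Definition locally_bounded y := (forall i, measurable_fun setT (fun s => y s 0 i)) /\
  forall t, exists M, forall s, 0 <= s <= t -> enorm (y s) <= M.

Lemma bmeas_path b y a c i : admissible b -> locally_bounded y -> 0 <= a ->
  bmeas leb `[a, c] (fun s => b s (y s) 0 i).
Proof.
move=> [mb _ gb] [my yM] a0; have [M hM] := yM c.
apply: (@bmeas_itv _ _ _ (C * (1 + M))).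
  apply: (measurableT_comp (mb i) (g := fun s : measurableTypeR R => (s, y s))).
  by apply: measurable_fun_pair => //; exact: measurable_fun_rV.
move=> s /andP[as_ sc]; rewrite (le_trans (coord_le_enorm _ _))//.
rewrite (le_trans (gb _ _))// ler_pM2l// lerD2l hM// sc andbT.
exact: le_trans as_.
Qed.

Lemma locally_bounded_cst x : locally_bounded (fun=> x).
Proof. by split=> [i|t]; [exact: measurable_cst|exists (enorm x)]. Qed.

Lemma bmeas_frozen b x a c i : admissible b -> bmeas leb `[a, c] (fun s => b s x 0 i).
Proof.
move=> [mb _ gb]; apply: (@bmeas_itv _ _ _ (C * (1 + enorm x))).
  exact: (measurableT_comp (mb i) (g := fun s : measurableTypeR R => (s, x))).
by move=> s _; rewrite (le_trans (coord_le_enorm _ _)).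
Qed.

Lemma enorm_rowint_itv (f : R -> V) a c M : a <= c ->
  (forall i, bmeas leb `[a, c] (fun s => f s 0 i)) ->
  (forall s, a <= s <= c -> enorm (f s) <= M) ->
  enorm (rowint leb `[a, c] f) <= M * (c - a).
Proof.
move=> ac bf fM; rewrite -(leb_itvE ac); apply: enorm_rowint => //.
exact: leb_itv_fin.
Qed.

Lemma rowint_itvD (f : R -> V) (a c d : R) : a <= c -> c <= d ->
  (forall i, bmeas leb `[a, d] (fun s => f s 0 i)) ->
  rowint leb `[a, d] f = rowint leb `[a, c] f + rowint leb `[c, d] f.
Proof. by move=> ac cd bf; apply/rowP => i; rewrite !mxE (@Rint_itvD _ a c d). Qed.

Lemma rowint_itv_continuous (f : R -> V) :
  (forall t i, bmeas leb `[0, t] (fun s => f s 0 i)) ->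
  (forall t, exists M, forall s, 0 <= s <= t -> enorm (f s) <= M) ->
  continuous (fun t => rowint leb `[0, t] f).
Proof.
move=> bf fM t0; have [M0 hM0] := fM (`|t0| + 1).
pose M := `|M0| + 1.
have M_gt0 : 0 < M by rewrite ltr_wpDl.
(* For a negative endpoint the interval is empty and the integral is 0, hence the case analysis on
   the signs of a and c. *)
have key a c : a <= c -> c <= `|t0| + 1 ->
    enorm (rowint leb `[0, c] f - rowint leb `[0, a] f) <= M * (c - a).
  move=> ac ct; have [a0|a0] := leP 0 a.
    rewrite (@rowint_itvD f 0 a c)// addrC addKr.
    apply: enorm_rowint_itv => //.
      move=> i; apply: bmeasS (bf c i) => // s /=.
      by rewrite !in_itv/= => /andP[as_ ->]; rewrite (le_trans a0).
    move=> s /andP[as_ sc]; rewrite (le_trans (hM0 _ _))//.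
      by rewrite (le_trans a0)//= (le_trans sc).
    by rewrite (le_trans (ler_norm _))// lerDl.
  have -> : rowint leb `[0, a] f = 0.
    by apply/rowP => i; rewrite !mxE set_itv_ge ?Rintegral_set0// bnd_simp -ltNge.
  rewrite subr0; have [c0|c0] := leP 0 c.
    rewrite (@le_trans _ _ (M * (c - 0)))//; last first.
      by rewrite ler_pM2l// lerD2l lerN2 ltW.
    apply: enorm_rowint_itv => //.
    move=> s /andP[s0 sc]; rewrite (le_trans (hM0 _ _))//.
      by rewrite s0 (le_trans sc).
    by rewrite (le_trans (ler_norm _))// lerDl.
  have -> : rowint leb `[0, c] f = 0.
    by apply/rowP => i; rewrite !mxE set_itv_ge ?Rintegral_set0// bnd_simp -ltNge.
  by rewrite enorm0 mulr_ge0// ?subr_ge0// ltW.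
apply/(@cvgrPdist_le R V _ (nbhs t0) (@nbhs_pfilter _ t0)) => e e0.
have d0 : 0 < Num.min 1 (e / M) by rewrite lt_min ltr01 divr_gt0.
near=> t.
have : `|t0 - t| <= Num.min 1 (e / M).
  by near: t; apply: (@cvgr_dist_le R R _ (nbhs t0) _ id t0 _ _ d0); exact: cvg_id.
rewrite le_min => /andP[t1 tM].
have tt : t <= `|t0| + 1.
  have := ler_norm (t - t0); rewrite distrC => /le_trans /(_ t1).
  by rewrite lerBlDl => /le_trans; apply; rewrite lerD2r ler_norm.
have tt0 : t0 <= `|t0| + 1 by rewrite (le_trans (ler_norm _))// lerDl.
rewrite (le_trans (norm_le_enorm _))//.
rewrite (@le_trans _ _ (M * `|t0 - t|))//; last first.
  by rewrite mulrC -ler_pdivlMr.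
have [t0t|t0t] := leP t0 t.
  have -> : `|t0 - t| = t - t0 by rewrite distrC ger0_norm// subr_ge0.
  by rewrite enorm_distC key.
have -> : `|t0 - t| = t0 - t by rewrite ger0_norm// subr_ge0 ltW.
by rewrite key// ltW.
Unshelve. all: by end_near. Qed.

Lemma continuous_coord_measurable (f : R -> V) i : continuous f ->
  measurable_fun setT (fun s => f s 0 i).
Proof.
move=> cf; apply: continuous_measurable_fun => s.
exact: cvg_comp (cf s) (@coord_continuous _ _ _ 0 i (f s)).
Qed.

Lemma path_bound b y t : admissible b -> locally_bounded y ->
  exists M, forall s, 0 <= s <= t -> enorm (b s (y s)) <= M.
Proof.
move=> [_ _ gb] [_ /(_ t)[M hM]]; exists (C * (1 + M)) => s st.
by rewrite (le_trans (gb _ _))// ler_pM2l// lerD2l hM.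
Qed.

Lemma locally_bounded_picard b x y : admissible b -> locally_bounded y ->
  continuous (fun t => x + rowint leb `[0, t] (fun s => b s (y s))) /\
  locally_bounded (fun t => x + rowint leb `[0, t] (fun s => b s (y s))).
Proof.
move=> ab ly.
have cy : continuous (fun t => x + rowint leb `[0, t] (fun s => b s (y s))).
  move=> t; apply: cvgD; first exact: cvg_cst.
  apply: rowint_itv_continuous => u.
    by move=> i; exact: bmeas_path.
  exact: path_bound.
split => //; split => [i|t]; first exact: continuous_coord_measurable.
have [M hM] := path_bound t ab ly.
exists (enorm x + `|M| * t) => s /andP[s0 st].
rewrite (le_trans (enormD _ _))// lerD2l (@le_trans _ _ (`|M| * (s - 0)))//.
  apply: enorm_rowint_itv => //; first by move=> i; exact: bmeas_path.
  move=> u /andP[u0 us]; rewrite (le_trans (hM _ _))// ?ler_norm// u0.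
  exact: le_trans st.
by rewrite subr0 ler_wpM2l.
Qed.

Fixpoint picard b k x t : V :=
  if k is j.+1 then x + rowint leb `[0, t] (fun s => b s (picard b j x s)) else x.

Lemma locally_bounded_picardn b k x : admissible b ->
  locally_bounded (picard b k x).
Proof.
move=> ab; elim: k => [|k IH]; first exact: locally_bounded_cst.
exact: (locally_bounded_picard x ab IH).2.
Qed.

Lemma bmeas_diff b y y' t i : admissible b -> locally_bounded y ->
  locally_bounded y' ->
  bmeas leb `[0, t] (fun s => (b s (y s) - b s (y' s)) 0 i).
Proof.
move=> ab ly ly'.
have := bmeasB (@bmeas_path b y 0 t i ab ly (lexx 0))
  (@bmeas_path b y' 0 t i ab ly' (lexx 0)).
by congr bmeas; apply/funext => s; rewrite !mxE.
Qed.

Lemma bmeas_expR t k A : bmeas leb `[0, t] (fun s => A * expR (k * s)).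
Proof.
apply: bmeasZ; apply: (@bmeas_itv _ _ _ (expR (`|k| * t))).
  apply: measurableT_comp; first exact: measurable_expR.
  by apply: measurable_funM; [exact: measurable_cst|exact: measurable_id].
move=> s /andP[s0 st]; rewrite ger0_norm ?expR_ge0// ler_expR.
by rewrite (le_trans (ler_norm _))// normrM ler_wpM2l// ger0_norm.
Qed.

(** The weight exp(2Ls) makes the Picard map a contraction of ratio 1/2: the integral of L A
    exp(2Ls) over [0, t] is A/2 (exp(2Lt) - 1). *)
Lemma picard_gap b y y' A t : admissible b -> locally_bounded y ->
  locally_bounded y' -> 0 <= t -> 0 <= A ->
  (forall s, 0 <= s <= t -> enorm (y s - y' s) <= A * expR (2 * L * s)) ->
  enorm (rowint leb `[0, t] (fun s => b s (y s))
    - rowint leb `[0, t] (fun s => b s (y' s))) <= A / 2 * (expR (2 * L * t) - 1).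
Proof.
move=> ab ly ly' t0 A0 yy'; rewrite rowintB; last 2 first.
  by move=> i; exact: bmeas_path.
  by move=> i; exact: bmeas_path.
have e : \int[leb]_(s in `[0, t]) (A / 2 * (2 * L * expR (2 * L * s))) =
    A / 2 * (expR (2 * L * t) - 1).
  by rewrite RintZ ?Rint_expR//; exact: bmeas_expR.
rewrite -e; apply: enorm_rowint_le.
- by move=> i; exact: bmeas_diff.
- by apply: bmeasZ; exact: bmeas_expR.
- move=> s /=; rewrite in_itv/= => st; have [_ lb _] := ab.
  rewrite (le_trans (lb _ _ _))//.
  rewrite [leRHS](_ : _ = L * (A * expR (2 * L * s))); last by field.
  by rewrite ler_pM2l// yy'.
Qed.

(** Size of the first Picard step in the weighted norm: C (1 + |x|) t is at most [flow_gap x] times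
    exp(2Lt), because 2Lt is at most exp(2Lt). *)
Definition flow_gap x := C * (1 + enorm x) / (2 * L).

Lemma flow_gap_ge0 x : 0 <= flow_gap x.
Proof.
by rewrite divr_ge0 ?mulr_ge0 ?addr_ge0 ?enorm_ge0// ltW// L0.
Qed.

Lemma picardS_dist b x k t : admissible b -> 0 <= t ->
  enorm (picard b k.+1 x t - picard b k x t) <=
  flow_gap x * expR (2 * L * t) / 2 ^+ k.
Proof.
move=> ab; elim: k t => [|k IH] t t0.
  rewrite /= addrC addKr expr0 divr1.
  rewrite (@le_trans _ _ (C * (1 + enorm x) * (t - 0)))//.
    apply: enorm_rowint_itv => //; first by move=> i; exact: bmeas_frozen.
    by move=> s _; have [_ _] := ab; exact.
  rewrite subr0 /flow_gap -[leRHS]mulrA ler_wpM2l//.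
    by rewrite mulr_ge0 ?addr_ge0 ?enorm_ge0// ltW.
  rewrite mulrC ler_pdivlMr ?mulr_gt0// mulrC.
  by rewrite (le_trans _ (expR_ge1Dx _))// lerDr.
rewrite [X in enorm (X - _)]/= [X in enorm (_ - X)]/= opprD addrACA subrr add0r.
rewrite (le_trans (@picard_gap b _ _ (flow_gap x / 2 ^+ k) t ab
  (locally_bounded_picardn k.+1 x ab) (locally_bounded_picardn k x ab) t0 _ _))//.
- by rewrite divr_ge0// ?flow_gap_ge0// exprn_ge0.
- move=> s /andP[s0 _]; rewrite (le_trans (IH _ s0))//.
  by rewrite mulrAC.
rewrite exprS invfM.
rewrite [leRHS](_ : _ = flow_gap x / 2 ^+ k / 2 * expR (2 * L * t)); last by ring.
by rewrite ler_wpM2l// ?gerBl// divr_ge0// divr_ge0// ?flow_gap_ge0.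
Qed.

Lemma picard_lipschitz b x x' k t : admissible b -> 0 <= t ->
  enorm (picard b k x t - picard b k x' t) <= enorm (x - x') * expR (2 * L * t).
Proof.
move=> ab; elim: k t => [|k IH] t t0.
  by rewrite /= ler_peMr ?enorm_ge0// -expR0 ler_expR !mulr_ge0// ltW.
rewrite /= opprD addrACA (le_trans (enormD _ _))//.
rewrite (@le_trans _ _ (enorm (x - x') +
  enorm (x - x') / 2 * (expR (2 * L * t) - 1)))// ?lerD2l.
  apply: picard_gap => //; [exact: locally_bounded_picardn|
    exact: locally_bounded_picardn|exact: enorm_ge0|].
  by move=> s /andP[s0 _]; exact: IH.
have h1 : 1 <= expR (2 * L * t).
  by rewrite -expR0 ler_expR !mulr_ge0// ltW.
have h2 := enorm_ge0 (x - x').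
nra.
Qed.

(** The factor n comes from taking the Picard limit one coordinate at a time. *)
Definition flow_bound t x :=
  enorm x + n%:R * (2 * (flow_gap x * expR (2 * L * t))).

(** The flow started at time 0, continued by the identity to negative times so that it is continuous
    on the whole line. The rate 2L is the price of the weighted norm; the rate L that the constant r
    calls for is recovered from the Euler maps in [flow_lip]. *)
Definition is_flow b (y : R -> V -> V) :=
  [/\ forall x, continuous (y ^~ x) /\ locally_bounded (y ^~ x),
      forall x t, t <= 0 -> y t x = x,
      forall x t, 0 <= t -> y t x = x + rowint leb `[0, t] (fun s => b s (y s x)),
      forall x x' t, 0 <= t -> enorm (y t x - y t x') <= enorm (x - x') * expR (2 * L * t)
    & forall x t, 0 <= t -> enorm (y t x) <= flow_bound t x].

Lemma flow_exists b : admissible b -> exists y : R -> V -> V, is_flow b y.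
Proof.
move=> ab.
(* The condition on t sits inside the existential so that a limit can be chosen for every t. *)
have h (x : V) (t : R) (i : 'I_n) : exists l, 0 <= t -> forall k,
    `|picard b k x t 0 i - l| <= 2 * (flow_gap x * expR (2 * L * t)) / 2 ^+ k.
  have [t0|t0] := leP 0 t; last by exists 0.
  have [k|l hl] := @geometric_limit R (fun k => picard b k x t 0 i)
      (flow_gap x * expR (2 * L * t)); last by exists l.
  rewrite (le_trans _ (picardS_dist x k ab t0))//.
  rewrite [leLHS](_ : _ = `|(picard b k.+1 x t - picard b k x t) 0 i|).
    exact: coord_le_enorm.
  by rewrite !mxE.
pose yl x t : V := \row_i sval (cid (h x t i)).
have yP x t k i : 0 <= t -> `|picard b k x t 0 i - yl x t 0 i| <=
    2 * (flow_gap x * expR (2 * L * t)) / 2 ^+ k.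
  by move=> t0; rewrite mxE; exact: (svalP (cid (h x t i)) t0).
pose B x t k : R := n%:R * (2 * (flow_gap x * expR (2 * L * t)) / 2 ^+ k).
have yE x t k : 0 <= t -> enorm (picard b k x t - yl x t) <= B x t k.
  move=> t0; rewrite (le_trans (enorm_le_norm _))// ler_wpM2l//.
  rewrite [leLHS]/Num.norm/= mx_normrE; apply: bigmax_le.
    by rewrite divr_ge0// mulr_ge0// mulr_ge0 ?flow_gap_ge0 ?expR_ge0.
  by move=> [j i] _ /=; rewrite (ord1 j) mxE [in X in _ + X]mxE yP.
(* Clipping time at 0 keeps the limit path measurable on the whole line. *)
pose Y x s := yl x (Num.max 0 s).
have Y0 s x : 0 <= s -> Y x s = yl x s by move=> s0; rewrite /Y max_r.
have m0 s : 0 <= Num.max 0 s :> R by rewrite le_max lexx.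
have YB s x : 0 <= s -> enorm (Y x s) <= flow_bound s x.
  move=> s0; rewrite Y0//; have := yE x s 0%N s0.
  rewrite /B expr0 divr1 => h1.
  have := enorm_triangle 0 x (yl x s); rewrite !sub0r !enormN => /le_trans; apply.
  by rewrite /flow_bound lerD2l.
have lY x : locally_bounded (Y x).
  split=> [i|t]; last first.
    exists (flow_bound t x) => s /andP[s0 st]; rewrite (le_trans (YB _ _ s0))//.
    rewrite lerD2l// !ler_wpM2l ?flow_gap_ge0//.
    by rewrite ler_expR ler_pM2l// mulr_gt0.
  apply: (@measurable_fun_cvg _ (measurableTypeR R) R setT
    (fun k s => picard b k x (Num.max 0 s) 0 i) (fun s => Y x s 0 i)) => [k|s _].
  - have mp := (locally_bounded_picardn k x ab).1 i.
    apply: (measurableT_comp mp).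
    by apply: measurable_maxr.
  - by apply: cvg_geom_dist => k; exact: yP.
(* One more integration gives a path that is continuous by construction. [yY] then identifies it
   with the Picard limit, so it solves the integral equation. *)
pose y t x := x + rowint leb `[0, t] (fun s => b s (Y x s)).
have yY t x : 0 <= t -> y t x = Y x t.
  move=> t0; apply/eqP; rewrite -subr_eq0; apply/eqP/enorm_eq0/eqP.
  rewrite eq_le enorm_ge0 andbT.
  pose g := n%:R * flow_gap x; pose e := expR (2 * L * t).
  apply: (@le_geom _ _ _ (g * (e - 1) + g * e)) => k; rewrite add0r.
  have -> : y t x - Y x t = (rowint leb `[0, t] (fun s => b s (Y x s))
       - rowint leb `[0, t] (fun s => b s (picard b k x s)))
       + (picard b k.+1 x t - yl x t).
    by rewrite /y /= -(Y0 _ _ t0) addrA; congr (_ - _); rewrite [in RHS]addrCA subrK.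
  rewrite (le_trans (enormD _ _))//.
  have h1 := @picard_gap b _ _ (n%:R * (2 * flow_gap x) / 2 ^+ k) t ab (lY x)
    (locally_bounded_picardn k x ab) t0.
  rewrite mulrDl lerD//.
    rewrite (le_trans (h1 _ _))//.
    - by rewrite divr_ge0// mulr_ge0// mulr_ge0// flow_gap_ge0.
    - move=> s /andP[s0 _]; rewrite enorm_distC Y0// (le_trans (yE _ _ _ s0))//.
      by rewrite /B le_eqVlt; apply/orP; left; apply/eqP; ring.
    - rewrite le_eqVlt; apply/orP; left; apply/eqP; rewrite /g -/e.
      by field; rewrite expf_neq0.
  rewrite (le_trans (yE _ _ _ t0))// /B exprS /g -/e le_eqVlt; apply/orP; left.
  by apply/eqP; field; rewrite expf_neq0.
exists y; split.
- by move=> x; exact: locally_bounded_picard.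
- move=> x t t0; rewrite /y.
  have -> : rowint leb `[0, t] (fun s => b s (Y x s)) = 0; last by rewrite addr0.
  apply/rowP => i; rewrite !mxE.
  move: t0; rewrite le_eqVlt => /predU1P[->|t0].
    by rewrite set_itv1 Rintegral_set1.
  by rewrite set_itv_ge ?Rintegral_set0// bnd_simp -ltNge.
- move=> x t t0; rewrite {1}/y; congr (_ + _); apply/rowP => i; rewrite !mxE.
  apply: eq_Rintegral => s; rewrite inE/= in_itv/= => /andP[s0 _].
  by rewrite yY.
- move=> x x' t t0; rewrite !yY//.
  rewrite !Y0//; pose A x := n%:R * (2 * (flow_gap x * expR (2 * L * t))).
  apply: (@le_geom _ _ _ (A x + A x')) => k.
  rewrite (le_trans (enorm_triangle _ (picard b k x t) _))//.
  rewrite (_ : _ + _ / _ = A x / 2 ^+ k +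
    (enorm (x - x') * expR (2 * L * t) + A x' / 2 ^+ k)); last by ring.
  rewrite lerD//; first by rewrite enorm_distC (le_trans (yE _ _ k t0))// /B mulrA.
  rewrite (le_trans (enorm_triangle _ (picard b k x' t) _))//.
  rewrite lerD ?picard_lipschitz//.
  by rewrite (le_trans (yE _ _ k t0))// /B mulrA.
- by move=> x t t0; rewrite yY// YB.
Qed.

End flows.

(** * Euler scheme: stability, error bound and sharp constants for the flow *)

Section euler.
Context (R : realType) (n : nat) (L C : R).
Hypothesis L0 : 0 < L.
Hypothesis C0 : 0 < C.
Local Notation leb := (@lebesgue_measure R).
Local Notation V := 'rV[R]_n.
Implicit Types (b : R -> V -> V) (x : V) (t : R).

Definition euler_step b (dt : R) k x : V :=
  x + rowint leb `[k%:R * dt, k.+1%:R * dt] (b ^~ x).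

Fixpoint euler b dt k j x : V :=
  if j is i.+1 then euler b dt k.+1 i (euler_step b dt k x) else x.

Lemma eulerSr b dt k j x :
  euler b dt k j.+1 x = euler_step b dt (k + j) (euler b dt k j x).
Proof.
elim: j k x => [|j IH] k x; first by rewrite addn0.
by rewrite -[LHS]/(euler b dt k.+1 j.+1 (euler_step b dt k x)) IH addnS.
Qed.

Lemma stepE dt k : k.+1%:R * dt - k%:R * dt = dt :> R.
Proof. by rewrite -mulrBl -natrB// subSnn mul1r. Qed.

Lemma le_step dt k : 0 <= dt -> k%:R * dt <= k.+1%:R * dt :> R.
Proof. by move=> dt0; rewrite ler_wpM2r// ler_nat. Qed.

(** Phrased with the difference of the displacements so that the triangle inequality yields the
    upper bound [euler_lip] and the lower bound [euler_lip_lower] alike. *)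
Lemma euler_step_lip b dt k x x' : admissible L C b -> 0 <= dt ->
  enorm (euler_step b dt k x - euler_step b dt k x' - (x - x')) <=
  L * dt * enorm (x - x').
Proof.
move=> ab dt0; rewrite /euler_step; set r := rowint _ _ _; set r' := rowint _ _ _.
have -> : x + r - (x' + r') - (x - x') = r - r'.
  by apply/rowP => i; rewrite !mxE; ring.
rewrite rowintB; last 2 first.
  by move=> i; exact: bmeas_frozen ab.
  by move=> i; exact: bmeas_frozen ab.
rewrite mulrAC -[X in _ <= _ * X](stepE dt k); apply: enorm_rowint_itv; first exact: le_step.
  move=> i; have := bmeasB (bmeas_frozen x (k%:R * dt) (k.+1%:R * dt) i ab)
    (bmeas_frozen x' (k%:R * dt) (k.+1%:R * dt) i ab).
  by congr bmeas; apply/funext => s; rewrite !mxE.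
by move=> s _; case: ab.
Qed.

Lemma euler_step_growth b dt k x : admissible L C b -> 0 <= dt ->
  enorm (euler_step b dt k x - x) <= C * dt * (1 + enorm x).
Proof.
move=> ab dt0; rewrite /euler_step addrAC subrr add0r.
rewrite mulrAC -[X in _ <= _ * X](stepE dt k); apply: enorm_rowint_itv; first exact: le_step.
  by move=> i; exact: bmeas_frozen ab.
by move=> s _; case: ab.
Qed.

Lemma euler_lip b dt k j x x' : admissible L C b -> 0 <= dt ->
  enorm (euler b dt k j x - euler b dt k j x') <=
  (1 + L * dt) ^+ j * enorm (x - x').
Proof.
move=> ab dt0; elim: j k x x' => [|j IH] k x x'; first by rewrite expr0 mul1r.
rewrite (le_trans (IH _ _ _))// exprSr -mulrA ler_wpM2l//.
  by rewrite exprn_ge0// addr_ge0// mulr_ge0// ltW.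
rewrite mulrDl mul1r; set u := _ - _.
rewrite (_ : u = (x - x') + (u - (x - x'))); last by rewrite addrC subrK.
rewrite (le_trans (enormD _ _))// lerD2l; exact: euler_step_lip.
Qed.

Lemma euler_lip_lower b dt k j x x' : admissible L C b -> 0 <= dt -> L * dt <= 1 ->
  (1 - L * dt) ^+ j * enorm (x - x') <=
  enorm (euler b dt k j x - euler b dt k j x').
Proof.
move=> ab dt0 Ldt; elim: j k x x' => [|j IH] k x x'; first by rewrite expr0 mul1r.
rewrite (le_trans _ (IH _ _ _))// exprSr -mulrA ler_wpM2l//.
  by rewrite exprn_ge0// subr_ge0.
rewrite mulrBl mul1r; set u := euler_step _ _ _ _ - _.
rewrite lerBlDr.
have {1}-> : x - x' = u - (u - (x - x')) by rewrite subKr.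
by rewrite (le_trans (enormB _ _))// lerD2l; exact: euler_step_lip.
Qed.

(** A step moves x by at most C dt (1 + |x|), so 1 + |x| shrinks at most by the factor 1 - C dt. Far
    points stay far, which later bounds the support of functions composed with Euler maps. *)
Lemma euler_growth_lower b dt k j x : admissible L C b -> 0 <= dt -> C * dt <= 1 ->
  (1 - C * dt) ^+ j * (1 + enorm x) <= 1 + enorm (euler b dt k j x).
Proof.
move=> ab dt0 Cdt; elim: j k x => [|j IH] k x; first by rewrite expr0 mul1r.
rewrite (le_trans _ (IH _ _))// exprSr -mulrA ler_wpM2l//.
  by rewrite exprn_ge0// subr_ge0.
rewrite mulrBl mul1r; set u := euler_step _ _ _ _.
rewrite lerBlDr -addrA lerD2l.
have {1}-> : x = u - (u - x) by rewrite subKr.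
by rewrite (le_trans (enormB _ _))// lerD2l; exact: euler_step_growth.
Qed.

Section flow_error.
Variables (b : R -> V -> V) (y : R -> V -> V) (T : R).
Hypothesis ab : admissible L C b.
Hypothesis fy : is_flow L C b y.

Definition speed_bound t x := C * (1 + flow_bound L C t x).

Lemma flow_bound_homo s t x : s <= t -> flow_bound L C s x <= flow_bound L C t x.
Proof.
move=> st; rewrite lerD2l// !ler_wpM2l ?flow_gap_ge0//.
by rewrite ler_expR ler_pM2l// mulr_gt0.
Qed.

Lemma flow_bound_ge0 t x : 0 <= flow_bound L C t x.
Proof.
rewrite addr_ge0 ?enorm_ge0// mulr_ge0// mulr_ge0// mulr_ge0 ?expR_ge0//.
exact: flow_gap_ge0.
Qed.

Lemma speed_bound_ge0 t x : 0 <= speed_bound t x.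
Proof.
by apply: mulr_ge0; [exact: ltW|apply: addr_ge0 => //; exact: flow_bound_ge0].
Qed.

Lemma flow_increment x s t : 0 <= s -> s <= t ->
  y t x - y s x = rowint leb `[s, t] (fun r => b r (y r x)).
Proof.
move=> s0 st; case: fy => cy _ ey _ _.
rewrite ey ?(le_trans s0)// (ey _ s)// (@rowint_itvD _ _ _ 0 s t)//.
  by rewrite opprD addrACA subrr add0r addrC addKr.
move=> i; apply: (bmeas_path _ _ _ ab) => //; exact: (cy x).2.
Qed.

Lemma flow_speed x s t : 0 <= s -> s <= t ->
  enorm (y t x - y s x) <= speed_bound t x * (t - s).
Proof.
move=> s0 st; rewrite flow_increment//; case: fy => cy _ _ _ by_.
apply: enorm_rowint_itv => //.
  by move=> i; apply: (bmeas_path _ _ _ ab) => //; exact: (cy x).2.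
move=> r /andP[sr rt]; have [_ _ gb] := ab; rewrite (le_trans (gb _ _))//.
rewrite ler_pM2l// lerD2l (le_trans (by_ _ _ _))// ?(le_trans s0)//.
exact: flow_bound_homo.
Qed.

Lemma flow_consistency x s t : 0 <= s -> s <= t ->
  enorm (y t x - y s x - rowint leb `[s, t] (b ^~ (y s x))) <=
  L * speed_bound t x * (t - s) ^+ 2.
Proof.
move=> s0 st; rewrite flow_increment//; case: (fy) => cy _ _ _ by_.
have bp i := bmeas_path C0 t i ab (cy x).2 s0.
rewrite rowintB//; last by move=> i; exact: bmeas_frozen ab.
rewrite expr2 mulrA; apply: enorm_rowint_itv => //.
  move=> i; have := bmeasB (bp i) (bmeas_frozen (y s x) s t i ab).
  by congr bmeas; apply/funext => r; rewrite !mxE.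
move=> r /andP[sr rt]; have [_ lb _] := ab; rewrite (le_trans (lb _ _ _))//.
rewrite -mulrA ler_pM2l// (le_trans (flow_speed _ s0 sr))//.
rewrite ler_pM ?speed_bound_ge0 ?subr_ge0 ?lerB//.
by rewrite ler_pM2l// lerD2l flow_bound_homo.
Qed.

(** The bound is the exact solution, starting from 0, of the recursion e' = (1 + L dt) e + L S dt^2,
    where S is the speed bound: stability of the step plus its consistency error. *)
Lemma euler_error dt x k : 0 <= dt -> k%:R * dt <= T ->
  enorm (y (k%:R * dt) x - euler b dt 0 k x) <=
  speed_bound T x * dt * ((1 + L * dt) ^+ k - 1).
Proof.
move=> dt0; elim: k => [|k IH] kT.
  case: fy => _ y0 _ _ _.
  by rewrite mul0r y0//= subrr enorm0 expr0 subrr mulr0.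
have kT' : k%:R * dt <= T by rewrite (le_trans _ kT)// le_step.
have {}IH := IH kT'.
rewrite eulerSr add0n.
have k0 : 0 <= k%:R * dt by rewrite mulr_ge0.
have h1 := flow_consistency x k0 (le_step k dt0).
rewrite stepE in h1.
have h2 := euler_step_lip k (y (k%:R * dt) x) (euler b dt 0 k x) ab dt0.
set Y := y (k.+1%:R * dt) x in h1 *; set Y0 := y (k%:R * dt) x in IH h1 h2.
set E0 := euler b dt 0 k x in IH h2 *; set E := euler_step b dt k E0 in h2 *.
have -> : Y - E = (Y - Y0 - rowint leb `[(k%:R * dt), (k.+1%:R * dt)] (b ^~ Y0))
    + ((euler_step b dt k Y0 - E - (Y0 - E0)) + (Y0 - E0)).
  rewrite /euler_step; set r := rowint _ _ _.
  by apply/rowP => i; rewrite !mxE; ring.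
rewrite (le_trans (enormD _ _))//.
have h3 : L * speed_bound (k.+1%:R * dt) x * dt ^+ 2 <=
    L * speed_bound T x * dt ^+ 2.
  rewrite ler_wpM2r ?sqr_ge0// ler_pM2l// ler_pM2l// lerD2l.
  exact: flow_bound_homo.
rewrite (le_trans (lerD (le_trans h1 h3) (enormD _ _)))//.
rewrite (le_trans (lerD (lexx _) (lerD h2 (lexx _))))//.
have -> : L * dt * enorm (Y0 - E0) + enorm (Y0 - E0) =
  (1 + L * dt) * enorm (Y0 - E0) by rewrite mulrDl mul1r addrC.
have Ld : 0 <= 1 + L * dt by rewrite addr_ge0// mulr_ge0// ltW.
rewrite (le_trans (lerD (lexx _) (ler_wpM2l Ld IH)))//.
by rewrite le_eqVlt [(1 + L * dt) ^+ k.+1]exprS; apply/orP; left; apply/eqP; ring.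
Qed.

End flow_error.

Lemma exp_upper (a : R) k : 0 <= a -> (1 + a) ^+ k <= expR (a * k%:R).
Proof.
move=> a0; rewrite mulrC expRM_natl lerXn2r ?nnegrE ?expR_ge0 ?addr_ge0//.
exact: expR_ge1Dx.
Qed.

(** On [0, 1/2] one has (1 - a)(1 + 2a) >= 1, and 1 + 2a is at most exp(2a). *)
Lemma exp_lower (a : R) k : 0 <= a <= 1 / 2 -> expR (- (2 * a * k%:R)) <= (1 - a) ^+ k.
Proof.
move=> /andP[a0 a1].
rewrite expRN mulrC expRM_natl -exprVn.
have e0 : 0 < expR (2 * a) by exact: expR_gt0.
apply: lerXn2r; rewrite ?nnegrE; [by rewrite invr_ge0 ltW|lra|].
have h : 1 + 2 * a <= expR (2 * a) by exact: expR_ge1Dx.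
rewrite -[leLHS]mul1r ler_pdivrMr//.
rewrite (@le_trans _ _ ((1 - a) * (1 + 2 * a)))//; first by nra.
by rewrite ler_wpM2l//; lra.
Qed.

Section flow_map.
Variables (b : R -> V -> V) (y : R -> V -> V) (T : R).
Hypothesis T0 : 0 < T.
Hypothesis ab : admissible L C b.
Hypothesis fy : is_flow L C b y.

Definition euler_map N := euler b (T / N.+1%:R) 0 N.+1.

Lemma dt_ge0 N : 0 <= T / N.+1%:R. Proof. by rewrite divr_ge0 ?ltW. Qed.

Lemma dtE N : N.+1%:R * (T / N.+1%:R) = T.
Proof. by rewrite mulrCA divff ?mulr1// pnatr_eq0. Qed.

Lemma euler_map_error x N :
  enorm (y T x - euler_map N x) <= speed_bound T x * T * expR (L * T) / N.+1%:R.
Proof.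
have h := @euler_error b y T ab fy (T / N.+1%:R) x N.+1 (dt_ge0 N).
rewrite dtE in h; rewrite (le_trans (h (lexx _)))//.
rewrite [leRHS]mulrAC mulrA ler_wpM2l//.
  by rewrite mulr_ge0 ?invr_ge0// mulr_ge0 ?speed_bound_ge0// ltW.
have h2 := @exp_upper (L * (T / N.+1%:R)) N.+1.
rewrite (_ : _ * N.+1%:R = L * T) in h2; last first.
  by rewrite -mulrA [_ / _ * _]mulrC dtE.
rewrite (le_trans _ (h2 _))//; first by rewrite ltW// ltrBlDr ltrDl.
by rewrite mulr_ge0 ?dt_ge0// ltW.
Qed.

Lemma euler_map_cvg x : enorm (y T x - euler_map N x) @[N --> \oo] --> (0 : R).
Proof.
apply: (@squeeze_cvgr _ _ _ _ (cst 0)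
  (fun N => speed_bound T x * T * expR (L * T) * N.+1%:R^-1)).
- by apply: nearW => N; rewrite enorm_ge0/= euler_map_error.
- exact: cvg_cst.
- rewrite -[X in _ --> X](mulr0 (speed_bound T x * T * expR (L * T))).
  by apply: cvgM; [exact: cvg_cst|exact: cvg_harmonic].
Qed.

Lemma euler_map_lip N x x' : enorm (euler_map N x - euler_map N x') <=
  expR (L * T) * enorm (x - x').
Proof.
rewrite (le_trans (euler_lip _ _ _ _ ab (dt_ge0 N)))// ler_wpM2r ?enorm_ge0//.
have := @exp_upper (L * (T / N.+1%:R)) N.+1.
rewrite (_ : _ * N.+1%:R = L * T); last by rewrite -mulrA [_ / _ * _]mulrC dtE.
by apply; rewrite mulr_ge0 ?dt_ge0// ltW.
Qed.

(** The Euler maps have Lipschitz constants (1 + L dt)^(N + 1), all at most exp(LT), and the limit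
    keeps this constant. *)
Lemma flow_lip x x' : enorm (y T x - y T x') <= expR (L * T) * enorm (x - x').
Proof.
have h : enorm (y T x - euler_map N x) + expR (L * T) * enorm (x - x') +
    enorm (y T x' - euler_map N x') @[N --> \oo] --> expR (L * T) * enorm (x - x').
  rewrite -[X in _ --> X](_ : 0 + expR (L * T) * enorm (x - x') + 0 = _); last first.
    by rewrite add0r addr0.
  by apply: cvgD; [apply: cvgD; [exact: euler_map_cvg|exact: cvg_cst]|
    exact: euler_map_cvg].
rewrite -(cvg_lim _ h)//; apply: limr_ge; first by apply/cvg_ex; eexists; exact: h.
apply: nearW => N.
rewrite (le_trans (enorm_triangle _ (euler_map N x) _))// -addrA lerD2l.
rewrite (le_trans (enorm_triangle _ (euler_map N x') _))//.
by rewrite lerD ?euler_map_lip// enorm_distC.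
Qed.

(** Quantitative injectivity of the flow map, on which the treatment of null sets rests. The Euler
    estimate requires L dt <= 1/2, hence is only available for large N. *)
Lemma flow_lip_lower x x' :
  expR (- (2 * L * T)) * enorm (x - x') <= enorm (y T x - y T x').
Proof.
have h : enorm (y T x - euler_map N x) + enorm (y T x - y T x') +
    enorm (y T x' - euler_map N x') @[N --> \oo] --> enorm (y T x - y T x').
  rewrite -[X in _ --> X](_ : 0 + enorm (y T x - y T x') + 0 = _); last first.
    by rewrite add0r addr0.
  by apply: cvgD; [apply: cvgD; [exact: euler_map_cvg|exact: cvg_cst]|
    exact: euler_map_cvg].
rewrite -(cvg_lim _ h)//; apply: limr_ge; first by apply/cvg_ex; eexists; exact: h.
have LT2 : (0 : R) < 1 / (2 * L * T) by rewrite divr_gt0// !mulr_gt0.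
near=> N.
have hN : L * (T / N.+1%:R) <= 1 / 2.
  have : N.+1%:R^-1 <= 1 / (2 * L * T).
    near: N; have := @cvg_harmonic R => /cvgrPdist_le/(_ _ LT2).
    by apply: filterS => N; rewrite sub0r normrN ger0_norm// invr_ge0.
  rewrite ler_pdivlMr ?mulr_gt0// => h1; rewrite ler_pdivlMr//.
  by apply: le_trans h1; rewrite le_eqVlt; apply/orP; left; apply/eqP; ring.
have := @euler_lip_lower b (T / N.+1%:R) 0 N.+1 x x' ab (dt_ge0 N).
rewrite -/(euler_map N) => h1.
have h2 := @exp_lower (L * (T / N.+1%:R)) N.+1.
rewrite (@le_trans _ _ (enorm (euler_map N x - euler_map N x')))//.
  rewrite (le_trans _ (h1 _))//; last by rewrite (le_trans hN)//; lra.
  rewrite ler_wpM2r ?enorm_ge0//.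
  rewrite (_ : 2 * _ * _ = 2 * L * T) in h2; last first.
    by rewrite -!mulrA [_^-1 * _]mulrC divff ?mulr1// pnatr_eq0.
  by apply: h2; rewrite hN mulr_ge0 ?dt_ge0// ltW.
rewrite (le_trans (enorm_triangle _ (y T x) _))// enorm_distC -addrA lerD2l.
exact: enorm_triangle.
Unshelve. all: by end_near. Qed.

End flow_map.

Lemma flow_jointly_continuous b y : is_flow L C b y ->
  continuous (fun p : R * V => y p.1 p.2).
Proof.
move=> [cy y0 _ lipy _] [t x].
have tp : (fun p : R * V => p.1) p @[p --> (t, x)] --> t by exact: cvg_fst.
have xp : (fun p : R * V => p.2) p @[p --> (t, x)] --> x by exact: cvg_snd.
apply: (proj2 (cvg_enormP _ _ _)).
(* A Lipschitz constant for all times within 1 of t; being at least 1, it also serves at negative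
   times, where the flow is the identity. *)
pose K := expR (2 * L * (`|t| + 1)).
apply: (@squeeze_cvgr _ _ _ _ (cst 0)
  (fun p : R * V => enorm (p.2 - x) * K + enorm (y p.1 x - y t x))).
- near=> p; rewrite enorm_ge0/= (le_trans (enorm_triangle _ (y p.1 x) _))// lerD2r.
  have pt : `|t - p.1| <= 1.
    by near: p; apply: (@cvgr_dist_le R R _ (nbhs (t, x)) _ _ t tp 1).
  have K1 : 1 <= K by rewrite -expR0 ler_expR !mulr_ge0 ?addr_ge0// ltW.
  have [p0|p0] := leP 0 p.1.
    rewrite (le_trans (lipy _ _ _ p0))// ler_wpM2l ?enorm_ge0// ler_expR.
    rewrite ler_pM2l ?mulr_gt0//.
    have := ler_norm (p.1 - t); rewrite distrC => /le_trans /(_ pt).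
    by rewrite lerBlDl => /le_trans; apply; rewrite lerD2r ler_norm.
  rewrite (y0 p.2) ?(ltW p0)// (y0 x) ?(ltW p0)//. 
  by have := ler_wpM2l (enorm_ge0 (p.2 - x)) K1; rewrite mulr1.
- exact: cvg_cst.
- rewrite -[X in _ --> X](_ : 0 * K + 0 = 0); last by rewrite mul0r addr0.
  apply: cvgD; last first.
    apply: (proj1 (cvg_enormP _ _ _)); exact: (cvg_comp _ (y ^~ x) tp ((cy x).1 t)).
  apply: cvgM; last exact: cvg_cst.
  exact: (proj1 (cvg_enormP _ _ _)).
Unshelve. all: by end_near. Qed.

End euler.

(** * Smooth functions *)
Section smooth_functions.
Context (R : realType).
Implicit Types (V W : normedModType R).

Lemma Ck_continuous V (f : V -> R) k : Ck k f -> continuous f.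
Proof.
case: k => // k [df _] x; apply: differentiable_continuous; exact: df.
Qed.

Lemma smooth_differentiable V (f : V -> R) : smooth f -> forall x, differentiable f x.
Proof. by move=> /(_ 1%N)[]. Qed.

Lemma smooth_derive V (f : V -> R) v : smooth f -> smooth (fun x => 'D_v f x).
Proof. by move=> sf k; have [_] := sf k.+1; exact. Qed.

Lemma CkS V (f : V -> R) k : Ck k.+1 f -> Ck k f.
Proof.
elim: k f => [f /Ck_continuous//|k IH f [df Df]].
by split=> // v; apply: IH; exact: Df.
Qed.

Lemma Ck_add V (f g : V -> R) k : Ck k f -> Ck k g -> Ck k (fun x => f x + g x).
Proof.
elim: k f g => [f g cf cg x|k IH f g [df Df] [dg Dg]].
  by apply: cvgD; [exact: cf|exact: cg].
split=> [x|v]; first exact: differentiableD.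
have -> : (fun x => 'D_v (fun x => f x + g x) x) = (fun x => 'D_v f x + 'D_v g x).
  by apply/funext => x; rewrite deriveD//; exact: diff_derivable.
by apply: IH; [exact: Df|exact: Dg].
Qed.

Lemma Ck_mul V (f g : V -> R) k : Ck k f -> Ck k g -> Ck k (fun x => f x * g x).
Proof.
elim: k f g => [f g cf cg x|k IH f g Cf Cg].
  by apply: cvgM; [exact: cf|exact: cg].
have [df Df] := Cf; have [dg Dg] := Cg.
split=> [x|v]; first exact: differentiableM.
have -> : (fun x => 'D_v (fun x => f x * g x) x) =
    (fun x => f x * 'D_v g x + g x * 'D_v f x).
  by apply/funext => x; rewrite deriveM//; exact: diff_derivable.
by apply: Ck_add; apply: IH; first [exact: Df|exact: Dg|exact: CkS].
Qed.

Lemma Ck_cst V (c : R) k : Ck k (fun _ : V => c).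
Proof.
elim: k c => [c x|k IH c]; first exact: cvg_cst.
split=> [x|v]; first exact: differentiable_cst.
have -> : (fun x => 'D_v (fun _ : V => c) x) = (fun=> 0).
  by apply/funext => x; exact: derive_cst.
exact: IH.
Qed.

Lemma smooth_mul V (f g : V -> R) : smooth f -> smooth g -> smooth (fun x => f x * g x).
Proof. by move=> sf sg k; exact: Ck_mul. Qed.

Lemma smooth_cst V (c : R) : smooth (fun _ : V => c).
Proof. by move=> k; exact: Ck_cst. Qed.

Section affine.
Variables (V W : normedModType R) (l : V -> W) (A : V -> W).
Hypothesis Al : forall (k : R) x v, A (k *: v + x) = k *: l v + A x.
Hypothesis dA : forall x, differentiable A x.

Lemma derive_affine (f : W -> R) v x : 'D_v (f \o A) x = 'D_(l v) f (A x).
Proof.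
rewrite /derive.
suff -> : (fun h : R => h^-1 *: (((f \o A) \o shift x) (h *: v) - (f \o A) x)) =
  (fun h : R => h^-1 *: ((f \o shift (A x)) (h *: l v) - f (A x))) by [].
by apply/funext => h /=; rewrite Al.
Qed.

(** The derivative of f o A in direction v is the derivative of f in the fixed direction l v,
    composed with A. The induction therefore stays among functions of the form g o A. *)
Lemma Ck_affine (f : W -> R) k : Ck k f -> Ck k (f \o A).
Proof.
elim: k f => [f cf x|k IH f [df Df]].
  exact: (cvg_comp A f (differentiable_continuous (dA x)) (cf (A x))).
split=> [x|v]; first exact: differentiable_comp.
have -> : (fun x => 'D_v (f \o A) x) = (fun x => 'D_(l v) f x) \o A.
  by apply/funext => x; exact: derive_affine.
by apply: IH; exact: Df.
Qed.

Lemma smooth_affine (f : W -> R) : smooth f -> smooth (f \o A).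
Proof. by move=> sf k; exact: Ck_affine. Qed.

End affine.

Definition vanishes_off V (K : set V) (f : V -> R) := forall x, ~ K x -> f x = 0.

Lemma vanishes_derive V (K : set V) (f : V -> R) v : closed K ->
  vanishes_off K f -> vanishes_off K (fun x => 'D_v f x).
Proof.
move=> cK fK x Kx.
rewrite -(@derive_cst R V R (0 : R) x v); apply: near_eq_derive.
have : nbhs x (~` K) by apply: open_nbhs_nbhs; split => //; exact: closed_openC.
by apply: filterS => y /fK.
Qed.

Lemma vanishes_bounded V (K : set V) (f : V -> R) : compact K -> continuous f ->
  vanishes_off K f -> exists2 B, 0 <= B & forall x, `|f x| <= B.
Proof.
move=> cK cf fK.
have : compact (f @` K).
  by apply: continuous_compact => //; exact: continuous_subspaceT.
move=> /compact_bounded[M [Mr hM]].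
exists (`|M| + 1) => [|x]; first by rewrite addr_ge0.
have [Kx|Kx] := pselect (K x); last by rewrite fK// normr0 addr_ge0.
apply: (hM (`|M| + 1)); last by exists x.
by rewrite (le_lt_trans (ler_norm M))// ltrDl.
Qed.

Section taylor.
Variables (V : normedModType R) (I : finType) (e : I -> V) (c : I -> V -> R).
Hypothesis ce : forall h, h = \sum_i c i h *: e i.
Hypothesis c_le : forall i h, `|c i h| <= `|h|.

Lemma derive_coord (f : V -> R) x h : differentiable f x ->
  'D_h f x = \sum_i c i h * 'D_(e i) f x.
Proof.
move=> df; rewrite deriveE// {1}(ce h) linear_sum; apply: eq_bigr => i _.
by rewrite linearZ deriveE.
Qed.

Lemma segment_MVT (f : V -> R) x h : (forall x, differentiable f x) ->
  exists2 s, 0 <= s <= 1 & f (x + h) - f x = 'D_h f (x + s *: h).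
Proof.
move=> df; pose A (s : R) : V := x + s *: h.
have dA (s : R) : differentiable A s.
  apply: (@differentiableD _ _ _ (cst x) (fun s : R => s *: h)).
    exact: differentiable_cst.
  by apply: (@differentiableZl _ _ _ (fun s : R => s) h s).
have dg (s : R) : is_derive s 1 (f \o A) ('D_h f (A s)).
  have -> : 'D_h f (A s) = 'D_1 (f \o A) s.
    rewrite (@derive_affine R V (fun s => s *: h) A) ?scale1r// => k t v.
    by rewrite /A scalerDl addrCA scalerA.
  apply: DeriveDef => //; by apply: diff_derivable; apply: differentiable_comp.
have cA : {within `[0, 1], continuous (f \o A)}.
  apply: continuous_subspaceT => s; apply: differentiable_continuous.
  exact: differentiable_comp.
have [s] := @MVT_segment R (f \o A) (fun s => 'D_h f (A s)) 0 1 ler01 (fun s _ => dg s) cA.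
rewrite in_itv/= subr0 mulr1 /A scale1r scale0r addr0 => s01 E.
by exists s.
Qed.

(** Two mean value steps along segments; compact support bounds all second derivatives at once. The
    spanning family [e] with coordinates [c] is abstract because it is used both for the reversed
    basis -delta_i and for time together with space. *)
Lemma smooth_taylor (K : set V) (f : V -> R) : compact K -> closed K ->
  smooth f -> vanishes_off K f ->
  exists2 B, 0 <= B & forall x h,
    `|f (x + h) - f x - \sum_i c i h * 'D_(e i) f x| <= B * `|h| ^+ 2.
Proof.
move=> cK clK sf fK.
have bij ij : exists B, 0 <= B /\
    forall x, `|'D_(e ij.2) (fun x => 'D_(e ij.1) f x) x| <= B.
  have [||B B0 hB] := @vanishes_bounded V K (fun x => 'D_(e ij.2) (fun x => 'D_(e ij.1) f x) x) cK.
  - by apply: (@Ck_continuous _ _ 0); apply: smooth_derive; exact: smooth_derive.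
  - by apply: vanishes_derive => //; exact: vanishes_derive.
  by exists B.
have {bij}[B0 hB] := choice bij.
pose B := \sum_ij B0 ij.
have BP x i j : `|'D_(e j) (fun x => 'D_(e i) f x) x| <= B.
  rewrite (le_trans ((hB (i, j)).2 x))// /B (bigD1 (i, j))//= lerDl sumr_ge0//.
  by move=> ij _; exact: (hB ij).1.
have B_ge0 : 0 <= B by apply: sumr_ge0 => ij _; exact: (hB ij).1.
exists (#|I|%:R ^+ 2 * B) => [|x h]; first by rewrite mulr_ge0// exprn_ge0.
have [s /andP[s0 s1] ->] := segment_MVT x h (smooth_differentiable sf).
rewrite derive_coord; last exact: smooth_differentiable.
rewrite -sumrB (le_trans (ler_norm_sum _ _ _))//.
rewrite (@le_trans _ _ (\sum_(i : I) #|I|%:R * B * `|h| ^+ 2))//; last first.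
  rewrite sumr_const -[leLHS]mulr_natl le_eqVlt; apply/orP; left; apply/eqP; ring.
apply: ler_sum => i _; rewrite -mulrBr normrM.
rewrite [leRHS](_ : _ = `|h| * (#|I|%:R * B * `|h|)); last by ring.
apply: ler_pM => //.
have [t _ /= ->] := segment_MVT x (s *: h) (smooth_differentiable (smooth_derive (e i) sf)).
rewrite derive_coord; last exact/smooth_differentiable/smooth_derive.
rewrite (le_trans (ler_norm_sum _ _ _))//.
rewrite (@le_trans _ _ (\sum_(j : I) B * `|h|))//; last first.
  rewrite sumr_const -[leLHS]mulr_natl le_eqVlt; apply/orP; left; apply/eqP; ring.
apply: ler_sum => j _; rewrite normrM mulrC; apply: ler_pM => //.
by rewrite (le_trans (c_le _ _))// normrZ ger0_norm// ler_piMl.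
Qed.

End taylor.

End smooth_functions.

(** * Smooth monotone transitions from 0 to 1 *)

Section smooth_step.
Context (R : realType).
Local Notation leb := (@lebesgue_measure R).

Lemma smooth_primitive (F k : R -> R) :
  (forall x : R, is_derive x 1 F (k x)) -> smooth k -> smooth F.
Proof.
move=> Fk sk; have dF (x : R) : differentiable F x.
  by apply/derivable1_diffP; case: (Fk x).
case=> [x|j]; first exact: differentiable_continuous.
split=> // v.
have -> : (fun x : R => 'D_v F x) = (fun x => v * k x).
  apply/funext => x; have [_ <-] := Fk x.
  rewrite !deriveE// -[in LHS](mulr1 v) -[v * 1]/(v *: 1) linearZ.
  by [].
by apply: Ck_mul; [exact: Ck_cst|exact: sk].
Qed.

Lemma smooth_comp_affine (f : R -> R) (a k : R) : smooth f ->
  smooth (fun s => f (k * (s - a))).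
Proof.
move=> sf; have d (x : R) : differentiable (fun s : R => k * (s - a)) x.
  by apply/derivable1_diffP.
apply: (@smooth_affine R R R (fun s : R => k * s) (fun s : R => k * (s - a))) => //.
by move=> c x v; rewrite /GRing.scale/=; ring.
Qed.

(** A normalised primitive of the bump k has all these properties; smoothness passes from k to its
    primitive, whose first derivative is k itself. *)
Lemma exists_smooth_step (k : R -> R) : smooth k -> (forall s, 0 <= k s) ->
  (forall s, 1 < `|s| -> k s = 0) -> (exists s, k s != 0) ->
  exists S : R -> R, [/\ smooth S, forall s, s <= 0 -> S s = 0,
    forall s, 1 <= s -> S s = 1, forall s, 0 <= S s <= 1 &
    forall s : R, 0 <= 'D_1 S s].
Proof.
move=> sk k0 ks [s0 ks0].
have ck : continuous k by exact: (@Ck_continuous _ _ _ 0).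
have mk : measurable_fun setT k by exact: continuous_measurable_fun.
have [B B0 kB] : exists2 B, 0 <= B & forall x, `|k x| <= B.
  apply: (@vanishes_bounded R R `[-1, 1]) => //; first exact: segment_compact.
  by move=> x; rewrite /= in_itv/= -ler_norml => /negP; rewrite -ltNge; exact: ks.
have ik u : leb.-integrable `]-oo, u] (EFin \o k).
  have -> : k = k \_ `[-1, 1].
    apply/funext => x; rewrite patchE; case: ifPn => //.
    by rewrite notin_setE /= in_itv/= -ler_norml => /negP; rewrite -ltNge; exact: ks.
  rewrite -restrict_EFin; apply/integrable_restrict => //.
  apply: bmeas_integrable; apply: bmeasS (@bmeas_itv R (-1) 1 B k mk _) => //.
  exact: measurableI.
pose F x := \int[leb]_(t in `]-oo, x]) k t.
have dF (x : R) : is_derive x 1 F (k x).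
  have xx : x < x + 1 by rewrite ltrDl.
  have [|d1 d2] := @continuous_FTC1 R k -oo%O x (x + 1) xx (ik _) _ (ck x).
    by rewrite ltNyr.
  by apply: DeriveDef => //; rewrite -derive1E.
have sF : smooth F by exact: smooth_primitive dF sk.
have F_mono a b : a <= b -> F a <= F b.
  move=> ab; have : 0 <= \int[leb]_(s in `[a, b]) k s.
    by apply: Rintegral_ge0 => s _.
  by rewrite (Rint_FTC ab ck dF) subr_ge0.
have F1 s : s <= -2 -> F s = 0.
  move=> s2; rewrite /F (@eq_Rintegral _ _ _ _ _ (cst 0)); first by rewrite Rintegral_cst// mul0r.
  move=> t; rewrite inE/= in_itv/= => ts; apply: ks.
  by rewrite ltr0_norm; lra.
have F2 s : 2 <= s -> F s = F 2.
  move=> s2; apply/eqP; rewrite -subr_eq0; apply/eqP.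
  rewrite -(Rint_FTC s2 ck dF) (@eq_Rintegral _ _ _ _ _ (cst 0)).
    by rewrite Rintegral_cst// mul0r.
  move=> t; rewrite inE/= in_itv/= => /andP[ts _]; apply: ks.
  by rewrite gtr0_norm; lra.
have Fm2 : F (-2) = 0 by exact: F1.
(* A zero total integral would make the monotone F vanish identically, and with it its derivative
   k. *)
have Fpos : 0 < F 2.
  rewrite lt_neqAle -{2}Fm2 F_mono; last by lra.
  rewrite andbT; apply/eqP => F20; move/eqP : ks0; apply.
  have -> : k s0 = 'D_1 F s0 by case: (dF s0).
  have -> : F = cst 0; last exact: derive_cst.
  apply/funext => s; apply/eqP; rewrite eq_le; apply/andP; split.
    have [s2|/ltW s2] := leP s 2; last by rewrite F2// -F20.
    by rewrite [leRHS]F20 F_mono.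
  have [s2|/ltW s2] := leP s (-2); first by rewrite F1.
  by rewrite /cst -Fm2 F_mono.
have dS (s : R) : 'D_1 (fun s : R => (F 2)^-1 * F (4 * (s - 2^-1))) s =
    (F 2)^-1 * (4 * k (4 * (s - 2^-1))).
  have dg : is_derive s 1 (fun s : R => 4 * (s - 2^-1)) 4.
    apply: DeriveDef; first by [].
    rewrite deriveM// deriveB// derive_cst derive_id derive_cst.
    by rewrite /GRing.scale/=; ring.
  have := @is_derive1_comp R F (fun s : R => 4 * (s - 2^-1)) s _ _ (dF _) dg.
  move=> /(@is_deriveZ R R R _ (F 2)^-1 s 1 _)[_].
  by rewrite /GRing.scale/= [k _ * _]mulrC.
have hS (s : R) : 4 * (s - 2^-1) = 4 * s - 2 by field.
(* The map s |-> 4 (s - 1/2) sends [0, 1] onto [-2, 2], outside of which F is constant. *)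
exists (fun s => (F 2)^-1 * F (4 * (s - 2^-1))); split.
- apply: smooth_mul; first exact: smooth_cst.
  exact: smooth_comp_affine.
- by move=> s s_le0; rewrite hS (F1 (4 * s - 2)) ?mulr0//; lra.
- move=> s s1; have h : 2 <= 4 * s - 2 by lra.
  by rewrite hS (F2 _ h) mulVf// gt_eqF.
- move=> s; have h : 0 <= F (4 * (s - 2^-1)) <= F 2.
    apply/andP; split.
      have [s2|/ltW s2] := leP (4 * (s - 2^-1)) (-2); first by rewrite F1.
      by rewrite -Fm2 F_mono.
    by have [s2|/ltW s2] := leP (4 * (s - 2^-1)) 2; [exact: F_mono|rewrite F2].
  case/andP: h => h1 h2; rewrite mulr_ge0 ?invr_ge0 ?(ltW Fpos)//=.
  by rewrite mulrC ler_pdivrMr// mul1r.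
- by move=> s; rewrite dS mulr_ge0 ?invr_ge0 ?(ltW Fpos)// mulr_ge0.
Qed.

End smooth_step.

(** * The continuity equation against test functions *)
Section narrow_grid.
Context (R : realType) (n : nat) (T : R) (mu : R -> probability 'rV[R]_n R).
Local Notation V := 'rV[R]_n.
Hypothesis T0 : 0 < T.
Hypothesis nmu : narrowly_continuous T mu.

Lemma bmeas_prob (P : probability V R) (f : V -> R) M : measurable_fun setT f ->
  (forall x, `|f x| <= M) -> bmeas P setT f.
Proof.
move=> mf fM; split => //; last by exists M.
by rewrite ltey_eq fin_num_measure.
Qed.

Lemma prob_bound (P : probability V R) (f : V -> R) M : measurable_fun setT f ->
  (forall x, `|f x| <= M) -> `|\int[P]_x f x| <= M.
Proof.
move=> mf fM; have -> : M = M * fine (P setT) by rewrite probability_setT mulr1.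
by apply: le_normr_bound => // ; exact: bmeas_prob mf fM.
Qed.

Lemma narrow_at (f : V -> R) s e : continuous f -> (exists M, forall x, `|f x| <= M) ->
  0 <= s <= T -> 0 < e -> exists2 d, 0 < d & forall t, 0 <= t <= T -> `|s - t| < d ->
  `|\int[mu s]_x f x - \int[mu t]_x f x| <= e.
Proof.
move=> cf fM sT e0; have /subspace_continuousP := nmu cf fM.
have s0T : `[0, T]%classic s by rewrite /= in_itv/=.
move=> /(_ s s0T)/cvgrPdist_le/(_ _ e0).
rewrite near_withinE => /nbhs_ballP[d /= d0 hd]; exists d => // t tT st.
by apply: hd => //; rewrite /= in_itv.
Qed.

Context d (Q : measurableType d) (q0 : Q) (tau : Q -> R) (G : Q -> V -> R) (M : R).
Hypothesis mtau : measurable_fun setT tau.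
Hypothesis mG : measurable_fun setT (fun p => G p.1 p.2).
Hypothesis GM : forall q x, `|G q x| <= M.
Hypothesis cG : forall q, continuous (G q).

Definition frozen_integral k N q := \int[mu (k%:R * (T / N.+1%:R))]_x G q x.

(** Left-endpoint discretisation of mu in time. The cells are half-open, so t = T falls into the one
    that starts at T: hence N + 2 cells for a subdivision into N + 1. *)
Definition grid_integral N q : R :=
  \sum_(k < N.+2) \1_[set s : R | k%:R * (T / N.+1%:R) <= s < k.+1%:R * (T / N.+1%:R)] (tau q)
    * frozen_integral k N q.

Lemma measurable_frozen k N : measurable_fun setT (frozen_integral k N).
Proof.
(* The Dirac mass merely supplies a finite measure on Q for the Fubini lemma. *)
have [] // := @bmeas_Rint1 _ _ Q V R \d_q0 (mu (k%:R * (T / N.+1%:R)))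
  setT setT G M measurableT measurableT.
- by rewrite /= diracT ltry.
- by rewrite ltey_eq fin_num_measure.
- by rewrite setXTT.
Qed.

Lemma measurable_grid N : measurable_fun setT (grid_integral N).
Proof.
apply: measurable_sum => k; apply: measurable_funM; last exact: measurable_frozen.
apply: (measurableT_comp _ mtau); apply: measurable_indic.
by rewrite -set_itvco.
Qed.

Lemma measurable_G q : measurable_fun setT (G q).
Proof. exact: continuous_measurable_rV. Qed.

Let dt_gt0 N : 0 < T / N.+1%:R. Proof. by rewrite divr_gt0. Qed.

Lemma grid_integralE N k q : (k < N.+2)%N ->
  k%:R * (T / N.+1%:R) <= tau q < k.+1%:R * (T / N.+1%:R) ->
  grid_integral N q = frozen_integral k N q.
Proof.
move=> kN kq; rewrite /grid_integral (bigD1 (Ordinal kN))//= big1 ?addr0.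
  by rewrite indicE mem_set// mul1r.
move=> i ik; rewrite indicE memNset ?mul0r//= => /andP[i1 i2].
case/andP : kq => k1 k2; move/eqP : ik; apply; apply: val_inj => /=.
have := le_lt_trans k1 i2; rewrite ltr_pM2r// ltr_nat ltnS => h1.
have := le_lt_trans i1 k2; rewrite ltr_pM2r// ltr_nat ltnS => h2.
by apply/eqP; rewrite eqn_leq h1 h2.
Qed.

Lemma gridP N q : 0 <= tau q <= T -> exists2 k, (k < N.+2)%N &
  k%:R * (T / N.+1%:R) <= tau q < k.+1%:R * (T / N.+1%:R).
Proof.
move=> /andP[q0' qT]; exists (Num.truncn (tau q / (T / N.+1%:R))).
  rewrite ltnS -(ler_nat R) (@le_trans _ _ (tau q / (T / N.+1%:R)))//.
    by rewrite truncn_le// divr_ge0// ltW.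
  by rewrite ler_pdivrMr// mulrCA divff ?mulr1// pnatr_eq0.
have h : 0 <= tau q / (T / N.+1%:R) by rewrite divr_ge0// ltW.
have /andP[h1 h2] := truncn_itv h.
by rewrite -ler_pdivlMr// h1 -ltr_pdivrMr// h2.
Qed.

Lemma grid_integral_bound N q : `|grid_integral N q| <= M.
Proof.
have M0 : 0 <= M by rewrite (le_trans _ (GM q 0)).
have [q0'|q0'] := pselect (exists2 k, (k < N.+2)%N &
    k%:R * (T / N.+1%:R) <= tau q < k.+1%:R * (T / N.+1%:R)); last first.
  rewrite /grid_integral big1 ?normr0// => k _; rewrite indicE memNset ?mul0r//=.
  by move=> h; apply: q0'; exists k.
have [k kN kq] := q0'; rewrite (grid_integralE kN kq).
by apply: prob_bound => //; exact: measurable_G.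
Qed.

Lemma grid_integral_cvg q : 0 <= tau q <= T ->
  grid_integral N q @[N --> \oo] --> \int[mu (tau q)]_x G q x.
Proof.
move=> qT; apply/cvgrPdist_le => e e0.
have [dd d0 hd] := @narrow_at (G q) (tau q) e (@cG q) (ex_intro _ M (GM q)) qT e0.
have dT : 0 < dd / T by rewrite divr_gt0.
near=> N.
have [k kN /[dup] kq /andP[k1 k2]] := gridP N qT.
rewrite (grid_integralE kN kq); apply: hd.
  case/andP : qT => q1 q2; rewrite mulr_ge0 ?(ltW (dt_gt0 N))//=.
  by rewrite (le_trans k1).
rewrite ger0_norm ?subr_ge0// ltrBlDl (lt_le_trans k2)//.
rewrite -natr1 mulrDl mul1r lerD2l -ler_pdivlMl// mulrC.
near: N; have := @cvg_harmonic R => /cvgrPdist_le/(_ _ dT).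
by apply: filterS => N; rewrite sub0r normrN ger0_norm// invr_ge0.
Unshelve. all: by end_near. Qed.

(** Since mu is only narrowly continuous in time, measurability in the parameter comes from the
    pointwise limit of the grid integrals, each a finite sum of measurable products. *)
Lemma measurable_narrow_integral (D : set Q) : measurable D ->
  (forall q, D q -> 0 <= tau q <= T) ->
  measurable_fun D (fun q => \int[mu (tau q)]_x G q x).
Proof.
move=> mD DT; apply: (@measurable_fun_cvg _ Q R D grid_integral).
  by move=> N; apply: measurable_funTS; exact: measurable_grid.
by move=> q /DT; exact: grid_integral_cvg.
Qed.

End narrow_grid.

Section step_limit.
Context (R : realType) (S : R -> R).
Local Notation leb := (@lebesgue_measure R).
Hypothesis sS : smooth S.
Hypothesis S0 : forall s, s <= 0 -> S s = 0.
Hypothesis S1 : forall s, 1 <= s -> S s = 1.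
Hypothesis dS0 : forall s : R, 0 <= 'D_1 S s.

Definition step a tau (s : R) : R := S (tau^-1 * (s - a)).

Lemma smooth_stepf a tau : smooth (step a tau).
Proof. exact: smooth_comp_affine. Qed.

Lemma step_is_derive a tau (s : R) :
  is_derive s 1 (step a tau) ('D_1 (step a tau) s).
Proof.
apply: DeriveDef => //; apply: diff_derivable.
exact/smooth_differentiable/smooth_stepf.
Qed.

Lemma step_deriveE a tau (s : R) : 'D_1 (step a tau) s = tau^-1 * 'D_1 S (tau^-1 * (s - a)).
Proof.
have dg : is_derive s 1 (fun s : R => tau^-1 * (s - a)) tau^-1.
  apply: DeriveDef; first by [].
  rewrite deriveM// deriveB// derive_cst derive_id derive_cst.
  by rewrite /GRing.scale/=; ring.
have dS : is_derive (tau^-1 * (s - a)) 1 S ('D_1 S (tau^-1 * (s - a))).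
  by apply: DeriveDef => //; apply: diff_derivable; exact: smooth_differentiable.
by have [_ ->] := @is_derive1_comp R S (fun s : R => tau^-1 * (s - a)) s _ _ dS dg;
  rewrite mulrC.
Qed.

Lemma step_derive_ge0 a tau s : 0 < tau -> 0 <= 'D_1 (step a tau) s.
Proof. by move=> tau0; rewrite step_deriveE mulr_ge0// invr_ge0 ltW. Qed.

Lemma step_le a tau s : 0 < tau -> s <= a -> step a tau s = 0.
Proof.
by move=> tau0 sa; apply: S0; rewrite pmulr_rle0 ?invr_gt0// subr_le0.
Qed.

Lemma step_ge a tau s : 0 < tau -> a + tau <= s -> step a tau s = 1.
Proof.
move=> tau0 sa; apply: S1; rewrite mulrC ler_pdivlMr// mul1r.
by rewrite lerBrDl.
Qed.

Lemma step_derive_out a tau (s : R) : 0 < tau -> ~ (a <= s <= a + tau) ->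
  'D_1 (step a tau) s = 0.
Proof.
move=> tau0 /negP; rewrite negb_and -!ltNge => /orP[sa|sa].
  rewrite -(@derive_cst R R R 0 s 1); apply: near_eq_derive.
  have : \forall x \near s, x < a by exact: lt_nbhsl.
  by apply: filterS => x xa; rewrite step_le// ltW.
rewrite -(@derive_cst R R R 1 s 1); apply: near_eq_derive.
have : \forall x \near s, a + tau < x by exact: lt_nbhsr.
by apply: filterS => x xa; rewrite step_ge// ltW.
Qed.

Lemma step_cont a tau : continuous ('D_1 (step a tau)).
Proof.
apply: (@Ck_continuous _ _ _ 0); apply: smooth_derive; exact: smooth_stepf.
Qed.

Lemma bmeas_step_derive a tau (T : R) : bmeas leb `[0, T] ('D_1 (step a tau)).
Proof.
have cD := @step_cont a tau.
have := @continuous_compact _ _ (fun s => 'D_1 (step a tau) s) `[0, T].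
move=> /(_ (continuous_subspaceT cD) (@segment_compact _ 0 T)).
move=> /compact_bounded[M [Mr hM]].
apply: (@bmeas_itv _ _ _ (`|M| + 1)); first exact: continuous_measurable_fun.
move=> s sT; apply: (hM (`|M| + 1)).
  by rewrite (le_lt_trans (ler_norm M))// ltrDl.
by exists s => //=; rewrite in_itv.
Qed.

(** The derivative of the step is nonnegative, has integral 1 and is carried by [a, a + tau]: a
    one-sided approximate identity at a. The condition tau <= T - a keeps all of its mass inside
    [0, T]. *)
Lemma step_limit (T a : R) (H : R -> R) e : 0 <= a < T -> 0 < e ->
  bmeas leb `[0, T] H ->
  (exists2 d, 0 < d & forall t, a <= t <= T -> t <= a + d -> `|H t - H a| <= e) ->
  exists2 d, 0 < d & forall tau, 0 < tau <= d ->
    `|\int[leb]_(s in `[0, T]) ('D_1 (step a tau) s * H s) - H a| <= e.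
Proof.
move=> /andP[a0 aT] e0 bH [d d0 hd].
exists (Num.min d (T - a)); first by rewrite lt_min d0 subr_gt0.
move=> tau /andP[tau0]; rewrite le_min => /andP[taud tauT].
have T0 : 0 <= T by rewrite (le_trans a0)// ltW.
have bD := bmeas_step_derive a tau T.
have I1 : \int[leb]_(s in `[0, T]) 'D_1 (step a tau) s = 1.
  rewrite (Rint_FTC T0 (@step_cont a tau) (@step_is_derive a tau)).
  by rewrite step_ge// ?step_le ?subr0//; lra.
have -> : H a = \int[leb]_(s in `[0, T]) (H a * 'D_1 (step a tau) s).
  by rewrite RintZ// I1 mulr1.
rewrite -RintB; [|exact: (bmeasM bD bH)|exact: bmeasZ].
have -> : e = \int[leb]_(s in `[0, T]) (e * 'D_1 (step a tau) s).
  by rewrite RintZ// I1 mulr1.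
rewrite (le_trans (le_normr_Rint _))//.
  by apply: bmeasB; [exact: (bmeasM bD bH)|exact: bmeasZ].
apply: le_Rint; [|exact: bmeasZ|].
  by apply: bmeas_norm; apply: bmeasB; [exact: (bmeasM bD bH)|exact: bmeasZ].
move=> s /=; rewrite in_itv/= => /andP[s0 sT].
rewrite [H a * _]mulrC -mulrBr normrM (ger0_norm (step_derive_ge0 _ _ tau0)) mulrC.
have [sa|sa] := pselect (a <= s <= a + tau); last by rewrite step_derive_out// !mulr0.
rewrite ler_wpM2r ?step_derive_ge0//; apply: hd.
  by case/andP: sa => ->.
by case/andP: sa => _ /le_trans; apply; rewrite lerD2l.
Qed.

End step_limit.

Lemma continuous_sum (R : realType) (X : topologicalType) (I : Type) (r : seq I)
  (F : I -> X -> R) : (forall i, continuous (F i)) ->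
  continuous (fun x => \sum_(i <- r) F i x).
Proof.
move=> cF; elim: r => [|i r IH] x.
  by under eq_fun do rewrite big_nil; exact: cvg_cst.
under eq_fun do rewrite big_cons.
by apply: cvgD; [exact: cF|exact: IH].
Qed.

Lemma continuous_mul (R : realType) (X : topologicalType) (f g : X -> R) :
  continuous f -> continuous g -> continuous (fun x => f x * g x).
Proof. by move=> cf cg x; apply: cvgM; [exact: cf|exact: cg]. Qed.

Lemma differentiable_fst (R : realType) (V W : normedModType R) (p : V * W) : differentiable (fun p : V * W => p.1) p.
Proof.
have l : linear (fun p : V * W => p.1) by [].
pose f : {linear (V * W)%type -> V} := HB.pack (fun p : V * W => p.1) (GRing.isLinear.Build _ _ _ _ _ l).
have -> : (fun p : V * W => p.1) = f by [].
apply: linear_differentiable => q; exact: cvg_fst.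
Qed.
Lemma differentiable_snd (R : realType) (V W : normedModType R) (p : V * W) : differentiable (fun p : V * W => p.2) p.
Proof.
have l : linear (fun p : V * W => p.2) by [].
pose f : {linear (V * W)%type -> W} := HB.pack (fun p : V * W => p.2) (GRing.isLinear.Build _ _ _ _ _ l).
have -> : (fun p : V * W => p.2) = f by [].
apply: linear_differentiable => q; exact: cvg_snd.
Qed.

(** * Integrated form of the continuity equation for a fixed spatial test function *)

Section time_regularity.
Context (R : realType) (n : nat) (T L C : R) (b : R -> 'rV[R]_n -> 'rV[R]_n)
  (mu : R -> probability 'rV[R]_n R) (psi : 'rV[R]_n -> R) (K : set 'rV[R]_n).
Local Notation V := 'rV[R]_n.
Local Notation leb := (@lebesgue_measure R).
Hypothesis T0 : 0 < T.
Hypothesis C0 : 0 < C.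
Hypothesis ab : admissible L C b.
Hypothesis nmu : narrowly_continuous T mu.
Hypothesis cmu : continuity_equation T b mu.
Hypothesis spsi : smooth psi.
Hypothesis psiK : vanishes_off K psi.
Hypothesis cK : compact K.
Hypothesis clK : closed K.

Definition transport s x : R := \sum_i b s x 0 i * 'D_(delta_mx 0 i) psi x.

Lemma continuous_field s i : continuous (fun x => b s x 0 i).
Proof.
have [_ lb _] := ab; move=> x.
apply/(@cvgrPdist_le R R _ (nbhs x) (@nbhs_pfilter _ x)) => e e0.
have : enorm (z - x) @[z --> x] --> (0 : R).
  exact: (proj1 (@cvg_enormP R n _ (nbhs x) id x (nbhs_filter x)) (fun A hA => hA)).
move=> /cvgrPdist_le; have e1 : 0 < e / (`|L| + 1) by rewrite divr_gt0// ltr_wpDl.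
move=> /(_ _ e1); apply: filterS => z; rewrite sub0r normrN ger0_norm ?enorm_ge0//.
rewrite ler_pdivlMr ?ltr_wpDl// => h.
have := coord_le_enorm (b s x - b s z) i; rewrite !mxE => /le_trans; apply.
rewrite (le_trans (lb _ _ _))//.
rewrite enorm_distC (le_trans _ h)// mulrC ler_wpM2l ?enorm_ge0//.
by rewrite (le_trans (ler_norm _))// lerDl.
Qed.

Lemma smooth_cont (f : V -> R) : smooth f -> continuous f.
Proof. by move=> sf; exact: (@Ck_continuous _ _ _ 0). Qed.

Lemma transport_bounded : exists2 M, 0 <= M & forall s x, `|transport s x| <= M.
Proof.
have [B B0 hB] := compact_enorm_bounded cK.
have h i : exists D, 0 <= D /\ forall x, `|'D_(delta_mx 0 i) psi x| <= D.
  have [||D D0 hD] := @vanishes_bounded R V K (fun x => 'D_(delta_mx 0 i) psi x) cK.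
  - exact/smooth_cont/smooth_derive.
  - exact: vanishes_derive.
  by exists D.
have {h}[D hD] := choice h.
have [_ _ gb] := ab.
have c0 : 0 <= C * (1 + B) by rewrite mulr_ge0 ?addr_ge0// ltW.
exists (\sum_i C * (1 + B) * D i) => [|s x].
  by apply: sumr_ge0 => i _; rewrite mulr_ge0// (hD i).1.
rewrite (le_trans (ler_norm_sum _ _ _))//; apply: ler_sum => i _.
rewrite normrM; have [Kx|Kx] := pselect (K x); last first.
  rewrite (vanishes_derive _ clK psiK Kx) normr0 mulr0 mulr_ge0//.
  exact: (hD i).1.
rewrite ler_pM ?(hD i).2// (le_trans (coord_le_enorm _ _))//.
rewrite (le_trans (gb _ _))//.
by rewrite ler_wpM2l ?lerD2l ?hB// ltW.
Qed.

Lemma measurable_transport :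
  measurable_fun setT (fun p : measurableTypeR R * V => transport p.1 p.2).
Proof.
apply: measurable_sum => i; apply: measurable_funM; first by case: ab.
apply: (measurableT_comp (f := fun x => 'D_(delta_mx 0 i) psi x)) => //.
by apply: continuous_measurable_rV; apply: smooth_cont; apply: smooth_derive.
Qed.

Lemma continuous_transport s : continuous (transport s).
Proof.
apply: continuous_sum => i; apply: continuous_mul; first exact: continuous_field.
by apply: smooth_cont; exact: smooth_derive.
Qed.

Let H s := \int[mu s]_x psi x.
Let g s := \int[mu s]_x transport s x.

Let psi_bounded : exists M, forall x, `|psi x| <= M.
Proof.
have [M _ hM] := vanishes_bounded cK (smooth_cont spsi) psiK.
by exists M.
Qed.

Let bH : bmeas leb `[0, T] H.
Proof.
have [M hM] := psi_bounded; split => //; [exact: leb_itv_fin| |].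
  apply: (@measurable_narrow_integral R n T mu T0 nmu _ (measurableTypeR R) 0
    (fun s => s) (fun _ => psi) M) => //.
  - exact: (measurableT_comp (continuous_measurable_rV (smooth_cont spsi))).
  - by move=> _; exact: smooth_cont.
exists M => s _; apply: prob_bound => //.
by apply: continuous_measurable_rV; exact: smooth_cont.
Qed.

Let bg : bmeas leb `[0, T] g.
Proof.
have [M _ hM] := transport_bounded; split => //; [exact: leb_itv_fin| |].
  apply: (@measurable_narrow_integral R n T mu T0 nmu _ (measurableTypeR R) 0
    (fun s => s) transport M) => //.
  - exact: measurable_transport.
  - exact: continuous_transport.
exists M => s _; apply: prob_bound => //.
by apply: continuous_measurable_rV; exact: continuous_transport.
Qed.

Let D0 (W : normedModType R) (f : W -> R) x : differentiable f x -> 'D_0 f x = 0.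
Proof. by move=> df; rewrite deriveE// linear0. Qed.

(** The test function is chi(t) psi(x); its support lies in [a, c] x K, a compact subset of ]0, T[ x
    R^n. *)
Lemma weak_equation (chi : R -> R) a c : 0 < a -> c < T -> smooth chi ->
  (forall s, ~ (a <= s <= c) -> chi s = 0) ->
  \int[leb]_(s in `[0, T]) ('D_1 chi s * H s + chi s * g s) = 0.
Proof.
move=> a0 cT schi chi0.
pose phi (p : R * V) := chi p.1 * psi p.2.
have sfst : smooth (chi \o (fun p : R * V => p.1)).
  apply: (@smooth_affine R (R * V)%type R fst) => //= p.
  exact: differentiable_fst.
have ssnd : smooth (psi \o (fun p : R * V => p.2)).
  apply: (@smooth_affine R (R * V)%type V snd) => //= p.
  exact: differentiable_snd.
have Dphi (v p : R * V) : 'D_v phi p = chi p.1 * 'D_(v.2) psi p.2 + psi p.2 * 'D_(v.1) chi p.1.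
  have e1 : 'D_v (chi \o (fun p : R * V => p.1)) p = 'D_(v.1) chi p.1.
    by apply: (@derive_affine R (R * V)%type R fst).
  have e2 : 'D_v (psi \o (fun p : R * V => p.2)) p = 'D_(v.2) psi p.2.
    by apply: (@derive_affine R (R * V)%type V snd).
  have d1 : derivable (chi \o (fun p : R * V => p.1)) p v.
    by apply: diff_derivable; exact: smooth_differentiable.
  have d2 : derivable (psi \o (fun p : R * V => p.2)) p v.
    by apply: diff_derivable; exact: smooth_differentiable.
  have := @deriveM _ _ (chi \o (fun p : R * V => p.1)) (psi \o (fun p : R * V => p.2)) p v d1 d2.
  by rewrite e1 e2.
have tphi : test_function T phi.
  pose Q : set (R * V) := `[a, c] `*` K.
  have cQ : compact Q by apply: compact_setX => //; exact: segment_compact.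
  have clQ : closed Q.
    have -> : Q = (fst @^-1` `[a, c]) `&` (snd @^-1` K).
      by apply/seteqP; split=> -[].
    apply: closedI; apply: closed_comp => //; first by move=> x _; exact: cvg_fst.
      exact: interval_closed.
    by move=> x _; exact: cvg_snd.
  have subQ : closure [set p | phi p != 0] `<=` Q.
    rewrite [X in _ `<=` X](closure_id Q).1//; apply: closureS => -[s x]/=.
    rewrite /phi mulf_eq0 negb_or => /andP[s0 x0]; split => /=; last first.
      by apply: contrapT => /psiK h; rewrite h eqxx in x0.
    by rewrite in_itv/=; apply/negPn/negP => /negP/chi0 h; rewrite h eqxx in s0.
  split.
  - exact: smooth_mul.
  - by apply: subclosed_compact cQ subQ; exact: closed_closure.
  - move=> p /subQ[/=]; rewrite !in_itv/= => /andP[pa pc] _; split => //=.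
    by rewrite (lt_le_trans a0)//= (le_lt_trans pc).
have := cmu tphi; rewrite [X in X = _ -> _](_ : _ = \int[leb]_(s in `[0, T]) ('D_1 chi s * H s + chi s * g s))//.
apply: eq_Rintegral => s _.
have [M hM] := psi_bounded; have [M' _ hM'] := transport_bounded.
have bpsi : bmeas (mu s) setT psi.
  by apply: bmeas_prob hM; by apply: continuous_measurable_rV; exact: smooth_cont.
have btr : bmeas (mu s) setT (transport s).
  by apply: bmeas_prob (hM' s); apply: continuous_measurable_rV; exact: continuous_transport.
rewrite -RintZ// -RintZ// -RintD; [|exact: bmeasZ|exact: bmeasZ].
apply: eq_Rintegral => x _; rewrite Dphi/= D0; last exact: smooth_differentiable.
rewrite mulr0 add0r mulrC; congr (_ + _); rewrite mulr_sumr; apply: eq_bigr => i _.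
rewrite Dphi/= (D0 (smooth_differentiable schi s)) mulr0 addr0; ring.
Qed.

Variable S : R -> R.
Hypothesis sS : smooth S.
Hypothesis S0 : forall s, s <= 0 -> S s = 0.
Hypothesis S1 : forall s, 1 <= s -> S s = 1.
Hypothesis S01 : forall s, 0 <= S s <= 1.
Hypothesis dS0 : forall s : R, 0 <= 'D_1 S s.

Let g_bound : exists2 M, 0 <= M & forall s, `|g s| <= M.
Proof.
have [M M0 hM] := transport_bounded; exists M => // s.
apply: prob_bound (hM s).
by apply: continuous_measurable_rV; exact: continuous_transport.
Qed.

(** The cut-off [chi] rises just after a and falls just after c. Its derivative tends to a
    difference of Dirac masses at a and c, and [chi] itself to the indicator of ]a, c]. *)
Let interior_increment a c : 0 < a -> a < c -> c < T ->
  H c - H a = \int[leb]_(s in `[a, c]) g s.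
Proof.
move=> a0 ac cT.
(* At most half of T - c, so that the support of [chi] stays away from T. *)
pose tau j : R := (T - c) / 2 * j.+1%:R^-1.
have tau0 j : 0 < tau j by rewrite mulr_gt0 ?invr_gt0// divr_gt0// subr_gt0.
have tau_cvg : tau j @[j --> \oo] --> (0 : R).
  rewrite -[X in _ --> X](mulr0 ((T - c) / 2)).
  by apply: cvgM; [exact: cvg_cst|exact: cvg_harmonic].
have tau_small e : 0 < e -> \forall j \near \oo, tau j <= e.
  move=> e0; move/cvgrPdist_le : tau_cvg => /(_ _ e0); apply: filterS => j.
  by rewrite sub0r normrN ger0_norm// ltW.
have tauT j : c + tau j < T.
  have : tau j <= (T - c) / 2.
    rewrite /tau -[leRHS]mulr1; apply: ler_wpM2l.
      by rewrite divr_ge0// subr_ge0 ltW.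
    by rewrite invf_le1 ?ler1n.
  by move=> h; lra.
pose chi j s := step S a (tau j) s - step S c (tau j) s.
have schi j : smooth (chi j).
  move=> k; have -> : chi j = (fun s => step S a (tau j) s + (-1) * step S c (tau j) s).
    by apply/funext => s; rewrite mulN1r.
  by apply: Ck_add; [|apply: Ck_mul; [exact: Ck_cst|]]; exact: smooth_stepf.
have Dchi j (s : R) : 'D_1 (chi j) s = 'D_1 (step S a (tau j)) s - 'D_1 (step S c (tau j)) s.
  by rewrite deriveB//; apply: diff_derivable; apply: smooth_differentiable;
    exact: smooth_stepf.
have chi_out j s : ~ (a <= s <= c + tau j) -> chi j s = 0.
  move=> /negP; rewrite negb_and -!ltNge => /orP[sa|sa]; rewrite /chi.
    by rewrite !(step_le S0 (tau0 j)) ?subrr// ltW// (lt_trans sa).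
  rewrite !(step_ge S1 (tau0 j)) ?subrr// ?ltW//.
  by rewrite (lt_trans _ sa)// ltrD2r.
have eq_j j : \int[leb]_(s in `[0, T]) ('D_1 (step S a (tau j)) s * H s) -
    \int[leb]_(s in `[0, T]) ('D_1 (step S c (tau j)) s * H s) +
    \int[leb]_(s in `[0, T]) (chi j s * g s) = 0.
  have bDa := bmeas_step_derive sS a (tau j) T.
  have bDc := bmeas_step_derive sS c (tau j) T.
  have bchi : bmeas leb `[0, T] (chi j).
    apply: (@bmeas_itv _ _ _ 1).
      by apply: continuous_measurable_fun; apply: (@Ck_continuous _ _ _ 0); exact: schi.
    move=> s _; rewrite /chi /step ler_norml.
    have := S01 ((tau j)^-1 * (s - a)); have := S01 ((tau j)^-1 * (s - c)).
    by move=> /andP[? ?] /andP[? ?]; apply/andP; split; lra.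
  have m1 := bmeasM bDa bH; have m2 := bmeasM bDc bH.
  rewrite -RintB// -RintD; [|exact: bmeasB|exact: (bmeasM bchi bg)].
  rewrite -[RHS](weak_equation a0 (tauT j) (schi j) (chi_out j)).
  by apply: eq_Rintegral => s _; rewrite Dchi; ring.
have lim_step x : 0 < x < T -> \int[leb]_(s in `[0, T]) ('D_1 (step S x (tau j)) s * H s)
    @[j --> \oo] --> H x.
  move=> /andP[x0 xT]; apply/cvgrPdist_le => e e0.
  have [||d d0 hd] := @step_limit R S sS S0 S1 dS0 T x H e _ e0 bH.
  - by rewrite ltW.
  - have x0T : 0 <= x <= T by rewrite !ltW.
    have [d d0 hd] := narrow_at nmu (smooth_cont spsi) psi_bounded x0T e0.
    exists (d / 2); first by rewrite divr_gt0.
    move=> t /andP[xt tT] txd; rewrite distrC; apply: hd.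
      by rewrite tT (le_trans _ xt)// ltW.
    by rewrite distrC ger0_norm ?subr_ge0//; lra.
  have := tau_small _ d0; apply: filterS => j jd.
  by rewrite distrC hd// tau0.
have lim_chi : \int[leb]_(s in `[0, T]) (chi j s * g s) @[j --> \oo] -->
    \int[leb]_(s in `[0, T]) (\1_`]a, c] s * g s).
  have [M M0 hM] := g_bound.
  apply: (proj2 (@bmeas_dominated_cvg _ _ _ leb `[0, T] (fun j s => chi j s * g s)
     _ M _ _ _)).
  - move=> j; apply: bmeasM => //.
    apply: (@bmeas_itv _ _ _ 1).
      by apply: continuous_measurable_fun; apply: (@Ck_continuous _ _ _ 0); exact: schi.
    move=> s _; rewrite /chi /step ler_norml.
    have := S01 ((tau j)^-1 * (s - a)); have := S01 ((tau j)^-1 * (s - c)).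
    by move=> /andP[? ?] /andP[? ?]; apply/andP; split; lra.
  - move=> j s _; rewrite normrM -[leRHS]mul1r ler_pM//.
    rewrite /chi /step ler_norml.
    have := S01 ((tau j)^-1 * (s - a)); have := S01 ((tau j)^-1 * (s - c)).
    by move=> /andP[? ?] /andP[? ?]; apply/andP; split; lra.
  - move=> s _; apply: cvgM; last exact: cvg_cst.
    have [sa|sa] := leP s a.
      rewrite indicE memNset ?mulr0n; last first.
        by rewrite /= in_itv/= => /andP[]; rewrite ltNge sa.
      apply: cvg_near_cst; apply: nearW => j.
      by rewrite /chi !(step_le S0 (tau0 j))// ?subrr// (le_trans sa)// ltW.
    have sa0 : 0 < s - a by rewrite subr_gt0.
    have [sc|sc] := leP s c.
      rewrite indicE mem_set ?mulr1n; last by rewrite /= in_itv/= sa.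
      apply: cvg_near_cst; have := tau_small _ sa0; apply: filterS => j hj.
      rewrite /chi (step_ge S1 (tau0 j)); last by lra.
      by rewrite (step_le S0 (tau0 j))// subr0.
    have sc0 : 0 < s - c by rewrite subr_gt0.
    rewrite indicE memNset ?mulr0n; last first.
      by rewrite /= in_itv/= => /andP[_]; rewrite leNgt sc.
    apply: cvg_near_cst; have := tau_small _ sc0; apply: filterS => j hj.
    by rewrite /chi !(step_ge S1 (tau0 j)) ?subrr//; lra.
have -> : \int[leb]_(s in `[a, c]) g s = \int[leb]_(s in `[0, T]) (\1_`]a, c] s * g s).
  rewrite -Rintegral_itv_obnd_cbnd; last first.
    apply: bmeas_integrable; apply: bmeasS bg => // s /=; rewrite !in_itv/=.
    by move=> /andP[as_ sc]; rewrite !ltW// ?(lt_trans a0)// (le_lt_trans sc).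
  rewrite [LHS]Rintegral_mkcond [RHS]Rintegral_mkcond.
  apply: eq_Rintegral => s _; rewrite !patchE indicE.
  case: ifPn; rewrite ?inE/= => sac.
    rewrite mem_set; last first.
      move: sac; rewrite /= !in_itv/= => /andP[as_ sc].
      by rewrite !ltW// ?(lt_trans a0)// (le_lt_trans sc).
    by rewrite mulr1n mul1r.
  by rewrite mulr0n mul0r; case: ifP.
have haT : 0 < a < T by rewrite a0 (lt_trans ac).
have hcT : 0 < c < T by rewrite cT (lt_trans a0).
have h : \int[leb]_(s in `[0, T]) ('D_1 (step S a (tau j)) s * H s) -
    \int[leb]_(s in `[0, T]) ('D_1 (step S c (tau j)) s * H s) +
    \int[leb]_(s in `[0, T]) (chi j s * g s) @[j --> \oo] -->
    H a - H c + \int[leb]_(s in `[0, T]) (\1_`]a, c] s * g s).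
  by apply: cvgD lim_chi; apply: cvgB; exact: lim_step.
have E : H a - H c + \int[leb]_(s in `[0, T]) (\1_`]a, c] s * g s) = 0.
  rewrite -(cvg_lim _ h)//; apply/cvg_lim => //.
  by apply: cvg_near_cst; apply: nearW => j; exact: eq_j.
by move: E; set u := \int[leb]_(s in _) _ => E; lra.
Qed.

(** Test functions do not see the times 0 and T. They are reached by shrinking [a, c] by dd / 3 at
    both ends, with four errors e / 4: two from narrow continuity at the endpoints, two from the
    short integrals. *)
Lemma narrow_increment a c : 0 <= a -> a <= c -> c <= T ->
  \int[mu c]_x psi x - \int[mu a]_x psi x =
  \int[leb]_(s in `[a, c]) \int[mu s]_x transport s x.
Proof.
move=> a0; rewrite le_eqVlt => /predU1P[->|ac] cT.
  by rewrite subrr set_itv1 Rintegral_set1.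
rewrite -/(H c) -/(H a) -/g.
have [M M0 hM] := g_bound.
have gI x y : 0 <= x -> x <= y -> y <= T ->
    `|\int[leb]_(s in `[x, y]) g s| <= M * (y - x).
  move=> x0 xy yT; rewrite -(leb_itvE xy); apply: le_normr_bound => [|s _//].
  apply: bmeasS bg => // s /=; rewrite !in_itv/= => /andP[xs sy].
  by rewrite (le_trans x0)//= (le_trans sy).
apply/eqP; rewrite -subr_eq0 -normr_le0; apply/ler_addgt0Pl => e e0; rewrite addr0.
have e4 : 0 < e / 4 by rewrite divr_gt0.
have aT : 0 <= a <= T by rewrite a0 (le_trans _ cT)// ltW.
have cT' : 0 <= c <= T by rewrite cT (le_trans a0)// ltW.
have [d1 d10 hd1] := narrow_at nmu (smooth_cont spsi) psi_bounded aT e4.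
have [d2 d20 hd2] := narrow_at nmu (smooth_cont spsi) psi_bounded cT' e4.
have eM : 0 < e / 4 / (M + 1) by rewrite divr_gt0// ltr_wpDl.
pose dd := Num.min (Num.min d1 d2) (Num.min (e / 4 / (M + 1)) (c - a)).
have dd0 : 0 < dd by rewrite !lt_min d10 d20 eM subr_gt0.
have : dd <= dd by []; rewrite {2}/dd !le_min => /andP[/andP[dd1 dd2] /andP[ddM ddac]].
pose x := a + dd / 3; pose y := c - dd / 3.
have ax : a <= x by rewrite /x; lra.
have xy : x < y by rewrite /x /y; lra.
have yc : y <= c by rewrite /y; lra.
have x0 : 0 < x by rewrite /x; lra.
have yT : y < T by rewrite /y; lra.
have h := interior_increment x0 xy yT.
have I1 : \int[leb]_(s in `[a, c]) g s = \int[leb]_(s in `[a, x]) g s +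
   (\int[leb]_(s in `[x, y]) g s + \int[leb]_(s in `[y, c]) g s).
  rewrite (@Rint_itvD _ a x c)//; last 2 first.
    by rewrite (le_trans _ yc)// ltW.
    apply: bmeasS bg => // s /=; rewrite !in_itv/= => /andP[xs sy].
    by rewrite (le_trans a0)//= (le_trans sy).
  congr (_ + _); apply: Rint_itvD => //; first exact: ltW.
  apply: bmeasS bg => // s /=; rewrite !in_itv/= => /andP[xs sy].
  by rewrite (le_trans (ltW x0))//= (le_trans sy).
have k1 : `|H a - H x| <= e / 4.
  apply: hd1; first by rewrite ltW//= (le_trans (ltW xy))// ltW.
  by rewrite distrC ger0_norm ?subr_ge0// /x; lra.
have k2 : `|H c - H y| <= e / 4.
  apply: hd2; first by rewrite (ltW yT) andbT (le_trans (ltW x0))// ltW.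
  by rewrite ger0_norm ?subr_ge0// /y; lra.
have ddM' : M * (dd / 3) <= e / 4.
  have : dd / 3 <= e / 4 / (M + 1) by lra.
  rewrite ler_pdivlMr ?ltr_wpDl// => /(le_trans _); apply.
  by rewrite mulrC ler_wpM2l ?lerDl//; lra.
have k3 : `|\int[leb]_(s in `[a, x]) g s| <= e / 4.
  rewrite (le_trans (gI _ _ a0 ax _))//; first by rewrite (le_trans (ltW xy))// ltW.
  by rewrite (le_trans _ ddM')// /x addrAC subrr add0r.
have k4 : `|\int[leb]_(s in `[y, c]) g s| <= e / 4.
  rewrite (le_trans (gI _ _ _ yc _))//; first by rewrite (le_trans (ltW x0))// ltW.
  by rewrite (le_trans _ ddM')// /y opprB addrC subrK.
rewrite I1 -h.
move: k1 k2 k3 k4; rewrite !ler_norml => /andP[? ?] /andP[? ?] /andP[? ?] /andP[? ?].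
by apply/andP; split; lra.
Qed.

End time_regularity.

(** * Mollification *)
Section image_measure.
Context d d' (T1 : measurableType d) (T2 : measurableType d') (R : realType).

(* The measurability proof is an argument so that the measure structure can be
   inferred from the term. *)
Definition image_measure (m : set T1 -> \bar R) (f : T1 -> T2)
  (mf : measurable_fun setT f) : set T2 -> \bar R := fun A => m (f @^-1` A).

Section measure.
Variables (m : {measure set T1 -> \bar R}) (f : T1 -> T2) (mf : measurable_fun setT f).

Let im0 : image_measure m mf set0 = 0%E.
Proof. by rewrite /image_measure preimage_set0 measure0. Qed.

Let im_ge0 A : (0 <= image_measure m mf A)%E.
Proof. exact: measure_ge0. Qed.

Let im_sigma_additive : semi_sigma_additive (image_measure m mf).
Proof.
move=> F mF tF mUF; rewrite /image_measure preimage_bigcup.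
apply: measure_semi_sigma_additive.
- by move=> n; rewrite -[X in measurable X]setTI; exact: mf.
- apply/trivIsetP => /= i j _ _ ij; rewrite -preimage_setI.
  by move/trivIsetP : tF => /(_ _ _ _ _ ij) ->//; rewrite preimage_set0.
- by rewrite -preimage_bigcup -[X in measurable X]setTI; exact: mf.
Qed.

HB.instance Definition _ := isMeasure.Build _ _ _ (image_measure m mf)
  im0 im_ge0 im_sigma_additive.

Lemma ge0_integral_image (g : T2 -> \bar R) : measurable_fun setT g ->
  (forall y, 0 <= g y)%E ->
  (\int[image_measure m mf]_y g y = \int[m]_x g (f x))%E.
Proof.
by move=> mg g0; apply: (ge0_integral_pushforward mf) => // y _; exact: g0.
Qed.

Lemma Rint_image (D : set T2) (g : T2 -> R) : measurable D ->
  (m (f @^-1` D) < +oo)%E -> bmeas (image_measure m mf) D g ->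
  bmeas m (f @^-1` D) (g \o f) /\
  \int[image_measure m mf]_(y in D) g y = \int[m]_(x in f @^-1` D) g (f x).
Proof.
move=> mD Doo [_ _ mg [M gM]].
have mfD : measurable (f @^-1` D) by rewrite -[X in measurable X]setTI; exact: mf.
have bg : bmeas m (f @^-1` D) (g \o f).
  split => //; last by exists M => x; exact: gM.
  by apply: (measurable_comp mD _ mg) => [_ [x Dx <-]//|]; exact: measurable_funTS.
split => //.
rewrite Rintegral_mkcond [RHS]Rintegral_mkcond /Rintegral; congr fine.
have e x : ((g \o f) \_ (f @^-1` D)) x = (g \_ D) (f x).
  rewrite !patchE; suff -> : (x \in f @^-1` D) = (f x \in D) by [].
  by apply/idP/idP; rewrite !inE.
under [RHS]eq_integral do rewrite e.
have mgD : measurable_fun setT (EFin \o (g \_ D)).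
  by apply/measurable_EFinP; exact/(measurable_restrictT _ _).1.
have ig : m.-integrable setT (EFin \o (g \_ D) \o f).
  have -> : EFin \o (g \_ D) \o f = EFin \o ((g \o f) \_ (f @^-1` D)).
    by apply/funext => x /=; rewrite -e.
  rewrite -restrict_EFin; apply/integrable_restrict => //.
  by rewrite setTI; exact: bmeas_integrable.
exact: (integral_pushforward mf mgD ig measurableT).
Qed.

End measure.

Section prob.
Variables (m : probability T1 R) (f : T1 -> T2) (mf : measurable_fun setT f).

Let im_setT : image_measure m mf setT = 1%E.
Proof. by rewrite /image_measure preimage_setT probability_setT. Qed.

HB.instance Definition _ := Measure_isProbability.Build _ _ _ (image_measure m mf) im_setT.

End prob.

End image_measure.

Section lebesgue_affine.
Context (R : realType).
Local Notation leb := (@lebesgue_measure R).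
Local Open Scope ereal_scope.

Lemma measurable_affine1 (c a : R) :
  measurable_fun setT (fun s : measurableTypeR R => (c * s + a)%R : measurableTypeR R).
Proof.
apply: measurable_funD; last exact: measurable_cst.
by apply: measurable_funM; [exact: measurable_cst|exact: measurable_id].
Qed.

(** The image of Lebesgue measure under s |-> c s + a, multiplied by c, gives half-open intervals
    their length, hence is Lebesgue measure. [integral_affine] repeats this in each coordinate by
    Tonelli. *)
Lemma integral_affine1 (c a : R) (f : measurableTypeR R -> \bar R) : (0 < c)%R ->
  measurable_fun setT f -> (forall s, 0 <= f s) ->
  \int[leb]_s f s = c%:E * \int[leb]_s f (c * s + a)%R.
Proof.
move=> c0 mf f0.
have mA := measurable_affine1 c a.
pose m := mscale (NngNum (ltW c0)) (image_measure leb mA).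
have hm A : measurable A -> leb A = m A.
  apply: (lebesgue_measure_unique (mu := m)) => _ [[x y] _ <-]/=.
  rewrite /m /mscale/= /image_measure.
  have -> : (fun s => (c * s + a)%R) @^-1` `]x, y] = `]((x - a) / c)%R, ((y - a) / c)%R]%classic.
    apply/seteqP; split=> s; rewrite /= !in_itv/= ltr_pdivrMr// ler_pdivlMr// ltrBlDr lerBrDr mulrC.
      by [].
    by [].
  rewrite !lebesgue_measure_itv/= !lte_fin ltr_pM2r ?invr_gt0// ltrD2r.
  case: ifPn => _; last by rewrite mule0.
  by rewrite -!EFinD -EFinM; congr EFin; field; rewrite gt_eqF.
rewrite (eq_measure_integral m) => [|A mA' _]; last exact: hm.
rewrite ge0_integral_mscale//=; congr (_ * _).
exact: ge0_integral_image.
Qed.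

Lemma integral_lebesgue_rVS n (f : 'rV[R]_n.+1 -> \bar R) :
  measurable_fun setT f -> (forall x, 0 <= f x) ->
  \int[lebesgue_rV R n.+1]_x f x =
  \int[leb]_s \int[lebesgue_rV R n]_x f (@consrV R n (s, x)) /\
  measurable_fun setT (fun s => \int[lebesgue_rV R n]_x f (@consrV R n (s, x))).
Proof.
move=> mf f0.
have mc := @measurable_consrV R n.
have mfc : measurable_fun setT (f \o @consrV R n) by exact: measurableT_comp.
split; last exact: (measurable_fun_fubini_tonelli_F (m2 := lebesgue_rV R n) (f \o @consrV R n) mfc (fun p => f0 _)).
transitivity (\int[(leb \x lebesgue_rV R n)%E]_p f (@consrV R n p)).
  exact: (ge0_integral_image (leb \x lebesgue_rV R n)%E mc).
exact: (fubini_tonelli1 (m1 := leb) (m2 := lebesgue_rV R n) (f \o @consrV R n) mfc (fun p => f0 _)).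
Qed.

Lemma measurable_affine n (c : R) (a : 'rV[R]_n) :
  measurable_fun setT (fun x : 'rV[R]_n => (c *: x + a)%R).
Proof.
apply: measurable_fun_rV => i; under eq_fun do rewrite !mxE.
apply: measurable_funD; last exact: measurable_cst.
by apply: measurable_funM; [exact: measurable_cst|exact: measurable_coord_rV].
Qed.

Lemma integral_affine n (c : R) (a : 'rV[R]_n) (f : 'rV[R]_n -> \bar R) : (0 < c)%R ->
  measurable_fun setT f -> (forall s, 0 <= f s) ->
  \int[lebesgue_rV R n]_x f x = (c ^+ n)%:E * \int[lebesgue_rV R n]_x f (c *: x + a)%R.
Proof.
move=> c0; elim: n a f => [|n IH] a f mf f0.
  rewrite expr0 mul1e; apply: eq_integral => x _; congr f.
  by apply/rowP => -[].
have mg : measurable_fun setT (fun x : 'rV[R]_n.+1 => f (c *: x + a)%R).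
  exact: (measurableT_comp mf (measurable_affine c a)).
have [-> _] := integral_lebesgue_rVS mf f0.
have [-> m2] := integral_lebesgue_rVS mg (fun x : 'rV[R]_n.+1 => f0 _).
pose a' : 'rV[R]_n := (\row_i a 0 (lift ord0 i))%R.
have e s (x : 'rV[R]_n) : (c *: @consrV R n (s, x) + a)%R =
    @consrV R n ((c * s + a 0 ord0)%R, (c *: x + a')%R).
  apply/rowP => i; rewrite !mxE; case: unliftP => [j ->|->]/=; last by [].
  by rewrite !mxE.
have -> : (fun s => \int[lebesgue_rV R n]_x f (c *: @consrV R n (s, x) + a)%R) =
    (fun s => \int[lebesgue_rV R n]_x f (@consrV R n ((c * s + a 0 ord0)%R, (c *: x + a')%R))).
  by apply/funext => s; apply: eq_integral => x _; rewrite e.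
have mfs s : measurable_fun setT (fun x => f (@consrV R n (s, x))).
  have := measurableT_comp mf (@measurable_consrV R n) => h.
  exact: (measurableT_comp h (measurable_pair1 s)).
have -> : (fun s => \int[lebesgue_rV R n]_x f (@consrV R n (s, x))) =
    (fun s => (c ^+ n)%:E * \int[lebesgue_rV R n]_x f (@consrV R n (s, (c *: x + a')%R))).
  by apply/funext => s; rewrite (IH a' _ (mfs s)).
have [_ m1] := integral_lebesgue_rVS mf f0.
have mI : measurable_fun setT (fun s => \int[lebesgue_rV R n]_x
    f (@consrV R n (s, (c *: x + a')%R))).
  apply: (measurable_fun_fubini_tonelli_F (m2 := lebesgue_rV R n)
    (fun p : measurableTypeR R * 'rV[R]_n => f (@consrV R n (p.1, (c *: p.2 + a')%R)))) => //.
  apply: (measurableT_comp mf).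
  apply: (measurableT_comp (@measurable_consrV R n)).
  apply: measurable_fun_pair => //.
  exact: (measurableT_comp (measurable_affine c a') measurable_snd).
rewrite ge0_integralZl//; last 2 first.
  by move=> s _; exact: integral_ge0.
  by rewrite lee_fin exprn_ge0// ltW.
rewrite (@integral_affine1 c (a 0%R ord0) _ c0)//; last first.
  by move=> s; exact: integral_ge0.
by rewrite muleA -EFinM -exprSr.
Qed.

End lebesgue_affine.

Section probability_of_set_function.
Context d (T : measurableType d) (R : realType).

Definition probability_axioms (m : set T -> \bar R) :=
  [/\ m set0 = 0%E, forall A, (0 <= m A)%E, semi_sigma_additive m & m setT = 1%E].

(** Carrying the proof as an argument lets the probability structure be inferred from the term, as
    for [image_measure]. *)
Definition set_function_of (m : set T -> \bar R) of probability_axioms m := m.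

Variables (m : set T -> \bar R) (hm : probability_axioms m).

Let m0 : set_function_of hm set0 = 0%E. Proof. by case: hm. Qed.
Let m_ge0 A : (0 <= set_function_of hm A)%E. Proof. by case: hm. Qed.
Let m_sa : semi_sigma_additive (set_function_of hm). Proof. by case: hm. Qed.
Let m_T : set_function_of hm setT = 1%E. Proof. by case: hm. Qed.

HB.instance Definition _ := isMeasure.Build _ _ _ (set_function_of hm) m0 m_ge0 m_sa.
HB.instance Definition _ := Measure_isProbability.Build _ _ _ (set_function_of hm) m_T.

Lemma exists_probability : exists P : probability T R, P = m :> (set T -> \bar R).
Proof. by exists (set_function_of hm). Qed.

End probability_of_set_function.

Lemma continuous_dist (R : realType) (W : normedModType R) (x : W) :
  continuous (fun y : W => `|y - x|).
Proof. by move=> y; apply: cvg_norm; apply: cvgB; [exact: cvg_id|exact: cvg_cst]. Qed.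

(** * Mollified probability measures *)

Section mollifiers.
Context (R : realType) (n : nat).
Local Notation V := 'rV[R]_n.
Local Notation lebV := (lebesgue_rV R n).
Implicit Types (x y z : V).

Definition eball r : set V := [set x | enorm x <= r].

Lemma closed_eball r : closed (eball r).
Proof.
have -> : eball r = @enorm R n @^-1` [set s | s <= r] by [].
by apply: closed_comp; [move=> x _; exact: enorm_continuous|exact: closed_le].
Qed.

Lemma compact_eball r : compact (eball r).
Proof. by apply: (@closed_enorm_compact _ _ _ r); [exact: closed_eball|]. Qed.

Lemma closed_rV_measurable (A : set V) : closed A -> measurable A.
Proof.
move=> cA; rewrite -[A]setCK; apply: measurableC.
by apply: rV_open_measurable; exact: closed_openC.
Qed.

Lemma measurable_eball r : measurable (eball r).
Proof. by apply: closed_rV_measurable; exact: closed_eball. Qed.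

Definition cube (x : V) r : set V := [set y | forall i, x 0 i - r <= y 0 i <= x 0 i + r].

Lemma cubeE x r : 0 <= r -> lebV (cube x r) = ((2 * r) ^+ n)%:E.
Proof.
move=> r0; have h i : (\row_i (x 0 i - r)) 0 i <= (\row_i (x 0 i + r)) 0 i :> R.
  by rewrite !mxE lerD2l (le_trans _ r0)// oppr_le0.
have := lebesgue_rV_box h.
rewrite (eq_bigr (fun=> 2 * r)); last by move=> i _; rewrite !mxE; ring.
rewrite prodr_const card_ord => <-; congr (lebV _).
by apply/seteqP; split => z zr i; have := zr i; rewrite !mxE.
Qed.

Lemma cube_norm x r y : 0 <= r -> cube x r y <-> `|y - x| <= r.
Proof.
move=> r0; split=> [h|h i].
  rewrite [leLHS]/Num.norm/= mx_normrE; apply: bigmax_le => // -[i j] _ /=.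
  rewrite (ord1 i) !mxE ler_distl; have /andP[h1 h2] := h j.
  by rewrite h1 h2.
have := le_trans (coord_le_norm (y - x) i) h; rewrite !mxE ler_distl => /andP[-> ->].
by [].
Qed.

Lemma closed_cube x r : 0 <= r -> closed (cube x r).
Proof.
move=> r0; have -> : cube x r = (fun y => `|y - x|) @^-1` [set s | s <= r].
  by apply/seteqP; split => y /(cube_norm x y r0).
apply: closed_comp; last exact: closed_le.
by move=> y _; exact: continuous_dist.
Qed.

Lemma measurable_cube x r : 0 <= r -> measurable (cube x r).
Proof. by move=> r0; apply: closed_rV_measurable; exact: closed_cube. Qed.

Lemma bounded_lebesgue_fin (A : set V) r : measurable A ->
  (forall x, A x -> enorm x <= r) -> (lebV A < +oo)%E.
Proof.
move=> mA Ar; have r0 : 0 <= `|r| by [].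
rewrite (@le_lt_trans _ _ (lebV (cube 0 `|r|)))//; last by rewrite cubeE ?ltry.
rewrite le_measure ?inE//; first exact: measurable_cube.
move=> x Ax; apply/(cube_norm _ _ r0); rewrite subr0.
by rewrite (le_trans (norm_le_enorm _))// (le_trans (Ar _ Ax))// ler_norm.
Qed.

Lemma eball_fin r : (lebV (eball r) < +oo)%E.
Proof. by apply: (@bounded_lebesgue_fin _ r) => //; exact: measurable_eball. Qed.

Variables (eta : V -> R) (eps : R).
Hypothesis meta : mollifier eta.
Hypothesis eps0 : 0 < eps.
Let rho := rescale eta eps.

Lemma rescale_smooth : smooth rho.
Proof.
have [seta _ _ _ _] := meta.
apply: smooth_mul; first exact: smooth_cst.
have d x : differentiable (fun x : V => eps^-1 *: x) x.
  by apply: differentiableZ.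
apply: (@smooth_affine R V V (fun x => eps^-1 *: x) (fun x => eps^-1 *: x)) => //.
by move=> k x v; rewrite scalerDr !scalerA mulrC.
Qed.

Lemma rescale_ge0 x : 0 <= rho x.
Proof.
have [_ e0 _ _ _] := meta; rewrite /rho /rescale mulr_ge0// invr_ge0 exprn_ge0//.
exact: ltW.
Qed.

Lemma rescale_out x : ~ eball eps x -> rho x = 0.
Proof.
move=> /negP; rewrite -ltNge => xe; have [_ _ _ e1 _] := meta.
rewrite /rho /rescale e1 ?mulr0// enormZ gtr0_norm ?invr_gt0//.
by rewrite mulrC ltr_pdivlMr// mul1r.
Qed.

Lemma rescale_continuous : continuous rho.
Proof. exact: (@Ck_continuous _ _ _ 0 (rescale_smooth 0)). Qed.

Lemma measurable_sub_rV : measurable_fun setT (fun p : V * V => p.1 - p.2).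
Proof.
apply: measurable_fun_rV => i; under eq_fun do rewrite !mxE.
apply: measurable_funB.
  exact: (measurableT_comp (@measurable_coord_rV R n i) measurable_fst).
exact: (measurableT_comp (@measurable_coord_rV R n i) measurable_snd).
Qed.

Lemma measurable_rescale_sub : measurable_fun setT (fun p : V * V => rho (p.1 - p.2)).
Proof.
apply: (measurableT_comp _ measurable_sub_rV).
exact: (continuous_measurable_rV rescale_continuous).
Qed.

Lemma rescale_bounded : exists2 M, 0 <= M & forall x, `|rho x| <= M.
Proof.
apply: (@vanishes_bounded R V (eball eps)); first exact: compact_eball.
  exact: rescale_continuous.
by move=> x; exact: rescale_out.
Qed.

Lemma integral_rescale y : (\int[lebV]_x (rho (x - y))%:E = 1)%E.
Proof.
have [seta e0 _ _ e1] := meta.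
have ceta : continuous eta by exact: (@Ck_continuous _ _ _ 0 (seta 0)).
have meta' : measurable_fun setT (EFin \o eta).
  by apply/measurable_EFinP; exact: continuous_measurable_rV.
have i0 : 0 < eps^-1 by rewrite invr_gt0.
rewrite -e1 (@integral_affine R n eps^-1 (- (eps^-1 *: y)) (EFin \o eta) i0 meta'); last first.
  by move=> x; rewrite lee_fin.
rewrite -ge0_integralZl//; last 3 first.
- exact: (measurableT_comp meta' (measurable_affine _ _)).
- by move=> x _; rewrite lee_fin.
- by rewrite lee_fin exprn_ge0// ltW.
by apply: eq_integral => x _; rewrite /= -EFinM /rho /rescale scalerBr exprVn.
Qed.

Lemma integral_shift x (f : V -> \bar R) : measurable_fun setT f -> (forall y, 0 <= f y)%E ->
  (\int[lebV]_y f y = \int[lebV]_z f (x + z)%R)%E.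
Proof.
move=> mf f0; rewrite (integral_affine x ltr01)// expr1n mul1e.
by apply: eq_integral => z _; rewrite scale1r addrC.
Qed.

Lemma Rint_rescale : \int[lebV]_(z in eball eps) rho z = 1.
Proof.
apply: EFin_inj; rewrite RintE.
  rewrite -(integral_rescale 0) [LHS]integral_mkcond; apply: eq_integral => z _.
  rewrite patchE subr0; case: ifPn => //.
  by rewrite notin_setE => /rescale_out ->.
have [M _ hM] := rescale_bounded.
split; [exact: measurable_eball|exact: eball_fin| |by exists M => z _].
by apply: measurable_funTS; exact: (continuous_measurable_rV rescale_continuous).
Qed.

Lemma Rint_shift x (F : V -> R) (B : set V) M : measurable B -> (lebV B < +oo)%E ->
  measurable_fun setT F -> (forall y, 0 <= F y <= M) -> (forall y, ~ B y -> F y = 0) ->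
  \int[lebV]_(y in B) (F y * rho (y - x)) = \int[lebV]_(z in eball eps) (F (x + z) * rho z).
Proof.
move=> mB Boo mF FM FB; have [Mr Mr0 hMr] := rescale_bounded.
have F0 y : 0 <= F y by case/andP: (FM y).
have nF y : `|F y| <= M by rewrite ger0_norm//; case/andP: (FM y).
have mrho : measurable_fun setT rho by exact: (continuous_measurable_rV rescale_continuous).
have mr : measurable_fun setT (fun y => rho (y - x)).
  have := measurableT_comp mrho (@measurable_affine R n 1 (- x)).
  by congr measurable_fun; apply/funext => y /=; rewrite scale1r.
have mFx : measurable_fun setT (fun z => F (x + z)).
  have := measurableT_comp mF (@measurable_affine R n 1 x).
  by congr measurable_fun; apply/funext => y /=; rewrite scale1r addrC.
apply: EFin_inj; rewrite !RintE; last 2 first.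
- split; [exact: measurable_eball|exact: eball_fin| |].
    by apply: measurable_funTS; exact: measurable_funM.
  by exists (M * Mr) => z _; rewrite normrM ler_pM.
- split => //; first by apply: measurable_funTS; exact: measurable_funM.
  by exists (M * Mr) => z _; rewrite normrM ler_pM.
transitivity (\int[lebV]_y (F y * rho (y - x))%:E)%E.
  rewrite [LHS]integral_mkcond; apply: eq_integral => y _.
  rewrite patchE; case: ifPn => //.
  by rewrite notin_setE => /FB ->; rewrite mul0r.
rewrite (@integral_shift x); last 2 first.
- by apply/measurable_EFinP; exact: measurable_funM.
- by move=> y; rewrite lee_fin mulr_ge0// rescale_ge0.
rewrite [RHS]integral_mkcond; apply: eq_integral => z _.
rewrite patchE [x + z]addrC addrK; case: ifPn => //.
by rewrite notin_setE => /rescale_out ->; rewrite mulr0.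
Qed.

Variable theta : probability V R.

(** By Tonelli the mollified mass of B is the theta-average over y of the integral of rho(x - y)
    over x in B. That inner integral is 1 when B contains the eps-ball about y and 0 when it misses
    it, which gives both comparisons. *)
Lemma mollify_probability : exists P : probability V R,
  (forall E, measurable E -> P E = with_density (mollify theta rho) E) /\
  (forall A B : set V, measurable A -> measurable B ->
    ((forall x y, enorm (x - y) <= eps -> A y -> B x) -> (theta A <= P B)%E) /\
    ((forall x y, enorm (x - y) <= eps -> B x -> A y) -> (P B <= theta A)%E)).
Proof.
have [M M0 hM] := rescale_bounded.
have mrho : measurable_fun setT rho by exact: (continuous_measurable_rV rescale_continuous).
have brho x : bmeas theta setT (fun y => rho (x - y)).
  apply: (@bmeas_prob _ _ _ _ M) => //.
  exact: (measurableT_comp measurable_rescale_sub (measurable_pair1 x)).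
pose g x := mollify theta rho x.
have gE x : (g x)%:E = (\int[theta]_y (rho (x - y))%:E)%E by rewrite /g /mollify RintE.
have g0 x : (0 <= (g x)%:E)%E.
  by rewrite gE; apply: integral_ge0 => y _; rewrite lee_fin rescale_ge0.
have mK : measurable_fun setT (fun p : V * V => (rho (p.1 - p.2))%:E).
  by apply/measurable_EFinP; exact: measurable_rescale_sub.
have mg : measurable_fun setT (EFin \o g).
  have := measurable_fun_fubini_tonelli_F (m2 := theta) _ mK.
  have h : forall p : V * V, (0 <= (rho (p.1 - p.2))%:E)%E.
    by move=> p; rewrite lee_fin rescale_ge0.
  by move=> /(_ h); congr measurable_fun; apply/funext => x; rewrite /fubini_F /= gE.
have dE E : measurable E -> with_density g E =
    (\int[theta]_y \int[lebV]_(x in E) (rho (x - y))%:E)%E.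
  move=> mE; rewrite /with_density integral_mkcond.
  transitivity (\int[lebV]_x \int[theta]_y ((\1_E x)%:E * (rho (x - y))%:E))%E.
    apply: eq_integral => x _; rewrite patchE indicE.
    case: ifPn => xE.
      by rewrite gE; apply: eq_integral => y _; rewrite mul1e.
    by rewrite integral0_eq// => y _; rewrite mul0e.
  rewrite (fubini_tonelli (m1 := lebV) (m2 := theta)
    (fun p => ((\1_E p.1)%:E * (rho (p.1 - p.2))%:E)%E)).
  - apply: eq_integral => y _; rewrite /fubini_G/= [RHS]integral_mkcond; apply: eq_integral => x _.
    by rewrite patchE indicE; case: ifPn => _; rewrite ?mul1e ?mul0e.
  - apply: emeasurable_funM => //; apply/measurable_EFinP.
    by apply: (measurableT_comp _ measurable_fst); exact: measurable_indic.
  - by move=> p; rewrite mule_ge0// lee_fin// rescale_ge0.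
have d0 : with_density g set0 = 0%E by rewrite /with_density integral_set0.
have d_ge0 E : (0 <= with_density g E)%E by exact: integral_ge0.
have dsa : semi_sigma_additive (with_density g) by exact: semi_sigma_additive_nng_induced.
have dT : with_density g setT = 1%E.
  rewrite dE//; under eq_integral do rewrite integral_rescale.
  by rewrite integral_cst// mul1e; exact: probability_setT.
have [|P Pg] := @exists_probability _ _ _ (with_density g); first by split.
exists P; rewrite Pg; split => // A B mA mB.
have PE : with_density g B = (\int[theta]_y \int[lebV]_(x in B) (rho (x - y))%:E)%E by exact: dE.
have mI : measurable_fun setT (fun y => \int[lebV]_(x in B) (rho (x - y))%:E)%E.
  have h : forall p : V * V, (0 <= (\1_B p.1)%:E * (rho (p.1 - p.2))%:E)%E.
    by move=> p; rewrite mule_ge0// lee_fin// rescale_ge0.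
  have mh : measurable_fun setT (fun p : V * V => (\1_B p.1)%:E * (rho (p.1 - p.2))%:E)%E.
    apply: emeasurable_funM => //; apply/measurable_EFinP.
    by apply: (measurableT_comp _ measurable_fst); exact: measurable_indic.
  have := measurable_fun_fubini_tonelli_G (m1 := lebV) _ mh h; congr measurable_fun.
  apply/funext => y; rewrite /fubini_G/= [RHS]integral_mkcond; apply: eq_integral => x _.
  by rewrite patchE indicE; case: ifPn => _; rewrite ?mul1e ?mul0e.
have I0 y : (0 <= \int[lebV]_(x in B) (rho (x - y))%:E)%E.
  by apply: integral_ge0 => x _; rewrite lee_fin rescale_ge0.
have I1 y : (\int[lebV]_(x in B) (rho (x - y))%:E <= 1)%E.
  rewrite -(integral_rescale y); apply: ge0_subset_integral => //.
    apply/measurable_EFinP.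
    exact: (measurableT_comp measurable_rescale_sub (measurable_pair2 y)).
  by move=> x _; rewrite lee_fin rescale_ge0.
have thA : theta A = (\int[theta]_y (\1_A y)%:E)%E by rewrite integral_indic// setIT.
have mA1 : measurable_fun setT (fun y => (\1_A y)%:E : \bar R).
  by apply/measurable_EFinP; exact: measurable_indic.
split=> AB; rewrite PE thA; apply: ge0_le_integral => //.
- move=> y _; rewrite indicE; case: (boolP (y \in A)) => [|_]; last exact: I0.
  rewrite inE => Ay; rewrite /= -(integral_rescale y) [leRHS]integral_mkcond.
  rewrite le_eqVlt; apply/orP; left; apply/eqP; apply: eq_integral => x _.
  rewrite patchE; case: ifPn => //; rewrite notin_setE => Bx.
  rewrite rescale_out//; apply: contra_not Bx => xy; exact: AB Ay.
- move=> y _; rewrite indicE; case: (boolP (y \in A)) => [_|]; first exact: I1.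
  rewrite notin_setE => Ay; rewrite le_eqVlt; apply/orP; left; apply/eqP.
  apply: integral0_eq => x Bx; rewrite rescale_out//.
  by apply: contra_not Ay => xy; exact: AB Bx.
Qed.

End mollifiers.

(** * Uniqueness of trajectories *)
Section uniqueness_step.
Context (R : realType) (n : nat) (T L C : R) (b : R -> 'rV[R]_n -> 'rV[R]_n)
  (mu : R -> probability 'rV[R]_n R).
Local Notation V := 'rV[R]_n.
Local Notation leb := (@lebesgue_measure R).
Local Notation lebV := (lebesgue_rV R n).
Hypothesis T0 : 0 < T.
Hypothesis L0 : 0 < L.
Hypothesis C0 : 0 < C.
Hypothesis ab : admissible L C b.
Hypothesis nmu : narrowly_continuous T mu.
Hypothesis cmu : continuity_equation T b mu.
Variable S : R -> R.
Hypothesis sS : smooth S.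
Hypothesis S0 : forall s, s <= 0 -> S s = 0.
Hypothesis S1 : forall s, 1 <= s -> S s = 1.
Hypothesis S01 : forall s, 0 <= S s <= 1.
Hypothesis dS0 : forall s : R, 0 <= 'D_1 S s.
Variables (f : V -> R) (M r0 : R).
Hypothesis M0 : 0 <= M.
Hypothesis r00 : 0 <= r0.
Hypothesis f01 : forall x, 0 <= f x <= 1.
Hypothesis f_lip : forall x x', `|f x - f x'| <= M * enorm (x - x').
Hypothesis f_out : forall x, r0 < enorm x -> f x = 0.
Variables (eta : V -> R) (eps : R).
Hypothesis meta : mollifier eta.
Hypothesis eps0 : 0 < eps.
Hypothesis eps1 : eps <= 1.

Let rho := rescale eta eps.
(** Under Euler steps 1 + |x| shrinks in total by no more than the factor exp(-2CT). A function
    carried by the ball of radius r0 and composed with Euler steps therefore vanishes outside the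
    ball of this radius. *)
Definition support_radius := (1 + r0) * expR (2 * C * T).
Local Notation R0 := support_radius.
Let B := @eball R n R0.
Let D := @eball R n eps.
Let M1 := M * expR (L * T).

Lemma lipschitz_continuous (g : V -> R) K :
  (forall x x', `|g x - g x'| <= K * enorm (x - x')) -> continuous g.
Proof.
move=> gK x; apply/(@cvgrPdist_le R R _ (nbhs x) (@nbhs_pfilter _ x)) => e e0.
have : enorm (z - x) @[z --> x] --> (0 : R).
  exact: (proj1 (@cvg_enormP R n _ (nbhs x) id x (nbhs_filter x)) (fun A hA => hA)).
move=> /cvgrPdist_le; have e1 : 0 < e / (`|K| + 1) by rewrite divr_gt0// ltr_wpDl.
move=> /(_ _ e1); apply: filterS => z; rewrite sub0r normrN ger0_norm ?enorm_ge0//.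
rewrite ler_pdivlMr ?ltr_wpDl// => h.
rewrite (le_trans (gK _ _))// enorm_distC (le_trans _ h)// mulrC ler_wpM2l ?enorm_ge0//.
by rewrite (le_trans (ler_norm _))// lerDl.
Qed.

Lemma lipschitz_measurable (g : V -> R) K :
  (forall x x', `|g x - g x'| <= K * enorm (x - x')) -> measurable_fun setT g.
Proof. by move=> gK; apply: continuous_measurable_rV; exact: (lipschitz_continuous gK). Qed.

Let mB : measurable B. Proof. exact: measurable_eball. Qed.
Let Boo : (lebV B < +oo)%E. Proof. exact: eball_fin. Qed.
Let mD : measurable D. Proof. exact: measurable_eball. Qed.
Let Doo : (lebV D < +oo)%E. Proof. exact: eball_fin. Qed.

Let crho : continuous rho. Proof. exact: rescale_continuous. Qed.
Let mrho : measurable_fun setT rho.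
Proof. exact: (continuous_measurable_rV crho). Qed.

(** The direction is -delta_i because the derivative is taken in x of rho(y - x). *)
Definition kappa i (z : V) : R := 'D_(- delta_mx 0 i) rho z.

Let skappa i : smooth (kappa i).
Proof. by apply: smooth_derive; exact: rescale_smooth. Qed.

Let kappa_out i z : ~ D z -> kappa i z = 0.
Proof.
move=> Dz; apply: (@vanishes_derive R V D rho (- delta_mx 0 i)) => //.
  exact: closed_eball.
by move=> x; exact: rescale_out.
Qed.

(** Integrated against mu(s), this is the time derivative at y of the mollified density. Restricting
    y to the ball [B] keeps it bounded although b may grow linearly: rho then confines x to a
    bounded set. *)
Definition flux (q : measurableTypeR R * V) x : R :=
  \1_B q.2 * \sum_i b q.1 x 0 i * kappa i (q.2 - x).

Lemma measurable_flux : measurable_fun setT (fun p => flux p.1 p.2).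
Proof.
apply: measurable_funM.
  apply: (measurableT_comp _ (measurableT_comp measurable_snd measurable_fst)).
  exact: measurable_indic.
apply: measurable_sum => i; apply: measurable_funM.
  have [mb _ _] := ab.
  apply: (measurableT_comp (mb i) (g := fun p : measurableTypeR R * V * V => (p.1.1, p.2))).
  by apply: measurable_fun_pair => //; exact: (measurableT_comp measurable_fst measurable_fst).
have mk : measurable_fun setT (kappa i).
  by apply: continuous_measurable_rV; exact: (@Ck_continuous _ _ _ 0 (skappa i 0)).
apply: (measurableT_comp mk (g := fun p : measurableTypeR R * V * V => p.1.2 - p.2)).
apply: (measurableT_comp (@measurable_sub_rV R n) (g := fun p : measurableTypeR R * V * V => (p.1.2, p.2))).
by apply: measurable_fun_pair => //; exact: (measurableT_comp measurable_snd measurable_fst).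
Qed.

Lemma continuous_flux q : continuous (flux q).
Proof.
apply: continuous_mul; first exact: cst_continuous.
apply: continuous_sum => i; apply: continuous_mul; first exact: (continuous_field ab).
have -> : (fun x => kappa i (q.2 - x)) = kappa i \o (fun x => q.2 - x) by [].
apply: (@Ck_continuous _ _ _ 0).
apply: (@Ck_affine R V V (fun v => - v) (fun x => q.2 - x)); last exact: (skappa i 0).
  by move=> c x v; rewrite opprD scalerN addrCA.
by move=> x; apply: differentiableB => //; exact: differentiable_cst.
Qed.

Lemma flux_bounded : exists2 MG, 0 <= MG & forall q x, `|flux q x| <= MG.
Proof.
have h i : exists K, 0 <= K /\ forall x, `|kappa i x| <= K.
  have [||K K0 hK] := @vanishes_bounded R V D (kappa i) (@compact_eball R n eps).
  - exact: (@Ck_continuous _ _ _ 0 (skappa i 0)).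
  - by move=> x; exact: kappa_out.
  by exists K.
have {h}[K hK] := choice h.
pose c := C * (1 + (R0 + 1)).
have c0 : 0 <= c.
  by rewrite mulr_ge0 ?(ltW C0)// addr_ge0// addr_ge0// mulr_ge0 ?expR_ge0// addr_ge0.
have K0 i : 0 <= K i by exact: (hK i).1.
exists (\sum_i c * K i) => [|[s y] x].
  by apply: sumr_ge0 => i _; rewrite mulr_ge0.
rewrite /flux/= indicE; case: (boolP (y \in B)) => [|_]; last first.
  by rewrite mul0r normr0; apply: sumr_ge0 => i _; rewrite mulr_ge0.
rewrite inE mul1r => By; rewrite (le_trans (ler_norm_sum _ _ _))//.
apply: ler_sum => i _; rewrite normrM.
have [Dz|/(kappa_out i)->] := pselect (D (y - x)); last by rewrite normr0 mulr0 mulr_ge0.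
apply: ler_pM => //; last exact: (hK i).2.
rewrite (le_trans (coord_le_enorm _ _))//; have [_ _ gb] := ab.
rewrite (le_trans (gb _ _))// /c ler_pM2l// lerD2l.
have := enorm_triangle x y 0; rewrite !subr0 enorm_distC => /le_trans; apply.
by rewrite addrC lerD// (le_trans _ eps1).
Qed.

Definition flux_integral (q : measurableTypeR R * V) : R := \int[mu q.1]_x flux q x.

(** Error made by freezing mu at the left end of the time cell. For fixed eps it tends to 0
    pointwise and boundedly, so dominated convergence disposes of it. *)
Definition flux_gap N (q : measurableTypeR R * V) : R :=
  `|flux_integral q - grid_integral T mu fst flux N q|.

Let mfst : measurable_fun setT (fun q : measurableTypeR R * V => q.1 : R).
Proof. exact: measurable_fst. Qed.

Let strip0 : set (measurableTypeR R * V) := `[0, T] `*` setT.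

Let mstrip0 : measurable strip0. Proof. exact: measurableX. Qed.

Lemma measurable_flux_integral : measurable_fun strip0 flux_integral.
Proof.
have [MG _ hMG] := flux_bounded.
have h (q : measurableTypeR R * V) : strip0 q -> 0 <= q.1 <= T.
  by case: q => s y [/= + _]; rewrite in_itv.
exact: (@measurable_narrow_integral R n T mu T0 nmu _ (measurableTypeR R * V)%type
  ((0 : R), (0 : V)) fst flux MG mfst measurable_flux hMG continuous_flux _ mstrip0 h).
Qed.

Lemma measurable_flux_gap N : measurable_fun strip0 (flux_gap N).
Proof.
have [MG _ hMG] := flux_bounded.
apply: measurableT_comp => //; apply: measurable_funB; first exact: measurable_flux_integral.
apply: measurable_funTS.
exact: (@measurable_grid R n T mu _ (measurableTypeR R * V)%type ((0 : R), (0 : V))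
  fst flux MG mfst measurable_flux hMG N).
Qed.

Lemma flux_gap_bounded : exists2 MG, 0 <= MG & forall N q, 0 <= flux_gap N q <= MG.
Proof.
have [MG MG0 hMG] := flux_bounded; exists (MG + MG); first exact: addr_ge0.
move=> N q; rewrite normr_ge0/= (le_trans (ler_normB _ _))// lerD//.
  by apply: prob_bound => //; apply: continuous_measurable_rV; exact: continuous_flux.
exact: (grid_integral_bound mu T0 fst hMG continuous_flux).
Qed.

Lemma flux_gap_cvg q : 0 <= q.1 <= T -> flux_gap N q @[N --> \oo] --> (0 : R).
Proof.
have [MG MG0 hMG] := flux_bounded => qT.
have h := @grid_integral_cvg R n T mu T0 nmu _ _ fst flux MG hMG continuous_flux q qT.
have h2 : flux_integral q - grid_integral T mu fst flux N q @[N --> \oo] --> (0 : R).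
  by rewrite -[X in _ --> X](subrr (flux_integral q)); apply: cvgB h; exact: cvg_cst.
have h3 := cvg_norm h2; rewrite normr0 in h3; exact: h3.
Qed.

Let section_meas (F : measurableTypeR R * V -> R) y : measurable_fun strip0 F ->
  measurable_fun `[0, T] (fun s => F (s, y)).
Proof.
move=> mF.
have sub : (fun s : measurableTypeR R => (s, y)) @` `[0, T] `<=` strip0.
  by move=> _ [s sT <-].
have mp : measurable_fun `[0, T] (fun s : measurableTypeR R => (s, y)).
  by apply: measurable_funTS; exact: measurable_pair2.
exact: (measurable_comp mstrip0 sub mF mp).
Qed.

Let sub_itv a c : 0 <= a -> c <= T -> `[a, c]%classic `<=` (`[0, T]%classic : set R).
Proof.
move=> a0 cT s /=; rewrite !in_itv/= => /andP[as_ sc].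
by rewrite (le_trans a0)//= (le_trans sc).
Qed.

Lemma bmeas_flux_gap N y a c : 0 <= a -> c <= T ->
  bmeas leb `[a, c] (fun s => flux_gap N (s, y)).
Proof.
move=> a0 cT; have [MG MG0 hMG] := flux_gap_bounded.
have h : bmeas leb `[0, T] (fun s => flux_gap N (s, y)).
  split => //; [exact: leb_itv_fin|exact: (section_meas _ (measurable_flux_gap N))|].
  by exists MG => s _; have /andP[? ?] := hMG N (s, y); rewrite ger0_norm.
by apply: bmeasS h => //; exact: sub_itv.
Qed.

Lemma bmeas_flux_integral y a c : 0 <= a -> c <= T ->
  bmeas leb `[a, c] (fun s => flux_integral (s, y)).
Proof.
move=> a0 cT; have [MG MG0 hMG] := flux_bounded.
have h : bmeas leb `[0, T] (fun s => flux_integral (s, y)).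
  split => //; [exact: leb_itv_fin|exact: (section_meas _ measurable_flux_integral)|].
  exists MG => s _; apply: prob_bound => //; apply: continuous_measurable_rV.
  exact: continuous_flux.
by apply: bmeasS h => //; exact: sub_itv.
Qed.

Lemma bmeas_flux_gap_space N a c : 0 <= a -> c <= T ->
  bmeas lebV B (fun y => \int[leb]_(s in `[a, c]) flux_gap N (s, y)).
Proof.
move=> a0 cT; have [MG MG0 hMG] := flux_gap_bounded.
apply: (@bmeas_Rint2 _ _ (measurableTypeR R) V R leb lebV `[a, c] B (fun s y => flux_gap N (s, y)) MG) => //.
- exact: leb_itv_fin.
- apply: measurable_funS (measurable_flux_gap N) => // -[s y] [/= sac _]; split => //.
  exact: (sub_itv a0 cT).
- by move=> s y _ _; have /andP[? ?] := hMG N (s, y); rewrite ger0_norm.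
Qed.

Lemma bmeas_mollified (P : probability V R) (E : V -> V) : measurable_fun setT E ->
  bmeas lebV B (fun y => \int[P]_x rho (y - E x)).
Proof.
move=> mE; have [Mr Mr0 hMr] := rescale_bounded meta eps0.
have Poo : (P setT < +oo)%E by rewrite ltey_eq fin_num_measure.
apply: (@bmeas_Rint1 _ _ V V R lebV P B setT (fun y x : V => rho (y - E x)) Mr) => //.
have m1 : measurable_fun setT (fun p : V * V => rho (p.1 - p.2)).
  exact: measurable_rescale_sub.
have m2 : measurable_fun setT (fun p : V * V => (p.1, E p.2)).
  by apply: measurable_fun_pair => //; exact: (measurableT_comp mE measurable_snd).
apply: measurable_funTS; exact: (measurableT_comp m1 m2).
Qed.

Lemma mollified_exchange (P : probability V R) (E : V -> V) (g : V -> R) :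
  measurable_fun setT E -> measurable_fun setT g -> (forall x, 0 <= g x <= 1) ->
  (forall x, ~ B x -> g x = 0) ->
  bmeas P setT (fun x : V => \int[lebV]_(z in D) (g (E x + z) * rho z)) /\
  \int[lebV]_(y in B) (g y * \int[P]_x rho (y - E x)) =
  \int[P]_x \int[lebV]_(z in D) (g (E x + z) * rho z).
Proof.
move=> mE mg g01 gB; have [Mr Mr0 hMr] := rescale_bounded meta eps0.
have ng x : `|g x| <= 1 by have /andP[? ?] := g01 x; rewrite ger0_norm.
have e x : \int[lebV]_(z in D) (g (E x + z) * rho z) =
    \int[lebV]_(y in B) (g y * rho (y - E x)).
  by rewrite -(@Rint_shift R n eta eps meta eps0 (E x) g B 1).
have mEr : measurable_fun setT (fun p : V * V => rho (p.1 - E p.2)).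
  have m1 : measurable_fun setT (fun p : V * V => rho (p.1 - p.2)).
    exact: measurable_rescale_sub.
  have m2 : measurable_fun setT (fun p : V * V => (p.1, E p.2)).
    by apply: measurable_fun_pair => //; exact: (measurableT_comp mE measurable_snd).
  exact: (measurableT_comp m1 m2).
have mgE : measurable_fun (B `*` setT) (fun p : V * V => g p.1 * rho (p.1 - E p.2)).
  by apply: measurable_funTS; apply: measurable_funM => //; exact: (measurableT_comp mg measurable_fst).
have brho y : bmeas P setT (fun x => rho (y - E x)).
  apply: (@bmeas_prob _ _ _ _ Mr) => [|x]; last exact: hMr.
  exact: (measurableT_comp mEr (measurable_pair1 y)).
have Poo : (P setT < +oo)%E by rewrite ltey_eq fin_num_measure.
have bnd y x : B y -> setT x -> `|g y * rho (y - E x)| <= 1 * Mr.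
  by move=> _ _; rewrite normrM ler_pM.
have -> : (fun x : V => \int[lebV]_(z in D) (g (E x + z) * rho z)) =
    (fun x : V => \int[lebV]_(y in B) (g y * rho (y - E x))).
  by apply/funext => x.
split.
  exact: (@bmeas_Rint2 _ _ V V R lebV P B setT (fun y x : V => g y * rho (y - E x)) (1 * Mr)).
rewrite -(@Rint_fubini _ _ V V R lebV P B setT (fun y x : V => g y * rho (y - E x)) (1 * Mr))//.
by apply: eq_Rintegral => y _; rewrite RintZ.
Qed.

Variable N : nat.
Let dt := T / N.+1%:R.
(** Ensures that a step from a point with |x| > R0 + 2 ends outside the ball of radius R0 + 1, and
    that C dt <= 1/2, as [exp_lower] requires. *)
Hypothesis hN : C * dt * (R0 + 3) <= 1 / 2.

Let dt0 : 0 < dt. Proof. by rewrite divr_gt0. Qed.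

Let R0_ge1 : 1 <= R0.
Proof.
have e : 1 <= expR (2 * C * T) by rewrite -expR0 ler_expR !mulr_ge0 ?(ltW C0) ?(ltW T0).
by rewrite -[leLHS]mulr1; apply: ler_pM => //; rewrite lerDl.
Qed.

Let Cdt : C * dt <= 1 / 2.
Proof.
apply: le_trans hN; rewrite ler_peMr// ?mulr_ge0// ?ltW//.
have := R0_ge1; lra.
Qed.

(** Discrete backward transport of f: the remaining Euler steps play the part of the solution of the
    adjoint equation. *)
Definition transported k x := f (euler b dt k (N.+1 - k) x).
Local Notation w := transported.

Lemma transportedS k x : (k < N.+1)%N -> w k x = w k.+1 (euler_step b dt k x).
Proof. by move=> kN; rewrite /w -(subnSK kN). Qed.

Lemma transported01 k x : 0 <= w k x <= 1. Proof. exact: f01. Qed.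

Let dtT k : (k <= N.+1)%N -> k%:R * dt <= T.
Proof.
move=> kN; rewrite /dt mulrCA ler_piMr ?(ltW T0)// ler_pdivrMr// mul1r ler_nat.
exact: kN.
Qed.

Lemma transported_lip k x x' : `|w k x - w k x'| <= M1 * enorm (x - x').
Proof.
rewrite (le_trans (f_lip _ _))// /M1 -mulrA ler_wpM2l//.
rewrite (le_trans (euler_lip L0 _ _ _ _ ab (ltW dt0)))// ler_wpM2r ?enorm_ge0//.
rewrite (le_trans (exp_upper _ (mulr_ge0 (ltW L0) (ltW dt0))))//.
rewrite ler_expR -mulrA ler_pM2l//.
by rewrite mulrC; exact: (dtT (leq_subr k N.+1)).
Qed.

Lemma transported_out k x : ~ B x -> w k x = 0.
Proof.
move=> /negP; rewrite -ltNge => xB; apply: f_out.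
have h := euler_growth_lower k (N.+1 - k) x ab (ltW dt0).
have h1 : C * dt <= 1 by have := Cdt; lra.
have h2 := @exp_lower R (C * dt) (N.+1 - k)%N.
have h3 : expR (- (2 * C * T)) <= (1 - C * dt) ^+ (N.+1 - k).
  rewrite (le_trans _ (h2 _))//; last by rewrite Cdt mulr_ge0// ltW.
  rewrite ler_expR lerN2; have := dtT (leq_subr k N.+1) => h3.
  rewrite [leLHS](_ : _ = 2 * C * ((N.+1 - k)%:R * dt)); last by ring.
  by rewrite ler_pM2l// mulr_gt0.
have {}h := h h1.
have h4 : 1 + r0 < expR (- (2 * C * T)) * (1 + enorm x).
  rewrite expRN mulrC ltr_pdivlMr ?expR_gt0// (lt_trans xB)// ltrDr//.
rewrite -(ltrD2l 1) (lt_le_trans h4)// (le_trans _ h)// ler_wpM2r//.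
by rewrite addr_ge0 ?enorm_ge0.
Qed.

Lemma measurable_transported k : measurable_fun setT (w k).
Proof. exact: lipschitz_measurable (@transported_lip k). Qed.

Let bw k : bmeas lebV B (w k).
Proof.
split => //; first by apply: measurable_funTS; exact: measurable_transported.
by exists 1 => x _; have /andP[h1 h2] := transported01 k x; rewrite ger0_norm.
Qed.

Definition mollified k y := \int[mu (k%:R * dt)]_x rho (y - x).
Local Notation u := mollified.

(** Discrete duality. Up to mollification it is the integral of f o [euler_map] against mu(0) for k
    = 0 and that of f against mu(T) for k = N + 1; the point is that it hardly changes with k. *)
Definition pairing k := \int[lebV]_(y in B) (w k y * u k y).
Local Notation h := pairing.

Lemma mollified_average (P : probability V R) (g : V -> R) K :
  (forall x x', `|g x - g x'| <= K * enorm (x - x')) -> (forall x, 0 <= g x <= 1) ->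
  (forall x, ~ B x -> g x = 0) -> 0 <= K ->
  `|\int[lebV]_(y in B) (g y * \int[P]_x rho (y - x)) - \int[P]_x g x| <= K * eps.
Proof.
move=> gK g01 gB K0; have [Mr Mr0 hMr] := rescale_bounded meta eps0.
have mg : measurable_fun setT g by exact: lipschitz_measurable gK.
have ng x : `|g x| <= 1 by have /andP[? ?] := g01 x; rewrite ger0_norm.
have brho y : bmeas P setT (fun x => rho (y - x)).
  apply: (@bmeas_prob _ _ _ _ Mr) => [|x]; last exact: hMr.
  have := measurableT_comp mrho (measurable_affine (-1) y).
  by congr measurable_fun; apply/funext => x /=; rewrite scaleN1r addrC.
have -> : \int[lebV]_(y in B) (g y * \int[P]_x rho (y - x)) =
    \int[P]_x \int[lebV]_(y in B) (g y * rho (y - x)).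
  rewrite -(@Rint_fubini _ _ V V R lebV P B setT (fun y x => g y * rho (y - x)) Mr)//.
  - by apply: eq_Rintegral => y _; rewrite RintZ.
  - by rewrite ltey_eq fin_num_measure.
  - apply: measurable_funTS; apply: measurable_funM.
      exact: (measurableT_comp mg measurable_fst).
    exact: measurable_rescale_sub.
  - by move=> y x _ _; rewrite normrM -[leRHS]mul1r ler_pM.
have bD x : bmeas lebV D (fun z => g (x + z) * rho z).
  split => //; last by exists (1 * Mr) => y _; rewrite normrM ler_pM.
  apply: measurable_funTS; apply: measurable_funM => //.
  have := measurableT_comp mg (@measurable_affine R n 1 x).
  by congr measurable_fun; apply/funext => y /=; rewrite scale1r addrC.
have bDr : bmeas lebV D rho.
  split => //; last by exists Mr => y _.
  exact: measurable_funTS.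
have E x : \int[lebV]_(y in B) (g y * rho (y - x)) = \int[lebV]_(z in D) (g (x + z) * rho z).
  exact: (@Rint_shift R n eta eps meta eps0 x g B 1).
have key x : `|\int[lebV]_(y in B) (g y * rho (y - x)) - g x| <= K * eps.
  have b1 := bD x; have b2 := bmeasZ (g x) bDr; have b3 := bmeasB b1 b2.
  have I1 := Rint_rescale meta eps0.
  have -> : g x = \int[lebV]_(z in D) (g x * rho z) by rewrite RintZ// I1 mulr1.
  rewrite E -RintB// (le_trans (le_normr_Rint b3))//.
  have -> : K * eps = \int[lebV]_(z in D) (K * eps * rho z) by rewrite RintZ// I1 mulr1.
  apply: le_Rint; [exact: bmeas_norm|exact: bmeasZ|].
  move=> z zD; rewrite -mulrBl normrM (ger0_norm (rescale_ge0 meta eps0 _)).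
  rewrite ler_wpM2r ?rescale_ge0// (le_trans (gK _ _))//.
  by rewrite addrAC subrr add0r ler_wpM2l.
have bI : bmeas P setT (fun x : V => \int[lebV]_(y in B) (g y * rho (y - x))).
  apply: (@bmeas_Rint2 _ _ V V R lebV P B setT (fun y x : V => g y * rho (y - x)) (1 * Mr)) => //.
  - by rewrite ltey_eq fin_num_measure.
  - apply: measurable_funTS; apply: measurable_funM.
      exact: (measurableT_comp mg measurable_fst).
    exact: measurable_rescale_sub.
  - by move=> y x _ _; rewrite normrM ler_pM.
have bgP : bmeas P setT g by exact: (bmeas_prob P mg ng).
rewrite -RintB//; apply: prob_bound key.
by have [_ _ + _] := bmeasB bI bgP.
Qed.

Lemma measurable_euler_step k : measurable_fun setT (euler_step b dt k).
Proof.
apply: measurable_fun_rV => i.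
apply: (@lipschitz_measurable _ (1 + L * dt)) => x x'.
have := coord_le_enorm (euler_step b dt k x - euler_step b dt k x') i.
rewrite !mxE => /le_trans; apply.
exact: (euler_lip L0 k 1 x x' ab (ltW dt0)).
Qed.

(** Mollified density of the image of mu(t_k) under one Euler step, to be compared with the true
    mollified density at t_(k+1). *)
Definition pushed k y := \int[mu (k%:R * dt)]_x rho (y - euler_step b dt k x).

(** The commutator of mollification and Euler step E: w_(k+1) is evaluated at E(x + z) on one side
    and at E(x) + z on the other. By [euler_step_lip] these points differ by at most L dt |z|. The
    factor dt is essential, since N + 1 such errors are added. *)
Lemma pairing_pushed k : (k < N.+1)%N ->
  `|h k - \int[lebV]_(y in B) (w k.+1 y * pushed k y)| <= M1 * (L * dt * eps).
Proof.
move=> kN; set P := mu (k%:R * dt).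
have [Mr Mr0 hMr] := rescale_bounded meta eps0.
have M1_ge0 : 0 <= M1 by rewrite mulr_ge0// expR_ge0.
have [b1 e1] := @mollified_exchange P id (w k) (@measurable_id _ _ _)
  (measurable_transported k) (transported01 k) (@transported_out k).
have [b2 e2] := @mollified_exchange P (euler_step b dt k) (w k.+1)
  (measurable_euler_step k) (measurable_transported k.+1) (transported01 k.+1)
  (@transported_out k.+1).
rewrite /pairing /mollified -/P e1 /pushed -/P e2 -RintB//.
have [_ _ md _] := bmeasB b1 b2; apply: prob_bound md _ => x.
have bD j v : bmeas lebV D (fun z => w j (v + z) * rho z).
  split => //; last first.
    exists (1 * Mr) => z _; rewrite normrM ler_pM//.
    by have /andP[? ?] := transported01 j (v + z); rewrite ger0_norm.
  apply: measurable_funTS; apply: measurable_funM => //.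
  have := measurableT_comp (measurable_transported j) (@measurable_affine R n 1 v).
  by congr measurable_fun; apply/funext => y /=; rewrite scale1r addrC.
have bDr : bmeas lebV D rho.
  by split => //; [exact: measurable_funTS|exists Mr => y _].
rewrite -RintB//.
have b3 := bmeasB (bD k x) (bD k.+1 (euler_step b dt k x)).
rewrite (le_trans (le_normr_Rint b3))//.
have I1 := Rint_rescale meta eps0.
have -> : M1 * (L * dt * eps) = \int[lebV]_(z in D) (M1 * (L * dt * eps) * rho z).
  by rewrite RintZ// I1 mulr1.
apply: le_Rint; [exact: bmeas_norm|exact: bmeasZ|].
move=> z zD; rewrite -mulrBl normrM (ger0_norm (rescale_ge0 meta eps0 _)).
rewrite ler_wpM2r ?rescale_ge0// transportedS// (le_trans (transported_lip _ _ _))//.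
rewrite ler_wpM2l//.
have := euler_step_lip k (x + z) x ab (ltW dt0).
rewrite [x + z - x]addrAC subrr add0r => hl.
rewrite opprD addrA (le_trans hl)// ler_wpM2l// mulr_ge0 ?(ltW L0)//.
exact: ltW.
Qed.

Definition taylor_property KT := forall z v,
  `|rho (z + v) - rho z - \sum_i (- v 0 i) * kappa i z| <= KT * `|v| ^+ 2.

Lemma exists_taylor : exists2 KT, 0 <= KT & taylor_property KT.
Proof.
have hb (v : V) : v = \sum_i (- v 0 i) *: (- delta_mx 0 i).
  rewrite [LHS]row_sum_delta; apply: eq_bigr => i _.
  by rewrite scalerN scaleNr opprK.
have hc i (v : V) : `|- v 0 i| <= `|v| by rewrite normrN coord_le_norm.
have [KT KT0 h] := @smooth_taylor R V _ (fun i => - delta_mx 0 i) (fun i v => - v 0 i)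
  hb hc D rho (@compact_eball R n eps) (@closed_eball R n eps) (rescale_smooth eps meta)
  (fun x hx => rescale_out meta eps0 hx).
by exists KT => // z v; exact: h.
Qed.

(** Second-order Taylor expansion of rho about y - x: the linear term is the time integral of the
    flux with mu frozen at t_k. The quadratic term uses |beta| <= C dt (R0 + 3) for |x| <= R0 +
    2. *)
Lemma pushed_expansion KT k y : 0 <= KT -> taylor_property KT -> (k < N.+1)%N -> B y ->
  `|pushed k y - u k y - \int[leb]_(s in `[k%:R * dt, k.+1%:R * dt])
      frozen_integral T mu flux k N (s, y)| <= KT * (C * (R0 + 3)) ^+ 2 * dt ^+ 2.
Proof.
move=> KT0 hKT kN By; set P := mu (k%:R * dt).
have [MG MG0 hMG] := flux_bounded.
have Poo : (P setT < +oo)%E by rewrite ltey_eq fin_num_measure.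
have [Mr Mr0 hMr] := rescale_bounded meta eps0.
have iB : \1_B y = 1 :> R by rewrite indicE mem_set.
pose I : set (measurableTypeR R) := `[k%:R * dt, k.+1%:R * dt]%classic.
have Ioo : (leb I < +oo)%E by exact: leb_itv_fin.
have mflux : measurable_fun (I `*` setT) (fun p : measurableTypeR R * V => flux (p.1, y) p.2).
  apply: measurable_funTS.
  apply: (measurableT_comp measurable_flux (g := fun p : measurableTypeR R * V => ((p.1, y), p.2))).
  by apply: measurable_fun_pair => //; apply: measurable_fun_pair.
have fub := @Rint_fubini _ _ (measurableTypeR R) V R leb P I setT
  (fun s x => flux (s, y) x) MG (measurable_itv _) measurableT Ioo Poo mflux (fun s x _ _ => hMG (s, y) x).
have b4 := @bmeas_Rint2 _ _ (measurableTypeR R) V R leb P I setT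
  (fun s x => flux (s, y) x) MG (measurable_itv _) measurableT Ioo Poo mflux (fun s x _ _ => hMG (s, y) x).
have bE (E : V -> V) : measurable_fun setT E -> bmeas P setT (fun x => rho (y - E x)).
  move=> mE; apply: (@bmeas_prob _ _ _ _ Mr) => [|x]; last exact: hMr.
  have m2 := measurable_affine (-1) y.
  have := measurableT_comp mrho (measurableT_comp m2 mE).
  by congr measurable_fun; apply/funext => x /=; rewrite scaleN1r addrC.
have b1 := bE _ (measurable_euler_step k); have b2 := bE id (@measurable_id _ _ _).
have -> : \int[leb]_(s in I) frozen_integral T mu flux k N (s, y) =
    \int[P]_x \int[leb]_(s in I) flux (s, y) x by exact: fub.
rewrite /pushed /mollified -/P -RintB// -RintB//; last exact: bmeasB.
have [_ _ md _] := bmeasB (bmeasB b1 b2) b4; apply: prob_bound md _ => x.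
have [_ _ gb] := ab.
have -> : \int[leb]_(s in I) flux (s, y) x = \sum_i rowint leb I (b ^~ x) 0 i * kappa i (y - x).
  rewrite /flux/= iB; under eq_Rintegral do rewrite mul1r.
  have bb i : bmeas leb I (fun s => b s x 0 i) by exact: bmeas_frozen ab.
  have mI : measurable I by exact: measurable_itv.
  rewrite Rintegral_sum//; last first.
    move=> i; have := bmeasZ (kappa i (y - x)) (bb i).
    by congr bmeas; apply/funext => s; rewrite mulrC.
  apply: eq_bigr => i _; rewrite mxE mulrC -RintZ//.
  by apply: eq_Rintegral => s _; rewrite mulrC.
set beta := rowint leb I (b ^~ x).
have step : euler_step b dt k x = x + beta by [].
have hbeta : enorm beta <= C * dt * (1 + enorm x).
  have := euler_step_growth k x ab (ltW dt0); rewrite step.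
  by rewrite addrAC subrr add0r.
rewrite step opprD addrA.
have cR : 0 <= KT * (C * (R0 + 3)) ^+ 2 * dt ^+ 2.
  by rewrite mulr_ge0 ?sqr_ge0// mulr_ge0 ?sqr_ge0.
(* The margin 2 makes room for the mollifier: beyond R0 + 2 neither x nor its Euler image lies
   within eps <= 1 of y, so every term vanishes. *)
have [xR|xR] := leP (enorm x) (R0 + 2).
  have := hKT (y - x) (- beta); under eq_bigr do rewrite mxE opprK.
  move=> /le_trans; apply; rewrite -mulrA ler_wpM2l// -exprMn normrN lerXn2r ?nnegrE//.
    rewrite mulr_ge0 ?(ltW dt0)// mulr_ge0 ?(ltW C0)//; have := R0_ge1; lra.
  rewrite (le_trans (norm_le_enorm _))// (le_trans hbeta)// mulrAC ler_wpM2r ?(ltW dt0)//.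
  by rewrite ler_pM2l//; lra.
have yR : enorm y <= R0 by exact: By.
have Dyx : ~ D (y - x).
  move=> h; have := enorm_triangle x y 0; rewrite !subr0 enorm_distC.
  have h' : enorm (y - x) <= eps := h.
  by have := eps1; lra.
have Dyxb : ~ D (y - x - beta).
  move=> h; have h' : enorm (y - x - beta) <= eps := h.
  have h1 := enorm_triangle x (y - beta) 0; rewrite !subr0 in h1.
  have h2 : enorm (x - (y - beta)) = enorm (y - x - beta).
    by rewrite enorm_distC addrAC.
  have h3 := enormB y beta.
  have h4 : C * dt * (1 + enorm x) < enorm x - R0 - 1.
    have c1 := hN; have c2 := R0_ge1.
    have c3 : 0 <= C * dt by rewrite mulr_ge0 ?(ltW C0)// ltW.
    have c4 := Cdt.
    have c5 : C * dt * (enorm x - (R0 + 2)) <= 1 / 2 * (enorm x - (R0 + 2)).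
      by rewrite ler_wpM2r// subr_ge0 ltW.
    have -> : C * dt * (1 + enorm x) = C * dt * (R0 + 3) + C * dt * (enorm x - (R0 + 2)).
      by ring.
    lra.
  have := eps1; lra.
have -> : rho (y - x - beta) = 0 by exact: rescale_out.
have -> : rho (y - x) = 0 by exact: rescale_out.
rewrite big1 ?subrr ?normr0// => i _; rewrite kappa_out ?mulr0//.
Qed.

Lemma mollified_increment k y : (k < N.+1)%N -> B y ->
  u k.+1 y - u k y =
  \int[leb]_(s in `[k%:R * dt, k.+1%:R * dt]) flux_integral (s, y).
Proof.
move=> kN By.
have iB : \1_B y = 1 :> R by rewrite indicE mem_set.
have dpsi x : differentiable (fun x : V => y - x) x.
  by apply: differentiableB => //; exact: differentiable_cst.
have Al (c : R) (x v : V) : y - (c *: v + x) = c *: - v + (y - x).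
  by rewrite opprD scalerN addrCA.
have spsi : smooth (rho \o (fun x : V => y - x)).
  by apply: (@smooth_affine R V V (fun v => - v) (fun x => y - x)) => //; exact: rescale_smooth.
pose K := [set x : V | D (y - x)].
have psiK : vanishes_off K (rho \o (fun x : V => y - x)).
  by move=> x /= Kx; apply: (rescale_out meta eps0).
have clK : closed K.
  have -> : K = (fun x : V => y - x) @^-1` D by [].
  apply: closed_comp; last exact: closed_eball.
  by move=> x _; apply: differentiable_continuous.
have cK : compact K.
  apply: (@closed_enorm_compact R n K (enorm y + eps)) => // x Kx.
  have := enorm_triangle x y 0; rewrite !subr0 enorm_distC => /le_trans; apply.
  by rewrite addrC lerD2l; exact: Kx.
have h := narrow_increment T0 C0 ab nmu cmu spsi psiK cK clK sS S0 S1 S01 dS0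
  (mulr_ge0 (ler0n R k) (ltW dt0)) (le_step k (ltW dt0)) (dtT kN).
rewrite /mollified h; apply: eq_Rintegral => s _; rewrite /flux_integral.
apply: eq_Rintegral => x _; rewrite /flux/= iB mul1r /transport.
apply: eq_bigr => i _; congr (_ * _); rewrite /kappa.
exact: (@derive_affine R V V (fun v => - v) (fun x => y - x)).
Qed.

Lemma mollified_pushed_gap KT k y : 0 <= KT -> taylor_property KT -> (k < N.+1)%N -> B y ->
  `|u k.+1 y - pushed k y| <=
  \int[leb]_(s in `[k%:R * dt, k.+1%:R * dt]) flux_gap N (s, y) +
  KT * (C * (R0 + 3)) ^+ 2 * dt ^+ 2.
Proof.
move=> KT0 hKT kN By.
have h1 := mollified_increment kN By.
have h2 := pushed_expansion KT0 hKT kN By.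
set I := \int[leb]_(s in _) frozen_integral _ _ _ _ _ _ in h2.
set G := \int[leb]_(s in _) flux_integral _ in h1.
have t0 : 0 <= k%:R * dt by rewrite mulr_ge0// ltW.
have t1 : k.+1%:R * dt <= T by exact: dtT.
have bF : bmeas leb `[k%:R * dt, k.+1%:R * dt] (fun s => frozen_integral T mu flux k N (s, y)).
  have [MG MG0 hMG] := flux_bounded.
  split => //; [exact: leb_itv_fin| |].
    apply: measurable_funTS.
    have mf := @measurable_frozen R n T mu _ (measurableTypeR R * V)%type ((0 : R), (0 : V))
      flux MG measurable_flux hMG k N.
    exact: (measurableT_comp mf (measurable_pair2 y)).
  exists MG => s _; apply: prob_bound => //; apply: continuous_measurable_rV.
  exact: continuous_flux.
have bG := bmeas_flux_integral y t0 t1.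
have bGap := bmeas_flux_gap N y t0 t1.
have GI : `|G - I| <= \int[leb]_(s in `[k%:R * dt, k.+1%:R * dt]) flux_gap N (s, y).
  rewrite /G /I -RintB// -Rintegral_itv_bndo_bndc; last first.
    apply: bmeas_integrable; apply: bmeasS (bmeasB bG bF) => //.
    exact: subset_itv_co_cc.
  rewrite -[leRHS]Rintegral_itv_bndo_bndc; last first.
    by apply: bmeas_integrable; apply: bmeasS bGap => //; exact: subset_itv_co_cc.
  have b1 : bmeas leb `[k%:R * dt, k.+1%:R * dt[ (fun s => flux_integral (s, y) - frozen_integral T mu flux k N (s, y)).
    by apply: bmeasS (bmeasB bG bF) => //; exact: subset_itv_co_cc.
  have b2 : bmeas leb `[k%:R * dt, k.+1%:R * dt[ (fun s => flux_gap N (s, y)).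
    by apply: bmeasS bGap => //; exact: subset_itv_co_cc.
  rewrite (le_trans (le_normr_Rint b1))//; apply: le_Rint => //; first exact: bmeas_norm.
  move=> s /=; rewrite in_itv/= => sI.
  have e : grid_integral T mu fst flux N (s, y) = frozen_integral T mu flux k N (s, y).
    by apply: (grid_integralE mu T0 flux) sI; exact: ltnW.
  by rewrite /flux_gap e.
have -> : u k.+1 y - pushed k y = (G - I) - (pushed k y - u k y - I).
  by rewrite -h1; ring.
by rewrite (le_trans (ler_normB _ _))// lerD.
Qed.

Lemma pairing_step KT k : 0 <= KT -> taylor_property KT -> (k < N.+1)%N ->
  `|h k.+1 - h k| <=
  \int[lebV]_(y in B) \int[leb]_(s in `[k%:R * dt, k.+1%:R * dt]) flux_gap N (s, y)
  + fine (lebV B) * (KT * (C * (R0 + 3)) ^+ 2 * dt ^+ 2) + M1 * (L * dt * eps).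
Proof.
move=> KT0 hKT kN.
have h1 := pairing_pushed kN.
set H := \int[lebV]_(y in B) (w k.+1 y * pushed k y) in h1.
have t0 : 0 <= k%:R * dt by rewrite mulr_ge0// ltW.
have t1 : k.+1%:R * dt <= T by exact: dtT.
have bu : bmeas lebV B (u k.+1) by exact: (bmeas_mollified _ (@measurable_id _ _ _)).
have bp : bmeas lebV B (pushed k) by exact: (bmeas_mollified _ (measurable_euler_step k)).
have bgap := bmeas_flux_gap_space N t0 t1.
have b1 := bmeasM (bw k.+1) bu; have b2 := bmeasM (bw k.+1) bp.
have h2 : `|h k.+1 - H| <= \int[lebV]_(y in B)
    (\int[leb]_(s in `[k%:R * dt, k.+1%:R * dt]) flux_gap N (s, y) +
     KT * (C * (R0 + 3)) ^+ 2 * dt ^+ 2).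
  rewrite /pairing /H -RintB//.
  rewrite (le_trans (le_normr_Rint (bmeasB b1 b2)))//.
  apply: le_Rint; first exact: (bmeas_norm (bmeasB b1 b2)).
    by apply: bmeasD => //; exact: bmeas_cst.
  move=> y By; rewrite -mulrBr normrM -[leRHS]mul1r; apply: ler_pM => //.
    by have /andP[? ?] := transported01 k.+1 y; rewrite ger0_norm.
  exact: mollified_pushed_gap.
rewrite RintD// in h2; last exact: bmeas_cst.
rewrite Rintegral_cst// [_ * fine _]mulrC in h2.
have -> : h k.+1 - h k = (h k.+1 - H) - (h k - H) by rewrite opprB addrA subrK.
by rewrite (le_trans (ler_normB _ _))// lerD.
Qed.

Lemma pairing_sum KT k : 0 <= KT -> taylor_property KT -> (k <= N.+1)%N ->
  `|h k - h 0| <=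
  \int[lebV]_(y in B) \int[leb]_(s in `[0, k%:R * dt]) flux_gap N (s, y)
  + k%:R * (fine (lebV B) * (KT * (C * (R0 + 3)) ^+ 2 * dt ^+ 2) + M1 * (L * dt * eps)).
Proof.
move=> KT0 hKT; elim: k => [|k IH] kN.
  rewrite subrr normr0 [X in _ + X]mul0r addr0; apply: Rintegral_ge0 => y _.
  apply: Rintegral_ge0 => s _; have [MG _ hMG] := flux_gap_bounded.
  by have /andP[] := hMG N (s, y).
have {}IH := IH (ltnW kN); have h1 := pairing_step KT0 hKT kN.
have t0 : 0 <= k%:R * dt by rewrite mulr_ge0// ltW.
have t1 : k.+1%:R * dt <= T by exact: dtT.
have t2 := le_step k (ltW dt0).
have e : \int[lebV]_(y in B) \int[leb]_(s in `[0, k.+1%:R * dt]) flux_gap N (s, y) =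
    \int[lebV]_(y in B) \int[leb]_(s in `[0, k%:R * dt]) flux_gap N (s, y) +
    \int[lebV]_(y in B) \int[leb]_(s in `[k%:R * dt, k.+1%:R * dt]) flux_gap N (s, y).
  rewrite -RintD//.
  - apply: eq_Rintegral => y _; rewrite (@Rint_itvD _ 0 (k%:R * dt))//.
    exact: bmeas_flux_gap.
  - by apply: bmeas_flux_gap_space => //; exact: (le_trans t2).
  - exact: bmeas_flux_gap_space.
have -> : h k.+1 - h 0 = (h k.+1 - h k) + (h k - h 0) by rewrite addrA subrK.
rewrite (le_trans (ler_normD _ _))// (le_trans (lerD h1 IH))// e -natr1 mulrDl mul1r.
move: (fine _ * _) (M1 * _) => Q1 Q2; rewrite mulrDl mul1r -[X in X + _ <= _]addrA addrACA.
by apply: lerD; rewrite addrC.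
Qed.

(** The first two terms vanish as N grows with eps fixed; KT depends on eps. The last one is O(eps):
    it collects N + 1 commutators of size M1 L dt eps and the mollification error M1 eps at each of
    the two end times. *)
Lemma uniqueness_estimate KT : 0 <= KT -> taylor_property KT ->
  `|\int[mu T]_x f x - \int[mu 0]_x f (euler_map b T N x)| <=
  \int[lebV]_(y in B) \int[leb]_(s in `[0, T]) flux_gap N (s, y)
  + fine (lebV B) * (KT * (C * (R0 + 3)) ^+ 2) * T * dt + (M1 * L * T + M1 + M1) * eps.
Proof.
move=> KT0 hKT.
have M1_ge0 : 0 <= M1 by rewrite mulr_ge0// expR_ge0.
have h1 := pairing_sum KT0 hKT (leqnn _).
have NT : N.+1%:R * dt = T by exact: dtE.
rewrite NT in h1.
have a0 := @mollified_average (mu (0%:R * dt)) (w 0) M1 (@transported_lip 0)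
  (transported01 0) (@transported_out 0) M1_ge0.
have a1 := @mollified_average (mu (N.+1%:R * dt)) (w N.+1) M1 (@transported_lip N.+1)
  (transported01 N.+1) (@transported_out N.+1) M1_ge0.
have w1 : w N.+1 = f by apply/funext => x; rewrite /transported subnn.
rewrite -/(h 0) mul0r in a0; rewrite -/(h N.+1) NT w1 in a1.
have -> : \int[mu 0]_x f (euler_map b T N x) = \int[mu 0]_x w 0 x.
  by apply: eq_Rintegral => x _; rewrite /transported subn0.
set I0 := \int[mu 0]_x w 0 x in a0 *; set I1 := \int[mu T]_x f x in a1 *.
have alg (x1 x2 x3 x4 : R) : x1 - x2 = (x3 - x4) - (x3 - x1) + (x4 - x2) by ring.
rewrite [I1 - I0](alg _ _ (h N.+1) (h 0)) {alg}.
rewrite (le_trans (ler_normD _ _))// (le_trans (lerD (ler_normB _ _) (lexx _)))//.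
rewrite (le_trans (lerD (lerD h1 a1) a0))// le_eqVlt; apply/orP; left; apply/eqP.
rewrite -NT; ring.
Qed.

End uniqueness_step.

Lemma Rint_dominated_cvg d (T : measurableType d) (R : realType)
  (mu : {measure set T -> \bar R}) D (f_ : nat -> T -> R) f M :
  (forall n, bmeas mu D (f_ n)) -> (forall n x, D x -> `|f_ n x| <= M) ->
  (forall x, D x -> f_ ^~ x @ \oo --> f x) ->
  \int[mu]_(x in D) f_ n x @[n --> \oo] --> \int[mu]_(x in D) f x.
Proof. by move=> h1 h2 h3; have [] := bmeas_dominated_cvg h1 h2 h3. Qed.

(** * Distance to a set and Lipschitz approximations of its indicator *)

Section setdist.
Context (R : realType) (n : nat) (A : set 'rV[R]_n).
Hypothesis A0 : A !=set0.
Local Notation V := 'rV[R]_n.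

Definition setdist (x : V) : R := inf [set enorm (x - a) | a in A].

Let has_lb x : has_lbound [set enorm (x - a) | a in A].
Proof. by exists 0 => _ [a _ <-]; exact: enorm_ge0. Qed.

Let nonempty x : [set enorm (x - a) | a in A] !=set0.
Proof. by have [a Aa] := A0; exists (enorm (x - a)), a. Qed.

Lemma setdist_le x a : A a -> setdist x <= enorm (x - a).
Proof. by move=> Aa; apply: ge_inf => //; exists a. Qed.

Lemma setdist_ge x c : (forall a, A a -> c <= enorm (x - a)) -> c <= setdist x.
Proof. by move=> h; apply: lb_le_inf => // _ [a Aa <-]; exact: h. Qed.

Lemma setdist_ge0 x : 0 <= setdist x.
Proof. by apply: setdist_ge => a _; exact: enorm_ge0. Qed.

Lemma setdist_adherent x e : 0 < e -> exists2 a, A a & enorm (x - a) < setdist x + e.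
Proof.
by move=> e0; have [_ [a Aa <-] h] := inf_adherent e0 (conj (nonempty x) (has_lb x)); exists a.
Qed.

Lemma setdist_lip x x' : `|setdist x - setdist x'| <= enorm (x - x').
Proof.
have h z z' : setdist z - setdist z' <= enorm (z - z').
  rewrite lerBlDl -lerBlDr; apply: setdist_ge => a Aa; rewrite lerBlDr addrC.
  by rewrite (le_trans (setdist_le _ Aa))// enorm_triangle.
by rewrite ler_norml h andbT lerNl opprB enorm_distC.
Qed.

Lemma setdist_eq0 x : closed A -> setdist x = 0 <-> A x.
Proof.
move=> cA; split=> [d0|Ax]; last first.
  by apply/eqP; rewrite eq_le setdist_ge0 andbT (le_trans (setdist_le x Ax))// subrr enorm0.
rewrite (closure_id A).1// => B /nbhs_ballP[e /= e0 eB].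
have [a Aa h] := setdist_adherent x e0; exists a; split=> //; apply: eB.
by rewrite -ball_normE/= (le_lt_trans (norm_le_enorm _))// -[e]add0r -d0.
Qed.

Lemma setdist_gt0 x : closed A -> ~ A x -> 0 < setdist x.
Proof.
by move=> cA Ax; rewrite lt_neqAle setdist_ge0 andbT eq_sym; apply/eqP => /(setdist_eq0 x cA).
Qed.

(** Lipschitz functions decreasing to the indicator of a closed [A]; they stand in for the indicator
    wherever continuity is called for. *)
Definition tent (k : nat) x : R := Num.max 0 (1 - k.+1%:R * setdist x).

Lemma tent01 k x : 0 <= tent k x <= 1.
Proof. by rewrite /tent le_max lexx/= ge_max ler01/= gerBl mulr_ge0// setdist_ge0. Qed.

Lemma tent_lip k x x' : `|tent k x - tent k x'| <= k.+1%:R * enorm (x - x').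
Proof.
have h z z' : tent k z - tent k z' <= k.+1%:R * enorm (z - z').
  have : k.+1%:R * setdist z' - k.+1%:R * setdist z <= k.+1%:R * enorm (z - z').
    rewrite -mulrBr ler_pM2l// (le_trans (ler_norm _))// (le_trans (setdist_lip _ _))//.
    by rewrite enorm_distC.
  have := enorm_ge0 (z - z'); have : 0 <= k.+1%:R * enorm (z - z').
    by rewrite mulr_ge0 ?enorm_ge0.
  rewrite /tent; case: (leP 0 (1 - k.+1%:R * setdist z)); case: (leP 0 (1 - k.+1%:R * setdist z')); lra.
by rewrite ler_norml h andbT lerNl opprB enorm_distC.
Qed.

Lemma tent_cvg x : closed A -> tent k x @[k --> \oo] --> (\1_A x : R).
Proof.
move=> cA; rewrite indicE; case: (boolP (x \in A)) => [|/negP]; rewrite inE => Ax.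
  have d0 : setdist x = 0 by apply/setdist_eq0.
  have -> : tent ^~ x = cst 1.
    by apply/funext => k; rewrite /tent d0 mulr0 subr0; apply/max_idPr.
  exact: cvg_cst.
have d0 := setdist_gt0 cA Ax; apply: cvg_near_cst.
exists (Num.trunc ((setdist x)^-1)) => // k /= hk; apply/max_idPl.
rewrite subr_le0 -ler_pdivrMr// div1r ltW// (lt_le_trans (truncnS_gt _))//.
by rewrite ler_nat ltnS.
Qed.

Lemma tent_out k x r : (forall a, A a -> enorm a <= r) -> r + 1 < enorm x -> tent k x = 0.
Proof.
move=> Ar rx; apply/max_idPl; rewrite subr_le0.
have d1 : 1 <= setdist x.
  apply: setdist_ge => a /Ar ha; rewrite -lerN2 -(lerD2l (enorm x)).
  have := enorm_dist x a => /(le_trans (ler_norm _)); lra.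
by rewrite -[leLHS]mulr1; apply: ler_pM => //; rewrite ler1n.
Qed.

End setdist.

Section uniqueness.
Context (R : realType) (n : nat) (T L C : R) (b y : R -> 'rV[R]_n -> 'rV[R]_n)
  (mu : R -> probability 'rV[R]_n R) (eta : 'rV[R]_n -> R).
Local Notation V := 'rV[R]_n.
Local Notation leb := (@lebesgue_measure R).
Local Notation lebV := (lebesgue_rV R n).
Hypothesis T0 : 0 < T.
Hypothesis L0 : 0 < L.
Hypothesis C0 : 0 < C.
Hypothesis ab : admissible L C b.
Hypothesis fy : is_flow L C b y.
Hypothesis nmu : narrowly_continuous T mu.
Hypothesis cmu : continuity_equation T b mu.
Hypothesis meta : mollifier eta.

(** The profile of eta along a coordinate axis is a bump on the line. It is not identically zero: by
    radial symmetry eta would then vanish, against its integral being 1. *)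
Lemma mollifier_smooth_step : (0 < n)%N -> exists S : R -> R,
  [/\ smooth S, forall s, s <= 0 -> S s = 0, forall s, 1 <= s -> S s = 1,
    forall s, 0 <= S s <= 1 & forall s, 0 <= 'D_1 S s].
Proof.
move=> n0; have [seta eta0 etar etao etaI] := meta.
pose e : V := delta_mx 0 (Ordinal n0).
have ee s : enorm (s *: e) = `|s|.
  rewrite /enorm (bigD1 (Ordinal n0))//= big1 => [|i /negPf hi].
    by rewrite !mxE !eqxx mulr1 addr0 sqrtr_sqr.
  by rewrite !mxE eqxx hi mulr0 expr0n.
apply: (@exists_smooth_step R (fun s => eta (s *: e))).
- apply: (@smooth_affine R R V (fun s => s *: e) (fun s => s *: e)) => //.
  by move=> k x z; rewrite scalerDl scalerA.
- by move=> s; exact: eta0.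
- by move=> s hs; apply: etao; rewrite ee.
- apply: contrapT => h; have h0 x : eta x = 0.
    rewrite (etar x (enorm x *: e)); last by rewrite ee ger0_norm// enorm_ge0.
    by apply/eqP/negP => /negP ?; apply: h; exists (enorm x).
  move: etaI; under eq_integral do rewrite h0.
  by rewrite integral0 => /eqP; rewrite eq_sym onee_eq0.
Qed.

Let flow_coord i : continuous (fun x => y T x 0 i).
Proof.
apply: (@lipschitz_continuous _ _ _ (expR (L * T))) => x x'.
have := coord_le_enorm (y T x - y T x') i; rewrite !mxE => /le_trans; apply.
exact: (flow_lip L0 C0 T0 ab).
Qed.

Lemma measurable_flow : measurable_fun setT (y T).
Proof. by apply: measurable_fun_rV => i; apply: continuous_measurable_rV; exact: flow_coord. Qed.

Section test.
Variables (f : V -> R) (M r0 : R).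
Hypothesis M0 : 0 <= M.
Hypothesis r00 : 0 <= r0.
Hypothesis f01 : forall x, 0 <= f x <= 1.
Hypothesis f_lip : forall x x', `|f x - f x'| <= M * enorm (x - x').
Hypothesis f_out : forall x, r0 < enorm x -> f x = 0.

Let f1 x : `|f x| <= 1.
Proof. by have /andP[? ?] := f01 x; rewrite ger0_norm. Qed.

Let cf : continuous f. Proof. exact: lipschitz_continuous f_lip. Qed.
Let mf : measurable_fun setT f. Proof. exact: continuous_measurable_rV. Qed.

Lemma euler_pushforward_cvg (P : probability V R) :
  \int[P]_x f (euler_map b T N x) @[N --> \oo] --> \int[P]_x f (y T x).
Proof.
apply: (@Rint_dominated_cvg _ _ _ _ _ _ _ (1)) => //.
- move=> N; apply: (@bmeas_prob _ _ _ _ 1) => //; apply: measurableT_comp => //.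
  apply: measurable_fun_rV => i; apply: (@lipschitz_measurable _ _ _ (expR (L * T))) => x x'.
  have -> : euler_map b T N x 0 i - euler_map b T N x' 0 i =
      (euler_map b T N x - euler_map b T N x') 0 i by rewrite [RHS]mxE; congr (_ + _); rewrite [RHS]mxE.
  by rewrite (le_trans (coord_le_enorm _ _))//; exact: (euler_map_lip L0 T0 ab).
- move=> x _; apply: (cvg_comp (euler_map b T ^~ x) f).
    apply/(@cvg_enormP R n); under eq_cvg do rewrite enorm_distC.
    exact: (euler_map_cvg L0 C0 T0 ab fy).
  exact: cf.
Qed.

Lemma uniqueness_test : \int[mu T]_x f x = \int[mu 0]_x f (y T x).
Proof.
(* In dimension 0 there is no axis along which to read off a bump, but the space is a single
   point. *)
have [n0|] := ltnP 0 n; last first.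
  rewrite leqn0 => /eqP n0; have sub (x x' : V) : x = x'.
    by apply/rowP => i; have := ltn_ord i; rewrite {2}n0.
  have e (P : probability V R) (g : V -> R) : \int[P]_x g x = g 0.
    rewrite (@eq_Rintegral _ _ _ P setT (cst (g 0))) => [|x _].
      by rewrite Rintegral_cst//= probability_setT mulr1.
    by rewrite (sub x 0).
  by rewrite !e (sub (y T 0) 0).
have [S [sS S0 S1 S01 dS0]] := mollifier_smooth_step n0.
set c := M * expR (L * T) * L * T + M * expR (L * T) + M * expR (L * T).
have c0 : 0 <= c by rewrite !addr_ge0// !mulr_ge0 ?expR_ge0 ?(ltW L0) ?(ltW T0).
have dt0 : T / N.+1%:R @[N --> \oo] --> (0 : R).
  by rewrite -(mulr0 T); apply: cvgMr; exact: cvg_harmonic.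
(* The limit in N is taken with eps fixed, since the Taylor constant and the flux gaps depend on
   eps; only then does eps tend to 0. *)
suff h eps : 0 < eps -> eps <= 1 ->
    `|\int[mu T]_x f x - \int[mu 0]_x f (y T x)| <= c * eps.
  apply/eqP; rewrite -subr_eq0 -normr_le0; apply/ler_addgt0Pl => e e0.
  have c1 : 0 < c + 1 by rewrite ltr_wpDl.
  have m0 : 0 < Num.min 1 (e / (c + 1)) by rewrite lt_min ltr01 divr_gt0.
  have m1 : Num.min 1 (e / (c + 1)) <= 1 by rewrite ge_min lexx.
  rewrite (le_trans (h _ m0 m1))// addr0 (@le_trans _ _ ((c + 1) * (e / (c + 1))))//.
    by apply: ler_pM; rewrite ?lerDl ?(ltW m0)// ge_min lexx orbT.
  by rewrite mulrC divfK// gt_eqF.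
move=> e0 e1.
have [KT KT0 hKT] := exists_taylor meta e0.
set r1 := support_radius T C r0.
have [MG MG0 hMG] := flux_gap_bounded mu T0 C0 ab r00 meta e0 e1.
have gap0 : \int[lebV]_(z in eball r1) \int[leb]_(s in `[0, T])
    flux_gap T C b mu r0 eta eps N (s, z) @[N --> \oo] --> (0 : R).
  rewrite -[X in _ --> X](_ : \int[lebV]_(z in eball r1) 0 = 0); last first.
    by rewrite Rintegral_cst ?mul0r//=; exact: measurable_eball.
  have bg N z := bmeas_flux_gap T0 C0 ab nmu r00 meta e0 e1 N z (lexx 0) (lexx T).
  have bd N z : `|\int[leb]_(s in `[0, T]) flux_gap T C b mu r0 eta eps N (s, z)| <=
      MG * fine (leb `[0, T]).
    by apply: le_normr_bound => // s _; have /andP[? ?] := hMG N (s, z); rewrite ger0_norm.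
  apply: (@Rint_dominated_cvg _ _ _ _ _ _ _ (MG * fine (leb `[0, T]))) => //.
    by move=> N; exact: (bmeas_flux_gap_space T0 C0 ab nmu r00 meta e0 e1 N (lexx 0) (lexx T)).
  move=> z _; rewrite -[X in _ --> X](_ : \int[leb]_(s in `[0, T]) 0 = 0); last first.
    by rewrite Rintegral_cst ?mul0r.
  apply: (@Rint_dominated_cvg _ _ _ _ _ _ _ (MG)) => //.
    by move=> N s _; have /andP[? ?] := hMG N (s, z); rewrite ger0_norm.
  by move=> s /=; rewrite in_itv/= => hs; exact: (flux_gap_cvg (L := L)).
set K := fine (lebV (eball r1)) * (KT * (C * (r1 + 3)) ^+ 2) * T.
have c1 : `|\int[mu T]_x f x - \int[mu 0]_x f (euler_map b T N x)| @[N --> \oo] -->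
    `|\int[mu T]_x f x - \int[mu 0]_x f (y T x)|.
  by apply: cvg_norm; apply: cvgB; [exact: cvg_cst|exact: euler_pushforward_cvg].
have c2 : \int[lebV]_(z in eball r1) \int[leb]_(s in `[0, T])
    flux_gap T C b mu r0 eta eps N (s, z) + K * (T / N.+1%:R) + c * eps @[N --> \oo] --> c * eps.
  rewrite -[X in _ --> X]add0r -[X in _ --> X + _](addr0 0) -[X in _ --> _ + X + _](mulr0 K).
  by apply: cvgD; [apply: cvgD => //; exact: cvgMr|exact: cvg_cst].
apply: (ler_cvg_to c1 c2).
have : C * (T / N.+1%:R) * (r1 + 3) @[N --> \oo] --> (0 : R).
  rewrite (_ : (0 : R) = C * 0 * (r1 + 3)); last by rewrite mulr0 mul0r.
  by apply: cvgMl; exact: cvgMr.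
have half : (0 : R) < 1 / 2 by rewrite divr_gt0.
move=> /cvgr_le/(_ _ half); apply: filterS => N hN.
exact: (uniqueness_estimate T0 L0 C0 ab nmu cmu sS S0 S1 S01 dS0 M0 r00 f01 f_lip f_out
  meta e0 e1 hN KT0 hKT).
Qed.

End test.

(** Compactness of [A] gives tents with bounded support, as [uniqueness_test] asks, and closedness
    lets them converge to the indicator, before and after composition with the flow. *)
Lemma uniqueness A : compact A -> mu T A = mu 0 (y T @^-1` A).
Proof.
move=> cA; have cl : closed A by apply: compact_closed => //; exact: norm_hausdorff.
have mA := closed_rV_measurable cl.
have mpA : measurable (y T @^-1` A).
  by rewrite -[X in measurable X]setTI; exact: measurable_flow.
have [A0|/set0P A0] := eqVneq A set0; first by rewrite A0 preimage_set0 !measure0.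
have [r r_gt0 Ar] := compact_enorm_bounded cA.
have bl k : forall x x', `|tent A k x - tent A k x'| <= k.+1%:R * enorm (x - x').
  by move=> x x'; exact: tent_lip.
have b1 k x : `|tent A k x| <= 1 by have /andP[? ?] := tent01 A0 k x; rewrite ger0_norm.
have mb k : measurable_fun setT (tent A k) := lipschitz_measurable (bl k).
have h k : \int[mu T]_x tent A k x = \int[mu 0]_x tent A k (y T x).
  apply: (@uniqueness_test _ k.+1%:R (r + 1)) => //.
  - by rewrite addr_ge0// ltW.
  - by move=> x; exact: tent01.
  - by move=> x; exact: tent_out.
have l1 : \int[mu T]_x tent A k x @[k --> \oo] --> \int[mu T]_x (\1_A x : R).
  apply: (@Rint_dominated_cvg _ _ _ _ _ _ _ (1)) => //.
    by move=> k; apply: (@bmeas_prob _ _ _ _ 1).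
  by move=> x _; exact: tent_cvg.
have l2 : \int[mu 0]_x tent A k (y T x) @[k --> \oo] --> \int[mu 0]_x (\1_A (y T x) : R).
  apply: (@Rint_dominated_cvg _ _ _ _ _ _ _ (1)) => //.
    move=> k; apply: (@bmeas_prob _ _ _ _ 1) => //.
    by apply: measurableT_comp => //; exact: measurable_flow.
  by move=> x _; exact: tent_cvg.
move: l2; under eq_cvg do rewrite -h; move=> /(cvg_unique (@Rhausdorff R) l1) hh.
have e (P : probability V R) (B : set V) : measurable B -> fine (P B) = \int[P]_x (\1_B x : R).
  by move=> mB; rewrite /Rintegral integral_indic// setIT.
by rewrite -[LHS]fineK ?fin_num_measure// -[RHS]fineK ?fin_num_measure// !e// hh.
Qed.

End uniqueness.

Section smooth_lip.
Context (R : realType) (V : normedModType R) (I : finType) (e : I -> V) (c : I -> V -> R).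
Hypothesis hc : forall h, h = \sum_i c i h *: e i.
Hypothesis c_le : forall i h, `|c i h| <= `|h|.

Lemma smooth_lip (K : set V) (f : V -> R) : compact K -> closed K -> smooth f -> vanishes_off K f ->
  exists2 B, 0 <= B & forall x x', `|f x - f x'| <= B * `|x - x'|.
Proof.
move=> cK clK sf fK.
have bi i : exists B, 0 <= B /\ forall x, `|'D_(e i) f x| <= B.
  have [||B B0 hB] := @vanishes_bounded R V K ('D_(e i) f) cK.
  - by apply: (@Ck_continuous _ _ _ 0); exact: smooth_derive.
  - exact: vanishes_derive.
  by exists B.
have {bi}[B hB] := choice bi.
exists (\sum_i B i) => [|x x']; first by apply: sumr_ge0 => i _; exact: (hB i).1.
have [s _] := segment_MVT x' (x - x') (smooth_differentiable sf).
rewrite [x' + _]addrC subrK => ->; rewrite (derive_coord hc); last exact: smooth_differentiable.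
rewrite (le_trans (ler_norm_sum _ _ _))// mulr_suml; apply: ler_sum => i _.
by rewrite normrM mulrC; apply: ler_pM => //; exact: (hB i).2.
Qed.

End smooth_lip.

(** Cutting [0, T] into N + 1 pieces bounds the increment by K T^2 / (N + 1). It replaces
    differentiation along trajectories, which are only Lipschitz in time. *)
Lemma quadratic_constant (R : realType) (g : R -> R) (T K : R) : 0 < T ->
  (forall s t, 0 <= s -> s <= t -> t <= T -> `|g t - g s| <= K * (t - s) ^+ 2) -> g T = g 0.
Proof.
move=> T0 h.
have hN N : `|g T - g 0| <= K * T ^+ 2 * N.+1%:R^-1.
  pose dt := T / N.+1%:R.
  have dt0 : 0 <= dt by rewrite divr_ge0// ltW.
  have dtT : N.+1%:R * dt = T by rewrite mulrC divfK.
  have hk k : (k <= N.+1)%N -> `|g (k%:R * dt) - g 0| <= k%:R * (K * dt ^+ 2).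
    elim: k => [_|k IH kN]; first by rewrite !mul0r subrr normr0.
    have -> : g (k.+1%:R * dt) - g 0 = (g (k.+1%:R * dt) - g (k%:R * dt)) + (g (k%:R * dt) - g 0).
      by ring.
    rewrite (le_trans (ler_normD _ _))// -[in leRHS]natr1 mulrDl mul1r addrC.
    rewrite lerD ?IH ?(ltnW kN)//.
    have := h (k%:R * dt) (k.+1%:R * dt); rewrite stepE; apply.
    - by rewrite mulr_ge0.
    - exact: le_step.
    - by rewrite -dtT ler_wpM2r// ler_nat.
  have := hk _ (leqnn _); rewrite dtT => /le_trans; apply.
  rewrite [leRHS](_ : _ = N.+1%:R * (K * dt ^+ 2))// -[in LHS]dtT.
  by field; rewrite nat1r pnatr_eq0.
apply/eqP; rewrite -subr_eq0 -normr_le0.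
have c : K * T ^+ 2 * N.+1%:R^-1 @[N --> \oo] --> (0 : R).
  by rewrite -(mulr0 (K * T ^+ 2)); apply: cvgMr; exact: cvg_harmonic.
by apply: (ler_cvg_to (cvg_cst _) c); exact: nearW.
Qed.

Lemma sum_option (V : nmodType) (I : finType) (F : option I -> V) :
  \sum_o F o = F None + \sum_i F (Some i).
Proof.
rewrite (bigD1 None)//=; congr (_ + _).
rewrite (reindex_omap (Some : I -> option I) id) => [|[i|]]//=.
by apply: eq_bigl => i; rewrite eqxx.
Qed.

(** Reduces continuity in time to sequences, the setting of dominated convergence. *)
Lemma sequentially_continuous (R : realType) (F : R -> R) t :
  (forall u : nat -> R, u @ \oo --> t -> F (u k) @[k --> \oo] --> F t) -> F s @[s --> t] --> F t.
Proof.
move=> hF; apply/cvgrPdist_le => e e0; apply: contrapT => h.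
have hn N : exists s, `|t - s| < N.+1%:R^-1 /\ e < `|F t - F s|.
  apply: contrapT => hN; apply: h; apply/nbhs_ballP.
  exists N.+1%:R^-1 => /=; first by rewrite invr_gt0.
  by move=> s ts; rewrite /= leNgt; apply/negP => hs; apply: hN; exists s.
have [u hu] := choice hn.
have ut : u @ \oo --> t.
  apply/cvgrPdist_lt => d d0.
  have /cvgr_lt/(_ _ d0) := @cvg_harmonic R.
  by apply: filterS => N; exact: (lt_trans (hu N).1).
have /cvgrPdist_le/(_ _ e0) [N _ /(_ N (leqnn N))/=] := hF u ut.
by rewrite leNgt (hu N).2.
Qed.

(** * Existence of trajectories *)
Section existence.
Context (R : realType) (n : nat) (T L C : R) (b y : R -> 'rV[R]_n -> 'rV[R]_n)
  (theta : probability 'rV[R]_n R).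
Local Notation V := 'rV[R]_n.
Local Notation leb := (@lebesgue_measure R).
Hypothesis T0 : 0 < T.
Hypothesis L0 : 0 < L.
Hypothesis C0 : 0 < C.
Hypothesis ab : admissible L C b.
Hypothesis fy : is_flow L C b y.

Lemma measurable_flow_at t : measurable_fun setT (y t).
Proof.
have [_ yid _ ylip _] := fy; apply: measurable_fun_rV => i.
have [t0|t0] := leP t 0.
  rewrite (_ : (fun x => y t x 0 i) = (fun x : V => x 0 i)); first exact: measurable_coord_rV.
  by apply/funext => x; rewrite yid.
apply: (@lipschitz_measurable _ _ _ (expR (2 * L * t))) => x x'.
have := coord_le_enorm (y t x - y t x') i; rewrite !mxE => /le_trans; apply.
by rewrite mulrC; exact: (ylip _ _ _ (ltW t0)).
Qed.

Definition flow_law t : probability V R := image_measure theta (measurable_flow_at t).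

Lemma flow_lawE t (f : V -> R) M : measurable_fun setT f -> (forall x, `|f x| <= M) ->
  \int[flow_law t]_x f x = \int[theta]_x f (y t x).
Proof.
move=> mf fM.
have [||_] := @Rint_image _ _ _ _ R theta (y t) (measurable_flow_at t) setT f measurableT.
- by rewrite preimage_setT ltey_eq fin_num_measure.
- exact: (@bmeas_prob R n (flow_law t) f M mf fM).
- by rewrite preimage_setT.
Qed.

Lemma flow_law_narrow : narrowly_continuous T flow_law.
Proof.
move=> f cf [M fM]; apply: continuous_subspaceT => t.
have mf := continuous_measurable_rV cf.
rewrite (_ : (fun t => _) = fun t => \int[theta]_x f (y t x)); last first.
  by apply/funext => s; rewrite (flow_lawE _ mf fM).
apply: sequentially_continuous => u ut.
apply: (@Rint_dominated_cvg _ _ _ _ _ _ _ M) => [k|//|x _].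
  by apply: (@bmeas_prob _ _ _ _ M) => //; apply: measurableT_comp => //; exact: measurable_flow_at.
have [yc _ _ _ _] := fy; have [cy _] := yc x.
exact: (cvg_comp _ _ (cvg_comp _ _ ut (cy t)) (cf _)).
Qed.

Lemma flow_law0 E : flow_law 0 E = theta E.
Proof.
have [_ yid _ _ _] := fy.
rewrite /flow_law/= /image_measure (_ : y 0 = id)//.
by apply/funext => x; rewrite yid.
Qed.

Section test_function.
Variable phi : R * V -> R.
Hypothesis tphi : test_function T phi.

Let K := closure [set p | phi p != 0].
Let sphi : smooth phi. Proof. by have [] := tphi. Qed.
Let cK : compact K. Proof. by have [] := tphi. Qed.
Let clK : closed K. Proof. exact: closed_closure. Qed.
Let phiK : vanishes_off K phi.
Proof.
move=> p Kp; apply/eqP/negP => /negP h; apply: Kp; exact: subset_closure.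
Qed.

Let direction (o : option 'I_n) : R * V := if o is Some i then (0, delta_mx 0 i) else (1, 0).
Let coordinate (o : option 'I_n) (p : R * V) : R := if o is Some i then p.2 0 i else p.1.

Let direction_span p : p = \sum_o coordinate o p *: direction o.
Proof.
rewrite sum_option/=; case: p => t x /=.
have -> : \sum_i x 0 i *: ((0, delta_mx 0 i) : R * V) = (0, x).
  rewrite [in RHS](row_sum_delta x); apply: (big_rec2 (fun (p : R * V) z => p = (0, z))) => // i p z _ ->.
  have -> : x 0 i *: ((0, delta_mx 0 i) : R * V) + (0, z) = (x 0 i *: 0 + 0, x 0 i *: delta_mx 0 i + z) by [].
  by rewrite scaler0 addr0.
have -> : t *: ((1, 0) : R * V) + (0, x) = (t * 1 + 0, t *: 0 + x) by [].
by rewrite mulr1 addr0 scaler0 add0r.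
Qed.

Let coordinate_le o p : `|coordinate o p| <= `|p|.
Proof.
rewrite prod_normE le_max; case: o => [i|]/=; last by rewrite lexx.
by rewrite coord_le_norm orbT.
Qed.

Let D o := 'D_(direction o) phi.

Let DK o : vanishes_off K (D o). Proof. exact: vanishes_derive. Qed.
Let cD o : continuous (D o).
Proof. by apply: (@Ck_continuous _ _ _ 0); exact: smooth_derive. Qed.

Let G (t : R) (x : V) : R := D None (t, x) + \sum_i b t x 0 i * D (Some i) (t, x).

Let G_bounded : exists M, forall t x, `|G t x| <= M.
Proof.
have h o : exists B, 0 <= B /\ forall p, `|D o p| <= B.
  by have [B B0 hB] := vanishes_bounded cK (@cD o) (@DK o); exists B.
have [B hB] := choice h.
have csnd : compact (snd @` K).
  by apply: continuous_compact => //; apply: continuous_subspaceT => p; exact: cvg_snd.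
have [r r0 hr] := compact_enorm_bounded csnd.
exists (B None + \sum_i C * (1 + r) * B (Some i)) => t x.
rewrite (le_trans (ler_normD _ _))// lerD ?(hB None).2// (le_trans (ler_norm_sum _ _ _))//.
apply: ler_sum => i _; rewrite normrM.
have Bi0 := (hB (Some i)).1.
have [Kp|/DK ->] := pselect (K (t, x)); last first.
  by rewrite normr0 mulr0 !mulr_ge0 ?(ltW C0)// addr_ge0// ltW.
apply: ler_pM => //; last exact: (hB (Some i)).2.
have [_ _ gb] := ab; rewrite (le_trans (coord_le_enorm _ _))// (le_trans (gb _ _))//.
by rewrite ler_pM2l// lerD2l; apply: hr; exists (t, x).
Qed.

Let measurable_G : measurable_fun setT (fun p : measurableTypeR R * V => G p.1 p.2).
Proof.
have mD o : measurable_fun setT (D o : measurableTypeR R * V -> R).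
  by apply: continuous_measurable_RrV; exact: cD.
have [mb _ _] := ab; apply: measurable_funD.
  by rewrite (_ : (fun _ => _) = D None)//; apply/funext => -[].
apply: measurable_sum => i; apply: measurable_funM => //.
by rewrite (_ : (fun _ => _) = D (Some i))//; apply/funext => -[].
Qed.

Let G_path x : bmeas leb `[0, T] (fun s => G s (y s x)).
Proof.
have [M hM] := G_bounded; split => //; [exact: leb_itv_fin| |by exists M].
apply: measurable_funTS; apply: (measurableT_comp measurable_G (g := fun s => (s, y s x))).
apply: measurable_fun_pair => //; apply: measurable_fun_rV => i.
by have [yc _ _ _ _] := fy; have [_ [my _]] := yc x; exact: my.
Qed.

(** The chain rule along a trajectory in integrated form: [g] compares phi(t, y_t) with the integral
    of its expected derivative and has quadratic increments, hence is constant up to T. As phi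
    vanishes at times 0 and T, so does the integral. *)
Let along_flow x : \int[leb]_(s in `[0, T]) G s (y s x) = 0.
Proof.
have [B B0 hB] := smooth_taylor direction_span coordinate_le cK clK sphi phiK.
have hl o : exists B, 0 <= B /\ forall p q, `|D o p - D o q| <= B * `|p - q|.
  have [|B' B'0 h] := smooth_lip direction_span coordinate_le cK clK _ (@DK o).
    exact: smooth_derive.
  by exists B'.
have [E hE] := choice hl.
pose S := 1 + speed_bound L C T x.
have S0 : 0 <= S by rewrite addr_ge0// speed_bound_ge0.
have [yc _ _ _ yb] := fy.
have pS s t : 0 <= s -> s <= t -> t <= T -> `|(t, y t x) - (s, y s x) : R * V| <= S * (t - s).
  move=> s0 st tT; rewrite prod_normE ge_max/=; apply/andP; split.
    by rewrite ger0_norm ?subr_ge0// ler_peMl ?subr_ge0// lerDl speed_bound_ge0.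
  rewrite (le_trans (norm_le_enorm _))//.
  rewrite (le_trans (flow_speed L0 C0 ab fy x s0 st))// ler_wpM2r ?subr_ge0//.
  rewrite /speed_bound (@le_trans _ _ (C * (1 + flow_bound L C T x)))//.
    by rewrite ler_pM2l// lerD2l flow_bound_homo.
  by rewrite /S lerDr.
have bS s i : 0 <= s -> s <= T -> `|b s (y s x) 0 i| <= S.
  move=> s0 sT; have [_ _ gb] := ab; rewrite (le_trans (coord_le_enorm _ _))//.
  rewrite (le_trans (gb _ _))// (@le_trans _ _ (C * (1 + flow_bound L C T x)))//.
    by rewrite ler_pM2l// lerD2l (le_trans (yb _ _ s0))// flow_bound_homo.
  by rewrite /S lerDr.
pose E1 := E None + \sum_i S * E (Some i).
pose g t := phi (t, y t x) - \int[leb]_(s in `[0, t]) G s (y s x).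
have gT : g T = g 0.
  apply: (@quadratic_constant _ _ _ (B * S ^+ 2 + E1 * S)) => // s t s0 st tT.
  have t0 := le_trans s0 st.
  have sub : `[s, t]%classic `<=` (`[0, T]%classic : set R).
    by move=> r /=; rewrite !in_itv/= => /andP[? ?]; rewrite (le_trans s0)//= (le_trans _ tT).
  have bG : bmeas leb `[s, t] (fun r => G r (y r x)) by apply: bmeasS (G_path x).
  have bb i : bmeas leb `[s, t] (fun r => b r (y r x) 0 i) by exact: (bmeas_path C0 _ _ ab (yc x).2).
  rewrite /g (@Rint_itvD _ 0 s t)//; last first.
    apply: bmeasS (G_path x) => // r /=; rewrite !in_itv/= => /andP[-> rt].
    exact: (le_trans rt).
  set Is := \int[leb]_(r in `[0, s]) _; set I := \int[leb]_(r in `[s, t]) _.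
  pose F r := D None (s, y s x) + \sum_i b r (y r x) 0 i * D (Some i) (s, y s x).
  have bFi i : bmeas leb `[s, t] (fun r => b r (y r x) 0 i * D (Some i) (s, y s x)).
    by apply: bmeasM => //; exact: bmeas_itv_cst.
  have bF : bmeas leb `[s, t] F.
    by apply: bmeasD; [exact: bmeas_itv_cst|apply: bmeas_sum => //; exact: leb_itv_fin].
  (* With the derivatives of phi frozen at time s, the linear Taylor term is itself a time integral,
     because y_t - y_s is the integral of the field. *)
  have FE : \int[leb]_(r in `[s, t]) F r =
      \sum_o coordinate o ((t, y t x) - (s, y s x)) * D o (s, y s x).
    rewrite /F RintD//; [|exact: bmeas_itv_cst|apply: bmeas_sum => //; exact: leb_itv_fin].
    rewrite sum_option/= Rintegral_cst// leb_itvE// mulrC; congr (_ + _).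
    rewrite Rintegral_sum ?leb_itv_fin//; apply: eq_bigr => i _.
    rewrite (flow_increment C0 ab fy x s0 st) !mxE mulrC -RintZ//.
    by apply: eq_Rintegral => r _; rewrite mulrC.
  have h1 := hB (s, y s x) ((t, y t x) - (s, y s x)).
  rewrite [(s, y s x) + _]addrC subrK -FE in h1.
  have h2 : `|\int[leb]_(r in `[s, t]) F r - I| <= E1 * S * (t - s) ^+ 2.
    rewrite /I -RintB// expr2 mulrA -{2}(leb_itvE st).
    apply: le_normr_bound; first exact: bmeasB.
    move=> r /=; rewrite in_itv/= => /andP[sr rt].
    have r0 := le_trans s0 sr; have rT := le_trans rt tT.
    have pr : `|((s, y s x) : R * V) - (r, y r x)| <= S * (t - s).
      by rewrite distrC (le_trans (pS _ _ s0 sr rT))// ler_wpM2l// lerD2r.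
    have Er o : `|D o (s, y s x) - D o (r, y r x)| <= E o * (S * (t - s)).
      by apply: (le_trans ((hE o).2 _ _)); apply: ler_wpM2l => //; exact: (hE o).1.
    rewrite /F /G opprD addrACA -sumrB -mulrA (le_trans (ler_normD _ _))// mulrDl lerD//.
    rewrite mulr_suml (le_trans (ler_norm_sum _ _ _))//; apply: ler_sum => i _.
    by rewrite -mulrBr normrM -mulrA; apply: ler_pM => //; exact: bS.
  have -> : phi (t, y t x) - (Is + I) - (phi (s, y s x) - Is) =
      (phi (t, y t x) - phi (s, y s x) - \int[leb]_(r in `[s, t]) F r) +
      (\int[leb]_(r in `[s, t]) F r - I) by ring.
  rewrite (le_trans (ler_normD _ _))// mulrDl lerD// (le_trans h1)//.
  rewrite -mulrA ler_wpM2l// -exprMn lerXn2r ?nnegrE//; last exact: pS.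
  by rewrite mulr_ge0// subr_ge0.
have phi0 t z : ~ (0 < t < T) -> phi (t, z) = 0.
  move=> h; apply: phiK => Kt; apply: h; have [_ _ /(_ _ Kt)] := tphi.
  by move=> [/= + _]; rewrite in_itv/=.
move: gT; rewrite /g !phi0; [|by rewrite ltxx|by rewrite ltxx andbF].
rewrite set_itv1 Rintegral_set1 => /eqP.
by rewrite !sub0r eqr_opp => /eqP.
Qed.

Lemma flow_law_test : \int[leb]_(t in `[0, T]) \int[flow_law t]_x G t x = 0.
Proof.
have [M hM] := G_bounded.
have mG t : measurable_fun setT (G t).
  apply: (measurableT_comp measurable_G (g := fun x : V => ((t : measurableTypeR R), x))).
  exact: measurable_fun_pair.
transitivity (\int[leb]_(t in `[0, T]) \int[theta]_x G t (y t x)).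
  by apply: eq_Rintegral => t _; exact: flow_lawE (mG t) (hM t).
rewrite (@Rint_fubini _ _ _ _ R leb theta _ _ _ M)//.
- transitivity (\int[theta]_x (0 : R)); last by rewrite Rintegral_cst// mul0r.
  by apply: eq_Rintegral => x _; exact: along_flow.
- exact: leb_itv_fin.
- by rewrite ltey_eq fin_num_measure.
- apply: measurable_funTS.
  apply: (measurableT_comp measurable_G (g := fun p : measurableTypeR R * V => (p.1, y p.1 p.2))).
  apply: measurable_fun_pair => //; apply: measurable_fun_rV => i.
  apply: continuous_measurable_RrV => p.
  have cy := flow_jointly_continuous L0 fy.
  exact: (cvg_comp _ _ (@cy p) (@coord_continuous R _ _ 0 i _)).
Qed.

End test_function.

Lemma flow_law_equation : continuity_equation T b flow_law.
Proof. by move=> phi tphi; exact: (flow_law_test tphi). Qed.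

End existence.

(** * Compactness of generalized controls *)
Section density.
Context (R : realType) (T : R) (H : set (measurableTypeR R) -> R).
Local Notation leb := (@lebesgue_measure R).
Let I : set (measurableTypeR R) := `[0, T]%classic.
Hypothesis H_ge0 : forall A, 0 <= H A.
Hypothesis H_additive : forall A B, measurable A -> measurable B -> A `&` B = set0 ->
  H (A `|` B) = H A + H B.
Hypothesis H_le : forall A, measurable A -> ((H A)%:E <= leb (A `&` I))%E.

Let mI : measurable I.
Proof. exact: measurable_itv. Qed.

Let l A := fine (leb (A `&` I)).

Let leb_fin A : measurable A -> leb (A `&` I) \is a fin_num.
Proof.
move=> mA; rewrite ge0_fin_numE//; apply: le_lt_trans (leb_itv_fin 0 T).
by apply: le_measure; rewrite ?inE//; do ?[exact: measurableI|exact: subIsetr|exact: subIsetl].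
Qed.

Let H_lel A : measurable A -> H A <= l A.
Proof. by move=> mA; rewrite -lee_fin fineK ?leb_fin// H_le. Qed.

Let H0 : H set0 = 0.
Proof.
apply/eqP; rewrite eq_le H_ge0 andbT; have := H_le measurable0.
by rewrite set0I measure0 lee_fin.
Qed.

Let H_finite_sum (F : (set (measurableTypeR R))^nat) k : (forall i, measurable (F i)) ->
  trivIset setT F -> \sum_(i < k) H (F i) = H (\big[setU/set0]_(i < k) F i).
Proof.
move=> mF tF; elim: k => [|k IH]; first by rewrite !big_ord0 H0.
rewrite !big_ord_recr/= IH H_additive//; first exact: bigsetU_measurable.
apply: (@trivIset_bigsetUI _ xpredT) => //; exact: sub_trivIset tF.
Qed.

(** A limit along an ultrafilter is a priori only finitely additive. Domination by Lebesgue measure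
    repairs this: the mass of a tail of the union is at most its length, which tends to 0. *)
Let H_sigma_additive : semi_sigma_additive (fun A => (H A)%:E).
Proof.
move=> F mF tF mUF.
have cl := @measure_semi_sigma_additive _ _ _ (mrestr leb (measurable_itv `[0, T])) F mF tF mUF.
have {cl}/fine_cvgP[_ cl] : (fun k => \sum_(0 <= i < k) leb (F i `&` I))%E @ \oo -->
    (l (\bigcup_i F i))%:E.
  by rewrite fineK ?leb_fin//.
apply/fine_cvgP; split; first by apply: nearW => k; rewrite sumEFin.
apply: (@squeeze_cvgr _ _ _ _ (fun k => H (\bigcup_i F i) -
    (l (\bigcup_i F i) - fine (\sum_(0 <= i < k) leb (F i `&` I))%E))
    (fun=> H (\bigcup_i F i))); last 2 first.
- rewrite -[X in _ --> X]subr0 -(subrr (l (\bigcup_i F i))).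
  apply: cvgB; first exact: cvg_cst.
  by apply: cvgB; first exact: cvg_cst.
- exact: cvg_cst.
apply: nearW => k /=; rewrite sumEFin/= !big_mkord H_finite_sum//.
pose A := \big[setU/set0]_(i < k) F i; pose B := (\bigcup_i F i) `\` A.
have mA : measurable A by exact: bigsetU_measurable.
have mB : measurable B by exact: measurableD.
have AB : A `&` B = set0 by apply/seteqP; split=> // x [? []].
have UE : \bigcup_i F i = A `|` B.
  rewrite /B setDE setUIr setUv setIT setUidr//.
  by rewrite /A -bigcup_mkord; move=> x [i _ Fi]; exists i.
have HU : H (\bigcup_i F i) = H A + H B by rewrite UE H_additive.
have lU : l (\bigcup_i F i) = l A + l B.
  have e : (A `&` I) `&` (B `&` I) = set0 by rewrite setIACA AB set0I.
  rewrite /l -fineD ?leb_fin// UE setIUl; congr fine.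
  exact: (measureU leb (measurableI _ _ mA mI) (measurableI _ _ mB mI) e).
have lA : fine (\sum_(i < k) leb (F i `&` I))%E = l A.
  rewrite /l /A big_distrl/=; congr fine.
  have mF' i : measurable (F i `&` I) by exact: measurableI.
  have tF' : trivIset setT (fun i => F i `&` I).
    exact: trivIset_setIr.
  by apply/esym; have := @measure_semi_additive _ _ _ leb _ k mF' tF'; apply; exact: bigsetU_measurable.
have hB := H_lel mB; have hB0 := H_ge0 B.
by rewrite -/A lA lU HU; apply/andP; split; lra.
Qed.

Definition density_set_function : set (measurableTypeR R) -> \bar R := fun A => (H A)%:E.

Let d0 : density_set_function set0 = 0%E. Proof. by rewrite /density_set_function H0. Qed.
Let d_ge0 A : (0 <= density_set_function A)%E. Proof. by rewrite lee_fin. Qed.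

HB.instance Definition _ := isMeasure.Build _ _ _ density_set_function d0 d_ge0 H_sigma_additive.

Let d_fin : fin_num_fun density_set_function. Proof. by []. Qed.

HB.instance Definition _ := Measure_isFinite.Build _ _ _ density_set_function d_fin.

Lemma exists_density : exists f : measurableTypeR R -> R,
  [/\ measurable_fun setT f, forall t, 0 <= f t, leb.-integrable setT (EFin \o f) &
    forall A, measurable A -> (H A)%:E = (\int[leb]_(t in A) (f t)%:E)%E].
Proof.
have dom : density_set_function `<< leb.
  apply/null_content_dominatesP => B mB B0.
  apply/eqP; rewrite eq_le measure_ge0 andbT -B0 (le_trans (H_le mB))//.
  by apply: le_measure; rewrite ?inE//; do ?[exact: measurableI|exact: subIsetr|exact: subIsetl].
have [f [f0 ff fi fE]] := radon_nikodym_sigma_finite dom.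
have fK : EFin \o (fine \o f) = f by apply/funext => t /=; rewrite fineK.
exists (fine \o f); split.
- by apply: measurableT_comp => //; exact: measurable_int fi.
- by move=> t; exact: fine_ge0.
- by rewrite fK.
- by move=> A mA; have e : (H A)%:E = _ := fE A mA; rewrite e; apply: eq_integral => t _; rewrite /= fineK.
Qed.

End density.

(** On the set where g < f the hypothesis forces equal integrals, hence f = g almost everywhere
    there; so that set is null. *)
Lemma ae_le_density (R : realType) (f g : measurableTypeR R -> R) :
  let leb := (@lebesgue_measure R) in
  leb.-integrable setT (EFin \o f) -> leb.-integrable setT (EFin \o g) ->
  (forall A, measurable A ->
    (\int[leb]_(t in A) (f t)%:E <= \int[leb]_(t in A) (g t)%:E)%E) ->
  {ae leb, forall t, f t <= g t}.
Proof.
move=> leb fi gi h.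
have mf : measurable_fun setT f by apply/measurable_EFinP; exact: measurable_int fi.
have mg : measurable_fun setT g by apply/measurable_EFinP; exact: measurable_int gi.
pose D := [set t | g t < f t].
have mD : measurable D.
  by rewrite -[X in measurable X]setTI; exact: (measurable_fun_ltr mg mf measurableT (Y := [set true])).
have fD : leb.-integrable D (EFin \o f) by apply: integrableS fi.
have := @integral_ae_eq _ _ R leb D mD (EFin \o g) (EFin \o f) fD.
have mgD : measurable_fun D (EFin \o g) by apply/measurable_EFinP; exact: measurable_funTS.
move=> /(_ mgD)[E ED mE|N [mN N0 hN]].
  apply/eqP; rewrite eq_le h//=; apply: le_integral => //.
  - exact: integrableS gi.
  - exact: integrableS fi.
  - by move=> t; rewrite inE => /ED; rewrite lee_fin => /ltW.
exists N; split=> // t /= /negP; rewrite -ltNge => ht; apply: hN => /=.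
by move=> /(_ ht) [] e; move: ht; rewrite e ltxx.
Qed.

(** Only the first point is required to lie in K, which spares checking where the approximating
    points are. *)
Lemma compact_modulus (R : realType) (V : normedModType R) (K : set V) (g : V -> R) e :
  compact K -> continuous g -> 0 < e ->
  exists2 d, 0 < d & forall x x', K x -> `|x - x'| <= d -> `|g x - g x'| <= e.
Proof.
move=> /compact_near_coveringP cK cg e0.
pose P d x := forall x', `|x - x'| <= d -> `|g x - g x'| <= e.
have hP : \forall d \near (0 : R)^'+, K `<=` P d.
  apply: cK => x Kx.
  have e2 : 0 < e / 2 by rewrite divr_gt0.
  have /cvgrPdist_le/(_ _ e2)/nbhs_ballP[r /= r0 hr] := cg x.
  have r2 : 0 < r / 2 by rewrite divr_gt0.
  exists (ball x (r / 2), [set d | d < r / 2]) => /=.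
    by split; [exact: nbhsx_ballx|exact: nbhs_right_lt].
  move=> [x' d] /=; rewrite -ball_normE/= => -[xx' dr] x'' hx''.
  have h1 : `|g x - g x'| <= e / 2.
    by apply: hr; rewrite -ball_normE/= (lt_trans xx')// ltr_pdivrMr// ltr_pMr// ltr1n.
  have h2 : `|g x - g x''| <= e / 2.
    apply: hr; rewrite -ball_normE/= (le_lt_trans (ler_distD x' _ _))// (splitr r) ltrD//.
    exact: (le_lt_trans hx'').
  rewrite (le_trans (ler_distD (g x) _ _))// (splitr e) lerD//.
  by rewrite distrC.
have [d /= [hd d0]] := filter_ex (filterI hP (nbhs_right_gt (0 : R))).
by exists d => // x x' Kx; exact: hd.
Qed.

(** * Nested cells of the control space, coded by binary numbers *)

Section wcode.
Context (R : realType) (m : nat).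
Local Notation W := 'rV[R]_m.

(** Each bit tests one coordinate i against a rational threshold -l + j / (l + 1). The countably
    many triples (i, l, j) are enumerated by [pickle]. *)
Definition bit (k : nat) (w : W) : bool :=
  if unpickle k is Some (i, l, j) then - l%:R + j%:R / l.+1%:R <= w 0 (i : 'I_m) else false.

(** Reading the bits as binary digits makes the cells both nested, the parent code being half the
    code, and linearly ordered, as stacking them into subintervals of [0, 1] demands. *)
Fixpoint wcode N w : nat := if N is k.+1 then ((wcode k w).*2 + bit k w)%N else 0%N.

Lemma code_lt N w : (wcode N w < 2 ^ N)%N.
Proof. by elim: N => //= N IH; rewrite expnS; case: bit; lia. Qed.

Lemma code_half N w : (wcode N.+1 w)./2 = wcode N w.
Proof. by rewrite /=; case: bit; lia. Qed.

Lemma code_anti N N' w w' : (N <= N')%N -> wcode N' w = wcode N' w' -> wcode N w = wcode N w'.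
Proof.
move=> /subnKC <-; elim: (N' - N)%N => [|k IH]; first by rewrite addn0.
by rewrite addnS => /(congr1 half); rewrite !code_half; exact: IH.
Qed.

Lemma code_bit N k w w' : (k < N)%N -> wcode N w = wcode N w' -> bit k w = bit k w'.
Proof.
move=> kN /(code_anti kN) /=; case: bit; case: bit => //; lia.
Qed.

Lemma measurable_code N k : measurable [set w | (wcode N w < k)%N].
Proof.
elim: N k => [|N IH] k.
  by case: k => [|k]; [rewrite (_ : mkset _ = set0)|rewrite (_ : mkset _ = setT)];
    rewrite //; apply/seteqP; split.
have mb : measurable [set w | bit N w].
  rewrite /bit; case: unpickle => [[[i l] j]|]; last first.
    by rewrite (_ : mkset _ = set0)//; apply/seteqP; split.
  rewrite -[X in measurable X]setTI.
  have : measurable_fun setT (fun w : W => - l%:R + j%:R / l.+1%:R <= w 0 i).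
    by apply: measurable_fun_ler => //; exact: measurable_coord_rV.
  by move=> /(_ measurableT [set true]); apply.
rewrite (_ : mkset _ = ([set w | bit N w] `&` [set w | (wcode N w < k./2)%N]) `|`
  (~` [set w | bit N w] `&` [set w | (wcode N w < uphalf k)%N])).
  by apply: measurableU; apply: measurableI => //; exact: measurableC.
apply/seteqP; split=> w /=; case: bit => /=.
- by move=> h; left; split => //; lia.
- by move=> h; right; split => //; lia.
- by move=> [[_ h]|[]//]; lia.
- by move=> [[]//|[_ h]]; lia.
Qed.

(** Within [-l, l] the thresholds of parameter l are 1 / (l + 1) <= d apart, so two points more than
    d apart in some coordinate are separated by one of them. N exceeds the indices of these finitely
    many tests. *)
Lemma code_diam r d : 0 < d -> exists N, forall w w', `|w| <= r -> `|w'| <= r ->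
  wcode N w = wcode N w' -> `|w - w'| <= d.
Proof.
move=> d0.
pose l := maxn (Num.trunc r).+1 (Num.trunc d^-1).+1.
have lr : r <= l%:R.
  by rewrite (le_trans (ltW (truncnS_gt r)))// ler_nat leq_maxl.
have ld : l.+1%:R^-1 <= d.
  rewrite invf_ple ?posrE// (le_trans (ltW (truncnS_gt _)))// ler_nat.
  by rewrite leqW// leq_maxr.
pose J := (2 * l * l.+1).+2.
pose N := (\max_(p : 'I_m * 'I_J) (pickle (p.1, l, nat_of_ord p.2))).+1.
have main w w' i : `|w| <= r -> `|w'| <= r -> wcode N w = wcode N w' -> w' 0 i - w 0 i <= d.
  move=> wr w'r cw; rewrite leNgt; apply/negP => hd.
  have wl : - l%:R <= w 0 i <= l%:R.
    by rewrite -ler_norml (le_trans (coord_le_norm _ _))// (le_trans wr).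
  have x0 : 0 <= (w 0 i + l%:R) * l.+1%:R.
    by rewrite mulr_ge0//; move: wl => /andP[]; lra.
  (* The first threshold strictly above w_i. As w'_i > w_i + d, it does not exceed w'_i. *)
  pose j := (Num.trunc ((w 0 i + l%:R) * l.+1%:R)).+1.
  have /andP[j1 j2] := truncn_itv x0; rewrite -/j in j2.
  have jJ : (j < J)%N.
    rewrite /j /J 2!ltnS -(ler_nat R) (le_trans j1)// natrM ler_wpM2r// natrM.
    by move: wl => /andP[]; lra.
  have kN : (pickle (i, l, j) < N)%N.
    by rewrite ltnS (@leq_bigmax _ (fun p : 'I_m * 'I_J => pickle (p.1, l, nat_of_ord p.2)) (i, Ordinal jJ)).
  have := code_bit kN cw; rewrite /bit pickleK.
  have -> : (- l%:R + j%:R / l.+1%:R <= w 0 i) = false.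
    apply/negbTE; rewrite -ltNge -ltrBlDl opprK ltr_pdivlMr//.
  have -> // : - l%:R + j%:R / l.+1%:R <= w' 0 i.
  rewrite -lerBrDl opprK ler_pdivrMr// /j -natr1 (le_trans (lerD j1 (lexx 1)))//.
  have : 1 <= d * l.+1%:R by rewrite -ler_pdivrMr// div1r.
  have : 0 < (l.+1%:R : R) by [].
  by move: hd; rewrite -subr_gt0 => hd hl h1; have := mulr_gt0 hd hl; nra.
exists N => w w' wr w'r cw.
rewrite [leLHS]/Num.norm/= mx_normrE; apply: bigmax_le; first exact: ltW.
move=> [i j] _ /=; rewrite (ord1 i) !mxE ler_norml; apply/andP; split.
  by rewrite lerNl opprB; exact: main.
by apply: main.
Qed.

End wcode.

Section young_basics.
Context (R : realType) (m : nat) (T : R).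
Local Notation leb := (@lebesgue_measure R).
Local Notation W := 'rV[R]_m.
Implicit Types nu : ymeasure R m.

Definition time : set (measurableTypeR R) := `[0, T]%classic.

Lemma measurable_time : measurable time. Proof. exact: measurable_itv. Qed.

Lemma measurable_stripT : measurable (@strip R m T).
Proof. by apply: measurableX => //; exact: measurable_time. Qed.

Lemma young_total nu : young_measure T nu -> nu setT = leb time.
Proof.
move=> [n0 nB]; rewrite -(nB _ measurable_time)//.
apply/eqP; rewrite eq_le; apply/andP; split; last first.
  apply: le_measure; rewrite ?inE//; exact: measurable_stripT.
have -> : setT = @strip R m T `|` ~` @strip R m T by rewrite setUv.
rewrite (le_trans (measureU2 _ _ _))//; [exact: measurable_stripT| |].
  by apply: measurableC; exact: measurable_stripT.
by rewrite [X in (_ + X)%E](n0 : nu (~` _) = 0%E) adde0.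
Qed.

Lemma young_fin nu A : young_measure T nu -> measurable A -> (nu A < +oo)%E.
Proof.
move=> yn mA; apply: (@le_lt_trans _ _ (nu setT)).
  by apply: le_measure; rewrite ?inE.
by rewrite young_total//; exact: leb_itv_fin.
Qed.

End young_basics.

(** The image of an ultrafilter is an ultrafilter, and one that contains the compact [0, M]
    converges in it. *)
Lemma ultra_limit (R : realType) (G : set_system nat) (u : nat -> R) M : UltraFilter G ->
  (forall j, 0 <= u j <= M) -> exists2 l : R, 0 <= l & u @ G --> l.
Proof.
move=> GU uM.
have UU : UltraFilter (u @ G).
  apply: Build_UltraFilter => H HF sub; apply/seteqP; split=> // A HA.
  have [//|GA] := in_ultra_setVsetC (u @^-1` A) GU.
  have GA' : (u @ G) (~` A) by exact: GA.
  have hAA := @filterI _ H _ _ _ HA (sub _ GA'); rewrite setICr in hAA.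
  by case: (@filter_not_empty _ _ HF); exact: hAA.
have hG : G (u @^-1` `[0, M]%classic).
  by apply: filterE => j /=; rewrite in_itv/= uM.
have := @segment_compact R 0 M; rewrite compact_ultra => /(_ _ UU)[//|l [/= + hl]].
by rewrite in_itv/= => /andP[l0 _]; exists l.
Qed.

Lemma filter_le (R : realType) (G : set_system nat) (u w : nat -> R) (l l' : R) :
  ProperFilter G -> u @ G --> l -> w @ G --> l' -> (forall j, u j <= w j) -> l <= l'.
Proof. by move=> GF ul wl uw; apply: (ler_cvg_to ul wl); exact: nearW. Qed.

Lemma filter_eq (R : realType) (G : set_system nat) (u : nat -> R) (l l' : R) :
  ProperFilter G -> u @ G --> l -> u @ G --> l' -> l = l'.
Proof. by move=> GF; exact: cvg_unique. Qed.

(** * Time densities of the limit masses of the cells *)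

Section limit_densities.
Context (R : realType) (m : nat) (T : R) (U : set 'rV[R]_m) (nus : nat -> ymeasure R m)
  (G : set_system nat) (u0 : 'rV[R]_m).
Local Notation leb := (@lebesgue_measure R).
Local Notation W := 'rV[R]_m.
Local Notation I := (time T).
Hypothesis GU : UltraFilter G.
Hypothesis cU : closed U.
Hypothesis Uu0 : U u0.
Hypothesis gnus : forall j, gen_control T U (nus j).

Let GF : ProperFilter G. Proof. exact: ultra_proper. Qed.

(** Cumulative in k: the successive values at a fixed level become the endpoints of the subintervals
    of [0, 1] from which a cell is selected. *)
Definition code_mass N k (B : set (measurableTypeR R)) j : R :=
  fine (nus j ((B `&` I) `*` [set w | (wcode N w < k)%N])).

Let mI := measurable_time T.

Let mB N k B : measurable B -> measurable ((B `&` I) `*` [set w : W | (wcode N w < k)%N]).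
Proof. by move=> hB; apply: measurableX; [exact: measurableI|exact: measurable_code]. Qed.

Let mass_fin j A : measurable A -> nus j A \is a fin_num.
Proof. by move=> mA; rewrite ge0_fin_numE//; have [yn _] := gnus j; exact: young_fin yn mA. Qed.

Let massK N k B j : measurable B ->
  (code_mass N k B j)%:E = nus j ((B `&` I) `*` [set w | (wcode N w < k)%N]).
Proof. by move=> hB; rewrite fineK// mass_fin//; exact: mB. Qed.

Let mass_total N k B j : measurable B -> ((code_mass N k B j)%:E <= leb (B `&` I))%E.
Proof.
move=> hB; rewrite massK//; have [[_ yB] _] := gnus j.
rewrite -yB; [|exact: measurableI|by move=> t []].
apply: le_measure; rewrite ?inE; [exact: mB|by apply: measurableX => //; exact: measurableI|].
by move=> p [? _].
Qed.

Let lebI_fin (B : set (measurableTypeR R)) : measurable B -> leb (B `&` I) \is a fin_num.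
Proof.
move=> hB; rewrite ge0_fin_numE//; apply: le_lt_trans (leb_itv_fin 0 T).
by apply: le_measure; rewrite ?inE//; exact: measurableI.
Qed.

Let mass_bound N k B j : measurable B -> 0 <= code_mass N k B j <= fine (leb (B `&` I)).
Proof.
by move=> hB; rewrite fine_ge0//= -lee_fin [X in (_ <= X)%E]fineK ?lebI_fin// mass_total.
Qed.

(* The absolute value only matters for non-measurable sets. *)
Definition limit_mass N k B : R := `|lim (code_mass N k B @ G)|.
Local Notation H := limit_mass.

Let HP N k B : measurable B -> code_mass N k B @ G --> H N k B.
Proof.
move=> hB; have [l l0 hl] := ultra_limit GU (fun j => mass_bound N k j hB).
rewrite /H; have -> : lim (code_mass N k B @ G) = l by apply: cvg_lim.
by rewrite ger0_norm.
Qed.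

Let H_le N k N' k' B : measurable B ->
  (forall j, code_mass N k B j <= code_mass N' k' B j) -> H N k B <= H N' k' B.
Proof. by move=> hB h; exact: (filter_le GF (@HP N k B hB) (@HP N' k' B hB)). Qed.

Let mass_mono N k k' B j : measurable B -> (k <= k')%N -> code_mass N k B j <= code_mass N k' B j.
Proof.
move=> hB kk'; rewrite -lee_fin !massK//; apply: le_measure; rewrite ?inE; try exact: mB.
by move=> p [? /= h]; split=> //=; exact: leq_trans kk'.
Qed.

(** The controls do not charge the complement of [0, T] x U, so a cell that misses U has no mass.
    This later keeps the selection inside U. *)
Let mass_empty N k B j : measurable B -> (forall u, U u -> wcode N u <> k) ->
  code_mass N k.+1 B j <= code_mass N k B j.
Proof.
move=> hB hk; rewrite -lee_fin !massK//; have [_ n0] := gnus j.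
have mN : measurable (~` (I `*` U)).
  by apply: measurableC; apply: measurableX => //; exact: closed_rV_measurable.
rewrite -[leRHS]adde0 -[X in (_ + X)%E]n0.
apply: le_trans (measureU2 _ _ _) => //; try exact: mB.
apply: le_measure; rewrite ?inE; [exact: mB|by apply: measurableU => //; exact: mB|].
move=> [t w] [/= [Bt It]]; rewrite ltnS leq_eqVlt => /predU1P[e|h]; last by left.
by right => -[_ /= Uw]; exact: (hk w).
Qed.

Let density N k : exists f : measurableTypeR R -> R,
  [/\ measurable_fun setT f, forall t, 0 <= f t, leb.-integrable setT (EFin \o f) &
    forall A, measurable A -> (H N k A)%:E = (\int[leb]_(t in A) (f t)%:E)%E].
Proof.
apply: (@exists_density R T) => [A|A B mA mB' AB|A mA]; first exact: normr_ge0.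
- apply: (filter_eq GF (@HP N k _ (measurableU _ _ mA mB'))).
  rewrite (_ : code_mass N k _ = fun j => code_mass N k A j + code_mass N k B j).
    by apply: cvgD; exact: HP.
  apply/funext => j; apply: EFin_inj; rewrite EFinD !massK//; last exact: measurableU.
  rewrite (_ : ((A `|` B) `&` I) `*` _ = (A `&` I) `*` [set w | (wcode N w < k)%N] `|`
      (B `&` I) `*` [set w | (wcode N w < k)%N]); last first.
    apply/seteqP; split=> [[t w] [[[At|Bt] It] h]|[t w] [[[At It] h]|[[Bt It] h]]].
    - by left.
    - by right.
    - by split => //; split => //; left.
    - by split => //; split => //; right.
  rewrite measureU//; try exact: mB.
  apply/seteqP; split=> // -[t w] [[[/= At _] _] [[/= Bt _] _]].
  by have : (A `&` B) t by []; rewrite AB.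
- rewrite -[leRHS](@fineK _ (leb (A `&` I))) ?lebI_fin// lee_fin.
  apply: (filter_le GF (@HP N k _ mA) (cvg_cst _)) => j.
  by have /andP[] := mass_bound N k j mA.
Qed.

(** The relations hold between masses on every measurable set of times, hence between densities
    almost everywhere; a modification on a null set makes them hold for every t, as the pointwise
    selection requires. *)
Lemma exists_limit_densities : exists F : nat -> nat -> measurableTypeR R -> R,
  [/\ forall N k, measurable_fun setT (F N k),
      forall N t, F N 0%N t = 0 /\ F N (2 ^ N)%N t = 1,
      forall N k t, F N.+1 k.*2 t = F N k t /\ F N k t <= F N k.+1 t,
      forall N k t, (forall u, U u -> wcode N u <> k) -> F N k.+1 t <= F N k t &
      forall N k B, measurable B -> B `<=` I ->
        code_mass N k B @ G --> fine (\int[leb]_(t in B) (F N k t)%:E)%E].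
Proof.
pose f N := projT1 (choice (density N)).
have hf N k : [/\ measurable_fun setT (f N k), forall t, 0 <= f N k t, leb.-integrable setT (EFin \o f N k) &
    forall A, measurable A -> (H N k A)%:E = (\int[leb]_(t in A) (f N k t)%:E)%E].
  exact: (projT2 (choice (density N)) k).
have mf N k : measurable_fun setT (f N k) by have [] := hf N k.
have fi N k : leb.-integrable setT (EFin \o f N k) by have [] := hf N k.
have fE N k A : measurable A -> (H N k A)%:E = (\int[leb]_(t in A) (f N k t)%:E)%E.
  by have [_ _ _] := hf N k; apply.
have ii : leb.-integrable setT (EFin \o (\1_I : _ -> R)).
  apply/integrableP; split; first by apply/measurable_EFinP; exact: measurable_indic.
  rewrite (@eq_integral _ _ _ leb setT (fun t => (\1_I t)%:E)) => [|t _]; last by rewrite /= ger0_norm.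
  by rewrite integral_indic// setIT; exact: leb_itv_fin.
have iE A : measurable A -> (\int[leb]_(t in A) (\1_I t)%:E)%E = leb (A `&` I).
  by move=> mA; rewrite integral_indic// setIC.
have zi : leb.-integrable setT (EFin \o (cst 0 : measurableTypeR R -> R)) by exact: integrable0.
have full N : [set w : W | (wcode N w < 2 ^ N)%N] = setT.
  by apply/seteqP; split=> // w _; exact: code_lt.
have fullE N A j : measurable A -> code_mass N (2 ^ N) A j = fine (leb (A `&` I)).
  move=> mA; rewrite /code_mass full; have [[_ yB] _] := gnus j.
  by rewrite yB//; do ?[exact: measurableI|move=> t []].
have HfullE N A : measurable A -> (H N (2 ^ N) A)%:E = leb (A `&` I).
  move=> mA; rewrite -[RHS]fineK ?lebI_fin//; congr EFin.
  apply: (filter_eq GF (@HP N (2 ^ N)%N _ mA)).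
  by under eq_cvg do rewrite fullE//; exact: cvg_cst.
pose good t N k := [/\ f N 0%N t <= 0, \1_I t <= f N (2 ^ N)%N t <= (\1_I t : R),
  f N.+1 k.*2 t = f N k t, f N k t <= f N k.+1 t &
  (forall u, U u -> wcode N u <> k) -> f N k.+1 t <= f N k t].
(* There are countably many relations, so a single null set covers all the exceptions. *)
have [N0 [mN0 N00 hN0]] : {ae leb, forall t, forall N k, good t N k}.
  apply: ae_foralln => N; apply: ae_foralln => k.
  have a1 : {ae leb, forall t, f N 0%N t <= 0}.
    apply: ae_le_density => // A mA; rewrite -fE// integral0 lee_fin.
    suff : code_mass N 0 A = cst 0.
      by move=> e; have := @HP N 0 _ mA; rewrite e => /(filter_eq GF (cvg_cst _)) <-.
    apply/funext => j; rewrite /code_mass (_ : _ `*` _ = set0) ?measure0//.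
    by apply/seteqP; split=> // p [].
  have a2 : {ae leb, forall t, \1_I t <= f N (2 ^ N)%N t}.
    by apply: ae_le_density => // A mA; rewrite iE// -fE// HfullE.
  have a3 : {ae leb, forall t, f N (2 ^ N)%N t <= \1_I t}.
    by apply: ae_le_density => // A mA; rewrite iE// -fE// HfullE.
  have e A : H N.+1 k.*2 A = H N k A.
    rewrite /H; congr (`|lim (_ @ G)|); apply/funext => j; rewrite /code_mass.
    congr (fine (nus j (_ `*` _))); apply/seteqP; split=> w /=; case: bit; lia.
  have a4 : {ae leb, forall t, f N.+1 k.*2 t <= f N k t}.
    by apply: ae_le_density => // A mA; rewrite -!fE// e.
  have a5 : {ae leb, forall t, f N k t <= f N.+1 k.*2 t}.
    by apply: ae_le_density => // A mA; rewrite -!fE// e.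
  have a6 : {ae leb, forall t, f N k t <= f N k.+1 t}.
    apply: ae_le_density => // A mA; rewrite -!fE// lee_fin; apply: H_le => // j.
    exact: mass_mono.
  have a7 : {ae leb, forall t, (forall u, U u -> wcode N u <> k) -> f N k.+1 t <= f N k t}.
    have [hk|hk] := pselect (forall u, U u -> wcode N u <> k); last first.
      by apply: nearW => t /hk.
    have : {ae leb, forall t, f N k.+1 t <= f N k t}.
      apply: ae_le_density => // A mA; rewrite -!fE// lee_fin; apply: H_le => // j.
      exact: mass_empty.
    by apply: filterS => t h _.
  have b1 : {ae leb, forall t, f N 0%N t <= 0 /\ \1_I t <= f N (2 ^ N)%N t <= (\1_I t : R)}.
    by move: a1 a2 a3; apply: filterS3 => t h1 h2 h3; split=> //; rewrite h2.
  have b2 : {ae leb, forall t, f N.+1 k.*2 t = f N k t /\ f N k t <= f N k.+1 t}.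
    by move: a4 a5 a6; apply: filterS3 => t h1 h2 h3; split=> //; apply/eqP; rewrite eq_le h1.
  by move: b1 b2 a7; apply: filterS3 => t [h1 h2] [h3 h4] h5.
pose D := I `\` N0.
have mD : measurable D by exact: measurableD.
have mDC := measurableC mD.
have goodD t : D t -> forall N k, good t N k.
  move=> [_ Nt]; apply: contrapT => h; apply: Nt; exact: hN0.
(* At the remaining times the densities of the Dirac mass at [u0] are used; they satisfy every
   relation because [u0] belongs to U. *)
pose F N k t : R := \1_D t * f N k t + \1_(~` D) t * ((wcode N u0 < k)%N)%:R.
have FD N k t : D t -> F N k t = f N k t.
  move=> Dt; rewrite /F !indicE mem_set// memNset ?mul1r ?mul0r ?addr0//.
have FnD N k t : ~ D t -> F N k t = ((wcode N u0 < k)%N)%:R.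
  by move=> Dt; rewrite /F !indicE memNset// mem_set// mul1r mul0r add0r.
exists F; split.
- by move=> N k; apply: measurable_funD; apply: measurable_funM => //; exact: measurable_indic.
- move=> N t; have [Dt|Dt] := pselect (D t); last by rewrite !FnD// ltn0 code_lt.
  rewrite !FD//; have [h1 h2 _ _ _] := goodD t Dt N 0%N.
  have [_ f0 _ _] := hf N 0%N.
  split; first by apply/eqP; rewrite eq_le h1 f0.
  move: h2; rewrite indicE mem_set; last by case: Dt.
  by move=> ?; apply/eqP; rewrite eq_le andbC.
- move=> N k t; have [Dt|Dt] := pselect (D t).
    by rewrite !FD//; have [_ _ h3 h4 _] := goodD t Dt N k.
  rewrite !FnD//; split; last by rewrite ler_nat; case: (ltnP _ k) => // h; rewrite ltnS (ltnW h).
  by congr (_%:R); rewrite /=; case: bit; lia.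
- move=> N k t hk; have [Dt|Dt] := pselect (D t).
    by rewrite !FD//; have [_ _ _ _] := goodD t Dt N k; apply.
  have hne := hk _ Uu0; rewrite !FnD// ler_nat ltnS.
  by case: (ltngtP (wcode N u0) k) hne => // ->.
- move=> N k B hB BI; rewrite (_ : fine _ = H N k B); first exact: HP.
  apply: EFin_inj; rewrite fE//; rewrite (@ae_eq_integral _ _ _ leb B (EFin \o f N k))//.
  + by rewrite fineK// -fE.
  + apply/measurable_EFinP; apply: measurable_funTS.
    by apply: measurable_funD; apply: measurable_funM => //; exact: measurable_indic.
  + by apply/measurable_EFinP; exact: measurable_funTS.
  + exists N0; split=> // t /= h; apply: contrapT => Nt; apply: h => Bt.
    by rewrite /= FD//; split => //; exact: BI.
Qed.

End limit_densities.

Lemma exists_unit_probability (R : realType) : exists P : probability (measurableTypeR R) R,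
  forall A, P A = lebesgue_measure (A `&` `[0, 1[%classic).
Proof.
pose D : set (measurableTypeR R) := `[0, 1[%classic.
have mD : measurable D by exact: measurable_itv.
have [|P PE] := @exists_probability _ (measurableTypeR R) R (mrestr lebesgue_measure mD); last first.
  by exists P => A; rewrite PE.
split; [exact: measure0|by move=> A; exact: measure_ge0|exact: measure_semi_sigma_additive|].
have := @lebesgue_measure_itv R `[0, 1[; rewrite /= lte_fin ltr01 sube0 => <-.
by rewrite /mrestr setTI.
Qed.

(** * Measurable selection of controls with the limit law *)

Section selector.
Context (R : realType) (m : nat) (T : R) (U : set 'rV[R]_m) (u0 : 'rV[R]_m)
  (P : probability (measurableTypeR R) R)
  (F : nat -> nat -> measurableTypeR R -> R).
Local Notation leb := (@lebesgue_measure R).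
Local Notation W := 'rV[R]_m.
Local Notation I := (time T).
Hypothesis kU : compact U.
Hypothesis Uu0 : U u0.
Hypothesis PE : forall A, P A = leb (A `&` `[0, 1[%classic).
Hypothesis mF : forall N k, measurable_fun setT (F N k).
Hypothesis Fend : forall N t, F N 0%N t = 0 /\ F N (2 ^ N)%N t = 1.
Hypothesis Fstep : forall N k t, F N.+1 k.*2 t = F N k t /\ F N k t <= F N k.+1 t.
Hypothesis Fempty : forall N k t, (forall u, U u -> wcode N u <> k) -> F N k.+1 t <= F N k t.

Let cU : closed U. Proof. by apply: compact_closed => //; exact: norm_hausdorff. Qed.

Let D01 : set (measurableTypeR R) := `[0, 1[%classic.
Let mD01 : measurable D01. Proof. exact: measurable_itv. Qed.

(** Values outside [0, 1[ are sent to 0, so that every parameter falls into exactly one subinterval;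
    P does not charge them. *)
Definition clamp (s : measurableTypeR R) : R := s * \1_D01 s.

Lemma clamp_id s : D01 s -> clamp s = s.
Proof. by move=> h; rewrite /clamp indicE mem_set// mulr1. Qed.

Lemma clamp01 s : 0 <= clamp s < 1.
Proof.
have [h|h] := pselect (D01 s); first by rewrite clamp_id//; move: h; rewrite /D01/= in_itv.
by rewrite /clamp indicE memNset// mulr0 lexx ltr01.
Qed.

Lemma measurable_clamp : measurable_fun setT clamp.
Proof. by apply: measurable_funM => //; exact: measurable_indic. Qed.

Lemma densities_mono N j k t : (j <= k)%N -> F N j t <= F N k t.
Proof.
move=> /subnKC <-; elim: (k - j)%N => [|i IH]; first by rewrite addn0.
by rewrite addnS (le_trans IH)//; have [] := Fstep N (j + i) t.
Qed.

Definition selected N k (p : measurableTypeR R * measurableTypeR R) : bool :=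
  F N k p.1 <= clamp p.2 < F N k.+1 p.1.

Lemma selected_exists N p : exists k, (k < 2 ^ N)%N && selected N k p.
Proof.
have /andP[s0 s1] := clamp01 p.2; have N0 : (0 < 2 ^ N)%N by rewrite expn_gt0.
have ex : exists k, clamp p.2 < F N k.+1 p.1.
  by exists (2 ^ N).-1; rewrite prednK// (Fend N p.1).2.
case: (ex_minnP ex) => k hk kmin; exists k.
rewrite /selected hk andbT; apply/andP; split.
  by rewrite -ltnS -(prednK N0) !ltnS; apply: kmin; rewrite prednK// (Fend N p.1).2.
case: k hk kmin => [|k] hk kmin; first by rewrite (Fend N p.1).1.
by rewrite leNgt; apply/negP => /kmin; rewrite ltnn.
Qed.

Lemma selected_unique N k k' p : selected N k p -> selected N k' p -> k = k'.
Proof.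
move=> /andP[h1 h2] /andP[h3 h4]; apply/eqP; rewrite eqn_leq; apply/andP; split.
  rewrite leqNgt; apply/negP => /(densities_mono N p.1) h.
  by have := lt_le_trans h4 (le_trans h h1); rewrite ltxx.
rewrite leqNgt; apply/negP => /(densities_mono N p.1) h.
by have := lt_le_trans h2 (le_trans h h3); rewrite ltxx.
Qed.

Definition cell N p : nat := projT1 (cid (selected_exists N p)).

Lemma cell_lt N p : (cell N p < 2 ^ N)%N.
Proof. by rewrite /cell; case: cid => k /= /andP[]. Qed.

Lemma selected_cell N p : selected N (cell N p) p.
Proof. by rewrite /cell; case: cid => k /= /andP[]. Qed.

Lemma selected_sum N (a : nat -> R) p : \sum_(k < 2 ^ N) (selected N k p)%:R * a k = a (cell N p).
Proof.
rewrite (bigD1 (Ordinal (cell_lt N p)))//= selected_cell mul1r big1 ?addr0// => k kc.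
case: (boolP (selected N k p)) => [h|_]; last by rewrite mul0r.
case/eqP: kc; apply: val_inj; exact: (selected_unique h (selected_cell N p)).
Qed.

(** The default [u0] is taken only for cells without a point of U, which are never selected. *)
Definition representative N k : W := xget u0 [set u | U u /\ wcode N u = k].

Lemma representative_in N k : U (representative N k).
Proof.
rewrite /representative; case: xgetP => [u _ []//|].
by [].
Qed.

Lemma representative_code N u : U u -> wcode N (representative N (wcode N u)) = wcode N u.
Proof.
move=> Uu; rewrite /representative; case: xgetP => [w _ []//|/(_ u)].
by case; split.
Qed.

Definition approx_selector N p : W := representative N (cell N p).

(** The subinterval of a cell that misses U is empty by [Fempty], so the selected cell meets U and
    its representative really lies in it. *)
Lemma approx_code N p : wcode N (approx_selector N p) = cell N p.
Proof.
have [[u [Uu e]]|h] := pselect (exists u, U u /\ wcode N u = cell N p).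
  by rewrite /approx_selector -e representative_code.
have /andP[h1 h2] := selected_cell N p.
have : F N (cell N p).+1 p.1 <= F N (cell N p) p.1.
  by apply: Fempty => u Uu e; apply: h; exists u.
by move=> h3; have := lt_le_trans h2 (le_trans h3 h1); rewrite ltxx.
Qed.

(** Since F (N + 1) (2k) = F N k, the subintervals of level N + 1 refine those of level N, and the
    selected cells are nested. *)
Lemma cell_half N p : (cell N.+1 p)./2 = cell N p.
Proof.
apply: (@selected_unique N _ _ p); last exact: selected_cell.
set k := cell N.+1 p; have /andP[h1 h2] := selected_cell N.+1 p.
rewrite /selected -(Fstep N k./2 p.1).1 -(Fstep N k./2.+1 p.1).1; apply/andP; split.
  by apply: le_trans h1; apply: densities_mono; rewrite /k; lia.
by apply: (lt_le_trans h2); apply: densities_mono; rewrite /k; lia.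
Qed.

Lemma approx_code_le N N' p : (N <= N')%N -> wcode N (approx_selector N' p) = wcode N (approx_selector N p).
Proof.
move=> /subnKC <-; elim: (N' - N)%N => [|i IH]; first by rewrite addn0.
rewrite addnS -IH; apply: (code_anti (leq_addr i N)).
by rewrite -code_half !approx_code cell_half.
Qed.

Lemma code_level d : 0 < d -> exists N, forall u u', U u -> U u' ->
  wcode N u = wcode N u' -> `|u - u'| <= d.
Proof.
move=> d0; have [r r0 hr] := compact_enorm_bounded kU.
have [N hN] := @code_diam R m r d d0; exists N => u u' Uu Uu'.
by apply: hN; apply: (le_trans (norm_le_enorm _)); exact: hr.
Qed.

Definition selector p : W := lim (approx_selector N p @[N --> \oo]).

(** The selected cells are nested and their traces on the compact U have diameter tending to 0, so
    the representatives form a Cauchy sequence. *)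
Lemma selector_cvg p : approx_selector N p @[N --> \oo] --> selector p.
Proof.
apply/cvg_ex; exists (selector p); apply: cauchy_cvg; apply: cauchy_exP => e e0.
have e2 : 0 < e / 2 by rewrite divr_gt0.
have [N hN] := code_level e2; exists (approx_selector N p); exists N => // N' /= NN'.
rewrite -ball_normE/= (@le_lt_trans _ _ (e / 2))//; last by rewrite ltr_pdivrMr// ltr_pMr// ltr1n.
apply: hN; [exact: representative_in|exact: representative_in|].
by rewrite approx_code_le.
Qed.

Lemma selector_in p : U (selector p).
Proof.
apply: (@closed_cvg _ _ _ eventually_filter (approx_selector ^~ p) U cU); last exact: selector_cvg.
by apply: nearW => N; exact: representative_in.
Qed.

Lemma uniform_level d : 0 < d -> exists N,
  (forall u u', U u -> U u' -> wcode N u = wcode N u' -> `|u - u'| <= d) /\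
  forall p, `|approx_selector N p - selector p| <= d.
Proof.
move=> d0; have [N hN] := code_level d0; exists N; split=> // p.
have c : `|approx_selector N p - approx_selector N' p| @[N' --> \oo] --> `|approx_selector N p - selector p|.
  by apply: cvg_norm; apply: cvgB; [exact: cvg_cst|exact: selector_cvg].
apply: (ler_cvg_to c (cvg_cst d)); exists N => // N' /= NN'.
by apply: hN; [exact: representative_in|exact: representative_in|rewrite approx_code_le].
Qed.

Lemma measurable_selected N k : measurable_fun setT (fun p => selected N k p).
Proof.
have mc : measurable_fun setT (fun p : measurableTypeR R * measurableTypeR R => clamp p.2).
  by apply: measurableT_comp; [exact: measurable_clamp|exact: measurable_snd].
have mf j : measurable_fun setT (fun p : measurableTypeR R * measurableTypeR R => F N j p.1).
  by apply: measurableT_comp => //; exact: measurable_fst.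
by apply: measurable_and; [exact: measurable_fun_ler|exact: measurable_fun_ltr].
Qed.

Lemma measurable_approx N (h : W -> R) : measurable_fun setT (fun p => h (approx_selector N p)).
Proof.
rewrite (_ : (fun _ => _) = fun p => \sum_(k < 2 ^ N) (selected N k p)%:R * h (representative N k)).
  apply: measurable_sum => k; apply: measurable_funM => //.
  rewrite (_ : (fun _ => _) = \1_[set p | selected N k p] :> (_ -> R)).
    apply: measurable_indic; rewrite -[X in measurable X]setTI.
    by have := @measurable_selected N k; move=> /(_ measurableT [set true]); exact.
  by apply/funext => p; rewrite indicE; congr ((nat_of_bool _)%:R); apply/idP/idP; rewrite inE.
by apply/funext => p; rewrite (selected_sum N (fun k => h (representative N k))).
Qed.

Lemma measurable_selector : measurable_fun setT selector.
Proof.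
apply: measurable_fun_rV => i.
apply: (@measurable_fun_cvg _ _ _ _ (fun N p => approx_selector N p 0 i)) => [N|p _].
  exact: (measurable_approx N (fun w => w 0 i)).
exact: (cvg_comp _ _ (selector_cvg (p := p)) (@coord_continuous R _ _ 0 i _)).
Qed.

Lemma measurable_selector_at t : measurable_fun setT (fun s => selector (t, s)).
Proof. by apply: measurableT_comp; [exact: measurable_selector|exact: measurable_pair1]. Qed.

Lemma selected_probability N k t : P [set s | selected N k (t, s)] = (F N k.+1 t - F N k t)%:E.
Proof.
have h1 := (Fstep N k t).2.
have hF j : (j <= 2 ^ N)%N -> 0 <= F N j t <= 1.
  by move=> jN; rewrite -{1}(Fend N t).1 -(Fend N t).2 !densities_mono.
rewrite PE; have [kN|kN] := ltnP k (2 ^ N); last first.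
  have e : F N k.+1 t <= F N k t.
    by apply: Fempty => u _ e; have := @code_lt R m N u; rewrite e ltnNge kN.
  rewrite (_ : _ `&` _ = set0) ?measure0.
    by congr EFin; apply/esym/eqP; rewrite subr_eq0 eq_le e h1.
  apply/seteqP; split=> // s [/= /andP[a b] _].
  by have := lt_le_trans b (le_trans e a); rewrite ltxx.
have -> : [set s | selected N k (t, s)] `&` `[0, 1[%classic = `[F N k t, F N k.+1 t[%classic.
  have /andP[a1 a2] := hF _ (ltnW kN); have /andP[a3 a4] := hF _ kN.
  apply/seteqP; split=> s /=.
    by move=> [+ hs]; rewrite /selected/= clamp_id// in_itv.
  rewrite in_itv/= => /andP[b1 b2].
  have hs : D01 s by rewrite /D01/= in_itv/= (le_trans a1 b1)//= (lt_le_trans b2).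
  by split=> //; rewrite /selected/= clamp_id// b1.
rewrite lebesgue_measure_itv/= lte_fin; move: h1; rewrite le_eqVlt => /predU1P[->|->//].
by rewrite ltxx subrr.
Qed.

Definition selector_kernel (t : measurableTypeR R) : {measure set W -> \bar R} :=
  image_measure P (measurable_selector_at t).

Let selector_kernel_measurable A : measurable A ->
  measurable_fun setT (fun t => selector_kernel t A).
Proof.
move=> mA; pose E := selector @^-1` A.
have mE : measurable E by rewrite -[E]setTI; exact: measurable_selector.
rewrite (_ : (fun _ => _) = fun t => P (xsection E t)); first exact: measurable_fun_xsection.
apply/funext => t; rewrite /selector_kernel/= /image_measure; congr (P _).
by apply/seteqP; split=> s; rewrite /xsection/= inE.
Qed.

HB.instance Definition _ := isKernel.Build _ _ _ _ R selector_kernel selector_kernel_measurable.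

Let selector_kernel_prob t : selector_kernel t setT = 1%E.
Proof. by rewrite /selector_kernel/= /image_measure preimage_setT probability_setT. Qed.

HB.instance Definition _ := Kernel_isProbability.Build _ _ _ _ R selector_kernel selector_kernel_prob.

Definition selector_pker : R.-pker measurableTypeR R ~> W := selector_kernel.

Let Ioo : (leb I < +oo)%E. Proof. exact: leb_itv_fin. Qed.

Let lebI : {finite_measure set (measurableTypeR R) -> \bar R} :=
  mfrestr (measurable_time T) Ioo.

Let lebIE A : lebI A = leb (A `&` I). Proof. by []. Qed.

Let graph (p : measurableTypeR R * measurableTypeR R) : measurableTypeR R * W := (p.1, selector p).

Let measurable_graph : measurable_fun setT graph.
Proof. by apply: measurable_fun_pair; [exact: measurable_fst|exact: measurable_selector]. Qed.

(** As the image of Lebesgue measure on [0, T] times P under (t, s) |-> (t, selector (t, s)), it is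
    disintegrated by the theorems of Tonelli and Fubini. *)
Definition selector_young : ymeasure R m := image_measure (lebI \x P)%E measurable_graph.

Lemma selector_young_measure : gen_control T U selector_young.
Proof.
have out : selector_young (~` (I `*` U)) = 0%E.
  rewrite /selector_young/= /image_measure.
  rewrite (_ : _ @^-1` _ = ~` I `*` setT).
    rewrite product_measure1E//; last by apply: measurableC; exact: measurable_time.
    have e0 : lebI (~` I) = 0%E by rewrite [LHS]lebIE setICl measure0.
    by rewrite [X in (X * _)%E]e0 mul0e.
  apply/seteqP; split=> [[t s] /= h|[t s] /= [h _] [h' _]//].
  by split=> // It; apply: h; split=> //; exact: selector_in.
split=> //; split.
  apply/eqP; rewrite eq_le measure_ge0 andbT -out; apply: le_measure; rewrite ?inE.
  - by apply: measurableC; exact: measurable_stripT.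
  - apply: measurableC; apply: measurableX; [exact: measurable_time|exact: closed_rV_measurable].
  - by move=> [t w] /= h [It _]; apply: h.
move=> B mB BI; rewrite /selector_young/= /image_measure (_ : _ @^-1` _ = B `*` setT).
  have eP : P setT = 1%E := probability_setT P.
  by rewrite product_measure1E// [X in (_ * X)%E]eP mule1 [LHS]lebIE setIidl.
by apply/seteqP; split=> -[t s].
Qed.

Lemma selector_young_ge0 (f : measurableTypeR R * W -> \bar R) : measurable_fun setT f ->
  (forall p, 0 <= f p)%E ->
  measurable_fun setT (fun t => \int[selector_kernel t]_w f (t, w))%E /\
  (\int[selector_young]_p f p = \int[leb]_(t in I) \int[selector_kernel t]_w f (t, w))%E.
Proof.
move=> mf f0.
have kE t : (\int[selector_kernel t]_w f (t, w) = fubini_F P (f \o graph) t)%E.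
  rewrite /fubini_F/=; apply: (@ge0_integral_image _ _ _ _ R P _ (measurable_selector_at t)
    (fun w => f (t, w))) => //.
  by apply: measurableT_comp => //; exact: measurable_pair1.
have mfg : measurable_fun setT (f \o graph) by exact: measurableT_comp.
have mk : measurable_fun setT (fun t => \int[selector_kernel t]_w f (t, w))%E.
  rewrite (_ : (fun t => _) = fubini_F P (f \o graph)); last by apply/funext => t; exact: kE.
  by apply: measurable_fun_fubini_tonelli_F => // p; exact: f0.
have g0 t : setT t -> (0 <= fubini_F P (fun z => f (graph z)) t)%E.
  by move=> _; apply: integral_ge0 => s _; exact: f0.
have mg : measurable_fun setT (fubini_F P (fun z => f (graph z))).
  by apply: measurable_fun_fubini_tonelli_F => // p; exact: f0.
have mIC : measurable (~` I) by apply: measurableC; exact: measurable_time.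
have e0 : lebI (~` I) = 0%E by rewrite [LHS]lebIE setICl measure0.
split=> //; rewrite (ge0_integral_image (lebI \x P)%E measurable_graph)// fubini_tonelli1//.
rewrite (@ge0_negligible_integral _ _ R lebI setT (~` I))//.
rewrite setDE setCK setTI.
rewrite (@eq_measure_integral _ _ R I leb); last first.
  by move=> A mA AI; rewrite [LHS]lebIE setIidl.
by apply: eq_integral => t _; rewrite kE.
Qed.

Lemma selector_disintegration : disintegration T selector_young selector_pker.
Proof.
have main (f : measurableTypeR R * W -> \bar R) : measurable_fun (@strip R m T) f ->
    (forall p, 0 <= f p)%E ->
    measurable_fun I (fun t => \int[selector_kernel t]_w f (t, w))%E /\
    (\int[selector_young]_(p in @strip R m T) f p =
     \int[leb]_(t in I) \int[selector_kernel t]_w f (t, w))%E.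
  move=> mf f0.
  have [||mk E] := @selector_young_ge0 (f \_ (@strip R m T)).
  - by apply: (proj1 (measurable_restrictT _ _)) => //; exact: measurable_stripT.
  - by move=> p; rewrite patchE; case: ifP.
  have e t : I t -> (fun w => (f \_ (@strip R m T)) (t, w)) = (fun w => f (t, w)).
    by move=> It; apply/funext => w; rewrite patchE mem_set.
  split.
    apply: eq_measurable_fun (measurable_funTS mk) => t; rewrite inE => It.
    by rewrite -(e t It).
  rewrite integral_mkcond E; apply: eq_integral => t; rewrite inE => It.
  by rewrite -(e t It).
move=> psi ipsi; have mpsi := measurable_int _ ipsi.
have [m1 e1] := main _ (measurable_funepos mpsi) (fun p => funepos_ge0 _ p).
have [m2 e2] := main _ (measurable_funeneg mpsi) (fun p => funeneg_ge0 _ p).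
have f1 := integral_funepos_lt_pinfty (@measurable_stripT R m T) ipsi; have f2 := integral_funeneg_lt_pinfty (@measurable_stripT R m T) ipsi.
rewrite integralE e1 e2 -integralB.
- apply: eq_integral => t _.
  rewrite [RHS]integralE.
  change (selector_pker t) with (selector_kernel t).
  congr (_ - _)%E.
    by apply: eq_integral => w _; rewrite !funeposE.
  by apply: eq_integral => w _; rewrite !funenegE.
- exact: measurable_time.
- apply/integrableP; split=> //; rewrite e1 in f1.
  rewrite (@eq_integral _ _ _ leb I (fun t => \int[selector_kernel t]_w (EFin \o psi)^\+ (t, w))%E)//.
  by move=> t _; rewrite gee0_abs//; apply: integral_ge0.
- apply/integrableP; split=> //; rewrite e2 in f2.
  rewrite (@eq_integral _ _ _ leb I (fun t => \int[selector_kernel t]_w (EFin \o psi)^\- (t, w))%E)//.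
  by move=> t _; rewrite gee0_abs//; apply: integral_ge0.
Qed.

Lemma selector_young_Rint (phi : measurableTypeR R * W -> R) M : measurable_fun setT phi ->
  (forall p, `|phi p| <= M) ->
  \int[selector_young]_(p in @strip R m T) phi p =
  \int[leb]_(t in I) \int[P]_s phi (t, selector (t, s)).
Proof.
move=> mphi bphi.
have pE : graph @^-1` @strip R m T = I `*` setT by apply/seteqP; split=> -[t s].
have fin1 : ((lebI \x P)%E (graph @^-1` @strip R m T) < +oo)%E.
  rewrite pE product_measure1E//; last exact: measurable_time.
  have eP : P setT = 1%E := probability_setT P.
  by rewrite [X in (_ * X)%E]eP mule1 [X in (X < _)%E]lebIE setIid.
have bm : bmeas selector_young (@strip R m T) phi.
  split; [exact: measurable_stripT|exact: fin1|exact: measurable_funTS|by exists M].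
have [_ ->] := @Rint_image _ _ _ _ R (lebI \x P)%E graph measurable_graph (@strip R m T) phi
  (@measurable_stripT R m T) fin1 bm.
rewrite pE; pose psi t s := phi (graph (t, s)).
transitivity (\int[(lebI \x P)%E]_(p in I `*` setT) psi p.1 p.2).
  by apply: eq_Rintegral => -[t s] _.
rewrite (@Rint_prod _ _ _ _ R lebI P I setT psi M)//.
- rewrite /Rintegral (@eq_measure_integral _ _ R I leb)// => A mA AI.
  by rewrite [LHS]lebIE setIidl.
- exact: measurable_time.
- by rewrite [X in (X < _)%E]lebIE setIid.
- by rewrite ltey_eq fin_num_measure.
- apply: measurable_funTS; apply: (measurableT_comp mphi).
  by rewrite (_ : (fun _ => _) = graph)//; apply/funext => -[].
- by move=> t s _ _; exact: bphi.
Qed.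

End selector.

Section control_integrals.
Context (R : realType) (m : nat) (T : R) (U : set 'rV[R]_m).
Local Notation W := 'rV[R]_m.
Local Notation I := (time T).
Local Notation leb := (@lebesgue_measure R).
Hypothesis cU : closed U.
Implicit Types (nu : ymeasure R m) (phi : measurableTypeR R * W -> R).

Lemma measurable_timeU : measurable (I `*` U).
Proof. by apply: measurableX; [exact: measurable_time|exact: closed_rV_measurable]. Qed.

Lemma bmeas_control nu D phi M : gen_control T U nu -> measurable D -> measurable_fun D phi ->
  (forall p, D p -> `|phi p| <= M) -> bmeas nu D phi.
Proof.
by move=> [yn _] mD mphi bphi; split=> //; [exact: young_fin yn mD|exists M].
Qed.

Lemma control_strip nu phi M : gen_control T U nu -> measurable_fun (@strip R m T) phi ->
  (forall p, (@strip R m T) p -> `|phi p| <= M) ->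
  \int[nu]_(p in @strip R m T) phi p = \int[nu]_(p in I `*` U) phi p.
Proof.
move=> gn mphi bphi; have [_ n0] := gn.
have mN : measurable (~` (I `*` U)) by apply: measurableC; exact: measurable_timeU.
have -> : I `*` U = @strip R m T `\` ~` (I `*` U).
  apply/seteqP; split=> [[t w] [It Uw]|[t w] [_ h]]; last exact: contrapT.
  by split; [split|move=> h; apply: h].
rewrite /Rintegral; congr fine; apply: negligible_integral => //.
- exact: measurable_stripT.
- apply: bmeas_integrable; exact: (bmeas_control gn (@measurable_stripT R m T) mphi bphi).
Qed.

Lemma control_gap nu (phi psi : measurableTypeR R * W -> R) M (e : R) : gen_control T U nu ->
  measurable_fun (@strip R m T) phi -> measurable_fun (@strip R m T) psi ->
  (forall p, (@strip R m T) p -> `|phi p| <= M) -> (forall p, (@strip R m T) p -> `|psi p| <= M) ->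
  (forall p, I p.1 -> U p.2 -> `|phi p - psi p| <= e) -> 0 <= e ->
  `|\int[nu]_(p in @strip R m T) phi p - \int[nu]_(p in @strip R m T) psi p| <= e * fine (leb I).
Proof.
move=> gn m1 m2 b1 b2 h e0; rewrite (control_strip gn m1 b1) (control_strip gn m2 b2).
have sub : I `*` U `<=` @strip R m T by move=> p [].
have c1 : bmeas nu (I `*` U) phi.
  by apply: bmeasS (bmeas_control gn (@measurable_stripT R m T) m1 b1) => //; exact: measurable_timeU.
have c2 : bmeas nu (I `*` U) psi.
  by apply: bmeasS (bmeas_control gn (@measurable_stripT R m T) m2 b2) => //; exact: measurable_timeU.
rewrite -RintB// (le_trans (le_normr_bound (bmeasB c1 c2) (fun p hp => h p hp.1 hp.2)))//.
rewrite ler_wpM2l//; have [yn _] := gn.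
have f1 := young_fin yn measurable_timeU; have f2 := leb_itv_fin (0 : R) T.
apply: fine_le; [by rewrite ge0_fin_numE|by rewrite ge0_fin_numE|].
rewrite -(young_total yn); apply: le_measure; rewrite ?inE//; exact: measurable_timeU.
Qed.

End control_integrals.

(** The three-epsilon argument along a filter: the approximants may change with e, provided that
    they approximate uniformly in j. *)
Lemma approximated_cvg (R : realType) (G : set_system nat) (a : nat -> R) (l : R) : Filter G ->
  (forall e, 0 < e -> exists (S : nat -> R) (s : R),
    [/\ forall j, `|a j - S j| <= e, S @ G --> s & `|l - s| <= e]) -> a @ G --> l.
Proof.
move=> GF h; apply/cvgrPdist_le => e e0.
have e3 : 0 < e / 3 by rewrite divr_gt0.
have [S [s [h1 /cvgrPdist_le/(_ _ e3) h2 h3]]] := h _ e3.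
apply: filterS h2 => j h2.
have h1j := h1 j; rewrite distrC in h1j.
have q1 := ler_distD s l (a j); have q2 := ler_distD (S j) s (a j); lra.
Qed.

Lemma filter_sum (R : realType) (G : set_system nat) n (f : nat -> nat -> R) (a : nat -> R) :
  Filter G -> (forall k, f k @ G --> a k) ->
  \sum_(k < n) f k j @[j --> G] --> \sum_(k < n) a k.
Proof.
move=> GF fa; elim: n => [|n IH].
  by rewrite big_ord0; under eq_cvg do rewrite big_ord0; exact: cvg_cst.
by rewrite big_ord_recr; under eq_cvg do rewrite big_ord_recr; exact: cvgD.
Qed.

(** * Convergence of the controls to the constructed limit *)

Section young_limit.
Context (R : realType) (m : nat) (T : R) (U : set 'rV[R]_m) (nus : nat -> ymeasure R m)
  (G : set_system nat) (u0 : 'rV[R]_m).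
Local Notation leb := (@lebesgue_measure R).
Local Notation W := 'rV[R]_m.
Local Notation I := (time T).
Hypothesis GU : UltraFilter G.
Hypothesis kU : compact U.
Hypothesis Uu0 : U u0.
Hypothesis gnus : forall j, gen_control T U (nus j).

Let GF : ProperFilter G. Proof. exact: ultra_proper. Qed.
Let cU : closed U. Proof. by apply: compact_closed => //; exact: norm_hausdorff. Qed.

Variables (P : probability (measurableTypeR R) R) (F : nat -> nat -> measurableTypeR R -> R).
Hypothesis PE : forall A, P A = leb (A `&` `[0, 1[%classic).
Hypothesis mF : forall N k, measurable_fun setT (F N k).
Hypothesis Fend : forall N t, F N 0%N t = 0 /\ F N (2 ^ N)%N t = 1.
Hypothesis Fstep : forall N k t, F N.+1 k.*2 t = F N k t /\ F N k t <= F N k.+1 t.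
Hypothesis Fempty : forall N k t, (forall u, U u -> wcode N u <> k) -> F N k.+1 t <= F N k t.
Hypothesis FE : forall N k B, measurable B -> B `<=` I ->
  code_mass T nus N k B @ G --> fine (\int[leb]_(t in B) (F N k t)%:E)%E.

Local Notation nu := (selector_young T P kU Uu0 mF Fend Fstep Fempty).
Local Notation rep := (representative U u0).

Variables (B : set (measurableTypeR R)) (g : W -> R) (M : R).
Hypothesis mB : measurable B.
Hypothesis BI : B `<=` I.
Hypothesis cg : continuous g.
Hypothesis gM : forall w, `|g w| <= M.

Let mg : measurable_fun setT g. Proof. exact: continuous_measurable_rV. Qed.

Let phi (p : measurableTypeR R * W) : R := \1_B p.1 * g p.2.
(** Freezes g at the representative of the cell: uniformly close to [phi] on U when the cells are
    small, and with integral a finite combination of code masses. *)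
Let step_phi N (p : measurableTypeR R * W) : R := \1_B p.1 * g (rep N (wcode N p.2)).

Let ind_le1 (A : set (measurableTypeR R)) t x : `|x| <= M -> `|\1_A t * x| <= M.
Proof.
move=> xM; rewrite indicE; case: (t \in A); first by rewrite mul1r.
by rewrite mul0r normr0 (le_trans _ xM).
Qed.

Let phiM p : `|phi p| <= M. Proof. exact: ind_le1. Qed.

Let mphi : measurable_fun setT phi.
Proof.
apply: measurable_funM; last by apply: measurableT_comp => //; exact: measurable_snd.
by apply: measurableT_comp; [exact: measurable_indic|exact: measurable_fst].
Qed.

Let code_eq N k : measurable [set w : W | wcode N w == k].
Proof.
rewrite (_ : mkset _ = [set w | (wcode N w < k.+1)%N] `\` [set w | (wcode N w < k)%N]).
  by apply: measurableD; exact: measurable_code.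
apply/seteqP; split=> w /=; first by move=> /eqP ->; split=> //; rewrite ltnn.
by rewrite ltnS leq_eqVlt => -[/orP[//|? /(_ _)]]; case.
Qed.

Let step_phiE N p : step_phi N p =
  \sum_(k < 2 ^ N) g (rep N k) * \1_(B `*` [set w : W | wcode N w == k]) p.
Proof.
rewrite (bigD1 (Ordinal (code_lt N p.2)))//= big1 ?addr0 => [|k kc].
  rewrite /step_phi mulrC; congr (_ * _); rewrite !indicE; congr ((nat_of_bool _)%:R).
  by apply/idP/idP; rewrite !inE; [move=> h; split => //=|case].
rewrite indicE memNset ?mulr0// => -[_ /= /eqP h]; case/eqP: kc.
exact/val_inj.
Qed.

Let mass_cell N k j : fine (nus j (B `*` [set w | wcode N w == k])) =
  code_mass T nus N k.+1 B j - code_mass T nus N k B j.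
Proof.
have fin A : measurable A -> nus j A \is a fin_num.
  by move=> mA; rewrite ge0_fin_numE//; have [yn _] := gnus j; exact: young_fin yn mA.
have m1 : measurable (B `*` [set w : W | wcode N w == k]) by exact: measurableX.
have m2 : measurable (B `*` [set w : W | (wcode N w < k)%N]).
  by apply: measurableX => //; exact: measurable_code.
apply/eqP; rewrite -subr_eq0 opprB addrA subr_eq0; apply/eqP.
rewrite /code_mass setIidl// -fineD ?fin// -measureU//.
  congr (fine (nus j _)); apply/seteqP; split=> -[t w] /=.
    by move=> [[Bt /eqP ->]|[Bt h]]; split=> //=; rewrite ltnS// ltnW.
  by move=> [Bt /=]; rewrite ltnS leq_eqVlt => /orP[h|h]; [left|right].
by apply/seteqP; split=> // -[t w] [[_ /= /eqP ->] [_ /=]]; rewrite ltnn.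
Qed.

Let step_sum N j : \int[nus j]_(p in @strip R m T) step_phi N p =
  \sum_(k < 2 ^ N) g (rep N k) * (code_mass T nus N k.+1 B j - code_mass T nus N k B j).
Proof.
have mS := @measurable_stripT R m T; have [yn _] := gnus j.
have Soo := young_fin yn mS.
have b1 k : bmeas (nus j) (@strip R m T) (\1_(B `*` [set w : W | wcode N w == k]) : _ -> R).
  by apply: bmeas_indic => //; exact: measurableX.
under eq_Rintegral do rewrite step_phiE.
rewrite Rintegral_sum//; last by move=> k; exact: bmeasZ.
apply: eq_bigr => k _; rewrite RintZ// -mass_cell; congr (_ * _).
rewrite /Rintegral integral_indic//; last exact: measurableX.
by rewrite setIidl// => -[t w] [Bt _]; split=> //; exact: BI.
Qed.

Let F01 N k t : (k <= 2 ^ N)%N -> 0 <= F N k t <= 1.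
Proof.
move=> kN; rewrite -{1}(Fend N t).1 -(Fend N t).2.
by rewrite !(densities_mono Fstep).
Qed.

Let bF N k : (k <= 2 ^ N)%N -> bmeas leb I (fun t => \1_B t * F N k t).
Proof.
move=> kN; split; [exact: measurable_time|exact: leb_itv_fin| |].
  by apply: measurable_funTS; apply: measurable_funM => //; exact: measurable_indic.
exists 1 => t _; have /andP[h0 h1] := F01 t kN; rewrite indicE.
by case: (t \in B); rewrite ?mul1r ?mul0r ?normr0// ger0_norm.
Qed.

Let int_F N k : \int[leb]_(t in I) (\1_B t * F N k t) = fine (\int[leb]_(t in B) (F N k t)%:E)%E.
Proof.
rewrite /Rintegral; congr fine; rewrite [RHS]integral_mkcond [LHS]integral_mkcond.
apply: eq_integral => t _; rewrite !patchE indicE.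
have [Bt|Bt] := boolP (t \in B); first by rewrite mem_set ?mul1r//; apply: BI; rewrite inE in Bt.
by rewrite mul0r; case: ifP.
Qed.

Local Notation apx := (approx_selector U u0 Fend).

Let mapx N (h : W -> R) : measurable_fun setT (fun p => h (apx N p)) := measurable_approx U u0 mF Fend Fstep N h.

Let finP : (P setT < +oo)%E. Proof. by rewrite ltey_eq fin_num_measure. Qed.
Let P1 : fine (P setT) = 1. Proof. by rewrite (probability_setT P). Qed.

Let inner N t : \int[P]_s g (apx N (t, s)) =
  \sum_(k < 2 ^ N) g (rep N k) * (F N k.+1 t - F N k t).
Proof.
have ms k : measurable [set s | selected F N k (t, s)].
  rewrite -[X in measurable X]setTI.
  have : measurable_fun setT (fun s => selected F N k (t, s)).
    by apply: (measurableT_comp (@measurable_selected _ _ mF N k)); exact: measurable_pair1.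
  by move=> /(_ measurableT [set true]); exact.
have bs k : bmeas P setT (\1_[set s | selected F N k (t, s)] : _ -> R).
  exact: bmeas_indic.
transitivity (\int[P]_s \sum_(k < 2 ^ N) g (rep N k) * \1_[set s | selected F N k (t, s)] s).
  apply: eq_Rintegral => s _.
  rewrite -[LHS](selected_sum Fend Fstep N (fun k => g (rep N k))); apply: eq_bigr => k _.
  by rewrite mulrC indicE; congr (_ * (nat_of_bool _)%:R); apply/idP/idP; rewrite inE.
rewrite Rintegral_sum//; last by move=> k; exact: bmeasZ.
apply: eq_bigr => k _; rewrite RintZ//; congr (_ * _).
rewrite /Rintegral integral_indic// setIT.
by rewrite [X in fine X = _](selected_probability PE Fend Fstep Fempty N k t).
Qed.

Let bspace (h : measurableTypeR R * measurableTypeR R -> R) : measurable_fun setT h ->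
  (forall p, `|h p| <= M) ->
  (forall t, bmeas P setT (fun s => h (t, s))) /\ bmeas leb I (fun t => \int[P]_s h (t, s)).
Proof.
move=> mh hM; split.
  move=> t; split => //; last by exists M.
  by apply: measurableT_comp => //; exact: measurable_pair1.
apply: (@bmeas_Rint1 _ _ _ _ R leb P I setT (fun t s => h (t, s)) M) => //.
- exact: measurable_time.
- exact: leb_itv_fin.
- by apply: measurable_funTS; rewrite (_ : (fun _ => _) = h)//; apply/funext => -[].
Qed.

(** One level N serves both sides. For the sequence, [step_sum] expresses the step integrals through
    code masses, which converge by [FE]. For the limit, [inner] computes the same combination from
    the law of the selected cell, and [uniform_level] controls the distance to the selector. *)
Lemma young_limit :
  \int[nus j]_(p in @strip R m T) phi p @[j --> G] --> \int[nu]_(p in @strip R m T) phi p.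
Proof.
apply: approximated_cvg => e e0.
set Tf := fine (leb I); have Tf0 : 0 <= Tf by rewrite fine_ge0.
pose d := e / (Tf + 1).
have d0 : 0 < d by rewrite divr_gt0// ltr_wpDl.
have dT : d * Tf <= e.
  by rewrite /d mulrAC ler_pdivrMr ?ltr_wpDl// ler_wpM2l ?lerDl// ltW.
have [dd dd0 hdd] := compact_modulus kU cg d0.
have [N [hN1 hN2]] := uniform_level kU Uu0 Fend Fstep Fempty dd0.
exists (fun j => \sum_(k < 2 ^ N) g (rep N k) *
  (code_mass T nus N k.+1 B j - code_mass T nus N k B j)).
exists (\sum_(k < 2 ^ N) g (rep N k) *
  (fine (\int[leb]_(t in B) (F N k.+1 t)%:E)%E - fine (\int[leb]_(t in B) (F N k t)%:E)%E)).
have ind_gap (A : set (measurableTypeR R)) t x y : `|x - y| <= d -> `|\1_A t * x - \1_A t * y| <= d.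
  move=> xy; rewrite -mulrBr indicE; case: (t \in A); first by rewrite mul1r.
  by rewrite mul0r normr0 ltW.
split.
- move=> j; rewrite -step_sum (le_trans _ dT)//.
  apply: (@control_gap _ _ _ _ cU _ _ _ M) => //.
  + exact: measurable_funTS.
  + apply: measurable_funTS; rewrite (_ : step_phi N = fun p => \sum_(k < 2 ^ N) g (rep N k) *
      \1_(B `*` [set w : W | wcode N w == k]) p); last by apply/funext => p; exact: step_phiE.
    apply: measurable_sum => k; apply: measurable_funM => //.
    by apply: measurable_indic; exact: measurableX.
  + by move=> p _; exact: ind_le1.
  + move=> [t w] _ Uw; apply: ind_gap; apply: hdd => //.
    apply: hN1 => //; first exact: representative_in.
    by rewrite representative_code.
  + exact: ltW.
- have hk k : g (rep N k) * (code_mass T nus N k.+1 B j - code_mass T nus N k B j) @[j --> G] -->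
      g (rep N k) * (fine (\int[leb]_(t in B) (F N k.+1 t)%:E)%E - fine (\int[leb]_(t in B) (F N k t)%:E)%E).
    by apply: cvgMr; apply: cvgB; exact: FE.
  have GF' : Filter G by typeclasses eauto.
  exact: (@filter_sum R G (2 ^ N)%N (fun k j => g (rep N k) * (code_mass T nus N k.+1 B j -
    code_mass T nus N k B j)) _ GF' hk).
- rewrite (selector_young_Rint T P kU Uu0 mF Fend Fstep Fempty mphi phiM).
  have h1 := bspace (h := fun p => \1_B p.1 * g (selector U u0 Fend p)).
  have h2 := bspace (h := fun p => \1_B p.1 * g (apx N p)).
  have mB1 : measurable_fun setT (fun p : measurableTypeR R * measurableTypeR R => (\1_B p.1 : R)).
    by apply: measurableT_comp; [exact: measurable_indic|exact: measurable_fst].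
  have {h1}[|p|c1 c2] := h1.
  + apply: measurable_funM => //; apply: measurableT_comp => //.
    exact: (measurable_selector kU Uu0 mF Fend Fstep Fempty).
  + exact: ind_le1.
  have {h2}[|p|c3 c4] := h2.
  + by apply: measurable_funM => //; exact: mapx.
  + exact: ind_le1.
  have -> : \sum_(k < 2 ^ N) g (rep N k) *
      (fine (\int[leb]_(t in B) (F N k.+1 t)%:E)%E - fine (\int[leb]_(t in B) (F N k t)%:E)%E) =
      \int[leb]_(t in I) \int[P]_s (\1_B t * g (apx N (t, s))).
    transitivity (\int[leb]_(t in I) \sum_(k < 2 ^ N) g (rep N k) *
        (\1_B t * F N k.+1 t - \1_B t * F N k t)).
      have bk (k : 'I_(2 ^ N)) : bmeas leb I (fun t => g (rep N k) *
          (\1_B t * F N k.+1 t - \1_B t * F N k t)).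
        by apply: bmeasZ; apply: bmeasB; apply: bF => //; exact: ltnW.
      rewrite Rintegral_sum//; [|exact: measurable_time|exact: leb_itv_fin].
      apply: eq_bigr => k _; rewrite RintZ; last first.
        by apply: bmeasB; apply: bF => //; exact: ltnW.
      by rewrite RintB ?int_F//; apply: bF => //; exact: ltnW.
    apply: eq_Rintegral => t _; rewrite RintZ; last first.
      split => //; last by exists M.
      by apply: (measurableT_comp (mapx N g)); exact: measurable_pair1.
    rewrite inner mulr_sumr; apply: eq_bigr => k _; ring.
  rewrite -RintB// (le_trans _ dT)//; apply: le_normr_bound; first exact: bmeasB.
  move=> t _; have e1 : d * fine (P setT) = d by rewrite P1 mulr1.
  have := @le_normr_bound _ _ _ P setT _ d (bmeasB (c1 t) (c3 t)).
  rewrite e1 RintB//; apply.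
  move=> s _; apply: ind_gap; rewrite distrC.
  apply: hdd; [exact: representative_in|exact: hN2].
Qed.

End young_limit.

(** * Compactness, uniqueness of limits and disintegration *)

Section compactness.
Context (R : realType) (m : nat) (T : R) (U : set 'rV[R]_m).
Local Notation leb := (@lebesgue_measure R).
Local Notation W := 'rV[R]_m.
Local Notation I := (time T).
Hypothesis kU : compact U.
Hypothesis U0 : U !=set0.

Let cU : closed U. Proof. by apply: compact_closed => //; exact: norm_hausdorff. Qed.

(** Convergence tested on products of an indicator in time and a bounded continuous function in
    space, along an arbitrary filter. These tests determine a control, and finite sums of them
    approximate the integrals entering an Euler step. *)
Definition rectangle_cvg (nus : nat -> ymeasure R m) (G : set_system nat) (nu : ymeasure R m) :=
  forall (B : set (measurableTypeR R)) (g : W -> R) M, measurable B -> B `<=` I ->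
    continuous g -> (forall w, `|g w| <= M) ->
    \int[nus j]_(p in @strip R m T) (\1_B p.1 * g p.2) @[j --> G] -->
    \int[nu]_(p in @strip R m T) (\1_B p.1 * g p.2).

Lemma young_compactness (nus : nat -> ymeasure R m) (G : set_system nat) : UltraFilter G ->
  (forall j, gen_control T U (nus j)) ->
  exists (nu : ymeasure R m) (k : R.-pker measurableTypeR R ~> W),
    [/\ gen_control T U nu, disintegration T nu k & rectangle_cvg nus G nu].
Proof.
move=> GU gnus; have [u0 Uu0] := U0.
have [F [mF Fend Fstep Fempty FE]] := exists_limit_densities GU cU Uu0 gnus.
have [P PE] := exists_unit_probability R.
exists (selector_young T P kU Uu0 mF Fend Fstep Fempty).
exists (selector_pker P kU Uu0 mF Fend Fstep Fempty); split.
- exact: selector_young_measure.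
- exact: selector_disintegration.
- by move=> B g M mB BI cg gM; exact: (young_limit GU gnus PE FE mB BI cg gM).
Qed.

(** Tents give the products with closed sets, complements those with open sets. A first pi-system
    argument reaches all measurable sets in space, a second one all measurable sets of the
    product. *)
Lemma control_unique (nu1 nu2 : ymeasure R m) : gen_control T U nu1 -> gen_control T U nu2 ->
  (forall (B : set (measurableTypeR R)) (g : W -> R) M, measurable B -> B `<=` I ->
    continuous g -> (forall w, `|g w| <= M) ->
    \int[nu1]_(p in @strip R m T) (\1_B p.1 * g p.2) =
    \int[nu2]_(p in @strip R m T) (\1_B p.1 * g p.2)) ->
  forall E, measurable E -> nu1 E = nu2 E.
Proof.
move=> g1 g2 h.
have mS := @measurable_stripT R m T.
have fin nu A : gen_control T U nu -> measurable A -> nu A \is a fin_num.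
  by move=> [yn _] mA; rewrite ge0_fin_numE//; exact: young_fin yn mA.
have ind nu (B : set (measurableTypeR R)) (K : set W) : gen_control T U nu ->
    measurable B -> B `<=` I -> measurable K ->
    \int[nu]_(p in @strip R m T) (\1_B p.1 * \1_K p.2) = fine (nu (B `*` K)).
  move=> gn mB BI mK; rewrite (@eq_Rintegral _ _ _ nu _ (\1_(B `*` K) : _ -> R)).
    rewrite /Rintegral integral_indic//; last exact: measurableX.
    by rewrite setIidl// => -[t w] [Bt _]; split=> //; exact: BI.
  move=> [t w] _; rewrite !indicE -natrM mulnb; congr ((nat_of_bool _)%:R).
  by rewrite in_setX.
have closed_eq (B : set (measurableTypeR R)) (K : set W) : measurable B -> B `<=` I ->
    closed K -> nu1 (B `*` K) = nu2 (B `*` K).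
  move=> mB BI cK; have [->|/set0P K0] := eqVneq K set0; first by rewrite setX0 !measure0.
  have mK := closed_rV_measurable cK.
  have b1 k w : `|tent K k w| <= 1 by have /andP[? ?] := tent01 K0 k w; rewrite ger0_norm.
  have cb k : continuous (tent K k).
    by apply: (@lipschitz_continuous _ _ _ k.+1%:R) => x x'; exact: tent_lip.
  have lim nu : gen_control T U nu -> \int[nu]_(p in @strip R m T) (\1_B p.1 * tent K k p.2)
      @[k --> \oo] --> fine (nu (B `*` K)).
    move=> gn; rewrite -ind//; apply: (@Rint_dominated_cvg _ _ _ _ _ _ _ 1).
    + move=> k; apply: (bmeas_control (M := 1) gn mS).
        apply: measurable_funTS; apply: measurable_funM.
          by apply: measurableT_comp; [exact: measurable_indic|exact: measurable_fst].
        apply: measurableT_comp; last exact: measurable_snd.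
        exact: continuous_measurable_rV (cb k).
      move=> p _; rewrite normrM -[leRHS]mulr1; apply: ler_pM => //.
      by rewrite indicE; case: (_ \in _); rewrite ?normr1 ?normr0.
    + move=> k p _; rewrite normrM -[leRHS]mulr1; apply: ler_pM => //.
      by rewrite indicE; case: (_ \in _); rewrite ?normr1 ?normr0.
    + by move=> p _; apply: cvgMr; exact: tent_cvg.
  have l1 := lim _ g1; have l2 := lim _ g2.
  have e : fine (nu1 (B `*` K)) = fine (nu2 (B `*` K)).
    apply: (filter_eq _ l1).
    rewrite (_ : (fun k => _) = fun k => \int[nu2]_(p in @strip R m T) (\1_B p.1 * tent K k p.2))//.
    by apply/funext => k; exact: (h _ _ 1).
  have mBK : measurable (B `*` K) by exact: measurableX.
  by rewrite -[LHS]fineK ?fin// e fineK// fin.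
have open_eq (B : set (measurableTypeR R)) (K : set W) : measurable B -> B `<=` I ->
    open K -> nu1 (B `*` K) = nu2 (B `*` K).
  move=> mB BI oK; have cK : closed (~` K) by exact: open_closedC.
  have split nu : gen_control T U nu -> nu (B `*` K) = (nu (B `*` setT) - nu (B `*` ~` K))%E.
    move=> gn.
    have m1 : measurable (B `*` K) by apply: measurableX => //; exact: rV_open_measurable.
    have m2 : measurable (B `*` ~` K) by apply: measurableX => //; exact: closed_rV_measurable.
    have -> : B `*` [set: W] = (B `*` K) `|` (B `*` ~` K).
      apply/seteqP; split=> [[t w] [Bt _]|[t w] [[]|[]]//].
      by have [Kw|Kw] := pselect (K w); [left|right].
    rewrite measureU ?addeK// ?fin//.
    by apply/seteqP; split=> // -[t w] [[_ ?] [_ ?]].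
  by rewrite !split// (closed_eq _ setT)// ?(closed_eq _ (~` K))//; exact: closedT.
have meas_eq (B : set (measurableTypeR R)) (K : set W) : measurable B -> B `<=` I ->
    measurable K -> nu1 (B `*` K) = nu2 (B `*` K).
  move=> mB BI mK.
  have mBT : measurable (B `*` [set: W]) by exact: measurableX.
  pose r (nu : ymeasure R m) : {measure set W -> \bar R} := image_measure (mrestr nu mBT) (@measurable_snd _ _ (measurableTypeR R) W).
  have rE nu A : r nu A = nu (B `*` A).
    rewrite /r/= /image_measure /mrestr; congr (nu _).
    by apply/seteqP; split=> [[t w] [? []]|[t w] []].
  rewrite -!rE; apply: (@measure_unique _ R W (@open W) (fun=> setT) _ _ _ _ (r nu1) (r nu2)) => //.
  - by move=> A A' oA oA'; exact: openI.
  - by move=> _; exact: openT.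
  - by apply/seteqP; split=> // w _; exists 0%N.
  - by move=> A oA; rewrite !rE; exact: open_eq.
  - by move=> _; rewrite rE; have [yn _] := g1; exact: young_fin yn mBT.
have out nu A : gen_control T U nu -> measurable A -> nu A = nu (A `&` @strip R m T).
  move=> [[n0 _] _] mA.
  have eA : A = (A `&` @strip R m T) `|` (A `&` ~` @strip R m T) by rewrite -setIUr setUv setIT.
  rewrite [in LHS]eA measureU.
  - rewrite [X in (_ + X)%E](_ : _ = 0%E) ?adde0//; apply/eqP; rewrite eq_le measure_ge0 andbT.
    rewrite -[leRHS]n0; apply: le_measure; rewrite ?inE.
    + by apply: measurableI => //; exact: measurableC.
    + exact: measurableC.
    + by move=> ? [].
  - exact: measurableI.
  - by apply: measurableI => //; exact: measurableC.
  - by apply/seteqP; split=> // p [[_ ?] [_ ?]].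
move=> E mE.
apply: (@measure_unique _ R _ [set X | exists A B, [/\ measurable A, measurable B & X = A `*` B]]
  (fun=> setT)) => //.
- rewrite measurable_prod_measurableType; congr (<<s _ >>).
  apply/seteqP; split=> [_ [A mA [B mB <-]]|_ [A [B [mA mB ->]]]]; first by exists A, B.
  by exists A => //; exists B.
- move=> _ _ [A [B [mA mB ->]]] [A' [B' [mA' mB' ->]]].
  by exists (A `&` A'), (B `&` B'); split; [exact: measurableI|exact: measurableI|rewrite setXI].
- by move=> _; exists setT, setT; split=> //; rewrite setXTT.
- by apply/seteqP; split=> // w _; exists 0%N.
- move=> _ [A [B [mA mB ->]]]; rewrite (out nu1)//; last exact: measurableX.
  rewrite (out nu2)//; last exact: measurableX.
  have AI : A `&` I `<=` I by move=> t [].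
  have mAI : measurable (A `&` I) by apply: measurableI => //; exact: measurable_time.
  by rewrite -setXI setIT; exact: meas_eq.
- by move=> _; have [yn _] := g1; exact: young_fin yn measurableT.
Qed.

(** Compactness applied to the constant sequence produces a limit that comes with a kernel; by
    [control_unique] this limit is [nu] itself. *)
Lemma exists_disintegration (nu : ymeasure R m) : gen_control T U nu ->
  exists k, disintegration T nu k.
Proof.
move=> gn; have [G [GU oG]] := ultraFilterLemma (@eventually_filter).
have [nu' [k [gn' dk c]]] := @young_compactness (fun=> nu) G GU (fun=> gn).
have GF : ProperFilter G by exact: ultra_proper.
have e := control_unique gn gn' (fun B g M mB BI cg gM =>
  filter_eq GF (cvg_cst _) (c B g M mB BI cg gM)).
have eI (f : measurableTypeR R * W -> \bar R) :
    (\int[nu]_(p in @strip R m T) f p = \int[nu']_(p in @strip R m T) f p)%E.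
  by apply: eq_measure_integral => A mA _; exact: e.
exists k => psi /integrableP[mpsi ipsi]; rewrite eI dk//.
by apply/integrableP; split=> //; rewrite -eI.
Qed.

End compactness.

Section pulled_kernel.
Context (R : realType) (n m : nat) (k : R.-pker measurableTypeR R ~> 'rV[R]_m).

(** A dummy space variable in the parameter gives measurability in (t, x) jointly for integrals
    against k t of functions that depend on x too. *)
Definition pulled_kernel (p : measurableTypeR R * 'rV[R]_n) : {measure set 'rV[R]_m -> \bar R} := k p.1.

Let pulled_measurable A : measurable A -> measurable_fun setT (fun p => pulled_kernel p A).
Proof.
move=> mA; have mk : measurable_fun setT (k ^~ A) by exact: measurable_kernel.
exact: (measurableT_comp mk measurable_fst).
Qed.

HB.instance Definition _ := isKernel.Build _ _ _ _ R pulled_kernel pulled_measurable.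

Let pulled_prob p : pulled_kernel p setT = 1%E.
Proof. exact: prob_kernel. Qed.

HB.instance Definition _ := Kernel_isProbability.Build _ _ _ _ R pulled_kernel pulled_prob.

Lemma measurable_pulled_integral (g : (measurableTypeR R * 'rV[R]_n) * 'rV[R]_m -> R) :
  measurable_fun setT g -> measurable_fun setT (fun p => \int[k p.1]_w g (p, w)).
Proof.
move=> mg; have me : measurable_fun setT (EFin \o g) by apply/measurable_EFinP.
have h1 : measurable_fun setT (fun p => \int[pulled_kernel p]_w (EFin \o g)^\+ (p, w))%E.
  by apply: measurable_fun_integral_finite_kernel => //; exact: measurable_funepos.
have h2 : measurable_fun setT (fun p => \int[pulled_kernel p]_w (EFin \o g)^\- (p, w))%E.
  by apply: measurable_fun_integral_finite_kernel => //; exact: measurable_funeneg.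
rewrite (_ : (fun p => _) = fine \o (fun p => \int[pulled_kernel p]_w (EFin \o g)^\+ (p, w) -
    \int[pulled_kernel p]_w (EFin \o g)^\- (p, w))%E).
  by apply: measurableT_comp => //; exact: emeasurable_funB.
apply/funext => p; rewrite /Rintegral /= [in LHS]integralE; congr (fine (_ - _)%E).
  by apply: eq_integral => w _; rewrite !funeposE.
by apply: eq_integral => w _; rewrite !funenegE.
Qed.

End pulled_kernel.

(** * Payoffs as measures of preimages *)
Section averaged.
Context (R : realType) (n m : nat) (T L C : R) (U : set 'rV[R]_m)
  (v : R -> 'rV[R]_n -> 'rV[R]_m -> 'rV[R]_n).
Local Notation leb := (@lebesgue_measure R).
Local Notation V := 'rV[R]_n.
Local Notation W := 'rV[R]_m.
Local Notation I := (time T).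
Hypothesis T0 : 0 < T.
Hypothesis L0 : 0 < L.
Hypothesis C0 : 0 < C.
Hypothesis kU : compact U.
Hypothesis cv : {within [set p : R * V * W | p.1.1 \in `[0, T] /\ U p.2],
  continuous (fun p => v p.1.1 p.1.2 p.2)}.
Hypothesis vlip : forall t u x x', t \in `[0, T] -> U u ->
  enorm (v t x u - v t x' u) <= L * enorm (x - x').
Hypothesis vgrow : forall t u x, t \in `[0, T] -> U u -> enorm (v t x u) <= C * (1 + enorm x).

Let cU : closed U. Proof. by apply: compact_closed => //; exact: norm_hausdorff. Qed.
Let mU : measurable U. Proof. exact: closed_rV_measurable. Qed.

Let D : set (R * V * W) := [set p | p.1.1 \in `[0, T] /\ U p.2].

Let cD : closed D.
Proof.
apply: (@closedI _ ((fun p => p.1.1) @^-1` `[0, T]%classic) (snd @^-1` U)).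
  apply: closed_comp; last exact: itv_closed.
  by move=> p _; exact: (cvg_comp _ _ (@cvg_fst _ _ _ _ _) (@cvg_fst _ _ _ _ _)).
by apply: closed_comp => // p _; exact: cvg_snd.
Qed.

(** The field is only known to be continuous within [0, T] x R^n x U; extension by zero makes it
    measurable everywhere and preserves the growth bound. *)
Definition extended_field i (q : R * V * W) : R :=
  if pselect (D q) is left _ then v q.1.1 q.1.2 q.2 0 i else 0.

Lemma extended_in i t x w : I t -> U w -> extended_field i (t, x, w) = v t x w 0 i.
Proof. by move=> It Uw; rewrite /extended_field; case: pselect => // -[]. Qed.

Lemma extended_bound i t x w : `|extended_field i (t, x, w)| <= C * (1 + enorm x).
Proof.
rewrite /extended_field; case: pselect => [[/= It Uw]|_].
  by rewrite (le_trans (coord_le_enorm _ _))// vgrow.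
by rewrite normr0 mulr_ge0 ?(ltW C0)// addr_ge0// enorm_ge0.
Qed.

Lemma measurable_extended i :
  measurable_fun setT (extended_field i : measurableTypeR R * V * W -> R).
Proof.
have ci : {within D, continuous (fun p => v p.1.1 p.1.2 p.2 0 i)}.
  apply/subspace_continuousP => q Dq; have /subspace_continuousP/(_ q Dq) hq := cv.
  exact: (cvg_comp _ _ hq (@coord_continuous R _ _ 0 i _)).
have mv := within_continuous_measurable_glue cD ci.
rewrite (_ : extended_field i = (fun p : measurableTypeR R * V * W => v p.1.1 p.1.2 p.2 0 i) \_ D).
  apply: (proj1 (measurable_restrictT _ _)) => //.
  rewrite (_ : D = (fun p : measurableTypeR R * V * W => p.1.1) @^-1` I `&` snd @^-1` U)//.
  apply: measurableI.
    rewrite -[X in measurable X]setTI.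
    have mf : measurable_fun setT (fun p : measurableTypeR R * V * W => p.1.1).
      by apply: measurableT_comp; exact: measurable_fst.
    by apply: mf => //; exact: measurable_time.
  rewrite -[X in measurable X]setTI.
  by apply: (@measurable_snd _ _ (measurableTypeR R * V)%type W) => //.
apply/funext => q; rewrite patchE /extended_field; case: pselect => Dq.
  by rewrite mem_set.
by rewrite memNset.
Qed.

Lemma measurable_extended_section i t x : measurable_fun setT (fun w : W => extended_field i (t, x, w)).
Proof.
apply: (measurableT_comp (measurable_extended i) (g := fun w : W => ((t : measurableTypeR R), x, w))).
exact: measurable_pair1.
Qed.

Section kernel_field.
Variable k : R.-pker measurableTypeR R ~> W.

(** Outside [0, T] the kernel and v are arbitrary. Setting the field to 0 there makes it admissible
    for all times, hence subject to the flow theory. *)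
Definition control_field (t : R) (x : V) : V :=
  if t \in `[0, T] then averaged_field U v k t x else 0.

Let kUfin t : (k t U < +oo)%E.
Proof.
apply: (@le_lt_trans _ _ (k t setT)); first by apply: le_measure; rewrite ?inE.
by rewrite prob_kernel ltry.
Qed.

Let kU1 t : 0 <= fine (k t U) <= 1.
Proof.
rewrite fine_ge0//= -lee_fin fineK ?ge0_fin_numE// -(prob_kernel (s := k) t).
by apply: le_measure; rewrite ?inE.
Qed.

Let bsection i t x : I t -> bmeas (k t) U (fun w => v t x w 0 i).
Proof.
move=> It; apply: (@eq_bmeas _ _ _ _ _ (fun w => extended_field i (t, x, w))).
  by move=> w Uw; rewrite extended_in.
split=> //; first by apply: measurable_funTS; exact: measurable_extended_section.
by exists (C * (1 + enorm x)) => w _; exact: extended_bound.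
Qed.

Lemma control_fieldE i t x : control_field t x 0 i = \int[k t]_w extended_field i (t, x, w).
Proof.
rewrite /control_field; case: ifP => [It|It].
  rewrite mxE /Rintegral; congr fine; rewrite [LHS]integral_mkcond; apply: eq_integral => w _.
  rewrite patchE; case: ifPn => [|]; rewrite ?inE ?notin_setE => Uw; first by rewrite extended_in.
  by rewrite /extended_field; case: pselect => // -[].
rewrite mxE /Rintegral (@eq_integral _ _ _ (k t) setT (cst 0%E)) ?integral0// => w _.
by rewrite /extended_field; case: pselect => //= -[/=]; rewrite It.
Qed.

Lemma control_field_admissible : admissible L C control_field.
Proof.
split=> [i|t x x'|t x].
- rewrite (_ : (fun p => _) = fun p : measurableTypeR R * V => \int[k p.1]_w extended_field i (p, w)).
    exact: measurable_pulled_integral (measurable_extended i).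
  by apply/funext => -[t x]; exact: control_fieldE.
- rewrite /control_field; case: ifP => It; last first.
    by rewrite subrr enorm0 mulr_ge0 ?(ltW L0)// enorm_ge0.
  rewrite -[averaged_field U v k t x]/(rowint (k t) U (v t x)).
  rewrite -[averaged_field U v k t x']/(rowint (k t) U (v t x')).
  rewrite rowintB => [|i|i]; [|exact: bsection|exact: bsection].
  have /andP[h0 h1] := kU1 t; have K0 : 0 <= L * enorm (x - x').
    by rewrite mulr_ge0 ?(ltW L0)// enorm_ge0.
  apply: (@le_trans _ _ (L * enorm (x - x') * fine (k t U))); last by rewrite ler_piMr.
  apply: enorm_rowint => // [i|w Uw]; last exact: vlip.
  apply: (@eq_bmeas _ _ _ _ _ (fun w => v t x w 0 i - v t x' w 0 i)).
    by move=> w _; rewrite !mxE.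
  by apply: bmeasB; exact: bsection.
- rewrite /control_field; case: ifP => It; last first.
    by rewrite enorm0 mulr_ge0 ?(ltW C0)// addr_ge0// enorm_ge0.
  rewrite -[averaged_field U v k t x]/(rowint (k t) U (v t x)).
  have /andP[h0 h1] := kU1 t; have K0 : 0 <= C * (1 + enorm x).
    by rewrite mulr_ge0 ?(ltW C0)// addr_ge0// enorm_ge0.
  apply: (@le_trans _ _ (C * (1 + enorm x) * fine (k t U))); last by rewrite ler_piMr.
  by apply: enorm_rowint => // [i|w Uw]; [exact: bsection|exact: vgrow].
Qed.

End kernel_field.

Definition control_integral i x a c (nu : ymeasure R m) : R :=
  \int[nu]_(p in @strip R m T) (\1_(`[a, c]%classic : set (measurableTypeR R)) p.1 *
    extended_field i (p.1, x, p.2)).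

Let mint i x a c : measurable_fun setT (fun p : measurableTypeR R * W =>
  \1_(`[a, c]%classic : set (measurableTypeR R)) p.1 * extended_field i (p.1, x, p.2)).
Proof.
apply: measurable_funM.
  apply: measurableT_comp; last exact: measurable_fst.
  by apply: measurable_indic; exact: measurable_itv.
apply: (measurableT_comp (measurable_extended i)
  (g := fun p : measurableTypeR R * W => (p.1, x, p.2))).
by apply: measurable_fun_pair => //; exact: measurable_fun_pair.
Qed.

Let bint i x a c (p : measurableTypeR R * W) :
  `|\1_(`[a, c]%classic : set (measurableTypeR R)) p.1 * extended_field i (p.1, x, p.2)| <=
  C * (1 + enorm x).
Proof.
rewrite normrM -[leRHS]mul1r; apply: ler_pM => //; last exact: extended_bound.
by rewrite indicE; case: (_ \in _); rewrite ?normr1 ?normr0.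
Qed.

(** Turns the Euler increment at a frozen x into an integral against [nu]; the right-hand side no
    longer involves the disintegration. *)
Lemma control_field_integral nu (k : R.-pker measurableTypeR R ~> W) i x a c :
  gen_control T U nu -> disintegration T nu k -> 0 <= a -> c <= T ->
  \int[leb]_(t in `[a, c]) control_field k t x 0 i = control_integral i x a c nu.
Proof.
move=> gn dk a0 cT; pose psi (p : measurableTypeR R * W) :=
  \1_(`[a, c]%classic : set (measurableTypeR R)) p.1 * extended_field i (p.1, x, p.2).
have ip : nu.-integrable (@strip R m T) (EFin \o psi).
  apply: bmeas_integrable; apply: (bmeas_control gn (@measurable_stripT R m T)).
    by apply: measurable_funTS; exact: mint.
  by move=> p _; exact: bint.
rewrite /control_integral {2}/Rintegral (dk psi ip) /Rintegral; congr fine.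
rewrite [LHS]integral_mkcond [RHS]integral_mkcond; apply: eq_integral => t _; rewrite !patchE.
case: ifPn => [|]; rewrite ?inE ?notin_setE => ht.
  have It : I t.
    by move: ht; rewrite /time/= !in_itv/= => /andP[? ?]; rewrite (le_trans a0)//= (le_trans _ cT).
  rewrite mem_set// control_fieldE fineK.
    by apply: eq_integral => w _; rewrite /psi/= indicE mem_set// mul1r.
  apply: integrable_fin_num => //; apply: bmeas_integrable; split=> //.
  - by rewrite prob_kernel ltry.
  - exact: measurable_extended_section.
  - by exists (C * (1 + enorm x)) => w _; exact: extended_bound.
case: ifP => // _; rewrite (@eq_integral _ _ _ (k t) setT (cst 0%E)) ?integral0// => w _.
by rewrite /psi/= indicE memNset// mul0r.
Qed.

Lemma time_cells (N : nat) (t : R) (h : nat -> R) : 0 <= t <= T ->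
  exists l, [/\ (l < N.+2)%N, `|t - l%:R * (T / N.+1%:R)| <= T / N.+1%:R &
    \sum_(j < N.+2) \1_(`[j%:R * (T / N.+1%:R), j.+1%:R * (T / N.+1%:R)[%classic :
      set (measurableTypeR R)) t * h j = h l].
Proof.
move=> /andP[t0 tT]; set dt := T / N.+1%:R; have dt0 : 0 < dt by rewrite divr_gt0.
have q0 : 0 <= t / dt by rewrite divr_ge0// ltW.
have /andP[l1 l2] := truncn_itv q0; set l := Num.trunc (t / dt) in l1 l2.
rewrite ler_pdivlMr// in l1; rewrite ltr_pdivrMr// in l2.
have lN : (l < N.+2)%N.
  rewrite ltnS -(ler_nat R) -(ler_pM2r dt0) (le_trans l1)//.
  by rewrite /dt mulrCA divff ?mulr1// pnatr_eq0.
exists l; split=> //.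
  by rewrite ger0_norm ?subr_ge0// lerBlDr ltW//; move: l2; rewrite -natr1 mulrDl mul1r addrC.
rewrite (bigD1 (Ordinal lN))//= indicE mem_set/=; last by rewrite in_itv/= l1.
rewrite mul1r big1 ?addr0// => j jl; rewrite indicE memNset ?mul0r//= in_itv/= => /andP[j1 j2].
case/eqP: jl; apply/val_inj/eqP => /=; rewrite eqn_leq; apply/andP; split.
  by rewrite -ltnS -(ltr_nat R) -(ltr_pM2r dt0) (le_lt_trans j1).
by rewrite -ltnS -(ltr_nat R) -(ltr_pM2r dt0) (le_lt_trans l1).
Qed.

(** The integrand jumps at a and c and v(., x, .) is defined on [0, T] x U only. A continuous
    extension g of it, frozen in time on short cells, yields a finite sum of rectangle functions
    within [d] of the integrand on [0, T] x U. *)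
Lemma control_integral_cvg (nus : nat -> ymeasure R m) (G : set_system nat) nu i x a c :
  Filter G -> (forall j, gen_control T U (nus j)) -> gen_control T U nu ->
  rectangle_cvg T nus G nu -> 0 <= a -> c <= T ->
  control_integral i x a c (nus j) @[j --> G] --> control_integral i x a c nu.
Proof.
move=> GF gnus gn rc a0 cT.
pose K : set (R * W) := `[0, T]%classic `*` U.
have kK : compact K by apply: compact_setX => //; exact: segment_compact.
have clK : closed K by apply: compact_closed => //; exact: norm_hausdorff.
pose M := C * (1 + enorm x).
have M0 : 0 < M by rewrite mulr_gt0// ltr_pwDl// enorm_ge0.
have cf : {within K, continuous (fun p : R * W => v p.1 x p.2 0 i : R^o)}.
  apply/subspace_continuousP => p [It Uw].
  have /subspace_continuousP/(_ (p.1, x, p.2)) hq := cv.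
  have {hq} hq := hq (conj It Uw).
  have hc : v z.1.1 z.1.2 z.2 0 i @[z --> within D (nbhs (p.1, x, p.2))] --> v p.1 x p.2 0 i.
    exact: (cvg_comp _ _ hq (@coord_continuous R _ _ 0 i _)).
  have hm : {for p, continuous (fun p : R * W => (p.1, x, p.2))}.
    apply: (@cvg_pairP _ (nbhs p) _ _ _ _ (p.1, x) p.2); last exact: cvg_snd.
    by apply: (@cvg_pairP _ (nbhs p) _ _ _ _ p.1 x); [exact: cvg_fst|exact: cvg_cst].
  move=> E /hc; rewrite /= /within/= !nbhs_simpl/= => hE.
  have := hm _ hE; rewrite /= nbhs_simpl/=; apply: filterS => q hq' [Iq Uq]; exact: hq'.
have bf p : K p -> `|v p.1 x p.2 0 i| <= M.
  by move=> [It Uw]; rewrite (le_trans (coord_le_enorm _ _))// vgrow.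
have [g [gE cg gM]] := @continuous_bounded_extension (R * W)%type R
  (@pseudometric_normal R _) K clK (fun p => v p.1 x p.2 0 i) M M0 cf bf.
apply: approximated_cvg => e e0.
set Tf := fine (leb I); have Tf0 : 0 <= Tf by rewrite fine_ge0.
pose d := e / (Tf + 1).
have d0 : 0 < d by rewrite divr_gt0// ltr_wpDl.
have dT : d * Tf <= e.
  by rewrite /d mulrAC ler_pdivrMr ?ltr_wpDl// ler_wpM2l ?lerDl// ltW.
have [dd dd0 hdd] := compact_modulus kK cg d0.
have [N hN] : exists N, T / N.+1%:R <= dd.
  exists (Num.trunc (T / dd)); rewrite ler_pdivrMr// mulrC -ler_pdivrMr//.
  by rewrite ltW// truncnS_gt.
pose dt := T / N.+1%:R.
pose J l : set (measurableTypeR R) := `[a, c]%classic `&` `[l%:R * dt, l.+1%:R * dt[%classic.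
have mJ l : measurable (J l) by apply: measurableI; exact: measurable_itv.
have JI l : J l `<=` I.
  move=> t [/= + _]; rewrite /time/= !in_itv/= => /andP[? ?].
  by rewrite (le_trans a0)//= (le_trans _ cT).
have inI (A B : set (measurableTypeR R)) t : (\1_(A `&` B) t : R) = \1_A t * \1_B t.
  by rewrite !indicE -natrM mulnb; congr ((nat_of_bool _)%:R); apply/idP/andP; rewrite !inE.
pose G0 l (w : W) := g (l%:R * dt, w).
have cG0 l : continuous (G0 l).
  move=> w; apply: (cvg_comp (fun w => (l%:R * dt, w)) g); last exact: cg.
  by apply: (@cvg_pairP _ (nbhs w) _ _ _ _ (l%:R * dt) w); [exact: cvg_cst|exact: cvg_id].
have mG0 l : measurable_fun setT (G0 l) by exact: continuous_measurable_rV.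
have bG0 l w : `|G0 l w| <= M by exact: gM.
pose Phi l (p : measurableTypeR R * W) : R := \1_(J l) p.1 * G0 l p.2.
have mPhi l : measurable_fun setT (Phi l).
  apply: measurable_funM; last by apply: measurableT_comp => //; exact: measurable_snd.
  by apply: measurableT_comp; [exact: measurable_indic|exact: measurable_fst].
have bPhi l p : `|Phi l p| <= M.
  rewrite normrM -[leRHS]mul1r; apply: ler_pM => //.
  by rewrite indicE; case: (_ \in _); rewrite ?normr1 ?normr0.
have sumE nu' : gen_control T U nu' -> \int[nu']_(p in @strip R m T) \sum_(l < N.+2) Phi l p =
    \sum_(l < N.+2) \int[nu']_(p in @strip R m T) Phi l p.
  move=> gn'; have [yn' _] := gn'; have mS := @measurable_stripT R m T.
  rewrite Rintegral_sum//; first exact: young_fin yn' mS.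
  move=> l; apply: (@bmeas_control _ _ _ _ nu' _ _ M gn' mS) => [|p _]; last exact: bPhi.
  exact: measurable_funTS.
have gap nu' : gen_control T U nu' ->
    `|control_integral i x a c nu' - \sum_(l < N.+2) \int[nu']_(p in @strip R m T) Phi l p| <= e.
  move=> gn'; rewrite -sumE// (le_trans _ dT)//.
  have NM : M <= N.+2%:R * M by rewrite ler_peMl ?(ltW M0)// ler1n.
  apply: (@control_gap _ _ _ _ cU _ _ _ (N.+2%:R * M)) => //.
  - by apply: measurable_funTS; exact: mint.
  - by apply: measurable_funTS; apply: measurable_sum.
  - by move=> p _; rewrite (le_trans _ NM)//; exact: bint.
  - move=> p _; rewrite (le_trans (ler_norm_sum _ _ _))//.
    apply: (@le_trans _ _ (\sum_(l < N.+2) M)); last by rewrite sumr_const card_ord mulr_natl.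
    by apply: ler_sum => l _; exact: bPhi.
  - move=> [t w] /= It Uw; rewrite extended_in//.
    have t01 : 0 <= t <= T by move: It; rewrite /time/= in_itv.
    have [l [lN hl]] := time_cells N (fun l => G0 l w) t01; rewrite -/dt in hl * => hs.
    have -> : \sum_(l < N.+2) Phi l (t, w) = \1_(`[a, c]%classic : set (measurableTypeR R)) t * G0 l w.
      rewrite -hs mulr_sumr; apply: eq_bigr => j _.
      rewrite /Phi inI -mulrA /=.
      by [].
    rewrite -mulrBr indicE; case: (_ \in _); last by rewrite mul0r normr0 ltW.
    have -> : v t x w 0 i = g (t, w) by apply: (gE (t, w)); rewrite inE.
    rewrite mul1r.
    apply: hdd => //; rewrite prod_normE/= subrr normr0 ge_max (ltW dd0) andbT.
    exact: (le_trans hl).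
  - exact: ltW.
exists (fun j => \sum_(l < N.+2) \int[nus j]_(p in @strip R m T) Phi l p).
exists (\sum_(l < N.+2) \int[nu]_(p in @strip R m T) Phi l p); split.
- by move=> j; exact: gap.
- have hk l : \int[nus j]_(p in @strip R m T) Phi l p @[j --> G] --> \int[nu]_(p in @strip R m T) Phi l p.
    exact: (rc (J l) (G0 l) M).
  exact: (@filter_sum R G N.+2 (fun l j => \int[nus j]_(p in @strip R m T) Phi l p) _ GF hk).
- exact: gap.
Qed.

End averaged.

(** * Flow maps of controls and the formula for the payoff *)

Section control_maps.
Context (R : realType) (n m : nat) (T L C : R) (U : set 'rV[R]_m)
  (v : R -> 'rV[R]_n -> 'rV[R]_m -> 'rV[R]_n).
Local Notation leb := (@lebesgue_measure R).
Local Notation V := 'rV[R]_n.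
Local Notation W := 'rV[R]_m.
Local Notation I := (time T).
Hypothesis T0 : 0 < T.
Hypothesis L0 : 0 < L.
Hypothesis C0 : 0 < C.
Hypothesis kU : compact U.
Hypothesis cv : {within [set p : R * V * W | p.1.1 \in `[0, T] /\ U p.2],
  continuous (fun p => v p.1.1 p.1.2 p.2)}.
Hypothesis vlip : forall t u x x', t \in `[0, T] -> U u ->
  enorm (v t x u - v t x' u) <= L * enorm (x - x').
Hypothesis vgrow : forall t u x, t \in `[0, T] -> U u -> enorm (v t x u) <= C * (1 + enorm x).

Local Notation field := (control_field T U v).
Let adm k : admissible L C (field k).
Proof. exact: (control_field_admissible L0 C0 kU cv vlip vgrow). Qed.

(** A relation rather than a function, because the map is built from a chosen disintegration;
    [control_map_unique] shows that the choice does not matter. *)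
Definition is_control_map (nu : ymeasure R m) (Phi : V -> V) :=
  exists k y, [/\ disintegration T nu k, is_flow L C (field k) y & Phi = y T].

(** Induction on the steps. The errors obey e_(l+1) <= (1 + L dt) e_l + d_l, where d_l compares the
    two steps at the same point z of the limit scheme; with x frozen at z, d_l is governed by
    [control_integral_cvg]. *)
Lemma euler_field_cvg (nus : nat -> ymeasure R m) (G : set_system nat) nu
    (ks : nat -> R.-pker measurableTypeR R ~> W) (k : R.-pker measurableTypeR R ~> W) N x :
  ProperFilter G -> (forall j, gen_control T U (nus j)) -> gen_control T U nu ->
  rectangle_cvg T nus G nu -> (forall j, disintegration T (nus j) (ks j)) ->
  disintegration T nu k ->
  enorm (euler_map (field (ks j)) T N x - euler_map (field k) T N x) @[j --> G] --> (0 : R).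
Proof.
move=> GF gnus gn rc dks dk; rewrite /euler_map; set dt := T / N.+1%:R.
have dt0 : 0 <= dt by rewrite divr_ge0// ltW.
have dtT : N.+1%:R * dt = T by rewrite /dt mulrC divfK.
elim: {-2}(N.+1) (leqnn N.+1) => [_|l IH lN].
  by rewrite /=; under eq_cvg do rewrite subrr enorm0; exact: cvg_cst.
have {}IH := IH (ltnW lN); set z := euler (field k) dt 0 l x in IH.
have t1 : 0 <= l%:R * dt by rewrite mulr_ge0.
have t2 : l.+1%:R * dt <= T by rewrite -dtT ler_wpM2r// ler_nat.
have hs : enorm (euler_step (field (ks j)) dt l z - euler_step (field k) dt l z) @[j --> G] --> (0 : R).
  apply: (proj1 (cvg_enormP _ _ _)); apply: cvg_rowP => i.
  rewrite /euler_step; under eq_cvg do rewrite !mxE.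
  rewrite !mxE; apply: cvgD; first exact: cvg_cst.
  rewrite (control_field_integral C0 kU cv vgrow i z gn dk t1 t2).
  under eq_cvg => j do rewrite (control_field_integral C0 kU cv vgrow i z (gnus j) (dks j) t1 t2).
  exact: (control_integral_cvg T0 C0 kU cv vgrow).
have h0 : (1 + L * dt) ^+ 1 * enorm (euler (field (ks j)) dt 0 l x - z) +
    enorm (euler_step (field (ks j)) dt l z - euler_step (field k) dt l z) @[j --> G] --> (0 : R).
  rewrite -[X in _ --> X]addr0 -[X in _ --> X + _](mulr0 ((1 + L * dt) ^+ 1)).
  by apply: cvgD => //; exact: cvgMr.
apply: (squeeze_cvgr _ (cvg_cst 0) h0); apply: nearW => j; rewrite enorm_ge0 andTb !eulerSr add0n -/z.
rewrite (le_trans (enorm_triangle _ (euler_step (field (ks j)) dt l z) _))// lerD2r.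
exact: (@euler_lip _ _ _ _ L0 _ dt l 1 _ _ (adm (ks j)) dt0).
Qed.

(** The Euler error bound K / (N + 1) depends on x but not on the control, so one N approximates all
    the maps at once, each of the two errors being at most e / 2. *)
Lemma control_map_cvg (nus : nat -> ymeasure R m) (G : set_system nat) nu
    (Phis : nat -> V -> V) (Phi : V -> V) x :
  ProperFilter G -> (forall j, gen_control T U (nus j)) -> gen_control T U nu ->
  rectangle_cvg T nus G nu -> (forall j, is_control_map (nus j) (Phis j)) ->
  is_control_map nu Phi -> enorm (Phis j x - Phi x) @[j --> G] --> (0 : R).
Proof.
move=> GF gnus gn rc cPhis [k [y [dk fy ->]]].
have [ks hks] := choice cPhis; have [ys hys] := choice hks.
set K := speed_bound L C T x * T * expR (L * T).
apply: approximated_cvg => e e0.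
have [N hN] : exists N, K / N.+1%:R <= e / 2.
  exists (Num.trunc (K / (e / 2))); rewrite ler_pdivrMr// mulrC -ler_pdivrMr ?divr_gt0//.
  by rewrite ltW// truncnS_gt.
pose E j := enorm (euler_map (field (ks j)) T N x - euler_map (field k) T N x).
exists E, 0; split; last by rewrite subrr normr0 ltW.
- have swap (a b a' b' : V) : a - b - (a' - b') = (a - a') - (b - b').
    by apply/rowP => i; rewrite !mxE; ring.
  move=> j; have [dkj fj ->] := hys j.
  have h1 := euler_map_error L0 C0 T0 (adm (ks j)) fj x N.
  have h2 := euler_map_error L0 C0 T0 (adm k) fy x N.
  rewrite -/K in h1 h2; rewrite (le_trans (enorm_dist _ _))//.
  set a := ys j T x in h1 *; set b := y T x in h2 *.
  rewrite /E; set a' := euler_map _ T N x in h1 *; set b' := euler_map (field k) T N x in h2 *.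
  rewrite swap.
  rewrite (le_trans (enormB _ _))// (splitr e) lerD//; first exact: le_trans hN.
  exact: le_trans hN.
- apply: (euler_field_cvg (nus := nus) (nu := nu)) => // j.
  by have [] := hys j.
Qed.

(** A constant sequence of controls converges to itself, so by [control_map_cvg] the constant
    sequence of maps [Phi] converges to [Phi']. *)
Lemma control_map_unique nu Phi Phi' : gen_control T U nu ->
  is_control_map nu Phi -> is_control_map nu Phi' -> Phi = Phi'.
Proof.
move=> gn c1 c2; apply/funext => x.
have h : (fun _ : nat => enorm (Phi x - Phi' x)) @ \oo --> (0 : R).
  apply: (@control_map_cvg (fun=> nu) \oo nu (fun=> Phi) Phi' x) => //.
  by move=> B g M *; exact: cvg_cst.
have /enorm_eq0/eqP : enorm (Phi x - Phi' x) = 0 by apply: (filter_eq _ _ h); exact: cvg_cst.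
by rewrite subr_eq0 => /eqP.
Qed.

(** The kernel comes from compactness, which asks for a point of U. If U were empty the control
    would be null, whereas its total mass is T > 0. *)
Lemma control_map_exists nu : gen_control T U nu -> exists Phi, is_control_map nu Phi.
Proof.
move=> gn; have [U0|] := pselect (U !=set0).
  have [k dk] := exists_disintegration kU U0 gn.
  by have [y fy] := flow_exists L0 C0 (adm k); exists (y T), k, y.
move=> /set0P/negP; rewrite negbK => /eqP U0; have [yn n0] := gn; exfalso.
move: n0; rewrite U0 setX0 setC0 (young_total yn) lebesgue_measure_itv/= lte_fin T0 sube0 => -[] /eqP.
by rewrite gt_eqF.
Qed.

Lemma control_map_lip nu Phi : is_control_map nu Phi ->
  (forall x x', enorm (Phi x - Phi x') <= expR (L * T) * enorm (x - x')) /\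
  (forall x x', expR (- (2 * L * T)) * enorm (x - x') <= enorm (Phi x - Phi x')).
Proof.
move=> [k [y [dk fy ->]]]; split=> x x'; first exact: (flow_lip L0 C0 T0 (adm k) fy).
by have := flow_lip_lower L0 C0 T0 (adm k) fy x x'; rewrite ?mulrA.
Qed.

Lemma measurable_control_map nu Phi A : is_control_map nu Phi -> measurable A ->
  measurable (Phi @^-1` A).
Proof.
move=> [k [y [dk fy ->]]] mA; rewrite -[X in measurable X]setTI.
exact: (measurable_flow_at fy).
Qed.

Lemma eq_continuity_equation (b b' : R -> V -> V) mu :
  (forall t, t \in `[0, T] -> b t = b' t) ->
  continuity_equation T b mu -> continuity_equation T b' mu.
Proof.
move=> bb' h phi tphi; rewrite -[RHS](h phi tphi); apply: eq_Rintegral => t; rewrite inE => It.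
by rewrite (bb' t It).
Qed.

(** Existence, through [flow_law], makes the [get] behind [trajectory] meaningful. The trajectory it
    returns has a kernel of its own, whose flow map is identified with [Phi] by uniqueness. [P] is a
    genuine probability agreeing with the set function [vartheta]. *)
Lemma payoffE (eta : V -> R) (vartheta : set V -> \bar R) (P : probability V R) A nu Phi :
  mollifier eta -> (forall E, measurable E -> P E = vartheta E) -> compact A ->
  gen_control T U nu -> is_control_map nu Phi ->
  payoff T U v vartheta A nu = P (Phi @^-1` A).
Proof.
move=> meta PE kA gn cPhi.
have fieldE k t : t \in `[0, T] -> field k t = averaged_field U v k t.
  by move=> It; apply/funext => x; rewrite /control_field It.
have ex : exists mu, is_trajectory T U v vartheta nu mu.
  have [k [y [dk fy _]]] := cPhi; exists (flow_law P fy); split.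
  - exact: flow_law_narrow.
  - by move=> E mE; rewrite flow_law0 PE.
  - exists k => //; apply: (eq_continuity_equation (fieldE k)).
    exact: (flow_law_equation P T0 L0 C0 (adm k) fy).
have := getPex ex; rewrite -/(trajectory T U v vartheta nu) => -[nmu mu0 [k dk ce]].
have [y fy] := flow_exists L0 C0 (adm k).
have ce' : continuity_equation T (field k) (trajectory T U v vartheta nu).
  by apply: eq_continuity_equation ce => t It; rewrite fieldE.
have cy : is_control_map nu (y T) by exists k, y.
rewrite /payoff (uniqueness T0 L0 C0 (adm k) fy nmu ce' meta kA).
rewrite (control_map_unique gn cPhi cy) mu0 ?PE//; apply: (measurable_control_map cy);
  by apply: closed_rV_measurable; apply: compact_closed => //; exact: norm_hausdorff.
Qed.

End control_maps.

Lemma sum_of_thirds (R : realFieldType) (p p1 p2 q e : R) :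
  - (p2 - p1) <= e / 3 -> - (q - p2) <= e / 3 -> p <= p1 + e / 3 -> p <= q + e.
Proof. lra. Qed.

(** * Closed neighbourhoods and upper semicontinuity of the mass of preimages *)

Section compact_nbhd.
Context (R : realType) (n : nat).
Local Notation V := 'rV[R]_n.

(** The image of A times a closed ball under addition. *)
Lemma closed_nbhd_compact (A : set V) d : compact A -> compact (closed_nbhd A d).
Proof.
move=> kA; have -> : closed_nbhd A d = (fun p : V * V => p.1 + p.2) @` (A `*` eball d).
  apply/seteqP; split=> [x [a Aa h]|_ [[a z] [/= Aa hz] <-]].
    by exists (a, x - a) => //=; rewrite addrC subrK.
  by exists a => //; rewrite addrC addKr.
apply: continuous_compact; last by apply: compact_setX => //; exact: compact_eball.
by apply: continuous_subspaceT => p; exact: add_continuous.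
Qed.

Lemma setdist_nbhd (A : set V) d x : A !=set0 -> closed_nbhd A d x -> setdist A x <= d.
Proof. by move=> A0 [a Aa h]; rewrite (le_trans (setdist_le x Aa)). Qed.

(** On the d-neighbourhood of A the tent of index k is at least 1 - (k + 1) d. Fixing k first and
    then taking j large costs e / 3 for each of: tent against indicator, [Phis j] against [Phi], and
    (k + 1) d. An empty A is set apart because [setdist] is then meaningless. *)
Lemma upper_semicontinuity (P : probability V R) (Phis : nat -> V -> V) (Phi : V -> V) (A : set V)
    (d : nat -> R) e K :
  (forall j x x', enorm (Phis j x - Phis j x') <= K * enorm (x - x')) ->
  (forall x x', enorm (Phi x - Phi x') <= K * enorm (x - x')) ->
  (forall x, enorm (Phis j x - Phi x) @[j --> \oo] --> (0 : R)) ->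
  d @ \oo --> (0 : R) -> compact A -> 0 < e ->
  \forall j \near \oo, fine (P (Phis j @^-1` closed_nbhd A (d j))) <= fine (P (Phi @^-1` A)) + e.
Proof.
move=> lips lip cvg d0 kA e0.
have [A0|/set0P A0] := eqVneq A set0.
  apply: nearW => j; rewrite (_ : _ @^-1` closed_nbhd _ _ = set0).
    by rewrite measure0 addr_ge0 ?fine_ge0// ltW.
  by apply/seteqP; split=> // x [a]; rewrite A0.
have clA : closed A by apply: compact_closed => //; exact: norm_hausdorff.
have mmap (F : V -> V) : (forall x x', enorm (F x - F x') <= K * enorm (x - x')) ->
    measurable_fun setT F.
  move=> hF; apply: measurable_fun_rV => i; apply: (@lipschitz_measurable _ _ _ K) => x x'.
  have -> : F x 0 i - F x' 0 i = (F x - F x') 0 i by rewrite !mxE.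
  by rewrite (le_trans (coord_le_enorm _ _)).
have mtent k : measurable_fun setT (tent A k).
  by apply: (@lipschitz_measurable _ _ _ k.+1%:R) => x x'; exact: tent_lip.
have btent k x : `|tent A k x| <= 1.
  by have /andP[? ?] := tent01 A0 k x; rewrite ger0_norm.
have finT : (P setT < +oo)%E by rewrite ltey_eq fin_num_measure.
have bm k (F : V -> V) : measurable_fun setT F -> bmeas P setT (fun x => tent A k (F x)).
  by move=> mF; split=> //; [exact: measurableT_comp|exists 1].
have mpre (F : V -> V) B : measurable_fun setT F -> measurable B -> measurable (F @^-1` B).
  by move=> mF mB; rewrite -[X in measurable X]setTI; exact: mF.
have probE B : measurable B -> fine (P B) = \int[P]_x (\1_B x : R).
  by move=> mB; rewrite /Rintegral integral_indic// setIT.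
have e3 : 0 < e / 3 by rewrite divr_gt0.
have l1 : \int[P]_x tent A k (Phi x) @[k --> \oo] --> fine (P (Phi @^-1` A)).
  rewrite probE; last exact: (mpre _ _ (mmap _ lip) (closed_rV_measurable clA)).
  apply: (@Rint_dominated_cvg _ _ _ _ _ _ _ 1) => [k|k x _|x _]; first exact: (bm k _ (mmap _ lip)).
    exact: btent.
  rewrite (_ : \1_(Phi @^-1` A) x = \1_A (Phi x) :> R); first exact: tent_cvg.
  by rewrite !indicE; congr ((nat_of_bool _)%:R); apply/idP/idP; rewrite !inE.
have /cvgrPdist_le/(_ _ e3)[k _ /(_ k (leqnn k))/= hk] := l1.
have l2 : \int[P]_x tent A k (Phis j x) @[j --> \oo] --> \int[P]_x tent A k (Phi x).
  apply: (@Rint_dominated_cvg _ _ _ _ _ _ _ 1) => [j|j x _|x _].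
  - exact: (bm k _ (mmap _ (lips j))).
  - exact: btent.
  - have c0 : k.+1%:R * enorm (Phis j x - Phi x) @[j --> \oo] --> (0 : R).
      by rewrite -(mulr0 k.+1%:R); apply: cvgMr; exact: cvg.
    apply/cvgrPdist_le => r r0; have /cvgr_le/(_ _ r0) := c0.
    apply: filterS => j; apply: le_trans.
    by rewrite distrC; exact: tent_lip.
have /cvgrPdist_le/(_ _ e3) l2' := l2.
have d1 : k.+1%:R * d j @[j --> \oo] --> (0 : R).
  by rewrite -(mulr0 k.+1%:R); exact: cvgMr.
have /cvgr_le/(_ _ e3) d2 := d1.
move: l2' d2; apply: filterS2 => j h1 h2.
have mj : measurable (Phis j @^-1` closed_nbhd A (d j)).
  apply: (mpre _ _ (mmap _ (lips j))); apply: closed_rV_measurable.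
  by apply: compact_closed; [exact: norm_hausdorff|exact: closed_nbhd_compact].
have : fine (P (Phis j @^-1` closed_nbhd A (d j))) <= \int[P]_x (tent A k (Phis j x) + e / 3).
  rewrite probE//; apply: le_Rint.
  - exact: bmeas_indic.
  - by apply: bmeasD; [exact: (bm k _ (mmap _ (lips j)))|exact: bmeas_cst].
  - move=> x _; have /andP[t0 _] := tent01 A0 k (Phis j x).
    rewrite indicE; case: (boolP (x \in _)) => [|_]; last by rewrite addr_ge0// ltW.
    rewrite inE => /(setdist_nbhd A0) hx; rewrite /tent -lerBlDr le_max; apply/orP; right.
    by rewrite lerD2l lerN2 (le_trans _ h2)// ler_wpM2l.
rewrite RintD//; [|exact: (bm k _ (mmap _ (lips j)))|exact: bmeas_cst].
rewrite Rintegral_cst//= (probability_setT P)/= mulr1.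
have /ler_normlP[a1 _] := h1; have /ler_normlP[a3 _] := hk.
exact: sum_of_thirds a1 a3.
Qed.

End compact_nbhd.

(** * Null sets under the flow *)
Section null_preimage.
Context (R : realType) (n : nat).
Local Notation V := 'rV[R]_n.
Local Notation lebV := (lebesgue_rV R n).
Variables (Phi : V -> V) (K c : R) (F : set V).
Hypothesis c0 : 0 < c.
Hypothesis lip : forall x x', enorm (Phi x - Phi x') <= K * enorm (x - x').
Hypothesis lower : forall x x', c * enorm (x - x') <= enorm (Phi x - Phi x').
Hypothesis kF : compact F.

Let clF : closed F. Proof. by apply: compact_closed => //; exact: norm_hausdorff. Qed.
Let mF : measurable F. Proof. exact: closed_rV_measurable. Qed.

Let mPhi : measurable_fun setT Phi.
Proof.
apply: measurable_fun_rV => i; apply: (@lipschitz_measurable _ _ _ K) => x x'.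
have -> : Phi x 0 i - Phi x' 0 i = (Phi x - Phi x') 0 i by rewrite !mxE.
by rewrite (le_trans (coord_le_enorm _ _)).
Qed.

Let mPF : measurable (Phi @^-1` F).
Proof. by rewrite -[X in measurable X]setTI; exact: mPhi. Qed.

(** The cubes have sup-norm radius d; the factor n converts this to a Euclidean distance. *)
Let near d : set V := closed_nbhd F (n%:R * d).

Let mnear d : measurable (near d).
Proof.
apply: closed_rV_measurable; apply: compact_closed; first exact: norm_hausdorff.
exact: closed_nbhd_compact.
Qed.

(* Tonelli applied to the pairs (x, z) with Phi x in F and z in the cube of
   center Phi x: the sections in z are cubes, those in x have small diameter. *)
Lemma preimage_volume d : 0 < d ->
  (lebV (Phi @^-1` F) * ((2 * d) ^+ n)%:E <=
   lebV (near d) * ((2 * (2 * n%:R * d / c)) ^+ n)%:E)%E.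
Proof.
move=> d0; set r := 2 * n%:R * d / c.
have r0 : 0 <= r by rewrite divr_ge0 ?(ltW c0)// !mulr_ge0// ltW.
pose S : set (V * V) := [set p | F (Phi p.1) /\ `|p.2 - Phi p.1| <= d].
have mS : measurable S.
  have m1 : measurable_fun setT (fun p : V * V => Phi p.1).
    by apply: measurableT_comp => //; exact: measurable_fst.
  rewrite (_ : S = (fun p : V * V => Phi p.1) @^-1` F `&`
      (fun p : V * V => p.2 - Phi p.1) @^-1` cube 0 d).
    apply: measurableI; rewrite -[X in measurable X]setTI; first exact: m1.
    apply: (measurableT_comp (@measurable_sub_rV R n) (g := fun p : V * V => (p.2, Phi p.1))) => //.
      by apply: measurable_fun_pair => //; exact: measurable_snd.
    by apply: measurable_cube; exact: ltW.
  apply/seteqP; split=> p [h1 h2]; split=> //.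
    by apply/(cube_norm 0 _ (ltW d0)); rewrite subr0.
  by move/(cube_norm 0 _ (ltW d0)): h2; rewrite subr0.
have mf : measurable_fun setT (EFin \o (\1_S : V * V -> R)).
  by apply/measurable_EFinP; exact: measurable_indic.
have f0 p : (0 <= (EFin \o (\1_S : V * V -> R)) p)%E by rewrite /= lee_fin indicE.
have e1 := @fubini_tonelli1 _ _ _ _ R lebV lebV _ mf f0.
have e2 := @fubini_tonelli2 _ _ _ _ R lebV lebV _ mf f0.
have x1 x : fubini_F lebV (EFin \o (\1_S : V * V -> R)) x =
    (((2 * d) ^+ n)%:E * (\1_(Phi @^-1` F) x)%:E)%E.
  rewrite /fubini_F/=.
  have [Fx|Fx] := pselect (F (Phi x)).
    rewrite [in RHS]indicE [X in _ = (_ * (nat_of_bool X)%:R%:E)%E]mem_set// mule1.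
    rewrite -(cubeE (Phi x) (ltW d0)).
    transitivity (\int[lebV]_z (\1_(cube (Phi x) d) z)%:E)%E.
      apply: eq_integral => z _; rewrite !indicE; congr ((nat_of_bool _)%:R%:E).
      apply/idP/idP; rewrite !inE => h; first by apply/(cube_norm _ _ (ltW d0)); case: h.
      by split=> //; apply/(cube_norm _ _ (ltW d0)).
    by rewrite integral_indic ?setIT//; apply: measurable_cube; exact: ltW.
  rewrite [in RHS]indicE [X in _ = (_ * (nat_of_bool X)%:R%:E)%E]memNset// mule0.
  by apply: integral0_eq => z _; rewrite indicE memNset// => -[].
have x2 z : (fubini_G lebV (EFin \o (\1_S : V * V -> R)) z <=
    ((2 * r) ^+ n)%:E * (\1_(near d) z)%:E)%E.
  rewrite /fubini_G/=.
  have [[x0 [Fx0 zx0]]|h] := pselect (exists x0, F (Phi x0) /\ `|z - Phi x0| <= d).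
    have nz : near d z.
      exists (Phi x0) => //; rewrite (le_trans (enorm_le_norm _))// ler_wpM2l//.
    rewrite [in leRHS]indicE mem_set// mule1 -(cubeE x0 r0).
    have -> : lebV (cube x0 r) = (\int[lebV]_x (\1_(cube x0 r) x)%:E)%E.
      by rewrite integral_indic ?setIT//; exact: measurable_cube.
    apply: ge0_le_integral => //.
    + by apply/measurable_EFinP; apply: measurableT_comp; [exact: measurable_indic|exact: measurable_pair2].
    + by apply/measurable_EFinP; apply: measurable_indic; exact: measurable_cube.
    + move=> x _; rewrite lee_fin !indicE; case: (boolP ((x, z) \in S)) => [|_]; last by [].
      rewrite inE => -[/= Fx zx]; rewrite mem_set//; apply/(cube_norm _ _ r0).
      rewrite (le_trans (norm_le_enorm _))// /r ler_pdivlMr// mulrC (le_trans (lower _ _))//.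
      rewrite (le_trans (enorm_le_norm _))// -[leRHS](_ : n%:R * (d + d) = _); last by ring.
      rewrite ler_wpM2l// (le_trans (ler_distD z _ _))// lerD//.
      by rewrite distrC.
  rewrite integral0_eq => [|x _]; first by rewrite mule_ge0// lee_fin ?indicE// exprn_ge0// mulr_ge0.
  by rewrite indicE memNset// => -[/= Fx zx]; apply: h; exists x.
have mono : (\int[lebV]_x fubini_F lebV (EFin \o (\1_S : V * V -> R)) x <=
    \int[lebV]_z (((2 * r) ^+ n)%:E * (\1_(near d) z)%:E))%E.
  rewrite -e1 e2; apply: ge0_le_integral => //.
  - by move=> z _; apply: integral_ge0 => x _; exact: f0.
  - exact: measurable_fun_fubini_tonelli_G.
  - by apply: measurable_funeM; apply/measurable_EFinP; exact: measurable_indic.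
move: mono; under eq_integral do rewrite x1.
have d20 : 0 <= (2 * d) ^+ n by rewrite exprn_ge0// mulr_ge0// ltW.
have r20 : 0 <= (2 * r) ^+ n by rewrite exprn_ge0// mulr_ge0.
rewrite !ge0_integralZl_EFin//; try by (apply/measurable_EFinP; exact: measurable_indic).
rewrite !integral_indic// !setIT => h.
by rewrite muleC (le_trans h)// muleC.
Qed.

(** Continuity from above: the closed neighbourhoods have finite measure and decrease to the closed
    set F. *)
Lemma near_cvg0 : lebV F = 0%E -> forall e, 0 < e -> exists2 d, 0 < d & (lebV (near d) < e%:E)%E.
Proof.
move=> F0 e e0.
have [r r_gt0 Fr] := compact_enorm_bounded kF.
pose d k : R := k.+1%:R^-1.
have nd k : near (d k) `<=` eball (r + n%:R).
  move=> x [y Fy xy]; rewrite /eball/= -[x](subrK y) addrC (le_trans (enormD _ _))// lerD ?Fr//.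
  by rewrite (le_trans xy)// ler_piMr// invf_le1 ?ler1n.
have fin k : (lebV (near (d k)) < +oo)%E.
  apply: (@le_lt_trans _ _ (lebV (eball (r + n%:R)))); last exact: eball_fin.
  apply: le_measure; rewrite ?inE//.
  exact: measurable_eball.
have cap : \bigcap_k near (d k) = F.
  apply/seteqP; split=> [x h|x Fx k _]; last first.
    by exists x; rewrite // subrr enorm0 mulr_ge0// invr_ge0.
  have F0' : F !=set0 by have [y Fy _] := h 0%N I; exists y.
  apply/(setdist_eq0 F0' x clF); apply/eqP; rewrite eq_le setdist_ge0// andbT.
  apply/ler_addgt0Pl => s s0; rewrite addr0.
  have cd : n%:R * d k @[k --> \oo] --> (0 : R).
    by rewrite -(mulr0 n%:R); apply: cvgMr; exact: cvg_harmonic.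
  have /cvgr_le/(_ _ s0)[k _ /(_ k (leqnn k))/= hk] := cd.
  by rewrite (le_trans (setdist_nbhd F0' (h k I))).
have cl : lebV (near (d k)) @[k --> \oo] --> lebV (\bigcap_k near (d k)).
  apply: nonincreasing_cvg_mu => //.
  - exact: fin.
  - by rewrite cap.
  - apply/nonincreasing_seqP => k; apply/subsetPset => x [y Fy xy]; exists y => //.
    by rewrite (le_trans xy)// ler_wpM2l// lef_pV2 ?posrE// ler_nat.
rewrite cap F0 in cl.
have : \forall k \near \oo, (lebV (near (d k)) < e%:E)%E.
  have ne : nbhs (0 : \bar R)%E [set y : \bar R | (y < e%:E)%E].
    by apply: open_nbhs_nbhs; split; [exact: open_ereal_lt_ereal|rewrite /= lte_fin].
  exact: cl ne.
by move=> [k _ /(_ k (leqnn k))/= hk]; exists (d k); rewrite ?invr_gt0.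
Qed.

(** In [preimage_volume] the two cubes have volumes in the ratio B = (2n / c)^n, independent of d.
    Hence the preimage has at most B times the measure of an arbitrarily small neighbourhood of
    F. *)
Lemma null_preimage : lebV F = 0%E -> lebV (Phi @^-1` F) = 0%E.
Proof.
move=> F0; apply/eqP; rewrite eq_le measure_ge0 andbT; apply/lee_addgt0Pr => e e0; rewrite add0e.
pose B := (2 * n%:R / c) ^+ n.
have B0 : 0 <= B by rewrite exprn_ge0// divr_ge0 ?(ltW c0)// mulr_ge0.
have B1 : 0 < B + 1 by rewrite ltr_wpDl.
have [d d0 hd] := near_cvg0 F0 (divr_gt0 e0 B1).
have := preimage_volume d0.
have q : 0 < (2 * d) ^+ n by rewrite exprn_gt0// mulr_gt0.
have -> : (2 * (2 * n%:R * d / c)) ^+ n = B * (2 * d) ^+ n.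
  by rewrite /B -exprMn; congr (_ ^+ n); field; rewrite gt_eqF.
rewrite EFinM muleA lee_pmul2r// ?lte_fin// => h; rewrite (le_trans h)//.
have fin : lebV (near d) \is a fin_num by rewrite ge0_fin_numE// (lt_trans hd)// ltry.
rewrite -(fineK fin) -EFinM lee_fin.
rewrite -(fineK fin) lte_fin in hd.
rewrite (@le_trans _ _ (e / (B + 1) * B))//; first by rewrite ler_wpM2r// ltW.
by rewrite mulrAC ler_pdivrMr// ler_wpM2l ?lerDl// ltW.
Qed.

End null_preimage.

(** If Q failed arbitrarily close to 0, some sequence would consist of counterexamples only. One
    good index per sequence is therefore enough, so a subsequence may be extracted beforehand. *)
Lemma near_right_by_sequences (R : realType) (Q : R -> Prop) :
  (forall e : nat -> R, (forall j, 0 < e j) -> e @ \oo --> (0 : R) -> exists j, Q (e j)) ->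
  \forall eps \near (0 : R)^'+, Q eps.
Proof.
move=> h; apply: contrapT => hn.
have hj j : exists eps, [/\ 0 < eps, eps < j.+1%:R^-1 & ~ Q eps].
  apply: contrapT => hj; apply: hn.
  have j0 : (0 : R) < j.+1%:R^-1 by rewrite invr_gt0.
  have hp := nbhs_right_gt (0 : R); have hq := nbhs_right_lt j0.
  by move: hp hq; apply: filterS2 => eps ep eq; apply: contrapT => nq; apply: hj; exists eps.
have [e he] := choice hj.
have [|//|j] := h e; first by move=> j; have [] := he j.
  apply/cvgrPdist_lt => d d0; have /cvgr_lt/(_ _ d0) := @cvg_harmonic R.
  apply: filterS => j hd; have [e0 e1 _] := he j.
  by rewrite sub0r normrN ger0_norm ?(ltW e0)// (lt_trans e1).
by have [_ _] := he j.
Qed.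

Lemma right_cvg_ereal (R : realType) (f : R -> \bar R) (l : R) :
  (forall c, 0 < c -> \forall eps \near (0 : R)^'+, ((l - c)%:E <= f eps <= (l + c)%:E)%E) ->
  f eps @[eps --> (0 : R)^'+] --> l%:E.
Proof.
move=> h; apply/fine_cvgP; split.
  have := h 1 ltr01; apply: filterS => eps /andP[h1 h2].
  by rewrite fin_numElt (lt_le_trans (ltNyr _) h1) (le_lt_trans h2 (ltry _)).
apply/cvgrPdist_le => c c0; have := h c c0; apply: filterS => eps /andP[h1 h2].
have fin : f eps \is a fin_num.
  by rewrite fin_numElt (lt_le_trans (ltNyr _) h1) (le_lt_trans h2 (ltry _)).
rewrite -(fineK fin) !lee_fin in h1 h2.
by rewrite /= ler_norml lerBlDr lerNl opprB lerBlDr; apply/andP; split; lra.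
Qed.

Lemma rational_dense (R : realType) (n : nat) : exists pts : nat -> 'rV[R]_n,
  forall x d, 0 < d -> exists i, enorm (x - pts i) <= d.
Proof.
exists (fun i => if unpickle i is Some q then \row_j ratr ((q : 'rV[rat]_n) 0 j) else 0) => x d d0.
pose O : set 'rV[R]_n := [set y | enorm (y - x) < d].
have oO : open O.
  rewrite (_ : O = (fun y => enorm (y - x)) @^-1` [set s | s < d])//.
  apply: open_comp; last exact: open_lt.
  move=> y _; apply: (@lipschitz_continuous _ _ _ 1) => z z'; rewrite mul1r.
  by rewrite (le_trans (enorm_dist _ _))// opprB addrA subrK.
have Ox : O x by rewrite /O/= subrr enorm0.
have [q [p [h1 h2]]] := rV_ball_rat oO Ox.
exists (pickle q); rewrite pickleK enorm_distC; apply: ltW; apply: h2 => j.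
by rewrite !mxE subrr normr0 (le_lt_trans _ (h1 j)).
Qed.

Lemma half_gap (R : realFieldType) (a b d e : R) :
  d < a / 2 -> e < a / 2 -> b <= d -> a - b <= e -> False.
Proof. lra. Qed.

Lemma sum_of_quarters (R : realFieldType) (a b c d e f : R) :
  a <= b + c -> c <= d + f -> b <= e / 4 -> f <= e / 4 -> d <= e / 2 -> a <= e.
Proof. lra. Qed.

(** * Limits of the optimal values *)
Section limits.
Context (R : realType) (n m : nat) (T L C : R) (U : set 'rV[R]_m)
  (v : R -> 'rV[R]_n -> 'rV[R]_m -> 'rV[R]_n).
Local Notation leb := (@lebesgue_measure R).
Local Notation lebV := (lebesgue_rV R n).
Local Notation V := 'rV[R]_n.
Local Notation W := 'rV[R]_m.
Local Notation I := (time T).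
Hypothesis T0 : 0 < T.
Hypothesis L0 : 0 < L.
Hypothesis C0 : 0 < C.
Hypothesis kU : compact U.
Hypothesis cv : {within [set p : R * V * W | p.1.1 \in `[0, T] /\ U p.2],
  continuous (fun p => v p.1.1 p.1.2 p.2)}.
Hypothesis vlip : forall t u x x', t \in `[0, T] -> U u ->
  enorm (v t x u - v t x' u) <= L * enorm (x - x').
Hypothesis vgrow : forall t u x, t \in `[0, T] -> U u -> enorm (v t x u) <= C * (1 + enorm x).

Let cU : closed U. Proof. by apply: compact_closed => //; exact: norm_hausdorff. Qed.
Local Notation is_map := (is_control_map T L C U v).
Let K := expR (L * T).
Let K0 : 0 < K. Proof. exact: expR_gt0. Qed.

Lemma control_nonempty (nu : ymeasure R m) : gen_control T U nu -> U !=set0.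
Proof.
move=> gn; apply: contrapT => /set0P/negP; rewrite negbK => /eqP U0; have [yn n0] := gn.
move: n0; rewrite U0 setX0 setC0 (young_total yn) lebesgue_measure_itv/= lte_fin T0 sube0 => -[] /eqP.
by rewrite gt_eqF.
Qed.

(** The limit control exists along an ultrafilter, from which no subsequence of controls is drawn.
    The maps, however, share a Lipschitz constant, so their convergence on a countable dense set
    suffices, and that can be realised along indices [s k]. *)
Lemma control_maps_compact (nus : nat -> ymeasure R m) (Phis : nat -> V -> V) :
  (forall j, gen_control T U (nus j)) -> (forall j, is_map (nus j) (Phis j)) ->
  exists nu Phi (s : nat -> nat), [/\ gen_control T U nu, is_map nu Phi,
    forall k, (k <= s k)%N & forall x, enorm (Phis (s k) x - Phi x) @[k --> \oo] --> (0 : R)].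
Proof.
move=> gnus cPhis; have U0 := control_nonempty (gnus 0%N).
have [G [GU oG]] := ultraFilterLemma (@eventually_filter).
have GF : ProperFilter G by exact: ultra_proper.
have [nu [ker [gn dk rc]]] := young_compactness kU U0 GU gnus.
have [Phi cPhi] := control_map_exists T0 L0 C0 kU cv vlip vgrow gn.
have cx x : enorm (Phis j x - Phi x) @[j --> G] --> (0 : R).
  exact: (control_map_cvg T0 L0 C0 kU cv vlip vgrow x GF gnus gn rc cPhis cPhi).
have [pts dense] := rational_dense R n.
(* Diagonal requirement: at stage k the first k + 1 dense points are within 1 / (k + 1) of their
   limits. Finitely many conditions at a time define a set of the ultrafilter. *)
pose E k j := forall i, (i <= k)%N -> enorm (Phis j (pts i) - Phi (pts i)) <= k.+1%:R^-1.
have GE k : G [set j | (k <= j)%N /\ E k j].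
  have h1 : G [set j | (k <= j)%N] by apply: oG; exists k.
  have h2 l : G [set j | forall i, (i < l)%N -> enorm (Phis j (pts i) - Phi (pts i)) <= k.+1%:R^-1].
    elim: l => [|l IH]; first by apply: filterE => j i.
    have k0 : (0 : R) < k.+1%:R^-1 by rewrite invr_gt0.
    have /cvgr_le/(_ _ k0) h := cx (pts l).
    move: IH h; apply: filterS2 => j h3 h4 i; rewrite ltnS leq_eqVlt => /predU1P[->//|]; exact: h3.
  by move: h1 (h2 k.+1); apply: filterS2 => j h3 h4; split=> // i ik; apply: h4.
have hs k : exists j, (k <= j)%N /\ E k j by exact: filter_ex (GE k).
have [s hs'] := choice hs.
exists nu, Phi, s; split=> // [k0|x]; first by have [] := hs' k0.
apply/cvgrPdist_le => e e0.
have d0 : 0 < e / (4 * K) by rewrite divr_gt0// mulr_gt0.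
have [i hi] := dense x _ d0.
have Kd : K * enorm (x - pts i) <= e / 4.
  rewrite (le_trans (ler_wpM2l (ltW K0) hi))// le_eqVlt; apply/orP; left; apply/eqP.
  by field; rewrite gt_eqF.
have e2 : 0 < e / 2 by rewrite divr_gt0.
have /cvgr_le/(_ _ e2) hh := @cvg_harmonic R.
have hi' : \forall j \near \oo, (i <= j)%N by exists i.
move: hh hi'; apply: filterS2 => j h1 h2.
have [lipj _] := control_map_lip T0 L0 C0 kU cv vlip vgrow (cPhis (s j)).
have [lip _] := control_map_lip T0 L0 C0 kU cv vlip vgrow cPhi.
rewrite sub0r normrN ger0_norm ?enorm_ge0//.
have q1 := enorm_triangle (Phis (s j) x) (Phis (s j) (pts i)) (Phi x).
have q2 := enorm_triangle (Phis (s j) (pts i)) (Phi (pts i)) (Phi x).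
have q3 := le_trans (lipj x (pts i)) Kd.
have q4 := lip (pts i) x; rewrite enorm_distC in q4.
have q5 : enorm (Phi (pts i) - Phi x) <= e / 4.
  by rewrite enorm_distC (le_trans (lip _ _)).
have q6 := le_trans ((hs' j).2 i h2) h1.
exact: sum_of_quarters q1 q2 q3 q5 q6.
Qed.

Lemma young_cvg_rectangle (nus : nat -> ymeasure R m) nu :
  young_cvg T nus nu -> rectangle_cvg T nus \oo nu.
Proof.
move=> yc B g M mB BI cg gM; apply: (yc (fun p => \1_B p.1 * g p.2)); split.
- apply: measurable_funTS; apply: measurable_funM.
    by apply: measurableT_comp; [exact: measurable_indic|exact: measurable_fst].
  by apply: measurableT_comp; [exact: continuous_measurable_rV|exact: measurable_snd].
- by move=> t _ /=; apply: continuous_mul; [exact: cst_continuous|exact: cg].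
- exists M => p _; rewrite normrM -[leRHS]mul1r; apply: ler_pM => //.
  by rewrite indicE; case: (_ \in _); rewrite ?normr1 ?normr0.
Qed.

(** The support condition survives the limit: 1 - tent, bounded, continuous and zero on U,
    integrates to 0 against every term and hence against the limit, and its limit in k is the
    indicator of the complement of U. *)
Lemma young_cvg_control (nus : nat -> ymeasure R m) nu :
  (forall j, gen_control T U (nus j)) -> young_measure T nu -> young_cvg T nus nu ->
  gen_control T U nu.
Proof.
move=> gnus yn yc; split=> //; have U0 := control_nonempty (gnus 0%N).
have mS := @measurable_stripT R m T.
have mU : measurable U by exact: closed_rV_measurable.
pose f k (p : measurableTypeR R * W) : R := 1 - tent U k p.2.
have f01 k p : `|f k p| <= 1.
  by have /andP[? ?] := tent01 U0 k p.2; rewrite ger0_norm ?subr_ge0// gerBl.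
have ct k : continuous (tent U k).
  by apply: (@lipschitz_continuous _ _ _ k.+1%:R) => x x'; exact: tent_lip.
have mf k : measurable_fun setT (f k).
  apply: measurable_funB => //; apply: measurableT_comp; last exact: measurable_snd.
  exact: continuous_measurable_rV.
have zero k : \int[nu]_(p in @strip R m T) f k p = 0.
  have h : \int[nus j]_(p in @strip R m T) f k p @[j --> \oo] --> \int[nu]_(p in @strip R m T) f k p.
    apply: yc; split; [exact: measurable_funTS| |by exists 1 => p _; exact: f01].
    move=> t _; apply: (@lipschitz_continuous _ _ _ k.+1%:R) => x x'.
    have -> : f k (t, x) - f k (t, x') = tent U k x' - tent U k x by rewrite /f/=; ring.
    by rewrite distrC; exact: tent_lip.
  have e : (fun j => \int[nus j]_(p in @strip R m T) f k p) = cst 0.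
    apply/funext => j; rewrite (control_strip cU (gnus j) (measurable_funTS (mf k)) (fun p _ => f01 k p)).
    transitivity (\int[nus j]_(p in I `*` U) (0 : R)).
      apply: eq_Rintegral => -[t w]; rewrite inE => -[_ Uw]; rewrite /f/tent/=.
      by rewrite (proj2 (setdist_eq0 U0 w cU) Uw) mulr0 subr0 (max_idPr _) ?ler01// subrr.
    have mIU := measurable_timeU T cU; have [ynj _] := gnus j; have fo := young_fin ynj mIU.
    by rewrite Rintegral_cst ?mul0r.
  by rewrite e in h; exact: (filter_eq _ h (cvg_cst _)).
have l : \int[nu]_(p in @strip R m T) f k p @[k --> \oo] -->
    \int[nu]_(p in @strip R m T) (1 - \1_U p.2 : R).
  apply: (@Rint_dominated_cvg _ _ _ _ _ _ _ 1) => [k|k p _|p _]; last 2 first.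
  - exact: f01.
  - by apply: cvgB; [exact: cvg_cst|exact: tent_cvg].
  - split=> //; [exact: young_fin yn mS|exact: measurable_funTS|by exists 1 => p _; exact: f01].
have l0 : \int[nu]_(p in @strip R m T) (1 - \1_U p.2 : R) = 0.
  have e : (fun k => \int[nu]_(p in @strip R m T) f k p) = cst 0 by apply/funext.
  by rewrite e in l; exact: (filter_eq _ l (cvg_cst _)).
have mo : measurable (@strip R m T `&` ~` (I `*` U)).
  by apply: measurableI => //; apply: measurableC; exact: measurable_timeU.
have oE : nu (@strip R m T `&` ~` (I `*` U)) = 0%E.
  rewrite -[LHS]fineK; last by rewrite ge0_fin_numE//; exact: young_fin yn mo.
  congr EFin; rewrite -l0.
  rewrite (@eq_Rintegral _ _ _ nu _ (\1_(~` (I `*` U)) : _ -> R)); last first.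
    move=> [t w]; rewrite inE => -[It _]; rewrite !indicE.
    have [Uw|Uw] := pselect (U w).
      by rewrite mem_set// subrr memNset// => h; apply: h.
    by rewrite memNset//= subr0 mem_set// => -[].
  by rewrite /Rintegral integral_indic//; [rewrite setIC|apply: measurableC; exact: measurable_timeU].
have [n0 _] := yn; apply/eqP; rewrite eq_le measure_ge0 andbT.
have -> : ~` (I `*` U) = (~` @strip R m T) `|` (@strip R m T `&` ~` (I `*` U)).
  rewrite setUIr setUC setUv setTI setUidr//.
  by move=> p h [? ?]; apply: h.
apply: le_trans (measureU2 _ _ _) _ => //; first exact: measurableC.
by rewrite [X in (_ + X)%E]oE adde0 [leLHS]n0.
Qed.

(** * Comparison of the original and the mollified problems *)

Section payoffs.
Variables (A : set V) (theta : probability V R) (eta : V -> R).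
Hypothesis kA : compact A.
Hypothesis meta : mollifier eta.
Let r := Num.max 1 K.
Let theta_ eps := with_density (mollify theta (rescale eta eps)).
Let A_ eps := closed_nbhd A (r * eps).

Let r0 : 0 < r. Proof. by rewrite lt_max ltr01. Qed.
Let Kr : K <= r. Proof. by rewrite le_max lexx orbT. Qed.
Let clA : closed A. Proof. by apply: compact_closed => //; exact: norm_hausdorff. Qed.

Let mnbhd d : measurable (closed_nbhd A d).
Proof.
apply: closed_rV_measurable; apply: compact_closed; first exact: norm_hausdorff.
exact: closed_nbhd_compact.
Qed.

Let mA : measurable A. Proof. exact: closed_rV_measurable. Qed.

Lemma payoff_theta nu Phi : gen_control T U nu -> is_map nu Phi ->
  payoff T U v theta A nu = theta (Phi @^-1` A).
Proof. by move=> gn cPhi; exact: (payoffE T0 L0 C0 kU cv vlip vgrow meta _ kA gn cPhi). Qed.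

Lemma payoff_sandwich eps nu Phi : 0 < eps -> gen_control T U nu -> is_map nu Phi ->
  (theta (Phi @^-1` A) <= payoff T U v (theta_ eps) (A_ eps) nu <=
   theta (Phi @^-1` closed_nbhd A (2 * r * eps)))%E.
Proof.
move=> e0 gn cPhi; have [P [PE hP]] := mollify_probability meta e0 theta.
have kAe : compact (A_ eps) by exact: closed_nbhd_compact.
rewrite (payoffE T0 L0 C0 kU cv vlip vgrow meta PE kAe gn cPhi).
have [lip _] := control_map_lip T0 L0 C0 kU cv vlip vgrow cPhi.
have mp B : measurable B -> measurable (Phi @^-1` B) := measurable_control_map cPhi.
have near x y : enorm (x - y) <= eps -> enorm (Phi x - Phi y) <= r * eps.
  by move=> h; rewrite (le_trans (lip _ _))// ler_pM// ?enorm_ge0// ltW.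
apply/andP; split.
  have [h _] := hP _ _ (mp _ mA) (mp _ (mnbhd (r * eps))); apply: h => x y xy Ay.
  by exists (Phi y) => //; exact: near.
have [_ h] := hP _ _ (mp _ (mnbhd (2 * r * eps))) (mp _ (mnbhd (r * eps))); apply: h => x y xy [a Aa h].
exists a => //; rewrite (le_trans (enorm_triangle _ (Phi x) _))//.
have -> : 2 * r * eps = r * eps + r * eps by ring.
by rewrite lerD// enorm_distC; exact: near.
Qed.

Variable nubar : R -> ymeasure R m.
Hypothesis opt : forall eps, 0 < eps -> optimal T U v (theta_ eps) (A_ eps) (nubar eps).

Let gbar eps : 0 < eps -> gen_control T U (nubar eps). Proof. by move=> /opt[]. Qed.

Let Fm (Phi : V -> V) B := fine (theta (Phi @^-1` B)).

Let FmE nu Phi B : is_map nu Phi -> measurable B -> theta (Phi @^-1` B) = (Fm Phi B)%:E.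
Proof.
by move=> c mB; rewrite fineK// fin_num_measure//; exact: (measurable_control_map c).
Qed.

Lemma optimal_value_le eps nu Phi Phie : 0 < eps -> gen_control T U nu -> is_map nu Phi ->
  is_map (nubar eps) Phie ->
  ((Fm Phi A)%:E <= payoff T U v (theta_ eps) (A_ eps) (nubar eps) <=
   (Fm Phie (closed_nbhd A (2 * r * eps)))%:E)%E.
Proof.
move=> e0 gn cPhi cPhie; have [ge hopt] := opt e0.
have /andP[h1 _] := payoff_sandwich e0 gn cPhi.
have /andP[_ h2] := payoff_sandwich e0 ge cPhie.
by rewrite -(FmE cPhi mA) -(FmE cPhie (mnbhd _)) h2 andbT (le_trans h1)// hopt.
Qed.

Lemma limit_value (e : nat -> R) (Phis : nat -> V -> V) nu Phi c :
  (forall j, 0 < e j) -> e @ \oo --> (0 : R) ->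
  (forall j, is_map (nubar (e j)) (Phis j)) -> is_map nu Phi ->
  (forall x, enorm (Phis j x - Phi x) @[j --> \oo] --> (0 : R)) -> 0 < c ->
  \forall j \near \oo, Fm (Phis j) (closed_nbhd A (2 * r * e j)) <= Fm Phi A + c.
Proof.
move=> e0 ecv cPhis cPhi cx c0.
apply: (@upper_semicontinuity _ _ theta Phis Phi A (fun j => 2 * r * e j) c K) => //.
- by move=> j; have [] := control_map_lip T0 L0 C0 kU cv vlip vgrow (cPhis j).
- by have [] := control_map_lip T0 L0 C0 kU cv vlip vgrow cPhi.
- by rewrite -(mulr0 (2 * r)); exact: cvgMr.
Qed.

(** Any competitor of (P) has value at most max(P_eps), and by semicontinuity these maxima do not
    exceed the value of the limit map in the limit. Only the maps are asked to converge, so this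
    serves both accumulation points and extracted subsequences. *)
Lemma limit_optimal (e : nat -> R) (Phis : nat -> V -> V) nu Phi :
  (forall j, 0 < e j) -> e @ \oo --> (0 : R) ->
  (forall j, is_map (nubar (e j)) (Phis j)) -> gen_control T U nu -> is_map nu Phi ->
  (forall x, enorm (Phis j x - Phi x) @[j --> \oo] --> (0 : R)) ->
  optimal T U v theta A nu.
Proof.
move=> e0 ecv cPhis gn cPhi cx; split=> // nu' gn'.
have [Phi' cPhi'] := control_map_exists T0 L0 C0 kU cv vlip vgrow gn'.
rewrite (payoff_theta gn cPhi) (payoff_theta gn' cPhi') (FmE cPhi mA) (FmE cPhi' mA) lee_fin.
apply/ler_addgt0Pr => c c0.
have [j _ /(_ j (leqnn j))/= hj] := limit_value e0 ecv cPhis cPhi cx c0.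
have /andP[h1 h2] := optimal_value_le (e0 j) gn' cPhi' (cPhis j).
by have := le_trans h1 h2; rewrite lee_fin => /le_trans; apply.
Qed.

Lemma accumulation_optimal (e : nat -> R) nu : (forall j, 0 < e j) -> e @ \oo --> (0 : R) ->
  young_measure T nu -> young_cvg T (nubar \o e) nu -> optimal T U v theta A nu.
Proof.
move=> e0 ecv yn yc; have gj j : gen_control T U ((nubar \o e) j) by exact: gbar.
have gn := young_cvg_control gj yn yc.
have [Phi cPhi] := control_map_exists T0 L0 C0 kU cv vlip vgrow gn.
have [Phis cPhis] := choice (fun j => control_map_exists T0 L0 C0 kU cv vlip vgrow (gj j)).
apply: (limit_optimal e0 ecv cPhis gn cPhi) => x.
have rc := young_cvg_rectangle yc.
exact: (control_map_cvg T0 L0 C0 kU cv vlip vgrow x _ gj gn rc cPhis cPhi).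
Qed.

Lemma optimal_subsequence (e : nat -> R) : (forall j, 0 < e j) -> e @ \oo --> (0 : R) ->
  exists nu Phi (s : nat -> nat) Phis, [/\ optimal T U v theta A nu, is_map nu Phi,
    forall j, is_map (nubar (e (s j))) (Phis j), (e \o s) @ \oo --> (0 : R) &
    forall x, enorm (Phis j x - Phi x) @[j --> \oo] --> (0 : R)].
Proof.
move=> e0 ecv; have gj j : gen_control T U (nubar (e j)) by exact: gbar.
have [Phis cPhis] := choice (fun j => control_map_exists T0 L0 C0 kU cv vlip vgrow (gj j)).
have [nu [Phi [s [gn cPhi sk cx]]]] := control_maps_compact gj cPhis.
have es : (e \o s) @ \oo --> (0 : R).
  apply: (cvg_comp s e); last exact: ecv.
  move=> B [N _ hB]; exists N => // k /= Nk; apply: hB => /=; exact: leq_trans (sk k).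
have on : optimal T U v theta A nu.
  by apply: (@limit_optimal (e \o s) (Phis \o s) nu Phi _ es _ gn cPhi cx) => j /=.
by exists nu, Phi, s, (Phis \o s); split; [exact: on|exact: cPhi|move=> j; exact: cPhis|exact: es|exact: cx].
Qed.

(** The given optimal controls of (P_eps), taken along eps = 1 / (j + 1), already produce an optimum
    of (P) in the limit. *)
Lemma optimal_exists : exists nu, optimal T U v theta A nu.
Proof.
have [|nu [_ [_ [_ [h _ _ _ _]]]]] := @optimal_subsequence harmonic _ (@cvg_harmonic R).
  by move=> j; rewrite /harmonic/= invr_gt0.
by exists nu.
Qed.

Lemma max_payoffE vartheta B nu : optimal T U v vartheta B nu ->
  max_payoff T U v vartheta B = payoff T U v vartheta B nu.
Proof.
move=> [gn h]; apply/eqP; rewrite eq_le; apply/andP; split.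
  by apply: ge_ereal_sup => _ [nu' gn' <-]; exact: h.
by apply: ereal_sup_ubound; exists nu.
Qed.

Lemma optimal_payoff_eq nu nu' : optimal T U v theta A nu -> optimal T U v theta A nu' ->
  payoff T U v theta A nu = payoff T U v theta A nu'.
Proof. by move=> [g h] [g' h']; apply/eqP; rewrite eq_le h' ?h. Qed.

(** From below, each max(P_eps) dominates the value of an optimum of (P). From above, along an
    extracted subsequence semicontinuity bounds it by the value of a limit control, which is optimal
    too. *)
Lemma max_payoff_cvg : max_payoff T U v (theta_ eps) (A_ eps) @[eps --> 0^'+] -->
  max_payoff T U v theta A.
Proof.
have [nu0 opt0] := optimal_exists; have [g0 _] := opt0.
have [Phi0 cPhi0] := control_map_exists T0 L0 C0 kU cv vlip vgrow g0.
rewrite (max_payoffE opt0) (payoff_theta g0 cPhi0) (FmE cPhi0 mA).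
apply: right_cvg_ereal => c c0; apply: near_right_by_sequences => e e0 ecv.
have [nu [Phi [s [Phis [on cPhi cPhis es cx]]]]] := optimal_subsequence e0 ecv.
have es0 j : 0 < (e \o s) j by exact: e0.
have [j _ /(_ j (leqnn j))/= hj] := limit_value es0 es cPhis cPhi cx c0.
exists (s j); rewrite (max_payoffE (opt (e0 (s j)))).
have /andP[h1 h2] := optimal_value_le (e0 (s j)) g0 cPhi0 (cPhis j).
apply/andP; split; first by rewrite (le_trans _ h1)// lee_fin gerBl ltW.
rewrite (le_trans h2)// lee_fin (le_trans hj)// lerD2r -lee_fin -(FmE cPhi mA) -(FmE cPhi0 mA).
have [gn _] := on; rewrite -(payoff_theta gn cPhi) -(payoff_theta g0 cPhi0).
by rewrite (optimal_payoff_eq on opt0).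
Qed.

(** Dominated convergence off the preimage of the boundary. If Phi x is interior to A, then
    [Phis j x] is eventually in A; if Phi x is outside A, it is at positive distance, and [Phis j x]
    eventually leaves the shrinking neighbourhoods. *)
Lemma boundary_vanishes (Phis : nat -> V -> V) (nus : nat -> ymeasure R m) nu Phi (d : nat -> R) :
  (forall j, is_map (nus j) (Phis j)) -> is_map nu Phi ->
  (forall x, enorm (Phis j x - Phi x) @[j --> \oo] --> (0 : R)) -> d @ \oo --> (0 : R) ->
  measurable (boundary A) -> theta (Phi @^-1` boundary A) = 0%E ->
  fine (theta ((Phis j @^-1` closed_nbhd A (d j)) `\` (Phis j @^-1` A))) @[j --> \oo] --> (0 : R).
Proof.
move=> cPhis cPhi cx d0 mb b0.
have [A0|/set0P A0] := eqVneq A set0.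
  rewrite (_ : (fun j => _) = cst 0); first exact: cvg_cst.
  apply/funext => j; rewrite (_ : _ `\` _ = set0) ?measure0//.
  by apply/seteqP; split=> // x [[a]]; rewrite A0.
pose E j := (Phis j @^-1` closed_nbhd A (d j)) `\` (Phis j @^-1` A).
pose N := Phi @^-1` boundary A.
have mN : measurable N by exact: (measurable_control_map cPhi).
have mE j : measurable (E j).
  by apply: measurableD; apply: (measurable_control_map (cPhis j)).
have mEN j : measurable (E j `\` N) by exact: measurableD.
have eE j : fine (theta (E j)) = \int[theta]_x (\1_(E j `\` N) x : R).
  rewrite /Rintegral integral_indic// setIT; congr fine; apply/eqP; rewrite eq_le; apply/andP; split.
    rewrite -[leRHS]adde0 -[X in (_ + X)%E]b0.
    apply: le_trans (measureU2 _ _ _) => //; apply: le_measure; rewrite ?inE//.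
      by apply: measurableU.
    by move=> x Ex; have [Nx|Nx] := pselect (N x); [right|left].
  by apply: le_measure; rewrite ?inE// => x [].
rewrite (_ : (fun j => _) = fun j => \int[theta]_x (\1_(E j `\` N) x : R)); last first.
  by apply/funext => j; exact: eE.
rewrite -[X in _ --> X](_ : \int[theta]_x (0 : R) = 0); last by rewrite Rintegral_cst// mul0r.
apply: (@Rint_dominated_cvg _ _ _ _ _ _ _ 1) => [j|j x _|x _].
- by apply: bmeas_indic => //; rewrite ltey_eq fin_num_measure.
- by rewrite indicE; case: (_ \in _); rewrite ?normr1 ?normr0.
have [Nx|Nx] := pselect (N x).
  rewrite (_ : (fun j => _) = cst 0); first exact: cvg_cst.
  by apply/funext => j; rewrite indicE memNset// => -[].
suff : \forall j \near \oo, ~ E j x.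
  move=> h; apply: cvg_near_cst; apply: filterS h => j h.
  by rewrite indicE memNset// => -[].
have [Ax|Ax] := pselect (A (Phi x)).
  have ix : A° (Phi x).
    by apply: contrapT => h; apply: Nx; split=> //; exact: subset_closure.
  have cP : Phis j x @[j --> \oo] --> Phi x by apply/(@cvg_enormP R n); exact: cx.
  have hA : \forall j \near \oo, A (Phis j x) by exact: (cP _ ix).
  by apply: filterS hA => j Aj [_ h]; exact: h.
have g0 := setdist_gt0 A0 clA Ax.
have g2 : 0 < setdist A (Phi x) / 2 by rewrite divr_gt0.
have /cvgr_lt/(_ _ g2) h1 := d0.
have /cvgr_lt/(_ _ g2) h2 := cx x.
move: h1 h2; apply: filterS2 => j h1 h2 [/(setdist_nbhd A0) h3 _].
have := le_trans (ler_norm _) (setdist_lip A0 (Phi x) (Phis j x)); rewrite enorm_distC.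
exact: half_gap h1 h2 h3.
Qed.

(** By [optimal_value_le] the optimum of (P) is at most the theta-mass that the control for eps
    brings into the neighbourhood of A. The part of it landing outside A tends to 0 by
    [boundary_vanishes], which leaves the payoff on A itself. *)
Lemma limit_payoff_cvg : theta `<< lebV -> lebV (boundary A) = 0%E ->
  payoff T U v theta A (nubar eps) @[eps --> 0^'+] --> max_payoff T U v theta A.
Proof.
move=> ac lb0; have [nu0 opt0] := optimal_exists; have [g0 hopt0] := opt0.
have [Phi0 cPhi0] := control_map_exists T0 L0 C0 kU cv vlip vgrow g0.
rewrite (max_payoffE opt0) (payoff_theta g0 cPhi0) (FmE cPhi0 mA).
apply: right_cvg_ereal => c c0; apply: near_right_by_sequences => e e0 ecv.
have [nu [Phi [s [Phis [on cPhi cPhis es cx]]]]] := optimal_subsequence e0 ecv.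
have kb : compact (boundary A).
  have [B _ hB] := compact_enorm_bounded kA.
  have eA : A = closure A by apply/closure_id.
  apply: (@closed_enorm_compact _ _ _ B); last by move=> x [h _]; apply: hB; rewrite eA.
  by rewrite /boundary setDE; apply: closedI; [exact: closed_closure|apply: open_closedC; exact: open_interior].
have mb : measurable (boundary A).
  by apply: closed_rV_measurable; apply: compact_closed => //; exact: norm_hausdorff.
have [lip low] := control_map_lip T0 L0 C0 kU cv vlip vgrow cPhi.
have n0 : lebV (Phi @^-1` boundary A) = 0%E := null_preimage (expR_gt0 _) lip low kb lb0.
have b0 : theta (Phi @^-1` boundary A) = 0%E.
  have mpb := measurable_control_map cPhi mb.
  by move/null_content_dominatesP : ac => /(_ _ mpb n0).
have d0 : 2 * r * e (s j) @[j --> \oo] --> (0 : R).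
  by rewrite -(mulr0 (2 * r)); apply: cvgMr.
have := boundary_vanishes cPhis cPhi cx d0 mb b0.
move=> /cvgr_le/(_ _ c0)[j _ /(_ j (leqnn j))/= hj].
exists (s j); have gj := gbar (e0 (s j)).
apply/andP; split; last first.
  rewrite (le_trans (hopt0 _ gj))// (payoff_theta g0 cPhi0) (FmE cPhi0 mA) lee_fin lerDl ltW//.
rewrite (payoff_theta gj (cPhis j)) (FmE (cPhis j) mA) lee_fin lerBlDr.
have /andP[h1 h2] := optimal_value_le (e0 (s j)) g0 cPhi0 (cPhis j).
have h3 := le_trans h1 h2; rewrite lee_fin in h3; rewrite (le_trans h3)//.
have m1 := measurable_control_map (cPhis j) mA.
have m2 := measurable_control_map (cPhis j) (mnbhd (2 * r * e (s j))).
have m3 := measurableD m2 m1.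
rewrite (@le_trans _ _ (Fm (Phis j) A + fine (theta (Phis j @^-1` closed_nbhd A (2 * r * e (s j)) `\`
  Phis j @^-1` A))))//; last by rewrite lerD2l.
rewrite /Fm -fineD ?fin_num_measure//; apply: fine_le.
- by rewrite fin_num_measure.
- by rewrite fin_numD !fin_num_measure.
- apply: le_trans (measureU2 _ _ _) => //; apply: le_measure; rewrite ?inE//.
    exact: measurableU.
  by move=> x hx; have [Ax|Ax] := pselect ((Phis j @^-1` A) x); [left|right].
Qed.

End payoffs.

End limits.

Theorem theorem3 (R : realType) (n m : nat) (T L C : R)
    (U : set 'rV[R]_m) (v : R -> 'rV[R]_n -> 'rV[R]_m -> 'rV[R]_n)
    (A : set 'rV[R]_n) (theta : probability 'rV[R]_n R)
    (eta : 'rV[R]_n -> R) (nubar : R -> ymeasure R m) :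
  let r := Num.max 1 (expR (L * T)) in
  let theta_ eps := with_density (mollify theta (rescale eta eps)) in
  let A_ eps := closed_nbhd A (r * eps) in
  0 < T -> 0 < L -> 0 < C ->
  compact U ->
  {within [set p : R * 'rV[R]_n * 'rV[R]_m | p.1.1 \in `[0, T] /\ U p.2],
    continuous (fun p => v p.1.1 p.1.2 p.2)} ->
  (forall t u, t \in `[0, T] -> U u -> Ck 2 (fun x => v t x u)) ->
  (forall t u x x', t \in `[0, T] -> U u ->
    enorm (v t x u - v t x' u) <= L * enorm (x - x')) ->
  (forall t u x, t \in `[0, T] -> U u ->
    enorm (v t x u) <= C * (1 + enorm x)) ->
  compact A ->
  mollifier eta ->
  (forall eps, 0 < eps -> optimal T U v (theta_ eps) (A_ eps) (nubar eps)) ->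
  [/\ forall (e : nat -> R) (nu : ymeasure R m),
        (forall j, 0 < e j) -> e j @[j --> \oo] --> 0 ->
        young_measure T nu -> young_cvg T (nubar \o e) nu ->
        optimal T U v theta A nu,
      exists nu, optimal T U v theta A nu,
      max_payoff T U v (theta_ eps) (A_ eps) @[eps --> 0^'+] -->
        max_payoff T U v theta A
    & theta `<< lebesgue_rV R n -> lebesgue_rV R n (boundary A) = 0%E ->
      payoff T U v theta A (nubar eps) @[eps --> 0^'+] -->
        max_payoff T U v theta A].
Proof.
move=> r theta_ A_ T0 L0 C0 kU cv _ vlip vgrow kA meta opt; split.
- move=> e nu e0 ecv yn yc.
  exact: (accumulation_optimal T0 L0 C0 kU cv vlip vgrow kA meta opt e0 ecv yn yc).
- exact: (optimal_exists T0 L0 C0 kU cv vlip vgrow kA meta opt).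
- exact: (max_payoff_cvg T0 L0 C0 kU cv vlip vgrow kA meta opt).
- exact: (limit_payoff_cvg T0 L0 C0 kU cv vlip vgrow kA meta opt).
Qed.
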